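(* Let $\{f_1,\dots,f_m\}\subseteq Z^\infty(\mathbb{D})$. If $I_{H^\infty(\mathbb{D})}(f_1,\dots,f_m)$ is an $M$-ideal in $H^\infty(\mathbb{D})$, then there exists an outer function $f\in Z^\infty(\mathbb{D})$ such that $$I_{H^\infty(\mathbb{D})}(f_1,\dots,f_m)=I_{H^\infty(\mathbb{D})}(f).$$
   Context: $\mathbb{D}$ is the open unit disc, $\mathbb{T}$ the unit circle, $\mu$ normalized Lebesgue measure on $\mathbb{T}$. $H^\infty(\mathbb{D})$ is the Banach algebra of bounded analytic functions on $\mathbb{D}$ with the supremum norm; $\tilde f(z)=\lim_{r\to1^-}f(rz)$ for a.e. $z\in\mathbb{T}$. $I_{H^\infty(\mathbb{D})}(f_1,\dots,f_m)$ is the closed ideal of $H^\infty(\mathbb{D})$ generated by $f_1,\dots,f_m$; in particular $I_{H^\infty(\mathbb{D})}(f)$ is the norm closure of $\{fg:g\in H^\infty(\mathbb{D})\}$. A function $f\in H^\infty(\mathbb{D})$ is outer if $\overline{\operatorname{span}}^{H^2(\mathbb{D})}\{z^mf:m\ge0\}=H^2(\mathbb{D})$, where $H^2(\mathbb{D})$ is the Hardy space. Every nonzero $f\in H^\infty(\mathbb{D})$ factors as $f=f_If_O$ with $f_I$ inner ($|\tilde f_I|=1$ a.e. on $\mathbb{T}$) and $f_O$ outer, uniquely up to unimodular constants. Zero sets: $z\in\mathbb{T}$ is an essential zero of an outer function $f\in H^\infty(\mathbb{D})$ if for every $\varepsilon>0$ and every open neighborhood $N_z\subset\mathbb{T}$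 of $z$, $\mu(|\tilde f|^{-1}(0,\varepsilon)\cap N_z)\ne0$; $Z_{\mathbb{T}}(f)$ is the set of essential zeros of $f$. For a general nonzero $f\in H^\infty(\mathbb{D})$, $Z_{\mathbb{T}}(f):=Z_{\mathbb{T}}(f_O)$. $Z^\infty(\mathbb{D})$ is the set of all nonzero $f\in H^\infty(\mathbb{D})$ that have a continuous extension to $\mathbb{D}\cup Z_{\mathbb{T}}(f)$. $M$-ideal: a closed subspace $C$ of a complex Banach space $X$ is an $M$-ideal in $X$ if there is a bounded linear projection $P:X^*\to X^*$ ($P^2=P$) with $\operatorname{ran}P=C^\perp=\{x^*\in X^*: x^*|_C\equiv0\}$ and $\|Px^*\|+\|(I-P)x^*\|=\|x^*\|$ for all $x^*\in X^*$. *)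

(* Defs.v *)
From HB Require Import structures.
From mathcomp Require Import all_boot all_order all_algebra.
From mathcomp Require Import complex ring lra.
From mathcomp Require Import all_classical all_reals all_analysis.

Set Implicit Arguments.
Unset Strict Implicit.
Unset Printing Implicit Defensive.

Import Order.TTheory GRing.Theory Num.Theory numFieldNormedType.Exports.

Local Open Scope classical_set_scope.
Local Open Scope ring_scope.

(* The complex numbers R[i] behind a constant of type numFieldType: on its
   carrier the norm and topology are those of an abstract numFieldType, and
   unification is not tempted to unfold the construction of R[i]. *)
Definition Cplx (R : realType) : numFieldType := R[i].

Section complex_numbers.
Variable R : realType.

Definition toC (r : R) : Cplx R := r%:C%C.

(* A norm over C takes values in C; rnorm x is the underlying real number. *)
Definition rnorm (V : normedZmodType (Cplx R)) (x : V) : R := complex.Re `|x|.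

Lemma rnormE (V : normedZmodType (Cplx R)) (x : V) : toC (rnorm x) = `|x|.
Proof.
rewrite /toC /rnorm.
have := normr_ge0 x; move: `|x| => [a b] /=.
by rewrite (@lecE R) => /andP[/eqP /= -> _].
Qed.

Lemma toCD x y : toC (x + y) = toC x + toC y.
Proof. by rewrite /toC rmorphD. Qed.

Lemma toCM x y : toC (x * y) = toC x * toC y.
Proof. by rewrite /toC rmorphM. Qed.

Lemma toC0 : toC 0 = 0. Proof. by []. Qed.

Lemma toC1 : toC 1 = 1. Proof. by []. Qed.

Lemma toC_le x y : (toC x <= toC y) = (x <= y).
Proof. exact: (@lecR R). Qed.

Lemma toC_lt x y : (toC x < toC y) = (x < y).
Proof. exact: (@ltcR R). Qed.

Lemma toC_inj : injective toC.
Proof. by move=> x y []. Qed.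

Lemma rnorm_ge0 (V : normedZmodType (Cplx R)) (x : V) : 0 <= rnorm x.
Proof. by rewrite -toC_le rnormE toC0. Qed.

Lemma rnormD (V : normedZmodType (Cplx R)) (x y : V) :
  rnorm (x + y) <= rnorm x + rnorm y.
Proof. by rewrite -toC_le toCD !rnormE ler_normD. Qed.

Lemma rnormZ (V : normedModType (Cplx R)) (a : Cplx R) (x : V) :
  rnorm (a *: x) = rnorm a * rnorm x.
Proof. by apply: toC_inj; rewrite toCM !rnormE normrZ. Qed.

Lemma rnormM (a b : Cplx R) : rnorm (a * b) = rnorm a * rnorm b.
Proof. by apply: toC_inj; rewrite toCM !rnormE normrM. Qed.

Lemma rnorm0 (V : normedZmodType (Cplx R)) : rnorm (0 : V) = 0.
Proof. by apply: toC_inj; rewrite rnormE normr0. Qed.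

Lemma rnorm0_eq0 (V : normedZmodType (Cplx R)) (x : V) : rnorm x = 0 -> x = 0.
Proof. by move=> x0; apply/eqP; rewrite -normr_eq0 -rnormE x0. Qed.

End complex_numbers.

Section supnorm.
Variables (R : realType) (T : Type) (A : set T).
Implicit Types f g : T -> Cplx R.

Definition bounded_on f := exists M : R, forall t, A t -> rnorm (f t) <= M.

Definition supnorm f : R := sup [set rnorm (f t) | t in A].

Lemma supnorm_ub f t : bounded_on f -> A t -> rnorm (f t) <= supnorm f.
Proof.
move=> [M fM] At; apply: ub_le_sup; last by exists t.
by exists M => _ [u Au <-]; exact: fM.
Qed.

Hypothesis A0 : A !=set0.

Lemma supnorm_le f (M : R) :
  (forall t, A t -> rnorm (f t) <= M) -> supnorm f <= M.
Proof.
move=> fM; apply: ge_sup; last by move=> _ [t At <-]; exact: fM.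
by case: A0 => t At; exists (rnorm (f t)); exists t.
Qed.

Lemma supnorm_ge0 f : bounded_on f -> 0 <= supnorm f.
Proof.
by case: A0 => t At bf; rewrite (le_trans _ (supnorm_ub bf At)) ?rnorm_ge0.
Qed.

Lemma bounded_onD f g :
  bounded_on f -> bounded_on g -> bounded_on (fun t => f t + g t).
Proof.
move=> [M fM] [N gN]; exists (M + N) => t At.
by rewrite (le_trans (rnormD _ _)) ?lerD ?fM ?gN.
Qed.

Lemma bounded_onM f g :
  bounded_on f -> bounded_on g -> bounded_on (fun t => f t * g t).
Proof.
move=> [M fM] [N gN]; exists (M * N) => t At.
by rewrite rnormM ler_pM ?rnorm_ge0 ?fM ?gN.
Qed.

Lemma bounded_on_cst a : bounded_on (fun=> a).
Proof. by exists (rnorm a). Qed.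

Lemma supnormD f g : bounded_on f -> bounded_on g ->
  supnorm (fun t => f t + g t) <= supnorm f + supnorm g.
Proof.
move=> bf bg; apply: supnorm_le => t At.
by rewrite (le_trans (rnormD _ _)) ?lerD ?supnorm_ub.
Qed.

Lemma supnormM f g : bounded_on f -> bounded_on g ->
  supnorm (fun t => f t * g t) <= supnorm f * supnorm g.
Proof.
move=> bf bg; apply: supnorm_le => t At.
by rewrite rnormM ler_pM ?rnorm_ge0 ?supnorm_ub.
Qed.

Lemma supnormZ a f : bounded_on f ->
  supnorm (fun t => a * f t) = rnorm a * supnorm f.
Proof.
move=> bf; apply/eqP; rewrite eq_le; apply/andP; split.
  by apply: supnorm_le => t At; rewrite rnormM ler_wpM2l ?rnorm_ge0 ?supnorm_ub.
have [->|a0] := eqVneq a 0.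
  rewrite rnorm0 mul0r supnorm_ge0//.
  by apply: bounded_onM => //; exact: bounded_on_cst.
have na0 : 0 < rnorm a.
  rewrite lt_neqAle rnorm_ge0 andbT eq_sym.
  by apply: contra_neq a0 => /rnorm0_eq0.
rewrite mulrC -ler_pdivlMr//; apply: supnorm_le => t At.
rewrite ler_pdivlMr// mulrC -rnormM.
apply: (supnorm_ub (f := fun t => a * f t)) => //.
by apply: bounded_onM => //; exact: bounded_on_cst.
Qed.

Lemma supnorm_eq0 f : bounded_on f -> supnorm f = 0 -> forall t, A t -> f t = 0.
Proof.
move=> bf f0 t At; apply/rnorm0_eq0/eqP.
by rewrite eq_le rnorm_ge0 andbT -f0 supnorm_ub.
Qed.

End supnorm.

Section dual.
Variables (R : realType) (X : normedModType (Cplx R)).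

Definition dual_pred : {pred X -> Cplx R} :=
  fun phi => `[< scalar phi /\ continuous phi >].

Record dual := Dual {
  dual_fun :> X -> Cplx R;
  dual_funP : dual_fun \in dual_pred }.

Lemma dual_predP (phi : X -> Cplx R) :
  phi \in dual_pred <-> scalar phi /\ continuous phi.
Proof. by split=> [/asboolP|/asboolP]. Qed.

Lemma dual_submod_closed : submod_closed dual_pred.
Proof.
split=> [|a phi psi /dual_predP[lphi cphi] /dual_predP[lpsi cpsi]].
  apply/dual_predP; split; last exact: cst_continuous.
  by move=> a x y /=; rewrite mulr0 addr0.
apply/dual_predP; split=> [b x y|x].
  rewrite !fctE /= lphi lpsi /GRing.scale/=; ring.
apply: continuousD; last exact: cpsi.
by apply: continuousM; [exact: cst_continuous|exact: cphi].
Qed.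

HB.instance Definition _ := [isSub for dual_fun].
HB.instance Definition _ := [Choice of dual by <:].
HB.instance Definition _ := GRing.isSubmodClosed.Build (Cplx R)
  (X -> Cplx R) dual_pred dual_submod_closed.
HB.instance Definition _ := [SubChoice_isSubLmodule of dual by <:].

Let unit_ball : set X := [set x | rnorm x <= 1].

Let unit_ball0 : unit_ball !=set0.
Proof. by exists 0; rewrite /unit_ball /= rnorm0. Qed.

Let dual_bounded (phi : dual) : bounded_on unit_ball phi.
Proof.
have /dual_predP[lphi cphi] := dual_funP phi.
pose F := GRing.isLinear.Build _ _ _ _ (phi : X -> Cplx R) lphi.
pose L : {linear X -> Cplx R | *%R} := HB.pack (phi : X -> Cplx R) F.
have cL : continuous (L : X -> Cplx R) := cphi.
have /linear_bounded_continuous/linear_boundedP := cL.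
move=> /pinfty_ex_gt0[M M0 phiM].
exists (rnorm M) => x x1; rewrite -toC_le !rnormE.
rewrite (le_trans (phiM x))// gtr0_norm// ler_piMr ?(ltW M0)//.
by rewrite -rnormE -toC1 toC_le.
Qed.

Definition dual_norm (phi : dual) : Cplx R :=
  toC (supnorm [set x : X | rnorm x <= 1] phi).

Lemma dual_addE (phi psi : dual) x : (phi + psi) x = phi x + psi x.
Proof. by []. Qed.

Lemma dual_scaleE (a : Cplx R) (phi : dual) x : (a *: phi) x = a * phi x.
Proof. by []. Qed.

Let dual_normD phi psi :
  dual_norm (phi + psi) <= dual_norm phi + dual_norm psi.
Proof. by rewrite -toCD toC_le; exact: supnormD. Qed.

Let dual_normZ (a : Cplx R) phi : dual_norm (a *: phi) = `|a| * dual_norm phi.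
Proof.
rewrite -rnormE -toCM /dual_norm.
rewrite (_ : dual_fun (a *: phi) = fun x => a * phi x).
  by rewrite supnormZ.
by apply/funext => x; exact: dual_scaleE.
Qed.

Let dual_norm_eq0 phi : dual_norm phi = 0 -> phi = 0.
Proof.
move=> /toC_inj phi0; apply/val_inj/funext => x /=.
have phi1 := supnorm_eq0 (@dual_bounded phi) phi0.
have [->|x0] := eqVneq x 0.
  have /dual_predP[lphi _] := dual_funP phi.
  by have := lphi (-1) 0 0; rewrite scaler0 addr0 mulN1r addNr.
have /dual_predP[lphi _] := dual_funP phi.
have := lphi `|x|^-1 x 0; rewrite addr0 phi1 => [|]; last first.
  by rewrite /unit_ball/= -toC_le rnormE normfZV.
rewrite (phi1 0); last by rewrite /unit_ball/= rnorm0.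
rewrite addr0 => /esym/eqP; rewrite mulf_eq0 invr_eq0 normr_eq0 (negPf x0)/=.
by move/eqP.
Qed.

HB.instance Definition _ := Lmodule_isNormed.Build (Cplx R) dual
  dual_normD dual_normZ dual_norm_eq0.

End dual.

Section M_ideal.
Variables (R : realType) (X : normedModType (Cplx R)).

Definition closed_subspace (C : set X) :=
  [/\ closed C, C 0 & forall (a : Cplx R) x y, C x -> C y -> C (a *: x + y)].

Definition annihilator (C : set X) : set (dual X) :=
  [set phi | forall x, C x -> phi x = 0].

Definition M_ideal (C : set X) :=
  closed_subspace C /\
  exists P : {linear dual X -> dual X},
    [/\ continuous P, forall phi, P (P phi) = P phi,
        range P = annihilator C &
        forall phi, `|P phi| + `|phi - P phi| = `|phi| ].

End M_ideal.

Section Hinf.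
Variable R : realType.

Definition disc : set (Cplx R) := [set z | `|z| < 1].

Definition circle : set (Cplx R) := [set z | `|z| = 1].

Definition analytic_on_disc (f : Cplx R -> Cplx R) :=
  forall z, disc z -> derivable f z 1.

(* A bounded analytic function on the disc is represented by its extension by
   0 to the plane, so that equality of representatives is equality on the
   disc.  In particular the unit of the algebra is the indicator function of
   the disc. *)
Definition Hinf_pred : {pred Cplx R -> Cplx R} :=
  fun f => `[< [/\ forall z, ~ disc z -> f z = 0, analytic_on_disc f &
                   bounded_on disc f] >].

Record Hinf := MkHinf {
  Hinf_fun :> Cplx R -> Cplx R;
  Hinf_funP : Hinf_fun \in Hinf_pred }.

Lemma Hinf_predP f : f \in Hinf_pred <->
  [/\ forall z, ~ disc z -> f z = 0, analytic_on_disc f & bounded_on disc f].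
Proof. by split=> [/asboolP|/asboolP]. Qed.

Let disc0 : disc !=set0.
Proof. by exists 0; rewrite /disc/= normr0. Qed.

Lemma Hinf_out (f : Hinf) z : ~ disc z -> f z = 0.
Proof. by have /Hinf_predP[+ _ _] := Hinf_funP f; exact. Qed.

Lemma Hinf_analytic (f : Hinf) : analytic_on_disc f.
Proof. by have /Hinf_predP[] := Hinf_funP f. Qed.

Lemma Hinf_bounded (f : Hinf) : bounded_on disc f.
Proof. by have /Hinf_predP[] := Hinf_funP f. Qed.

Lemma Hinf_submod_closed : submod_closed Hinf_pred.
Proof.
split=> [|a f g /Hinf_predP[f0 df bf] /Hinf_predP[g0 dg bg]].
  apply/Hinf_predP; split=> //; last exact: bounded_on_cst.
apply/Hinf_predP; split=> [z Dz|z Dz|].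
- by rewrite !fctE f0// g0// scaler0 addr0.
- by apply: derivableD; [apply: derivableZ; exact: df|exact: dg].
- apply: bounded_onD => //.
  by apply: (bounded_onM (f := fun=> a)) => //; exact: bounded_on_cst.
Qed.

HB.instance Definition _ := [isSub for Hinf_fun].
HB.instance Definition _ := [Choice of Hinf by <:].
HB.instance Definition _ := GRing.isSubmodClosed.Build (Cplx R)
  (Cplx R -> Cplx R) Hinf_pred Hinf_submod_closed.
HB.instance Definition _ := [SubChoice_isSubLmodule of Hinf by <:].

Lemma Hinf_addE (f g : Hinf) z : (f + g) z = f z + g z.
Proof. by []. Qed.

Lemma Hinf_scaleE (a : Cplx R) (f : Hinf) z : (a *: f) z = a * f z.
Proof. by []. Qed.

Let Hinf_mul_subproof (f g : Hinf) : (f : Cplx R -> Cplx R) * g \in Hinf_pred.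
Proof.
apply/Hinf_predP; split=> [z Dz|z Dz|].
- by rewrite !fctE (Hinf_out _ Dz) mul0r.
- by apply: derivableM; exact: Hinf_analytic.
- by apply: bounded_onM; exact: Hinf_bounded.
Qed.

Definition Hinf_mul f g := MkHinf (Hinf_mul_subproof f g).

Lemma open_disc : open disc.
Proof.
rewrite (_ : disc = ball (0 : Cplx R) 1); first exact: ball_open.
by apply/seteqP; split=> z; rewrite /disc -ball_normE /ball_/= sub0r normrN.
Qed.

Let Hinf_one_subproof :
  (fun z : Cplx R => (z \in disc)%:R : Cplx R) \in Hinf_pred.
Proof.
apply/Hinf_predP; split=> [z Dz|z Dz|].
- by rewrite memNset.
- have D1 : {near z, (cst 1 : Cplx R -> Cplx R) =1 fun w => (w \in disc)%:R}.
    have := open_nbhs_nbhs (conj open_disc Dz).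
    by apply: filterS => w Dw; rewrite mem_set.
  exact: near_eq_derivable D1 (derivable_cst _ _ _).
- by exists 1 => z Dz; rewrite mem_set// -toC_le rnormE normr1.
Qed.

Definition Hinf_one := MkHinf Hinf_one_subproof.

Let mulA : associative Hinf_mul.
Proof. by move=> f g h; apply/val_inj/funext => z /=; rewrite !fctE mulrA. Qed.

Let mulC : commutative Hinf_mul.
Proof. by move=> f g; apply/val_inj/funext => z /=; rewrite !fctE mulrC. Qed.

Let mul1f : left_id Hinf_one Hinf_mul.
Proof.
move=> f; apply/val_inj/funext => z /=; rewrite !fctE.
have [Dz|Dz] := pselect (disc z); first by rewrite mem_set// mul1r.
by rewrite Hinf_out// mulr0.
Qed.

Let mulDl : left_distributive Hinf_mul +%R.
Proof. by move=> f g h; apply/val_inj/funext => z /=; rewrite !fctE mulrDl. Qed.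

Let one_neq0 : Hinf_one != 0.
Proof.
apply/eqP => /(congr1 (fun f : Hinf => f 0))/eqP/=.
by rewrite mem_set/= ?oner_eq0// /disc/= normr0.
Qed.

HB.instance Definition _ := GRing.Zmodule_isComNzRing.Build Hinf
  mulA mulC mul1f mulDl one_neq0.

Lemma Hinf_mulE (f g : Hinf) z : (f * g) z = f z * g z.
Proof. by []. Qed.

Definition Hinf_norm (f : Hinf) : Cplx R := toC (supnorm disc f).

Let Hinf_normD f g : Hinf_norm (f + g) <= Hinf_norm f + Hinf_norm g.
Proof. by rewrite -toCD toC_le; apply: supnormD => //; exact: Hinf_bounded. Qed.

Let Hinf_normZ (a : Cplx R) f : Hinf_norm (a *: f) = `|a| * Hinf_norm f.
Proof.
rewrite -rnormE -toCM /Hinf_norm.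
rewrite (_ : Hinf_fun (a *: f) = fun z => a * f z).
  by rewrite supnormZ//; exact: Hinf_bounded.
by apply/funext => z; exact: Hinf_scaleE.
Qed.

Let Hinf_norm_eq0 f : Hinf_norm f = 0 -> f = 0.
Proof.
move=> /toC_inj f0; apply/val_inj/funext => z /=.
have [Dz|] := pselect (disc z); last exact: Hinf_out.
by apply: (supnorm_eq0 _ f0) => //; exact: Hinf_bounded.
Qed.

HB.instance Definition _ := Lmodule_isNormed.Build (Cplx R) Hinf
  Hinf_normD Hinf_normZ Hinf_norm_eq0.

Lemma Hinf_normM (f g : Hinf) : `|f * g| <= `|f| * `|g|.
Proof. by rewrite -toCM toC_le; apply: supnormM => //; exact: Hinf_bounded. Qed.

End Hinf.

Section circle_measure.
Variable R : realType.

Definition expi (t : R) : Cplx R := (cos t +i* sin t)%C.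

Definition Cplx_borel := g_sigma_algebraType (@open (Cplx R)).

(* Normalized Lebesgue measure on the circle, as a Borel measure on the plane
   carried by the circle. *)
Definition circle_measure (A : set Cplx_borel) : \bar R :=
  (((2 * pi)^-1)%R%:E *
   lebesgue_measure (`[0%R, (2 * pi)%R[ `&` expi @^-1` A))%E.

Lemma expi_continuous : continuous (expi : R -> Cplx R).
Proof.
move=> t; apply/(@cvgrPdist_lt (Cplx R) (Cplx R)) => e e0.
have e0' : 0 < rnorm e.
  by rewrite -toC_lt rnormE toC0 gtr0_norm.
have e2 : 0 < rnorm e / 2 by rewrite divr_gt0.
have /cvgrPdist_lt/(_ _ e2) ct := @continuous_cos R t.
have /cvgrPdist_lt/(_ _ e2) st := @continuous_sin R t.
near=> u.
rewrite -(gtr0_norm e0) -!rnormE toC_lt.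
have -> : expi t - expi u =
    toC (cos t - cos u) + toC (sin t - sin u) * ('i%C : Cplx R).
  rewrite /expi /toC; apply/eqP; rewrite eq_complex /=.
  by rewrite !(mul0r, mulr0, mul1r, mulr1, subr0, addr0, add0r) !eqxx.
have toC_norm (x : R) : rnorm (toC x) = `|x|.
  by rewrite /rnorm normc_def /= expr0n/= addr0 sqrtr_sqr.
have i1 : rnorm ('i%C : Cplx R) = 1.
  by rewrite /rnorm normc_def /= expr0n/= expr1n add0r sqrtr1.
rewrite (le_lt_trans (rnormD _ _))// rnormM i1 mulr1 !toC_norm.
rewrite [ltRHS]splitr ltrD//; near: u; [exact: ct|exact: st].
Unshelve. all: by end_near. Qed.

Lemma measurable_expi :
  measurable_fun setT (expi : measurableTypeR R -> Cplx_borel).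
Proof.
apply: (@measurability _ _ (measurableTypeR R) Cplx_borel setT expi
  (@open (Cplx R))) => //.
move=> _ [A oA <-]; rewrite setTI; apply: measurable_realfun.open_measurable.
by move/continuousP : expi_continuous; exact.
Qed.

Let mI : measurable (`[0, 2 * pi[%classic : set (measurableTypeR R)).
Proof. exact: measurable_itv. Qed.

Let pi2_ge0 : 0 <= (2 * pi : R)^-1.
Proof. by rewrite invr_ge0 mulr_ge0// pi_ge0. Qed.

Let circle_measure0 : circle_measure set0 = 0%E.
Proof. by rewrite /circle_measure preimage_set0 setI0 measure0 mule0. Qed.

Let circle_measure_ge0 A : (0 <= circle_measure A)%E.
Proof. by rewrite mule_ge0// lee_fin. Qed.

Let circle_measure_sigma_additive : semi_sigma_additive circle_measure.
Proof.
pose mu : {measure set (measurableTypeR R) -> \bar R} :=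
  mrestr lebesgue_measure mI.
pose nu := measure_function_pushforward__canonical__measure_function_Measure
  mu measurable_expi.
rewrite (_ : circle_measure = mscale (NngNum pi2_ge0) nu).
  exact: measure_semi_sigma_additive.
apply/funext => A; rewrite /circle_measure /mscale /=.
by rewrite /pushforward /mrestr setIC.
Qed.

HB.instance Definition _ := isMeasure.Build _ _ _ circle_measure
  circle_measure0 circle_measure_ge0 circle_measure_sigma_additive.

Lemma circle_measureT : circle_measure setT = 1%E.
Proof.
have pi2 : 0 < 2 * pi :> R by rewrite mulr_gt0// pi_gt0.
rewrite /circle_measure preimage_setT setIT lebesgue_measure_itv/= lte_fin pi2.
by rewrite sube0 -EFinM mulVf// gt_eqF.
Qed.

End circle_measure.

Section Hardy.
Variable R : realType.
Local Notation mu := (@circle_measure R).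

(* Unspecified where the limit does not exist, which for bounded analytic
   functions is a null set of points of the circle (Fatou). *)
Definition radial_limit (f : Cplx R -> Cplx R) (z : Cplx R) : Cplx R :=
  lim (f (toC r * z) @[r --> (1 : R)^'-]).

Definition H2_norm (f : Cplx R -> Cplx R) : \bar R :=
  ereal_sup [set 'N[mu]_2%:E[(fun z => (rnorm (f (toC r * z)))%:E)]%E
            | r in [set r : R | 0 <= r < 1]].

(* Only the restriction to the disc of a function is relevant here. *)
Definition H2 : set (Cplx R -> Cplx R) :=
  [set f | analytic_on_disc f /\ (H2_norm f < +oo)%E].

Definition H2_closure (A : set (Cplx R -> Cplx R)) : set (Cplx R -> Cplx R) :=
  [set g | H2 g /\
     forall e : R, 0 < e -> exists2 h, A h & (H2_norm (g - h)%R < e%:E)%E].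

(* The span of the functions z ^+ m * f, written as polynomial multiples. *)
Definition shift_span (f : Cplx R -> Cplx R) : set (Cplx R -> Cplx R) :=
  range (fun (p : {poly Cplx R}) z => p.[z] * f z).

Definition outer (f : Hinf R) := H2_closure (shift_span f) = H2.

Definition inner (f : Hinf R) :=
  {ae mu, forall z, circle z -> `|radial_limit f z| = 1}.

Definition outer_ess_zero (f : Hinf R) : set (Cplx R) :=
  [set z | circle z /\
     forall (e : R) (U : set (Cplx R)), 0 < e -> open_nbhs z U ->
       mu ([set w | circle w /\ 0 < rnorm (radial_limit f w) < e] `&` U)
         <> 0%E].

(* The outer factor is unique up to a unimodular constant, which does not
   affect its essential zeros. *)
Definition ess_zero (f : Hinf R) : set (Cplx R) :=
  [set z | exists fI fO : Hinf R,
     [/\ inner fI, outer fO, f = fI * fO & outer_ess_zero fO z]].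

Definition Zinf (f : Hinf R) :=
  f != 0 /\
  exists g : Cplx R -> Cplx R, (forall z, disc z -> g z = f z) /\
    {within (@disc R) `|` ess_zero f, continuous g}.

Definition closed_ideal (I : set (Hinf R)) :=
  [/\ closed I, I 0, forall f g, I f -> I g -> I (f + g) &
      forall f g, I f -> I (f * g)].

Definition ideal_gen (S : set (Hinf R)) : set (Hinf R) :=
  smallest closed_ideal S.

Lemma ideal_gen1 (f : Hinf R) : ideal_gen [set f] = closure (range ( *%R f)).
Proof.
have mulg_cts (g : Hinf R) : continuous (fun h : Hinf R => h * g).
  move=> h; apply/(@cvgrPdist_lt (Cplx R) (Hinf R) _ (nbhs h)) => e e0.
  near=> k.
  rewrite -mulrBl (le_lt_trans (Hinf_normM _ _))//.
  have g1 : 0 < `|g| + 1 by rewrite ltr_wpDl.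
  rewrite (@le_lt_trans _ _ (`|h - k| * (`|g| + 1)))//.
    by rewrite ler_wpM2l// lerDl.
  rewrite -ltr_pdivlMr//; near: k; apply: cvgr_dist_lt; first exact: cvg_id.
  by rewrite divr_gt0.
apply/seteqP; split.
  apply: smallest_sub; last first.
    by move=> _ ->; apply: subset_closure; exists 1 => //; rewrite mulr1.
  split.
  - exact: closed_closure.
  - by apply: subset_closure; exists 0 => //; rewrite mulr0.
  - move=> g h cg ch U.
    have := @add_continuous _ (g, h).
    move=> /[apply] -[[V W] /= [Vg Wh] VWU].
    have [_ [[g' _ <-] Vg']] := cg V Vg.
    have [_ [[h' _ <-] Wh']] := ch W Wh.
    exists (f * (g' + h')); split; first by exists (g' + h').
    by rewrite mulrDr; exact: (VWU (_, _)).
  - move=> g h cg U /(mulg_cts h g) /cg[_ [[g' _ <-] Ug']].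
    by exists (f * (g' * h)); split; [exists (g' * h)|rewrite mulrA].
move=> g cg I [[cI _ _ IM] fI]; apply: cI.
move: g cg; apply: closureS => _ [g _ <-]; apply: IM.
exact: fI.
Unshelve. all: by end_near. Qed.

End Hardy.

(* Main.v *)
(* Write J for the ideal.  Splitting functionals by the L-projection gives, as in
   the n-ball property of M-ideals: finitely many balls that have a common point
   and all meet J have, after an arbitrarily small enlargement, a common point
   in J.  Applied to the unit balls about 1 + c f_i and 1 - c f_i this produces
   y in J with |1 - y|^2 + |c f_i|^2 <= (1 + e)^2, and the elements
   1 - (1 - y)^n, pushed back into the ball |1 - Y| <= 1 by further ball
   intersections, form an approximate unit (Y_n) for the f_i.  Then
   x = sum 2^-n Y_n lies in J and has nonnegative real part, so that
   f_i = lim x f_i / (x + e) and J is the closed ideal generated by x.  The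
   functions w = e / (x + e) satisfy |w|^2 <= Re w and w(0) -> 0, hence tend to 0
   in H^2; thus 1 = lim x / (x + e) is in the H^2-closure of the multiples of x
   and x is outer.

   An essential zero of x is one of every f_i, because f_i = lim x h_n with h_n
   bounded; this uses the existence of inner-outer factorizations and of radial
   limits (Fatou).  There f_i extends continuously by 0, and the functions
   tending to 0 at a given point form a closed ideal, so x tends to 0 too.

   Inner-outer factorization is done in l^2, on Taylor coefficients: if q is
   the component of A orthogonal to the shifts of A P, P the polynomials, then q
   is orthogonal to its own shifts, phi = q / |q| is an isometric multiplier,
   and A = phi h with h cyclic.  Radial limits come from Poisson's formula at
   Lebesgue points. *)
From HB Require Import structures.
Require Import Defs.
From mathcomp Require Import all_boot all_order all_algebra.
From mathcomp Require Import complex ring lra.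
From mathcomp Require Import all_classical all_reals all_analysis measurable_realfun.

Set Implicit Arguments.
Unset Strict Implicit.
Unset Printing Implicit Defensive.

Import Order.TTheory GRing.Theory Num.Theory numFieldNormedType.Exports.

Local Open Scope classical_set_scope.
Local Open Scope ring_scope.

(** * Complex numbers *)

(** The exact bound |1 - Y| <= 1 is what allows a single generator: it gives 2 Re Y >= |Y|^2, so the
    terms of sum 2^-n Y_n cannot cancel. A power of 1 - y is only bounded by 1 + d, whence the
    further round of ball intersections, with halved excess at each turn. The powers work because t
    (1 - t)^n <= 1/n: |1 - y| can be close to 1 only where f_i is small, so f_i (1 - y)^n is
    uniformly small. The quotients f_i / (x + k) approximate well for two different reasons. Where
    |f_i| < e, the error k f_i / (x + k) is already below e. Where |f_i| >= e, some Y_n lies within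
    1/2 of 1, so Re x >= 2^-n / 2, and k is chosen after n. Finiteness of the family enters through
    the finite families of balls: one y serves all the f_i at once. Essential zeros involve the
    outer factor only where its modulus is positive; so besides the existence of factorizations one
    needs that the boundary values of an outer function are nonzero almost everywhere. *)

Section complex_basics.
Variable R : realType.
Local Notation C := (Cplx R).

Definition re (z : C) : R := complex.Re z.
Definition im (z : C) : R := complex.Im z.
Definition cconj (z : C) : C := (re z -i* im z)%C.
Definition imag : C := 'i%C.

Lemma cplxP (z w : C) : re z = re w -> im z = im w -> z = w.
Proof. by case: z => a b; case: w => c d /= -> ->. Qed.

Lemma reD z w : re (z + w) = re z + re w. Proof. by case: z; case: w. Qed.
Lemma imD z w : im (z + w) = im z + im w. Proof. by case: z; case: w. Qed.
Lemma reN z : re (- z) = - re z. Proof. by case: z. Qed.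
Lemma imN z : im (- z) = - im z. Proof. by case: z. Qed.
Lemma reB z w : re (z - w) = re z - re w. Proof. by rewrite reD reN. Qed.
Lemma imB z w : im (z - w) = im z - im w. Proof. by rewrite imD imN. Qed.
Lemma reM z w : re (z * w) = re z * re w - im z * im w.
Proof. by case: z; case: w. Qed.
Lemma imM z w : im (z * w) = re z * im w + im z * re w.
Proof. by case: z => a b; case: w => c d /=; rewrite /im/= addrC. Qed.
Lemma re_toC (r : R) : re (toC r) = r. Proof. by []. Qed.
Lemma im_toC (r : R) : im (toC r) = 0. Proof. by []. Qed.
Lemma re0 : re 0 = 0. Proof. by []. Qed.
Lemma im0 : im 0 = 0. Proof. by []. Qed.
Lemma re1 : re 1 = 1. Proof. by []. Qed.
Lemma im1 : im 1 = 0. Proof. by []. Qed.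
Lemma re_imag : re imag = 0. Proof. by []. Qed.
Lemma im_imag : im imag = 1. Proof. by []. Qed.
Lemma re_conj z : re (cconj z) = re z. Proof. by []. Qed.
Lemma im_conj z : im (cconj z) = - im z. Proof. by []. Qed.

Definition cE := (reD, imD, reN, imN, reM, imM, re_toC, im_toC, re0, im0, re1,
  im1, re_imag, im_imag, re_conj, im_conj).

Lemma cplxE z : z = toC (re z) + imag * toC (im z).
Proof. by apply: cplxP; rewrite !cE; ring. Qed.

Lemma rnorm_sq (z : C) : rnorm z ^+ 2 = re z ^+ 2 + im z ^+ 2.
Proof.
rewrite /rnorm; case: z => a b; rewrite normc_def/= sqr_sqrtr//.
by rewrite addr_ge0// sqr_ge0.
Qed.

Lemma rnorm_sqr_conj (z : C) : toC (rnorm z ^+ 2) = z * cconj z.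
Proof. by rewrite rnorm_sq; apply: cplxP; rewrite !cE; ring. Qed.

Lemma re_le (z : C) : `|re z| <= rnorm z.
Proof.
rewrite -(@ler_pXn2r _ 2) ?nnegrE ?rnorm_ge0// rnorm_sq real_normK ?num_real//.
by rewrite lerDl sqr_ge0.
Qed.

Lemma im_le (z : C) : `|im z| <= rnorm z.
Proof.
rewrite -(@ler_pXn2r _ 2) ?nnegrE ?rnorm_ge0// rnorm_sq real_normK ?num_real//.
by rewrite lerDr sqr_ge0.
Qed.

Lemma rnorm_toC (r : R) : rnorm (toC r) = `|r|.
Proof. by rewrite /rnorm normc_def/= expr0n/= addr0 sqrtr_sqr. Qed.

Lemma rnorm_imag : rnorm imag = 1.
Proof. by rewrite /rnorm normc_def/= expr0n/= expr1n add0r sqrtr1. Qed.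

Lemma rnorm1 : rnorm (1 : C) = 1.
Proof. by rewrite -toC1 rnorm_toC normr1. Qed.

Lemma rnorm_le_reim (z : C) : rnorm z <= `|re z| + `|im z|.
Proof.
rewrite {1}(cplxE z) (le_trans (rnormD _ _))//.
by rewrite rnormM rnorm_imag mul1r !rnorm_toC.
Qed.

Lemma rnormN (V : normedZmodType C) (x : V) : rnorm (- x) = rnorm x.
Proof. by rewrite /rnorm normrN. Qed.

Lemma rnorm_distC (V : normedZmodType C) (x y : V) : rnorm (x - y) = rnorm (y - x).
Proof. by rewrite -rnormN opprB. Qed.

Lemma rnormB (V : normedZmodType C) (x y : V) : rnorm (x - y) <= rnorm x + rnorm y.
Proof. by rewrite (le_trans (rnormD _ _))// rnormN. Qed.

Lemma rnorm_subr (V : normedZmodType C) (x y : V) : rnorm x <= rnorm y + rnorm (x - y).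
Proof. by rewrite -{1}(subrK y x) addrC rnormD. Qed.

Lemma rnorm_trian (V : normedZmodType C) (y x z : V) :
  rnorm (x - z) <= rnorm (x - y) + rnorm (y - z).
Proof. by rewrite (le_trans _ (rnormD _ _))// addrA subrK. Qed.

Lemma rnorm_dist_dist (V : normedZmodType C) (x y : V) :
  `|rnorm x - rnorm y| <= rnorm (x - y).
Proof.
have h1 := rnorm_subr x y; have h2 := rnorm_subr y x.
by rewrite rnorm_distC in h2; rewrite ler_norml; apply/andP; split; lra.
Qed.

Lemma rnormX (z : C) n : rnorm (z ^+ n) = rnorm z ^+ n.
Proof. by elim: n => [|n IH]; rewrite ?expr0 ?rnorm1// !exprS rnormM IH. Qed.

Lemma rnorm_eq0 (V : normedZmodType C) (x : V) : (rnorm x == 0) = (x == 0).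
Proof.
apply/eqP/eqP => [|->]; [exact: rnorm0_eq0|exact: rnorm0].
Qed.

Lemma rnorm_gt0 (V : normedZmodType C) (x : V) : (0 < rnorm x) = (x != 0).
Proof. by rewrite lt_neqAle rnorm_ge0 andbT eq_sym rnorm_eq0. Qed.

Lemma rnormV (z : C) : rnorm z^-1 = (rnorm z)^-1.
Proof.
have [->|z0] := eqVneq z 0; first by rewrite invr0 rnorm0 invr0.
have r0 : rnorm z != 0 by rewrite rnorm_eq0.
by apply: (mulfI r0); rewrite -rnormM !divff// rnorm1.
Qed.

Lemma rnorm_sum (V : normedZmodType C) I (r : seq I) (P : pred I) (F : I -> V) :
  rnorm (\sum_(i <- r | P i) F i) <= \sum_(i <- r | P i) rnorm (F i).
Proof.
elim/big_ind2 : _ => [|x a y b xa yb|//]; first by rewrite rnorm0.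
by rewrite (le_trans (rnormD _ _))// lerD.
Qed.

Lemma conjD z w : cconj (z + w) = cconj z + cconj w.
Proof. by apply: cplxP; rewrite !cE; ring. Qed.
Lemma conjM z w : cconj (z * w) = cconj z * cconj w.
Proof. by apply: cplxP; rewrite !cE; ring. Qed.
Lemma conj0 : cconj 0 = 0. Proof. by apply: cplxP; rewrite !cE; ring. Qed.
Lemma conj_toC r : cconj (toC r) = toC r.
Proof. by apply: cplxP; rewrite !cE; ring. Qed.
Lemma rnorm_conj z : rnorm (cconj z) = rnorm z.
Proof.
apply/eqP; rewrite -(@eqrXn2 _ 2) ?rnorm_ge0// !rnorm_sq !cE.
by rewrite sqrrN.
Qed.

Lemma toCN (r : R) : toC (- r) = - toC r.
Proof. by apply: cplxP; rewrite !cE; ring. Qed.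
Lemma toCB (r s : R) : toC (r - s) = toC r - toC s.
Proof. by rewrite toCD toCN. Qed.
Lemma toCX (r : R) n : toC (r ^+ n) = toC r ^+ n.
Proof. by elim: n => [|n IH]; rewrite ?expr0// !exprS toCM IH. Qed.
Lemma toCV (r : R) : toC r^-1 = (toC r)^-1.
Proof. by rewrite /toC fmorphV. Qed.
Lemma toC_eq0 (r : R) : (toC r == 0) = (r == 0).
Proof. by rewrite -rnorm_eq0 rnorm_toC normr_eq0. Qed.

Lemma discE (z : C) : disc z <-> rnorm z < 1.
Proof. by rewrite /disc/= -rnormE -toC1 toC_lt. Qed.
Lemma circleE (z : C) : circle z <-> rnorm z = 1.
Proof.
rewrite /circle/= -rnormE; split => [|->]//.
by move=> h; apply: toC_inj; rewrite h.
Qed.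

Lemma expi0 : expi 0 = 1 :> C.
Proof. by apply: cplxP; rewrite /re/im/= ?cos0 ?sin0. Qed.
Lemma expiD (s t : R) : expi (s + t) = expi s * expi t :> C.
Proof.
apply: cplxP; rewrite !cE /re /im /= ?cosD ?sinD; ring.
Qed.
Lemma conj_expi (t : R) : cconj (expi t) = expi (- t).
Proof. by apply: cplxP; rewrite ?cE /re /im /= ?cosN ?sinN. Qed.
Lemma rnorm_expi (t : R) : rnorm (expi t) = 1.
Proof.
apply/eqP; rewrite -(@eqrXn2 _ 2) ?rnorm_ge0// rnorm_sq expr1n /re/im/=.
by rewrite cos2Dsin2.
Qed.
Lemma expi_neq0 (t : R) : expi t != 0.
Proof. by rewrite -rnorm_eq0 rnorm_expi oner_eq0. Qed.
Lemma expiN (t : R) : expi (- t) = (expi t)^-1.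
Proof.
apply: (mulfI (expi_neq0 t)); rewrite divff ?expi_neq0//.
by rewrite -expiD subrr expi0.
Qed.
Lemma expi_X (t : R) n : expi t ^+ n = expi (n%:R * t).
Proof.
elim: n => [|n IH]; first by rewrite mul0r expi0.
by rewrite exprS IH -expiD -natr1 mulrDl mul1r addrC.
Qed.
Lemma expi_2pi : expi (2 * pi) = 1 :> C.
Proof. by apply: cplxP; rewrite /re/im/= mulr_natl ?cos2pi ?sin2pi. Qed.
Lemma circle_expi (t : R) : circle (expi t).
Proof. by apply/circleE; rewrite rnorm_expi. Qed.

(** Distances in a normed space over [Cplx R] are themselves complex numbers; this translation makes
    every epsilon below a real number. *)
Lemma cvg_rnormP (V : normedModType C) T (F : set_system T) {FF : Filter F}
    (f : T -> V) (l : V) :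
  f @ F --> l <-> forall e : R, 0 < e -> \forall x \near F, rnorm (l - f x) < e.
Proof.
split=> [/cvgrPdist_lt h e e0|h].
  have /h : 0 < toC e by rewrite -toC0 toC_lt.
  by apply: filterS => x; rewrite -rnormE toC_lt.
apply/cvgrPdist_lt => e e0.
have e0' : 0 < rnorm e by rewrite rnorm_gt0 gt_eqF.
have := h _ e0'; apply: filterS => x.
by rewrite -toC_lt !rnormE (gtr0_norm e0).
Qed.

Lemma nbhs_rnormP (V : normedModType C) (x : V) (U : set V) :
  nbhs x U <-> exists2 e : R, 0 < e & forall y, rnorm (x - y) < e -> U y.
Proof.
split=> [|[e e0 h]].
  move=> /nbhs_ballP[e /= e0] h; exists (rnorm e); first by rewrite rnorm_gt0 gt_eqF.
  move=> y; rewrite -toC_lt !rnormE (gtr0_norm e0) => xy; apply: h.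
  by rewrite -ball_normE.
apply/nbhs_ballP; exists (toC e) => /=; first by rewrite -toC0 toC_lt.
by move=> y; rewrite -ball_normE /ball_/= -rnormE toC_lt; exact: h.
Qed.

Lemma rnorm_continuous (V : normedModType C) : continuous (@rnorm R V).
Proof.
move=> x; apply/(@cvgrPdist_lt R R _ _ (nbhs_filter _)) => e e0; apply/nbhs_rnormP; exists e => // y xy.
by rewrite (le_lt_trans (rnorm_dist_dist _ _)).
Qed.

Lemma re_continuous : continuous re.
Proof.
move=> x; apply/(@cvgrPdist_lt R R _ _ (nbhs_filter _)) => e e0; apply/(nbhs_rnormP (V := C)); exists e => // y xy.
by rewrite -reB (le_lt_trans (re_le _)).
Qed.

Lemma im_continuous : continuous im.
Proof.
move=> x; apply/(@cvgrPdist_lt R R _ _ (nbhs_filter _)) => e e0; apply/(nbhs_rnormP (V := C)); exists e => // y xy.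
by rewrite -imB (le_lt_trans (im_le _)).
Qed.

Lemma toC_continuous : continuous (@toC R).
Proof.
move=> x; apply/(cvg_rnormP (V := C) (FF := nbhs_filter _)) => e e0; apply/(@nbhs_ballP R R); exists e => // y /=.
by rewrite -ball_normE/= -toCB rnorm_toC.
Qed.

Lemma conj_continuous : continuous cconj.
Proof.
move=> x; apply/(cvg_rnormP (V := C) (FF := nbhs_filter _)) => e e0; apply/(nbhs_rnormP (V := C)); exists e => // y xy.
have -> : cconj x - cconj y = cconj (x - y) by apply: cplxP; rewrite !cE; ring.
by rewrite rnorm_conj.
Qed.

End complex_basics.

(** * Integrals over a segment *)

Section real_integral.
Variable R : realType.
Local Notation leb := (@lebesgue_measure R).
Implicit Types (a b c : R) (f g : R -> R).

Definition rint a b f : R := \int[leb]_(t in `[a, b]) f t.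
Definition rintble a b f := leb.-integrable `[a, b] (EFin \o f).
(** Two-sided continuity at each point of the segment, endpoints included: it composes directly,
    without subspace topologies. *)
Definition rcts a b f := forall t, a <= t <= b -> {for t, continuous f}.

Lemma rcts_within a b f : rcts a b f -> {within `[a, b], continuous f}.
Proof.
move=> cf; apply: continuous_in_subspaceT => x; rewrite inE/= in_itv/=.
exact: cf.
Qed.

Lemma rcts_rintble a b f : rcts a b f -> rintble a b f.
Proof.
move=> cf; apply: continuous_compact_integrable; first exact: segment_compact.
exact: rcts_within.
Qed.

Lemma rintbleD a b f g : rintble a b f -> rintble a b g ->
  rintble a b (fun t => f t + g t).
Proof.
by move=> fi gi; apply: (eq_integrable _ _ _ _ (integrableD _ fi gi)).
Qed.

Lemma rintbleZ a b k f : rintble a b f -> rintble a b (fun t => k * f t).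
Proof.
by move=> fi; apply: (eq_integrable _ _ _ _ (@integrableZl _ _ _ _ _ _ k _ fi)).
Qed.

Lemma rintble_cst a b k : rintble a b (fun=> k).
Proof. by apply: rcts_rintble => t _; exact: cst_continuous. Qed.

Lemma rintD a b f g : rintble a b f -> rintble a b g ->
  rint a b (fun t => f t + g t) = rint a b f + rint a b g.
Proof. by move=> fi gi; rewrite /rint RintegralD. Qed.

Lemma rintZ a b k f : rintble a b f ->
  rint a b (fun t => k * f t) = k * rint a b f.
Proof. by move=> fi; rewrite /rint RintegralZl. Qed.

Lemma rintN a b f : rintble a b f -> rint a b (fun t => - f t) = - rint a b f.
Proof.
move=> fi; rewrite -mulN1r -rintZ//; congr rint; apply/funext => t.
by rewrite mulN1r.
Qed.

Lemma rint_cst a b k : a <= b -> rint a b (fun=> k) = k * (b - a).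
Proof.
move=> ab; rewrite /rint Rintegral_cst//= (@lebesgue_measure_itv R `[a, b])/= lte_fin.
by case: ltgtP ab => //= -> _; rewrite subrr.
Qed.

Lemma le_rint a b f g : rintble a b f -> rintble a b g ->
  (forall t, a <= t <= b -> f t <= g t) -> rint a b f <= rint a b g.
Proof.
by move=> fi gi fg; apply: le_Rintegral => // t /=; rewrite in_itv/=; exact: fg.
Qed.

Lemma eq_rint a b f g : (forall t, a <= t <= b -> f t = g t) ->
  rint a b f = rint a b g.
Proof.
by move=> fg; apply: eq_Rintegral => t; rewrite inE/= in_itv/=; exact: fg.
Qed.

Lemma rint_norm a b f (M : R) : a <= b -> rintble a b f ->
  (forall t, a <= t <= b -> `|f t| <= M) -> `|rint a b f| <= M * (b - a).
Proof.
move=> ab fi fM; rewrite ler_norml -mulNr -!rint_cst//.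
apply/andP; split; apply: le_rint => //; try exact: rintble_cst.
  by move=> t /fM; rewrite ler_norml => /andP[].
by move=> t /fM; rewrite ler_norml => /andP[].
Qed.

Lemma rint_split a b c f : a <= c <= b -> rintble a b f ->
  rint a b f = rint a c f + rint c b f.
Proof.
move=> /andP[ac cb] fi; have := @Rintegral_itvB R f (BLeft a) (BRight b) c fi.
rewrite !bnd_simp => /(_ ac cb) h; apply/eqP; rewrite addrC -subr_eq.
rewrite /rint h; apply/eqP; apply: Rintegral_itv_obnd_cbnd.
by apply: integrableS fi => // t /=; rewrite !in_itv/= => /andP[/ltW ct ->];
  rewrite (le_trans ac).
Qed.

Lemma rint_FTC a b (F : R -> R) f : a < b -> rcts a b f ->
  (forall t : R, is_derive t 1 F (f t)) -> rint a b f = F b - F a.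
Proof.
move=> ab cf dF; rewrite /rint /Rintegral (@continuous_FTC2 R f F a b)//.
- exact: rcts_within.
- split=> [t _||].
  + by have := dF t => - [].
  + apply: cvg_at_right_filter; apply: differentiable_continuous.
    by apply/derivable1_diffP; have := dF a => -[].
  + apply: cvg_at_left_filter; apply: differentiable_continuous.
    by apply/derivable1_diffP; have := dF b => -[].
- by move=> t _; rewrite derive1E; have := dF t => -[].
Qed.

End real_integral.

(** * Integrals of complex-valued functions *)

Section complex_integral.
Variable R : realType.
Local Notation C := (Cplx R).
Implicit Types (a b c : R) (u v : R -> C).

(** Locked so that the integral stays atomic for simplification and unification; [re_cint] and
    [im_cint] are its interface. *)
Definition cint a b u : C :=
  locked (toC (rint a b (fun t => re (u t))) +
          imag R * toC (rint a b (fun t => im (u t)))).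
Definition cintble a b u :=
  rintble a b (fun t => re (u t)) /\ rintble a b (fun t => im (u t)).
Definition ccts a b u := forall t, a <= t <= b -> {for t, continuous u}.

Lemma re_cint a b u : re (cint a b u) = rint a b (fun t => re (u t)).
Proof. by rewrite /cint -lock !cE; ring. Qed.

Lemma im_cint a b u : im (cint a b u) = rint a b (fun t => im (u t)).
Proof. by rewrite /cint -lock !cE; ring. Qed.

Lemma ccts_re a b u : ccts a b u -> rcts a b (fun t => re (u t)).
Proof.
move=> cu t abt; apply: (@continuous_comp _ _ _ u (@re R)); first exact: cu.
exact: re_continuous.
Qed.

Lemma ccts_im a b u : ccts a b u -> rcts a b (fun t => im (u t)).
Proof.
move=> cu t abt; apply: (@continuous_comp _ _ _ u (@im R)); first exact: cu.
exact: im_continuous.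
Qed.

Lemma ccts_cintble a b u : ccts a b u -> cintble a b u.
Proof.
by move=> cu; split; apply: rcts_rintble; [exact: ccts_re|exact: ccts_im].
Qed.

Lemma cintbleD a b u v : cintble a b u -> cintble a b v ->
  cintble a b (fun t => u t + v t).
Proof.
move=> [u1 u2] [v1 v2]; split.
  by under [X in rintble _ _ X]eq_fun do rewrite reD; exact: rintbleD.
by under [X in rintble _ _ X]eq_fun do rewrite imD; exact: rintbleD.
Qed.

Lemma cintbleZ a b k u : cintble a b u -> cintble a b (fun t => k * u t).
Proof.
move=> [u1 u2]; split.
  under [X in rintble _ _ X]eq_fun do rewrite reM -mulNr.
  by apply: rintbleD; exact: rintbleZ.
under [X in rintble _ _ X]eq_fun do rewrite imM.
by apply: rintbleD; exact: rintbleZ.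
Qed.

Lemma cintD a b u v : cintble a b u -> cintble a b v ->
  cint a b (fun t => u t + v t) = cint a b u + cint a b v.
Proof.
move=> [u1 u2] [v1 v2]; apply: cplxP; rewrite !(reD, imD) !(re_cint, im_cint).
  by rewrite -rintD//; apply: eq_rint => t _; rewrite reD.
by rewrite -rintD//; apply: eq_rint => t _; rewrite imD.
Qed.

Lemma cintZ a b k u : cintble a b u ->
  cint a b (fun t => k * u t) = k * cint a b u.
Proof.
move=> [u1 u2]; apply: cplxP; rewrite !(reM, imM) !(re_cint, im_cint).
  rewrite -mulNr -!rintZ// -rintD//; [|exact: rintbleZ|exact: rintbleZ].
  by apply: eq_rint => t _; rewrite reM mulNr.
rewrite -!rintZ// -rintD//; [|exact: rintbleZ|exact: rintbleZ].
by apply: eq_rint => t _; rewrite imM.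
Qed.

Lemma cintbleN a b u : cintble a b u -> cintble a b (fun t => - u t).
Proof.
by move=> /(cintbleZ (-1)); under [X in cintble _ _ X]eq_fun do rewrite mulN1r.
Qed.

Lemma eq_cint a b u v : (forall t, a <= t <= b -> u t = v t) ->
  cint a b u = cint a b v.
Proof.
by move=> uv; apply: cplxP; rewrite !(re_cint, im_cint); apply: eq_rint => t /uv ->.
Qed.

Lemma cintN a b u : cintble a b u -> cint a b (fun t => - u t) = - cint a b u.
Proof.
move=> ui; rewrite -mulN1r -cintZ//; apply: eq_cint => t _.
by rewrite mulN1r.
Qed.

Lemma cintB a b u v : cintble a b u -> cintble a b v ->
  cint a b (fun t => u t - v t) = cint a b u - cint a b v.
Proof. by move=> ui vi; rewrite cintD ?cintN//; exact: cintbleN. Qed.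

Lemma cintbleB a b u v : cintble a b u -> cintble a b v ->
  cintble a b (fun t => u t - v t).
Proof. by move=> ui vi; apply: cintbleD => //; exact: cintbleN. Qed.

Lemma cintble_cst a b k : cintble a b (fun=> k).
Proof. by split; exact: rintble_cst. Qed.

Lemma cint_cst a b k : a <= b -> cint a b (fun=> k) = k * toC (b - a).
Proof.
by move=> ab; apply: cplxP; rewrite !(re_cint, im_cint) rint_cst// !cE; ring.
Qed.

Lemma cint0 a b : cint a b (fun=> 0) = 0.
Proof.
have := @cintZ a b 0 (fun=> 0) (cintble_cst _ _ _).
by rewrite !mul0r.
Qed.

Lemma cintble_sum a b n (F : nat -> R -> C) :
  (forall i, cintble a b (F i)) -> cintble a b (fun t => \sum_(i < n) F i t).
Proof.
move=> Fi; elim: n => [|n IH].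
  have -> : (fun t => \sum_(i < 0) F i t) = (fun=> 0).
    by apply/funext => t; rewrite big_ord0.
  exact: cintble_cst.
have -> : (fun t => \sum_(i < n.+1) F i t) = (fun t => \sum_(i < n) F i t + F n t).
  by apply/funext => t; rewrite big_ord_recr.
exact: (cintbleD IH (Fi n)).
Qed.

Lemma cint_sum a b n (F : nat -> R -> C) : (forall i, cintble a b (F i)) ->
  cint a b (fun t => \sum_(i < n) F i t) = \sum_(i < n) cint a b (F i).
Proof.
move=> Fi; elim: n => [|n IH].
  by rewrite big_ord0 -[RHS](cint0 a b); apply: eq_cint => t _; rewrite big_ord0.
rewrite big_ord_recr/= -IH -cintD//; last exact: cintble_sum.
by apply: eq_cint => t _; rewrite big_ord_recr.
Qed.

(* The factor 2 comes from bounding the real and imaginary parts separately. *)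
Lemma cint_norm a b u (M : R) : a <= b -> cintble a b u ->
  (forall t, a <= t <= b -> rnorm (u t) <= M) ->
  rnorm (cint a b u) <= 2 * M * (b - a).
Proof.
move=> ab [u1 u2] uM; rewrite (le_trans (rnorm_le_reim _))//.
rewrite re_cint im_cint -mulrA mulr_natl mulr2n lerD//.
  by apply: rint_norm => // t /uM; exact/le_trans/re_le.
by apply: rint_norm => // t /uM; exact/le_trans/im_le.
Qed.

Lemma cint_split a b c u : a <= c <= b -> cintble a b u ->
  cint a b u = cint a c u + cint c b u.
Proof.
move=> acb [u1 u2]; apply: cplxP; rewrite !(reD, imD, re_cint, im_cint).
  exact: rint_split.
exact: rint_split.
Qed.

Lemma cint_id a b : a < b ->
  cint a b (@toC R) = toC ((b ^+ 2 - a ^+ 2) / 2).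
Proof.
move=> ab; have d (t : R) : is_derive t 1 (fun t : R => t ^+ 2 * 2^-1) t.
  apply: is_derive_eq.
  by rewrite /GRing.scale/= mulr0 mulr0 add0r !mulr1 -mulr2n mulrnAr -mulrnAl -mulr_natl divff ?mul1r.
apply: cplxP; rewrite !(re_cint, im_cint) ?(re_toC, im_toC).
  rewrite (@rint_FTC _ a b _ id ab _ d) ?mulrBl//.
  by move=> t _; exact: cvg_id.
by rewrite (@eq_rint _ a b _ (fun=> 0)) ?rint_cst ?mul0r// ltW.
Qed.

Lemma expi_continuousC : continuous (@expi R : R -> C).
Proof. exact: expi_continuous. Qed.

Lemma ccts_expi a b k : ccts a b (fun t => expi (k * t)).
Proof.
move=> t _; apply: (@continuous_comp _ _ _ (fun t => k * t) (@expi R)).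
  by apply: continuousM; [exact: cst_continuous|exact: cvg_id].
exact: expi_continuousC.
Qed.

Lemma expi_int (n : int) : expi (n%:~R * (2 * pi)) = 1 :> C.
Proof.
have en (m : nat) : expi (m%:R * (2 * pi)) = 1 :> C.
  by rewrite -expi_X expi_2pi expr1n.
case: n => m; first exact: en.
by rewrite NegzE intrN mulNr expiN en invr1.
Qed.

Lemma cint_expi (n : int) : n != 0 ->
  cint 0 (2 * pi) (fun t => expi (n%:~R * t)) = 0.
Proof.
move=> n0; have nR : n%:~R != 0 :> R by rewrite intr_eq0.
have pi0 : 0 < 2 * pi :> R by rewrite mulr_gt0// pi_gt0.
have en := expi_int n.
have sn : sin (n%:~R * (2 * pi)) = 0 :> R by have := congr1 (@im R) en.
have cn : cos (n%:~R * (2 * pi)) = 1 :> R by have := congr1 (@re R) en.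
have dn (t : R) : is_derive t 1 (fun t => n%:~R * t) n%:~R.
  by apply: is_derive_eq; rewrite /GRing.scale/= mulr1.
have cosD (t : R) : is_derive t 1 (fun t => sin (n%:~R * t) * n%:~R^-1) (cos (n%:~R * t)).
  have h := @is_derive1_comp _ _ _ _ _ _ (is_derive_sin (n%:~R * t)) (dn t).
  apply: is_derive_eq.
  by rewrite /GRing.scale/= !mulr0 add0r mulrCA mulVf ?mulr1.
have sinD (t : R) : is_derive t 1 (fun t => - cos (n%:~R * t) * n%:~R^-1) (sin (n%:~R * t)).
  have h := @is_derive1_comp _ _ _ _ _ _ (is_derive_cos (n%:~R * t)) (dn t).
  apply: is_derive_eq.
  by rewrite /GRing.scale/= !mulr0 add0r; field.
have ce := @ccts_expi 0 (2 * pi) n%:~R.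
apply: cplxP; rewrite !(re_cint, im_cint).
  rewrite (@rint_FTC _ _ _ (fun t => sin (n%:~R * t) / n%:~R)) ?sn//.
    by rewrite mulr0 sin0 mul0r subrr.
  exact: ccts_re.
rewrite (@rint_FTC _ _ _ (fun t => - cos (n%:~R * t) / n%:~R)) ?cn//.
  by rewrite mulr0 cos0 subrr.
exact: ccts_im.
Qed.

End complex_integral.

Lemma geo_small (R : realType) (q c e : R) : 0 <= q -> q < 1 -> 0 < e ->
  exists N, forall n, (N <= n)%N -> c * q ^+ n < e.
Proof.
move=> q0 q1 e0; have q1' : `|q| < 1 by rewrite ger0_norm.
have /cvgrPdist_lt h := @cvg_geometric R c q q1'.
have [N _ hN] := h _ e0; exists N => n /hN.
rewrite /geometric/= sub0r normrN; exact/le_lt_trans/ler_norm.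
Qed.

(** * Goursat's theorem *)

Section goursat.
Variable R : realType.
Local Notation C := (Cplx R).
Implicit Types (G : C -> C) (w z : C) (a b c d s t : R).

(** The derivative in epsilon form, with error relative to |h|: no quotients appear in Goursat's
    estimate or in the chain rule. [cdiffP] identifies it with [derivable]. *)
Definition cdiff G w := exists L : C, forall e : R, 0 < e ->
  exists2 d : R, 0 < d & forall h : C, rnorm h < d ->
    rnorm (G (w + h) - G w - L * h) <= e * rnorm h.

Lemma cdiff_continuous G w : cdiff G w -> {for w, continuous G}.
Proof.
move=> [L /(_ 1 ltr01)[d d0 hd]]; apply/(cvg_rnormP (V := C) (F := nbhs w)) => e e0.
have L1 : 0 < rnorm L + 1 by rewrite ltr_wpDl ?rnorm_ge0.
apply/nbhs_rnormP; exists (Num.min d (e / (rnorm L + 1))).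
  by rewrite lt_min d0 divr_gt0.
move=> y; rewrite lt_min => /andP[wyd wye].
have := hd (y - w); rewrite [w + _]addrC subrK (rnorm_distC y) => /(_ wyd).
rewrite mul1r => h.
have -> : G w - G y = - (G y - G w - L * (y - w)) - L * (y - w) by ring.
rewrite (le_lt_trans (rnormB _ _))// rnormN rnormM (rnorm_distC y).
rewrite (le_lt_trans (lerD h (lexx _)))//.
by move: wye; rewrite ltr_pdivlMr// mulrDr mulr1 addrC (mulrC (rnorm L)).
Qed.

Definition pt s t : C := (s +i* t)%C.

Lemma ptE s t : pt s t = toC s + imag R * toC t.
Proof. by rewrite {1}(cplxE (pt s t)). Qed.

Lemma pt_continuousl t : continuous (fun s => pt s t).
Proof.
move=> s; have -> : (fun s => pt s t) = (fun s => toC s + imag R * toC t).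
  by apply/funext => x; rewrite ptE.
by apply: continuousD; [exact: toC_continuous|exact: cst_continuous].
Qed.

Lemma pt_continuousr s : continuous (fun t => pt s t).
Proof.
move=> t; have -> : (fun t => pt s t) = (fun t => toC s + imag R * toC t).
  by apply/funext => x; rewrite ptE.
apply: (@continuousD C C R (fun=> toC s)); first exact: cst_continuous.
by apply: (@continuousM C R (fun=> imag R)); [exact: cst_continuous|exact: toC_continuous].
Qed.

(** The integral of G(w) dw counterclockwise around the boundary of [rect a b c d]. *)
Definition bdint G a b c d : C :=
  cint a b (fun s => G (pt s c)) + imag R * cint c d (fun t => G (pt b t))
  - cint a b (fun s => G (pt s d)) - imag R * cint c d (fun t => G (pt a t)).

Definition rect a b c d : set C :=
  [set w : C | a <= re w <= b /\ c <= im w <= d].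

Section sides.
Variables (G : C -> C) (a b c d : R).
Hypothesis cG : forall w : C, rect a b c d w -> {for w, continuous G}.

Lemma side_h y : c <= y <= d -> ccts a b (fun s => G (pt s y)).
Proof.
move=> cyd s asb; apply: (@continuous_comp _ _ _ (fun s => pt s y) G).
  exact: pt_continuousl.
by apply: cG; split.
Qed.

Lemma side_v x : a <= x <= b -> ccts c d (fun t => G (pt x t)).
Proof.
move=> axb t ctd; apply: (@continuous_comp _ _ _ (fun t => pt x t) G).
  exact: pt_continuousr.
by apply: cG; split.
Qed.

Lemma bdint_splitl m : a <= m <= b -> c <= d ->
  bdint G a b c d = bdint G a m c d + bdint G m b c d.
Proof.
move=> amb cd; have [am mb] := andP amb; rewrite /bdint.
rewrite (@cint_split _ a b m (fun s => G (pt s c)))//; last first.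
  by apply/ccts_cintble/side_h; rewrite lexx cd.
rewrite (@cint_split _ a b m (fun s => G (pt s d)))//; last first.
  by apply/ccts_cintble/side_h; rewrite lexx cd.
by ring.
Qed.

Lemma bdint_splitr m : c <= m <= d -> a <= b ->
  bdint G a b c d = bdint G a b c m + bdint G a b m d.
Proof.
move=> amb cd; have [am mb] := andP amb; rewrite /bdint.
rewrite (@cint_split _ c d m (fun s => G (pt a s)))//; last first.
  by apply/ccts_cintble/side_v; rewrite lexx cd.
rewrite (@cint_split _ c d m (fun s => G (pt b s)))//; last first.
  by apply/ccts_cintble/side_v; rewrite lexx cd.
by ring.
Qed.

Lemma bdint_norm (M : R) : a <= b -> c <= d ->
  (forall w : C, rect a b c d w -> rnorm (G w) <= M) ->
  rnorm (bdint G a b c d) <= 4 * M * ((b - a) + (d - c)).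
Proof.
move=> ab cd GM; rewrite /bdint.
have h y : c <= y <= d -> rnorm (cint a b (fun s => G (pt s y))) <= 2 * M * (b - a).
  move=> cyd; apply: cint_norm => //; first exact/ccts_cintble/side_h.
  by move=> t atb; apply: GM; split.
have v x : a <= x <= b -> rnorm (cint c d (fun t => G (pt x t))) <= 2 * M * (d - c).
  move=> cyd; apply: cint_norm => //; first exact/ccts_cintble/side_v.
  by move=> t atb; apply: GM; split.
rewrite (le_trans (rnormB _ _))// (le_trans (lerD (rnormB _ _) (lexx _)))//.
rewrite (le_trans (lerD (lerD (rnormD _ _) (lexx _)) (lexx _)))//.
rewrite !rnormM rnorm_imag !mul1r.
have := h c; have := h d; have := v a; have := v b; rewrite !lexx ab cd.
move=> /(_ isT) h1 /(_ isT) h2 /(_ isT) h3 /(_ isT) h4; nra.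
Qed.

End sides.

(** This allows the affine part of a function at a point to be subtracted, leaving only the error of
    differentiability under the integral. *)
Lemma bdint_affine (A B : C) a b c d : a < b -> c < d ->
  bdint (fun w => A + B * w) a b c d = 0.
Proof.
move=> ab cd.
have ci a' b' : cintble a' b' (@toC R).
  by apply: ccts_cintble => t _; exact: toC_continuous.
have h y : cint a b (fun s => A + B * pt s y) =
    (A + B * (imag R * toC y)) * toC (b - a) + B * toC ((b ^+ 2 - a ^+ 2) / 2).
  rewrite (@eq_cint _ _ _ _ (fun s => (A + B * (imag R * toC y)) + B * toC s)).
    rewrite cintD; [|exact: cintble_cst|exact: cintbleZ].
    by rewrite cint_cst ?ltW// cintZ// cint_id.
  by move=> t _; rewrite ptE; ring.
have v x : cint c d (fun t => A + B * pt x t) =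
    (A + B * toC x) * toC (d - c) + B * imag R * toC ((d ^+ 2 - c ^+ 2) / 2).
  rewrite (@eq_cint _ _ _ _ (fun t => (A + B * toC x) + B * imag R * toC t)).
    rewrite cintD; [|exact: cintble_cst|exact: cintbleZ].
    by rewrite cint_cst ?ltW// cintZ// cint_id.
  by move=> t _; rewrite ptE; ring.
(* [ring] does not know that i^2 = -1, so this product is reduced by hand. *)
have iv x : imag R * cint c d (fun t => A + B * pt x t) =
    imag R * (A + B * toC x) * toC (d - c) - B * toC ((d ^+ 2 - c ^+ 2) / 2).
  rewrite v mulrDr [imag R * (B * _ * _)]mulrA [imag R * (B * _)]mulrCA.
  have -> : imag R * imag R = -1 by apply: cplxP; rewrite !cE; ring.
  by ring.
rewrite /bdint !h !iv; set E := toC (_ / 2); set F := toC (_ / 2).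
by rewrite !toCB; clear; ring.
Qed.

Lemma bdint_sub G a b c d (A B : C) : a < b -> c < d ->
  (forall w : C, rect a b c d w -> {for w, continuous G}) ->
  bdint (fun w => G w - (A + B * w)) a b c d = bdint G a b c d.
Proof.
move=> ab cd cG; rewrite -[RHS]subr0 -(bdint_affine A B ab cd).
have cA : forall w : C, rect a b c d w -> {for w, continuous (fun w : C => A + B * w)}.
  move=> w _; apply: continuousD; first exact: cst_continuous.
  by apply: continuousM; [exact: cst_continuous|exact: cvg_id].
rewrite /bdint.
have ex1 : a <= a <= b by rewrite lexx ltW.
have ex2 : a <= b <= b by rewrite lexx ltW.
have ex3 : c <= c <= d by rewrite lexx ltW.
have ex4 : c <= d <= d by rewrite lexx ltW.
do 2 (rewrite (@cintB _ a b); [|exact: (ccts_cintble (side_h cG _))|exact: (ccts_cintble (side_h cA _))]).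
do 2 (rewrite (@cintB _ c d); [|exact: (ccts_cintble (side_v cG _))|exact: (ccts_cintble (side_v cA _))]).
move: (cint _ _ _) (cint _ _ _) (cint _ _ _) (cint _ _ _) (cint _ _ _) (cint _ _ _) (cint _ _ _) (cint _ _ _).
by clear => *; ring.
Qed.

(** On a rectangle of half-perimeter s around the point, [G] differs from its affine part by at most
    e s, and [bdint_norm] multiplies this by 4 s. *)
Lemma goursat_local G p q (e : R) : cdiff G (pt p q) -> 0 < e ->
  exists2 r : R, 0 < r & forall a b c d, a < b -> c < d ->
    rect a b c d (pt p q) -> (b - a) + (d - c) < r ->
    (forall w : C, rect a b c d w -> {for w, continuous G}) ->
    rnorm (bdint G a b c d) <= 4 * e * ((b - a) + (d - c)) ^+ 2.
Proof.
move=> [L dG] e0; have [r r0 hr] := dG _ e0; exists r => // a b c d ab cd.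
move=> [/= apb cqd] abcd cG.
set w0 := pt p q.
rewrite -(@bdint_sub _ _ _ _ _ (G w0 - L * w0) L)//.
rewrite expr2 mulrA -(mulrA 4).
apply: bdint_norm; [|exact: ltW|exact: ltW|].
  move=> w rw; apply: continuousB; first exact: cG.
  apply: continuousD; first exact: cst_continuous.
  by apply: continuousM; [exact: cst_continuous|exact: cvg_id].
move=> w [aw cw].
have ww : rnorm (w - w0) <= (b - a) + (d - c).
  rewrite (le_trans (rnorm_le_reim _))// reB imB /w0; apply: lerD.
    rewrite ler_norml; case/andP: aw => aw1 aw2; case/andP: apb => *.
    have -> : re (pt p q) = p by [].
    by apply/andP; split; lra.
  rewrite ler_norml; case/andP: cw => cw1 cw2; case/andP: cqd => *.
  have -> : im (pt p q) = q by [].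
  by apply/andP; split; lra.
have -> : G w - (G w0 - L * w0 + L * w) = G (w0 + (w - w0)) - G w0 - L * (w - w0).
  by rewrite (addrC w0 (w - w0)) subrK; ring.
rewrite (le_trans (hr _ _))//; first exact: le_lt_trans abcd.
by rewrite ler_wpM2l// ltW.
Qed.

(** Pigeonhole on the four quarters, whose boundary integrals add up. Sides are written [A + A] so
    that halving needs no division. *)
Lemma goursat_bisect G p q (A B eta : R) : 0 < A -> 0 < B ->
  (forall w : C, rect p (p + (A + A)) q (q + (B + B)) w -> {for w, continuous G}) ->
  4 * eta <= rnorm (bdint G p (p + (A + A)) q (q + (B + B))) ->
  exists x : R * R, [/\ x.1 = p \/ x.1 = p + A, x.2 = q \/ x.2 = q + B &
    eta <= rnorm (bdint G x.1 (x.1 + A) x.2 (x.2 + B))].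
Proof.
move=> A0 B0 cG; pose m := p + A; pose n := q + B.
rewrite !(addrA _ A) !(addrA _ B) -/m -/n in cG *.
have [pm mm] : p <= m /\ m <= m + A by move: A0; rewrite /m; clear; lra.
have [qn nn] : q <= n /\ n <= n + B by move: B0; rewrite /n; clear; lra.
have pm2 := le_trans pm mm; have qn2 := le_trans qn nn.
rewrite (@bdint_splitl _ _ _ _ _ cG m) ?pm ?mm//.
rewrite (@bdint_splitr _ p m _ _ _ n) ?qn ?nn//; last first.
  move=> w [/andP[w1 w2] w3]; apply: cG; split => //.
  by rewrite w1/= (le_trans w2).
rewrite (@bdint_splitr _ m _ _ _ _ n) ?qn ?nn//; last first.
  move=> w [/andP[w1 w2] w3]; apply: cG; split => //.
  by rewrite w2 (le_trans pm).
move=> h; have := le_trans h (rnormD _ _).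
move=> /le_trans/(_ (lerD (rnormD _ _) (rnormD _ _))) {}h.
have [g1|g1] := leP eta (rnorm (bdint G p m q n)).
  by exists (p, q); split; [left|left|].
have [g2|g2] := leP eta (rnorm (bdint G p m n (n + B))).
  by exists (p, n); split; [left|right|].
have [g3|g3] := leP eta (rnorm (bdint G m (m + A) q n)).
  by exists (m, q); split; [right|left|].
exists (m, n); split; [by right|by right|].
move: h g1 g2 g3; rewrite /=.
move: (rnorm _) (rnorm _) (rnorm _) (rnorm _).
by clear => *; lra.
Qed.

Lemma goursat G a b c d : a < b -> c < d ->
  (forall w : C, rect a b c d w -> cdiff G w) -> bdint G a b c d = 0.
Proof.
move=> ab cd dG.
have cG w : rect a b c d w -> {for w, continuous G}.
  by move=> /dG; exact: cdiff_continuous.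
apply/eqP; apply/negP => /negP; rewrite -rnorm_gt0.
set eta := rnorm _ => eta0.
pose A k : R := (b - a) / 2 ^+ k; pose B k : R := (d - c) / 2 ^+ k.
have A0 k : 0 < A k by rewrite divr_gt0 ?exprn_gt0// subr_gt0.
have B0 k : 0 < B k by rewrite divr_gt0 ?exprn_gt0// subr_gt0.
have A2 k : A k = A k.+1 + A k.+1 by rewrite /A exprS invfM; lra.
have B2 k : B k = B k.+1 + B k.+1 by rewrite /B exprS invfM; lra.
(* Invariant of the bisection: the k-th rectangle, with lower left corner [x], stays inside the
   given one and carries at least eta / 4^k. *)
pose Q k (x : R * R) := [/\ a <= x.1, x.1 + A k <= b, c <= x.2, x.2 + B k <= d &
  eta / 4 ^+ k <= rnorm (bdint G x.1 (x.1 + A k) x.2 (x.2 + B k))].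
(* The implication sits under the existential so that [choice] yields a total successor function. *)
have step k x : exists y, Q k x -> Q k.+1 y /\
    [/\ x.1 <= y.1, y.1 + A k.+1 <= x.1 + A k, x.2 <= y.2 &
        y.2 + B k.+1 <= x.2 + B k].
  have [Qx|nQ] := pselect (Q k x); last by exists x.
  case: Qx => ax xb cx xd hx.
  have A'0 := A0 k.+1; have B'0 := B0 k.+1; rewrite A2 in xb hx.
  rewrite B2 in xd hx; rewrite (A2 k) (B2 k).
  set A' := A k.+1 in A'0 xb hx *; set B' := B k.+1 in B'0 xd hx *.
  have e2 : eta / 4 ^+ k = 4 * (eta / 4 ^+ k.+1).
    by rewrite exprS invfM mulrCA (mulrA 4) mulfV// mul1r.
  rewrite e2 in hx.
  have [|y [y1 y2 hy]] := goursat_bisect A'0 B'0 _ hx.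
    move=> w [/andP[w1 w2] /andP[w3 w4]]; apply: cG; split.
      by rewrite (le_trans ax)//= (le_trans w2).
    by rewrite (le_trans cx)//= (le_trans w4).
  have [z1 z2] : x.1 <= y.1 /\ y.1 + A' <= x.1 + (A' + A').
    by case: y1 A'0 => ->; clear; lra.
  have [z3 z4] : x.2 <= y.2 /\ y.2 + B' <= x.2 + (B' + B').
    by case: y2 B'0 => ->; clear; lra.
  exists y => _; split; split => //.
  - exact: (le_trans ax).
  - exact: (le_trans z2).
  - exact: (le_trans cx).
  - exact: (le_trans z4).
have /choice[F hF] : forall kx : nat * (R * R), exists y, Q kx.1 kx.2 -> Q kx.1.+1 y /\
    [/\ kx.2.1 <= y.1, y.1 + A kx.1.+1 <= kx.2.1 + A kx.1, kx.2.2 <= y.2 &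
        y.2 + B kx.1.+1 <= kx.2.2 + B kx.1] by move=> [k x]; exact: step.
pose x := fix x k := if k is k'.+1 then F (k', x k') else (a, c).
have Qx k : Q k (x k).
  elim: k => [|k IH]; last by have [] := hF (k, x k) IH.
  by rewrite /Q /A /B !expr0 !divr1/= !(addrC _ (_ - _)) !subrK; split.
have xS k := (hF (k, x k) (Qx k)).2.
have mono k j : [/\ (x k).1 <= (x (k + j)%N).1,
    (x (k + j)%N).1 + A (k + j)%N <= (x k).1 + A k, (x k).2 <= (x (k + j)%N).2 &
    (x (k + j)%N).2 + B (k + j)%N <= (x k).2 + B k].
  elim: j => [|j [h1 h2 h3 h4]]; first by rewrite addn0; split.
  have [] := xS (k + j)%N; rewrite addnS => k1 k2 k3 k4; split.
  - exact: (le_trans h1).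
  - exact: (le_trans k2).
  - exact: (le_trans h3).
  - exact: (le_trans k4).
have bnd k n : [/\ (x n).1 <= (x k).1 + A k & (x n).2 <= (x k).2 + B k].
  have := A0 n; have := B0 n; have := A0 k; have := B0 k => *.
  case: (leqP k n) => kn.
    have [_ h1 _ h2] := mono k (n - k)%N; rewrite subnKC// in h1 h2.
    by split; [apply: le_trans h1|apply: le_trans h2]; rewrite lerDl ltW.
  have [h1 _ h2 _] := mono n (k - n)%N; rewrite subnKC 1?ltnW// in h1 h2.
  by split; [apply: (le_trans h1)|apply: (le_trans h2)]; rewrite lerDl ltW.
(* (p, q) is the common point of the nested rectangles, as the limit of their lower left corners. *)
pose p := sup (range (fun k => (x k).1)); pose q := sup (range (fun k => (x k).2)).
have pk k : (x k).1 <= p <= (x k).1 + A k.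
  apply/andP; split.
    apply: ub_le_sup; last by exists k.
    by exists ((x 0%N).1 + A 0%N) => _ [n _ <-]; have [] := bnd 0%N n.
  apply: ge_sup; first by exists (x 0%N).1; exists 0%N.
  by move=> _ [n _ <-]; have [] := bnd k n.
have qk k : (x k).2 <= q <= (x k).2 + B k.
  apply/andP; split.
    apply: ub_le_sup; last by exists k.
    by exists ((x 0%N).2 + B 0%N) => _ [n _ <-]; have [] := bnd 0%N n.
  apply: ge_sup; first by exists (x 0%N).2; exists 0%N.
  by move=> _ [n _ <-]; have [] := bnd k n.
have dpq : cdiff G (pt p q).
  apply: dG; have [] := Qx 0%N; have := pk 0%N; have := qk 0%N.
  by move=> /andP[? ?] /andP[? ?] ? ? ? ? _; split; apply/andP; split;
    rewrite /re /im /=; lra.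
pose S : R := (b - a) + (d - c).
have S0 : 0 < S by rewrite /S; lra.
(* With the error eta / (8 S^2) the local bound on the k-th rectangle is half of eta / 4^k, against
   the invariant. *)
have [r r0 hr] := goursat_local dpq (divr_gt0 eta0 (mulr_gt0 (ltr0n R 8) (exprn_gt0 2 S0))).
have [k hk] : exists k : nat, S / 2 ^+ k < r.
  have [N hN] := @geo_small R 2^-1 S r (ltac:(by rewrite invr_ge0)) (ltac:(by rewrite invf_lt1// ltr1n)) r0.
  by exists N; rewrite -exprVn; exact: hN.
have sAB : A k + B k = S / 2 ^+ k by rewrite /A /B /S [RHS]mulrDl.
have [ax xb cx xd hx] := Qx k.
have /= := hr (x k).1 ((x k).1 + A k) (x k).2 ((x k).2 + B k).
rewrite !ltrDl A0 B0 => /(_ isT isT).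
rewrite !(addrAC _ _ (- _)) !subrr !add0r sAB => h.
have := h (conj (pk k) (qk k)) hk.
have cGk w : rect (x k).1 ((x k).1 + A k) (x k).2 ((x k).2 + B k) w ->
    {for w, continuous G}.
  by case=> /andP[? ?] /andP[? ?]; apply: cG; split; apply/andP; split; lra.
move=> /(_ cGk) /(le_trans hx).
rewrite expr_div_n -exprM mulnC exprM (_ : 2 ^+ 2 = 4 :> R); last by rewrite expr2 -natrM.
have : 0 < (4 : R) ^+ k by rewrite exprn_gt0.
move: (4 ^+ k) S0 eta0 => T; clear -T => S0 eta0 T0.
have -> : 4 * (eta / (8 * S ^+ 2)) * (S ^+ 2 / T) = (eta / 2) / T.
  by field; rewrite !gt_eqF.
by rewrite ler_pM2r ?invr_gt0//; move: eta0; clear; lra.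
Qed.

End goursat.

(** * Complex differentiability and means over circles *)

Section cdiff_theory.
Variable R : realType.
Local Notation C := (Cplx R).
Implicit Types (f g G : C -> C) (w z : C).

Lemma cdiffP G w : cdiff G w <-> derivable G w 1.
Proof.
split=> [[L dG]|].
  apply/cvg_ex; exists L; apply/(cvg_rnormP (V := C)) => e e0.
  have [d d0 hd] := dG _ (divr_gt0 e0 (ltr0n R 2)).
  rewrite near_withinE; apply/(nbhs_rnormP (V := C)); exists d => // h hd0 /eqP h0.
  have := hd h; rewrite sub0r rnormN in hd0 => /(_ hd0).
  have -> : L - h^-1 *: (G (h *: (1 : C) + w) - G w) =
      - (h^-1 * (G (w + h) - G w - L * h)).
    rewrite /GRing.scale/= mulr1 (addrC h) [in RHS]mulrBr (mulrCA _ L).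
    by rewrite mulVf ?mulr1 ?opprB//; exact/eqP.
  rewrite rnormN rnormM rnormV mulrC => h1.
  have h2 : 0 < rnorm h by rewrite rnorm_gt0; apply/eqP.
  rewrite [X in X < _]mulrC ltr_pdivrMr//; apply: le_lt_trans h1 _.
  by rewrite ltr_pM2r// ltr_pdivrMr// ltr_pMr// ltr1n.
move=> /cvg_ex[L hL]; exists L => e e0.
have := (cvg_rnormP (V := C) _ _).1 hL _ e0 => /(_ (ltac:(by typeclasses eauto))).
rewrite near_withinE => /(nbhs_rnormP (V := C))[d d0 hd]; exists d => // h hd0.
have [->|h0] := eqVneq h 0.
  by rewrite addr0 subrr mulr0 subr0 rnorm0 mulr0.
have h2 : 0 < rnorm h by rewrite rnorm_gt0.
have := hd h; rewrite sub0r rnormN => /(_ hd0 h0).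
have -> : L - h^-1 *: (G (h *: (1 : C) + w) - G w) =
      - (h^-1 * (G (w + h) - G w - L * h)).
  rewrite /GRing.scale/= mulr1 (addrC h) [in RHS]mulrBr (mulrCA _ L).
  by rewrite mulVf// mulr1 opprB.
by rewrite rnormN rnormM rnormV mulrC ltr_pdivrMr// => /ltW.
Qed.

Lemma cdiff_near f g w (e : R) : 0 < e -> (forall z, rnorm (w - z) < e -> f z = g z) ->
  cdiff f w -> cdiff g w.
Proof.
move=> e0 fg [L dL]; exists L => d /dL[r r0 hr].
exists (Num.min e r); first by rewrite lt_min e0.
move=> h; rewrite lt_min => /andP[he hr']; rewrite -!fg ?subrr ?rnorm0//.
  exact: hr.
by rewrite opprD addrA subrr sub0r rnormN.
Qed.

Lemma cdiff_comp f g w : cdiff f w -> cdiff g (f w) -> cdiff (fun z => g (f z)) w.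
Proof.
move=> df dg; have cf := cdiff_continuous df; case: df dg => [L hL] [M hM].
exists (M * L) => e e0.
have c0 : 0 < rnorm L + 1 by rewrite ltr_wpDl ?rnorm_ge0.
pose e1 : R := e / 2 / (rnorm L + 1).
have e10 : 0 < e1 by rewrite !divr_gt0.
have M0 : 0 < rnorm M + 1 by rewrite ltr_wpDl ?rnorm_ge0.
pose e2 : R := Num.min 1 (e / 2 / (rnorm M + 1)).
have e20 : 0 < e2 by rewrite lt_min ltr01/= !divr_gt0.
have [d1 d10 h1] := hM _ e10; have [d2 d20 h2] := hL _ e20.
exists (Num.min d2 (d1 / (rnorm L + 1))); first by rewrite lt_min d20 divr_gt0.
move=> h; rewrite lt_min => /andP[hd2 hd1].
set k := f (w + h) - f w.
have hk := h2 _ hd2; rewrite -/k in hk.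
have kb : rnorm k <= (rnorm L + 1) * rnorm h.
  have -> : k = (k - L * h) + L * h by rewrite subrK.
  rewrite (le_trans (rnormD _ _))// rnormM [leRHS]mulrDl addrC lerD2l.
  rewrite (le_trans hk)// ler_wpM2r ?rnorm_ge0//.
  by rewrite ge_min lexx.
have kd : rnorm k < d1.
  by rewrite (le_lt_trans kb)// mulrC -ltr_pdivlMr.
have := h1 _ kd; rewrite {1}/k [f w + _]addrC subrK => h3.
have -> : g (f (w + h)) - g (f w) - M * L * h =
  (g (f (w + h)) - g (f w) - M * k) + M * (k - L * h) by ring.
rewrite (le_trans (rnormD _ _))// rnormM.
have -> : e * rnorm h = e1 * ((rnorm L + 1) * rnorm h) + e / 2 * rnorm h.
  by rewrite /e1; field; rewrite gt_eqF.
apply: lerD; first by rewrite (le_trans h3)// ler_wpM2l// ltW.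
rewrite (le_trans (ler_wpM2l (rnorm_ge0 _) hk))// mulrA ler_wpM2r ?rnorm_ge0//.
rewrite (@le_trans _ _ ((rnorm M + 1) * e2))//.
  by rewrite ler_wpM2r ?lerDl// ltW.
by rewrite mulrC -ler_pdivlMr// ge_min lexx orbT.
Qed.

Lemma cdiff_cst k w : cdiff (fun=> k) w.
Proof. by apply/cdiffP; exact: derivable_cst. Qed.

Lemma cdiff_id w : cdiff (fun z => z) w.
Proof. by apply/cdiffP; exact: derivable_id. Qed.

Lemma cdiffD f g w : cdiff f w -> cdiff g w -> cdiff (fun z => f z + g z) w.
Proof. by move=> /cdiffP df /cdiffP dg; apply/cdiffP; exact: derivableD. Qed.

Lemma cdiffB f g w : cdiff f w -> cdiff g w -> cdiff (fun z => f z - g z) w.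
Proof. by move=> /cdiffP df /cdiffP dg; apply/cdiffP; exact: derivableB. Qed.

Lemma cdiffM f g w : cdiff f w -> cdiff g w -> cdiff (fun z => f z * g z) w.
Proof. by move=> /cdiffP df /cdiffP dg; apply/cdiffP; exact: derivableM. Qed.

Lemma cdiffX f n w : cdiff f w -> cdiff (fun z => f z ^+ n) w.
Proof.
move=> df; elim: n => [|n IH].
  have -> : (fun z => f z ^+ 0) = (fun=> 1) by apply/funext => z; rewrite expr0.
  exact: cdiff_cst.
have -> : (fun z => f z ^+ n.+1) = (fun z => f z * f z ^+ n).
  by apply/funext => z; rewrite exprS.
exact: cdiffM.
Qed.

Lemma cdiff_inv w : w != 0 -> cdiff (fun z => z^-1) w.
Proof.
move=> w0; exists (- (w^-1 * w^-1)) => e e0.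
have rw : 0 < rnorm w by rewrite rnorm_gt0.
have r2 : 0 < rnorm w / 2 by rewrite divr_gt0.
exists (Num.min (rnorm w / 2) (e * (rnorm w ^+ 2 * (rnorm w / 2)))).
  by rewrite lt_min r2/= !mulr_gt0// exprn_gt0.
move=> h; rewrite lt_min => /andP[h1 h2].
have wh : rnorm w / 2 <= rnorm (w + h).
  have := rnorm_subr w (w + h); rewrite opprD addrA subrr sub0r rnormN.
  by move: (rnorm w) (rnorm h) (rnorm (w + h)) h1; clear => *; lra.
have wh0 : w + h != 0 by rewrite -rnorm_gt0 (lt_le_trans r2).
have -> : (w + h)^-1 - w^-1 - - (w^-1 * w^-1) * h = (h * h) * (w ^+ 2 * (w + h))^-1.
  by field; rewrite ?w0 ?wh0 ?(addrC h) ?wh0.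
rewrite !rnormM rnormV rnormM rnormX -mulrA mulrC ler_wpM2r ?rnorm_ge0//.
have P : 0 < rnorm w ^+ 2 * rnorm (w + h) by rewrite mulr_gt0 ?exprn_gt0// rnorm_gt0.
rewrite ler_pdivrMr// (le_trans (ltW h2))// ler_wpM2l ?(ltW e0)//.
by rewrite ler_wpM2l// exprn_ge0// ltW.
Qed.

Lemma cdiffV f w : f w != 0 -> cdiff f w -> cdiff (fun z => (f z)^-1) w.
Proof. by move=> f0 df; apply: (cdiff_comp df); exact: cdiff_inv. Qed.

Lemma is_derive_small (F : R -> R) (l : R) : is_derive (0 : R) 1 F l ->
  forall e : R, 0 < e -> exists2 d : R, 0 < d & forall h : R, `|h| < d ->
    `|F h - F 0 - l * h| <= e * `|h|.
Proof.
move=> [dF lF] e e0; have := dF; rewrite /derivable => /cvg_ex[l' hl].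
have ll : l' = l.
  by rewrite -lF /derive; apply/esym; apply/cvg_lim => //; exact: hl.
rewrite {}ll in hl.
have /cvgrPdist_lt/(_ _ e0) := hl.
rewrite near_withinE => /(@nbhs_ballP R R)[d /= d0 hd]; exists d => // h hd0.
have [->|h0] := eqVneq h 0; first by rewrite subrr mulr0 subr0 !normr0 mulr0.
have := hd h; rewrite -ball_normE/= sub0r normrN => /(_ hd0 h0).
have h2 : 0 < `|h| by rewrite normr_gt0.
have -> : l - h^-1 *: (F (h *: (1 : R) + 0) - F 0) = - (h^-1 * (F h - F 0 - l * h)).
  rewrite /GRing.scale/= mulr1 addr0 [in RHS]mulrBr mulrCA mulVf ?mulr1//.
  by rewrite opprB.
by rewrite normrN normrM normfV mulrC ltr_pdivrMr// => /ltW.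
Qed.

Definition cexp (w : C) : C := toC (expR (re w)) * expi (im w).

Lemma cexpD z w : cexp (z + w) = cexp z * cexp w.
Proof. by rewrite /cexp reD imD expRD expiD toCM; ring. Qed.

(** By the addition formula only exp(h) - 1 - h has to be estimated. It splits into the first-order
    errors of [expR], [cos] and [sin] at 0 and the product of Re h and Im h. *)
Lemma cexp_cdiff w : cdiff cexp w.
Proof.
exists (cexp w) => e e0.
pose K : R := rnorm (cexp w) + 1.
have K0 : 0 < K by rewrite ltr_wpDl ?rnorm_ge0.
(* The terms below amount to 6 [e1] |h|; 8 leaves room, and [K] absorbs the factor |exp w|. *)
have [e1 e10 [e11 e1e]] : exists2 e1 : R, 0 < e1 & e1 <= 1 /\ e1 <= e / K / 8.
  exists (Num.min 1 (e / K / 8)); first by rewrite lt_min ltr01/= !divr_gt0.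
  by rewrite !ge_min !lexx orbT.
have dE : is_derive (0 : R) 1 expR 1 by have := is_derive_expR (0 : R); rewrite expR0.
have dC : is_derive (0 : R) 1 cos 0.
  by have := is_derive_cos (0 : R); rewrite sin0 oppr0.
have dS : is_derive (0 : R) 1 sin 1 by have := is_derive_sin (0 : R); rewrite cos0.
have [d1 d10 h1] := is_derive_small dE e10.
have [d2 d20 h2] := is_derive_small dC e10.
have [d3 d30 h3] := is_derive_small dS e10.
exists (Num.min e1 (Num.min d1 (Num.min d2 d3))); first by rewrite !lt_min e10 d10 d20 d30.
move=> h; rewrite !lt_min => /and4P[he hd1 hd2 hd3].
have rh := re_le h; have ih := im_le h.
have -> : cexp (w + h) - cexp w - cexp w * h = cexp w * (cexp h - 1 - h).
  by rewrite cexpD; ring.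
rewrite rnormM.
have {}h1 := h1 _ (le_lt_trans rh hd1).
have {}h2 := h2 _ (le_lt_trans ih hd2).
have {}h3 := h3 _ (le_lt_trans ih hd3).
rewrite expR0 mul1r in h1; rewrite cos0 mul0r subr0 in h2.
rewrite sin0 subr0 mul1r in h3.
have b1 : rnorm (expi (im h) - 1 - imag R * toC (im h)) <= 2 * (e1 * rnorm h).
  rewrite (le_trans (rnorm_le_reim _))// !cE !(mul0r, mulr0, mul1r, addr0, add0r, subr0).
  rewrite /re /im/= -/(im h) mulr_natl mulr2n lerD//.
    by rewrite (le_trans h2)// ler_wpM2l// ltW.
  by rewrite (le_trans h3)// ler_wpM2l// ltW.
have -> : cexp h - 1 - h = toC (expR (re h) - 1 - re h) * expi (im h) +
   (1 + toC (re h)) * (expi (im h) - 1 - imag R * toC (im h)) +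
   imag R * toC (im h) * toC (re h).
  rewrite {2}(cplxE h) /cexp !toCB toC1; ring.
have big : rnorm (toC (expR (re h) - 1 - re h) * expi (im h) +
   (1 + toC (re h)) * (expi (im h) - 1 - imag R * toC (im h)) +
   imag R * toC (im h) * toC (re h)) <= 8 * e1 * rnorm h.
  rewrite (le_trans (rnormD _ _))// (le_trans (lerD (rnormD _ _) (lexx _)))//.
  rewrite !rnormM rnorm_expi rnorm_imag !rnorm_toC mulr1 mul1r.
  have r1 : rnorm (1 + toC (re h)) <= 2.
    rewrite (le_trans (rnormD _ _))// rnorm1 rnorm_toC (_ : 2 = 1 + 1)// lerD2l.
    by rewrite (le_trans rh)// (le_trans (ltW he)).
  have t1 : `|expR (re h) - 1 - re h| <= e1 * rnorm h.
    by rewrite (le_trans h1)// ler_wpM2l// ltW.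
  have t2 : rnorm (1 + toC (re h)) * rnorm (expi (im h) - 1 - imag R * toC (im h)) <=
     2 * (2 * (e1 * rnorm h)).
    by rewrite ler_pM ?rnorm_ge0.
  have t3 : `|im h| * `|re h| <= e1 * rnorm h.
    by rewrite mulrC ler_pM// (le_trans rh)// ltW.
  move: t1 t2 t3 (mulr_ge0 (ltW e10) (rnorm_ge0 h)).
  move: (rnorm _ * rnorm _) (`|_ - _|) (`|_| * `|_|) => x y v.
  by rewrite -mulrA; move: (e1 * rnorm h) => u; clear => *; lra.
rewrite (le_trans (ler_wpM2l (rnorm_ge0 _) big))// mulrA ler_wpM2r ?rnorm_ge0//.
rewrite (@le_trans _ _ (K * (8 * e1)))//.
  by rewrite ler_wpM2r ?lerDl// mulr_ge0// ltW.
by rewrite mulrC -ler_pdivlMr// mulrC -ler_pdivlMr.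
Qed.

End cdiff_theory.

Section circle_means.
Variable R : realType.
Local Notation C := (Cplx R).
Implicit Types (f g G : C -> C) (w z : C) (r t : R).

Definition circ r t : C := toC r * expi t.
Definition cmean (u : R -> C) : C := toC (2 * pi)^-1 * cint 0 (2 * pi) u.

Lemma rnorm_circ r t : 0 <= r -> rnorm (circ r t) = r.
Proof. by move=> r0; rewrite rnormM rnorm_expi mulr1 rnorm_toC ger0_norm. Qed.

Lemma circ_neq0 r t : 0 < r -> circ r t != 0.
Proof. by move=> r0; rewrite -rnorm_gt0 rnorm_circ ?ltW. Qed.

Lemma circ_continuous r : continuous (circ r).
Proof.
move=> t; apply: (@continuousM C R (fun=> toC r)); first exact: cst_continuous.
exact: expi_continuousC.
Qed.

Lemma twopi_gt0 : 0 < 2 * pi :> R.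
Proof. by rewrite mulr_gt0// pi_gt0. Qed.

Lemma twopi_neq0 : 2 * pi != 0 :> R.
Proof. by rewrite gt_eqF// twopi_gt0. Qed.

(* Goursat's theorem for G (exp w) on the rectangle [ln r0, ln r1] x [0, 2 pi]. *)
Lemma cmean_const_annulus G (r0 r1 : R) : 0 < r0 -> r0 < r1 ->
  (forall w, r0 <= rnorm w <= r1 -> cdiff G w) ->
  cmean (fun t => G (circ r0 t)) = cmean (fun t => G (circ r1 t)).
Proof.
move=> r00 r01 dG; have r10 : 0 < r1 by exact: lt_trans r01.
have lr : ln r0 < ln r1 by rewrite ltr_ln ?posrE.
have := @goursat R (fun w => G (cexp w)) (ln r0) (ln r1) 0 (2 * pi) lr twopi_gt0.
have nc w : rnorm (cexp w) = expR (re w).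
  by rewrite /cexp rnormM rnorm_expi mulr1 rnorm_toC ger0_norm ?expR_ge0.
have H w : rect (ln r0) (ln r1) 0 (2 * pi) w -> cdiff (fun w => G (cexp w)) w.
  move=> [/andP[w1 w2] _]; apply: cdiff_comp; first exact: cexp_cdiff.
  apply: dG; rewrite nc -[X in X <= _ <= _]lnK ?posrE// -[X in _ <= _ <= X]lnK ?posrE//.
  by rewrite !ler_expR w1.
move=> /(_ H); rewrite /bdint.
(* The horizontal sides cancel by 2 pi periodicity; the vertical ones are the integrals over the
   circles of radius [r1] and [r0]. *)
have e2 : cint (ln r0) (ln r1) (fun s => G (cexp (pt s 0))) =
    cint (ln r0) (ln r1) (fun s => G (cexp (pt s (2 * pi)))).
  by apply: eq_cint => s _; rewrite /cexp /re /im/= expi_2pi expi0.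
have er r : 0 < r -> cint 0 (2 * pi) (fun t => G (cexp (pt (ln r) t))) =
    cint 0 (2 * pi) (fun t => G (circ r t)).
  by move=> rr; apply: eq_cint => s _; rewrite /cexp /re /im/= lnK ?posrE.
have key (A A' B B' E E' : C) : A = A' -> B = E -> B' = E' ->
    A + imag R * B - A' - imag R * B' = 0 -> imag R * (E - E') = 0.
  by move=> <- <- <- <-; ring.
move=> /(key _ _ _ _ _ _ e2 (er _ r10) (er _ r00)).
move/eqP; rewrite mulf_eq0 -rnorm_eq0 rnorm_imag oner_eq0/= subr_eq0 => /eqP e.
by rewrite /cmean e.
Qed.

Lemma circ_bounded G (q : R) : 0 <= q ->
  (forall w, rnorm w <= q -> {for w, continuous G}) ->
  exists2 M : R, 0 <= M & forall r t, 0 <= r <= q -> 0 <= t <= 2 * pi -> rnorm (G (circ r t)) <= M.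
Proof.
move=> q0 cG.
pose K : set (R * R) := `[0, q]%classic `*` `[0, 2 * pi]%classic.
have cK : compact K by apply: compact_setX; exact: segment_compact.
pose F (x : R * R) : R := rnorm (G (circ x.1 x.2)).
have cF : {within K, continuous F}.
  apply: continuous_in_subspaceT => x; rewrite inE => -[/= + _].
  rewrite in_itv/= => /andP[x0 xq].
  apply: (@continuous_comp _ _ _ (fun x : R * R => circ x.1 x.2) (fun w => rnorm (G w))).
    apply: continuousM.
      by apply: (@continuous_comp _ _ _ fst (@toC R)); [exact: cvg_fst|exact: toC_continuous].
    by apply: (@continuous_comp _ _ _ snd (@expi R)); [exact: cvg_snd|exact: expi_continuousC].
  apply: (@continuous_comp _ _ _ G (@rnorm R C)); last exact: rnorm_continuous.
  by apply: cG; rewrite rnorm_circ.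
have := continuous_compact cF cK => /compact_bounded[M [_ hM]].
exists (Num.max 0 (M + 1)); first by rewrite le_max lexx.
move=> r t r1 t1; rewrite le_max; apply/orP; right.
have M1 : M < M + 1 by rewrite ltrDl.
have := hM _ M1 (F (r, t)).
rewrite /= ger0_norm ?rnorm_ge0//; apply.
by exists (r, t) => //; split; rewrite /= in_itv.
Qed.

End circle_means.

Section mean_theory.
Variable R : realType.
Local Notation C := (Cplx R).
Implicit Types (f g G : C -> C) (w z : C) (r t : R) (u v : R -> C).
Local Notation cI := (cintble 0 (2 * pi)).

Lemma cmeanD u v : cI u -> cI v -> cmean (fun t => u t + v t) = cmean u + cmean v.
Proof. by move=> iu iv; rewrite /cmean cintD// mulrDr. Qed.

Lemma cmeanB u v : cI u -> cI v -> cmean (fun t => u t - v t) = cmean u - cmean v.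
Proof. by move=> iu iv; rewrite /cmean cintB// mulrBr. Qed.

Lemma cmeanZ k u : cI u -> cmean (fun t => k * u t) = k * cmean u.
Proof. by move=> iu; rewrite /cmean cintZ// mulrCA. Qed.

Lemma eq_cmean u v : (forall t, 0 <= t <= 2 * pi -> u t = v t) -> cmean u = cmean v.
Proof. by move=> uv; rewrite /cmean (eq_cint uv). Qed.

Lemma cmean_cst k : cmean (fun=> k) = k :> C.
Proof.
rewrite /cmean cint_cst ?subr0; last exact/ltW/twopi_gt0.
by rewrite mulrCA -toCM mulVf ?twopi_neq0// mulr1.
Qed.

Lemma cmean_sum n (F : nat -> R -> C) : (forall i, cI (F i)) ->
  cmean (fun t => \sum_(i < n) F i t) = \sum_(i < n) cmean (F i).
Proof. by move=> Fi; rewrite /cmean cint_sum// mulr_sumr. Qed.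

Lemma rnorm_cmean u (M : R) : cI u ->
  (forall t, 0 <= t <= 2 * pi -> rnorm (u t) <= M) -> rnorm (cmean u) <= 2 * M.
Proof.
move=> iu uM; rewrite /cmean rnormM rnorm_toC ger0_norm ?invr_ge0 ?(ltW (twopi_gt0 _))//.
rewrite mulrC ler_pdivrMr ?twopi_gt0//.
by have := cint_norm (ltW (twopi_gt0 R)) iu uM; rewrite subr0.
Qed.

Lemma cmean_expi (n : int) : n != 0 -> cmean (fun t => expi (n%:~R * t)) = 0.
Proof. by move=> n0; rewrite /cmean cint_expi// mulr0. Qed.

Lemma circ_expX r t n : circ r t ^+ n = toC (r ^+ n) * expi (n%:R * t).
Proof. by rewrite /circ exprMn expi_X toCX. Qed.

Lemma cI_cont u : continuous u -> cI u.
Proof. by move=> cu; apply: ccts_cintble => t _; exact: cu. Qed.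

Lemma cI_circ G r : 0 <= r -> (forall w, rnorm w = r -> {for w, continuous G}) ->
  cI (fun t => G (circ r t)).
Proof.
move=> r0 cG; apply: ccts_cintble => t _.
apply: (@continuous_comp _ _ _ (circ r) G); first exact: circ_continuous.
by apply: cG; rewrite rnorm_circ.
Qed.

Lemma ae_lebS (P Q : R -> Prop) : (forall x, P x -> Q x) ->
  {ae (@lebesgue_measure R), forall x, P x} -> {ae (@lebesgue_measure R), forall x, Q x}.
Proof.
by apply: filterS; exact: (ae_filter_ringOfSetsType (@lebesgue_measure R)).
Qed.

Lemma ae_lebI (P Q : R -> Prop) : {ae (@lebesgue_measure R), forall x, P x} ->
  {ae (@lebesgue_measure R), forall x, Q x} -> {ae (@lebesgue_measure R), forall x, P x /\ Q x}.
Proof.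
by apply: filterI; exact: (ae_filter_ringOfSetsType (@lebesgue_measure R)).
Qed.

Lemma rintble_measurable a b (f : R -> R) : rintble a b f ->
  measurable_fun (`[a, b] : set (measurableTypeR R)) f.
Proof. by move=> /integrableP[mf _]; exact/measurable_realfun.measurable_EFinP. Qed.

Lemma rint_dct a b (f_ : nat -> R -> R) (f : R -> R) (M : R) :
  (forall n, rintble a b (f_ n)) ->
  measurable_fun (`[a, b] : set (measurableTypeR R)) f ->
  {ae (@lebesgue_measure R), forall t, a <= t <= b -> f_ n t @[n --> \oo] --> f t} ->
  (forall n t, a <= t <= b -> `|f_ n t| <= M) ->
  rintble a b f /\ rint a b (f_ n) @[n --> \oo] --> rint a b f.
Proof.
move=> fi mf ff fM.
have mI : measurable (`[a, b]%classic : set (measurableTypeR R)) by [].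
have [] := @dominated_convergence _ _ R (@lebesgue_measure R) `[a, b] mI
    (fun n => EFin \o f_ n) (EFin \o f) (fun=> M%:E).
- by move=> n; have /integrableP[] := fi n.
- exact/measurable_realfun.measurable_EFinP.
- apply: ae_lebS ff => t h; rewrite /= in_itv/= => /h {}h.
  by apply/fine_cvgP; split; [exact: nearW|exact: h].
- exact: rintble_cst.
- by apply: aeW => t n; rewrite /= in_itv/= lee_fin; exact: fM.
move=> fint _ h; split => //.
rewrite /rint /Rintegral; apply: fine_cvg.
rewrite fineK; first exact: h.
exact: integrable_fin_num.
Qed.

Definition cmeasurable u := measurable_fun (`[0, 2 * pi] : set (measurableTypeR R)) (fun t => re (u t)) /\
  measurable_fun (`[0, 2 * pi] : set (measurableTypeR R)) (fun t => im (u t)).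

Lemma cmean_dct (u_ : nat -> R -> C) u (M : R) : (forall n, cI (u_ n)) ->
  cmeasurable u ->
  {ae (@lebesgue_measure R), forall t, 0 <= t <= 2 * pi -> u_ n t @[n --> \oo] --> u t} ->
  (forall n t, 0 <= t <= 2 * pi -> rnorm (u_ n t) <= M) ->
  cI u /\ cmean (u_ n) @[n --> \oo] --> cmean u.
Proof.
move=> ui [mre mim] uu uM.
have [r1 r2] : rintble 0 (2 * pi) (fun t => re (u t)) /\
    rint 0 (2 * pi) (fun t => re (u_ n t)) @[n --> \oo] --> rint 0 (2 * pi) (fun t => re (u t)).
  apply: (@rint_dct _ _ _ _ M) => //; first by move=> n; have [] := ui n.
    apply: ae_lebS uu => t h /h; apply: continuous_cvg; exact: re_continuous.
  by move=> n t /(uM n) h; apply: le_trans h; exact: re_le.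
have [i1 i2] : rintble 0 (2 * pi) (fun t => im (u t)) /\
    rint 0 (2 * pi) (fun t => im (u_ n t)) @[n --> \oo] --> rint 0 (2 * pi) (fun t => im (u t)).
  apply: (@rint_dct _ _ _ _ M) => //; first by move=> n; have [] := ui n.
    apply: ae_lebS uu => t h /h; apply: continuous_cvg; exact: im_continuous.
  by move=> n t /(uM n) h; apply: le_trans h; exact: im_le.
split => //; rewrite /cmean; apply: (@cvgM C); first exact: cvg_cst.
rewrite /cint -lock.
under eq_cvg do rewrite -lock.
apply: (@cvgD C).
  by apply: (@cvg_comp _ _ _ (fun n => rint 0 (2 * pi) (fun t => re (u_ n t))) (@toC R) _ (nbhs (rint 0 (2 * pi) (fun t => re (u t))))) => //; exact: toC_continuous.
apply: (@cvgM C); first exact: cvg_cst.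
by apply: (@cvg_comp _ _ _ (fun n => rint 0 (2 * pi) (fun t => im (u_ n t))) (@toC R) _ (nbhs (rint 0 (2 * pi) (fun t => im (u t))))) => //; exact: toC_continuous.
Qed.

Lemma cI_cmeasurable u : cI u -> cmeasurable u.
Proof. by case=> *; split; exact: rintble_measurable. Qed.

Lemma cmean_circ_cvg G (q r : R) (x : nat -> R) : 0 <= r <= q ->
  (forall w, rnorm w <= q -> {for w, continuous G}) ->
  (forall n, 0 <= x n <= q) -> x n @[n --> \oo] --> r ->
  cmean (fun t => G (circ (x n) t)) @[n --> \oo] --> cmean (fun t => G (circ r t)).
Proof.
move=> rq cG xq xr.
have q0 : 0 <= q by case/andP: rq => /le_trans; exact.
have [M M0 hM] := circ_bounded q0 cG.
have iG s : 0 <= s <= q -> cI (fun t => G (circ s t)).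
  by move=> /andP[s0 sq]; apply: cI_circ => // w ws; apply: cG; rewrite ws.
have [] := @cmean_dct (fun n t => G (circ (x n) t)) (fun t => G (circ r t)) M => //.
- by move=> n; exact: iG.
- exact/cI_cmeasurable/iG.
- apply: aeW => t _.
  apply: (@cvg_comp _ _ _ (fun n => circ (x n) t) G _ (nbhs (circ r t))).
    apply: (@cvgM C); last exact: cvg_cst.
    by apply: (@cvg_comp _ _ _ x (@toC R) _ (nbhs r)) => //; exact: toC_continuous.
  by apply: cG; rewrite rnorm_circ; case/andP: rq.
- by move=> n t; exact: hM.
Qed.

End mean_theory.

(** * Cauchy's formula and Taylor series *)

Section taylor.
Variable R : realType.
Local Notation C := (Cplx R).
Implicit Types (f g G : C -> C) (w z : C) (r t : R) (n : nat).
Local Notation cI := (cintble 0 (2 * pi)).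

Lemma analytic_cdiff f z : analytic_on_disc f -> rnorm z < 1 -> cdiff f z.
Proof. by move=> af /discE Dz; apply/cdiffP/af. Qed.

Lemma analytic_continuous f z : analytic_on_disc f -> rnorm z < 1 -> {for z, continuous f}.
Proof. by move=> af Dz; exact/cdiff_continuous/analytic_cdiff. Qed.

(** This sequence starts at b and tends to a; it serves to approach an exceptional radius from one
    chosen side. *)
Lemma harmonic_seq_cvg (a b : R) : a + (b - a) * n.+1%:R^-1 @[n --> \oo] --> a.
Proof.
rewrite -[X in _ --> X]addr0 -[X in _ --> _ + X](mulr0 (b - a)).
apply: (@cvgD R R); first exact: cvg_cst.
apply: (@cvgM R); first exact: cvg_cst.
exact: cvg_harmonic.
Qed.

Lemma harmonic_seq_itv (a b : R) n : a < b ->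
  a < a + (b - a) * n.+1%:R^-1 <= b.
Proof.
move=> ab; have h0 : 0 < (n.+1%:R^-1 : R) by rewrite invr_gt0.
rewrite ltrDl mulr_gt0 ?subr_gt0//= -lerBrDl ler_piMr ?subr_ge0 ?(ltW ab)//.
by rewrite invf_le1// ler1n.
Qed.

Lemma harmonic_seq_itvN (a b : R) n : b < a ->
  b <= a + (b - a) * n.+1%:R^-1 < a.
Proof.
move=> ab; have h0 : 0 < (n.+1%:R^-1 : R) by rewrite invr_gt0.
rewrite gtrDl pmulr_llt0// subr_lt0 ab andbT -lerBlDl ler_niMr ?subr_le0 ?(ltW ab)//.
by rewrite invf_le1// ler1n.
Qed.

Lemma cvgC_cst_eq (u : nat -> C) (a b : C) : (forall n, u n = b) ->
  u n @[n --> \oo] --> a -> a = b.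
Proof.
move=> ub ua; apply/eqP; rewrite -subr_eq0 -rnorm_eq0 eq_le rnorm_ge0 andbT.
apply/ler_addgt0Pl => e e0; rewrite addr0.
have [N _ hN] := (cvg_rnormP (V := C) _ _).1 ua _ e0.
by have := hN N (leqnn N); rewrite /= ub => /ltW.
Qed.

Section cauchy.
Variables (f : C -> C) (z : C).
Hypothesis (af : analytic_on_disc f) (z1 : rnorm z < 1).

(** The difference quotient of f at z, completed by the derivative and multiplied by w. It is
    differentiable off z and merely continuous at z; the factor w gives F(0) = 0. *)
Let cauchy_kernel : exists F : C -> C,
  [/\ forall w, w != z -> F w = (f w - f z) / (w - z) * w, F 0 = 0,
      forall w, rnorm w < 1 -> {for w, continuous F} &
      forall w, rnorm w < 1 -> w != z -> cdiff F w].
Proof.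
have [D hD] := analytic_cdiff af z1.
pose Q w := if w == z then D else (f w - f z) / (w - z).
have dQ w : rnorm w < 1 -> w != z -> cdiff Q w.
  move=> w1 wz; have wz0 : 0 < rnorm (w - z) by rewrite rnorm_gt0 subr_eq0.
  apply: (@cdiff_near _ (fun w => (f w - f z) / (w - z)) _ _ _ wz0).
    move=> y yw; rewrite /Q; case: eqP => // yz; rewrite -yz ltxx // in yw.
  apply/cdiffP; apply: derivableM.
    by apply: derivableB; [apply/cdiffP/analytic_cdiff|exact: derivable_cst].
  apply: derivableV; first by rewrite subr_eq0.
  by apply: derivableB; [exact: derivable_id|exact: derivable_cst].
have cQ w : rnorm w < 1 -> {for w, continuous Q}.
  move=> w1; have [->|wz] := eqVneq w z; last exact/cdiff_continuous/dQ.
  apply/(cvg_rnormP (V := C) (F := nbhs z)) => e e0.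
  have [d d0 hd] := hD _ (divr_gt0 e0 (ltr0n R 2)).
  apply/nbhs_rnormP; exists d => // y zy; rewrite /Q eqxx.
  case: eqP => [_|/eqP yz]; first by rewrite subrr rnorm0.
  rewrite rnorm_distC in zy.
  have := hd (y - z) zy; rewrite [z + _]addrC subrK => h.
  have n0 : 0 < rnorm (y - z) by rewrite rnorm_gt0 subr_eq0.
  have -> : D - (f y - f z) / (y - z) = - ((f y - f z - D * (y - z)) / (y - z)).
    by rewrite [X in _ = - X]mulrBl mulfK ?subr_eq0// opprB.
  rewrite rnormN rnormM rnormV ltr_pdivrMr//; apply: le_lt_trans h _.
  by rewrite ltr_pM2r// ltr_pdivrMr// ltr_pMr// ltr1n.
exists (fun w => Q w * w); split.
- by move=> w wz; rewrite /Q (negPf wz).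
- by rewrite mulr0.
- by move=> w w1; apply: (@continuousM C C); [exact: cQ|exact: cvg_id].
- move=> w w1 wz; apply/cdiffP; apply: derivableM; last exact: derivable_id.
  exact/cdiffP/dQ.
Qed.

(** Let m(r) be the mean of F over the circle of radius r. By Goursat's theorem m is constant on
    each side of |z|; it is continuous, and m(0) = F(0) = 0. Continuity carries the value 0 from
    radius 0 and across |z|, so the singularity at z is never integrated around. *)
Lemma cauchy_mean0 r : rnorm z < r -> r < 1 ->
  cmean (fun t => (f (circ r t) - f z) / (circ r t - z) * circ r t) = 0.
Proof.
move=> zr r1; have [F [Fz F0 cF dF]] := cauchy_kernel.
pose m r := cmean (fun t => F (circ r t)).
have r0 : 0 <= r by rewrite (le_trans (rnorm_ge0 z)) ?(ltW zr).
have -> : cmean (fun t => (f (circ r t) - f z) / (circ r t - z) * circ r t) = m r.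
  apply: eq_cmean => t _; rewrite Fz//; apply/eqP => cz.
  by move: zr; rewrite -cz rnorm_circ// ltxx.
have m0 : m 0 = 0.
  rewrite /m -[RHS](cmean_cst (0 : C)); apply: eq_cmean => t _.
  by rewrite /circ toC0 mul0r F0.
have mlim (a b q : R) (c : C) : 0 <= a <= q -> q < 1 ->
    (forall n, 0 <= a + (b - a) * n.+1%:R^-1 <= q) ->
    (forall n, m (a + (b - a) * n.+1%:R^-1) = c) -> m a = c.
  move=> aq q1 xq xc.
  apply: (@cvgC_cst_eq (fun n => m (a + (b - a) * n.+1%:R^-1)) _ _ xc).
  refine (@cmean_circ_cvg R F q a _ aq _ xq (@harmonic_seq_cvg a b)).
  by move=> w wq; apply: cF; exact: le_lt_trans q1.
have mconst a b : 0 < a -> a <= b -> b < 1 -> (b < rnorm z \/ rnorm z < a) -> m a = m b.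
  move=> a0; rewrite le_eqVlt => /predU1P[->//|ab] b1 zab.
  apply: cmean_const_annulus => // w /andP[aw wb].
  apply: dF; first exact: le_lt_trans b1.
  apply/eqP => wz; rewrite wz in aw wb.
  by case: zab; rewrite ltNge ?wb ?aw.
have mlt a : 0 < a -> a < rnorm z -> m a = 0.
  move=> a0 az; rewrite -m0; apply/esym; apply: (mlim 0 a a).
  - by rewrite lexx ltW.
  - exact: lt_trans z1.
  - by move=> n; have /andP[/ltW-> ->] := harmonic_seq_itv n a0.
  - move=> n; have /andP[h1 h2] := harmonic_seq_itv n a0.
    by apply: mconst => //; [exact: lt_trans z1|left].
have mz : m (rnorm z) = 0.
  have [->//|z0] := eqVneq (rnorm z) 0.
  have {}z0 : 0 < rnorm z by rewrite lt_neqAle eq_sym z0 rnorm_ge0.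
  have zz : rnorm z / 2 < rnorm z by rewrite ltr_pdivrMr// ltr_pMr// ltr1n.
  apply: (mlim _ (rnorm z / 2) (rnorm z)) => //.
  - by rewrite lexx ltW.
  - move=> n; have /andP[h1 /ltW->] := harmonic_seq_itvN n zz.
    by rewrite andbT (le_trans _ h1)// divr_ge0// rnorm_ge0.
  - move=> n; have /andP[h1 h2] := harmonic_seq_itvN n zz.
    by apply: mlt => //; rewrite (lt_le_trans _ h1)// divr_gt0.
rewrite -mz; apply/esym; apply: (mlim _ r r) => //.
- by rewrite rnorm_ge0 ltW.
- move=> n; have /andP[h1 ->] := harmonic_seq_itv n zr.
  by rewrite (le_trans (rnorm_ge0 z) (ltW h1)).
- move=> n; have /andP[h1 h2] := harmonic_seq_itv n zr.
  by apply: mconst => //; [exact: (le_lt_trans (rnorm_ge0 z) h1)|right].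
Qed.

End cauchy.

Lemma geo_expand (x : C) n : 1 - x != 0 ->
  (1 - x)^-1 = \sum_(i < n) x ^+ i + x ^+ n * (1 - x)^-1.
Proof.
move=> x1; elim: n => [|n IH]; first by rewrite big_ord0 add0r expr0 mul1r.
rewrite big_ord_recr/= {1}IH -addrA; congr (_ + _).
apply: (mulIf x1); rewrite mulrDl -!mulrA mulVf// !mulr1 exprSr; ring.
Qed.

(** Cauchy's integral for the Taylor coefficient. The radius 1/2 is an arbitrary choice, by
    [tcoefE]. *)
Definition tcoef f n : C := cmean (fun t => f (circ 2^-1 t) * (circ 2^-1 t)^-1 ^+ n).

Lemma half_itv : 0 < (2^-1 : R) < 1.
Proof. by rewrite invr_gt0 ltr0n/= invf_lt1// ltr1n. Qed.

Lemma circV_cdiff w n : w != 0 -> cdiff (fun w : C => w^-1 ^+ n) w.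
Proof.
by move=> w0; apply: cdiffX; exact: cdiff_inv.
Qed.

Lemma tcoefE f n r : analytic_on_disc f -> 0 < r < 1 ->
  tcoef f n = cmean (fun t => f (circ r t) * (circ r t)^-1 ^+ n).
Proof.
move=> af /andP[r0 r1]; have /andP[h0 h1] := half_itv.
have key a b : 0 < a -> a < b -> b < 1 ->
    cmean (fun t => f (circ a t) * (circ a t)^-1 ^+ n) =
    cmean (fun t => f (circ b t) * (circ b t)^-1 ^+ n).
  move=> a0 ab b1; apply: (@cmean_const_annulus R (fun w => f w * w^-1 ^+ n)) => //.
  move=> w /andP[aw wb]; apply/cdiffP; apply: derivableM; apply/cdiffP.
    by apply: analytic_cdiff => //; exact: le_lt_trans b1.
  by apply: circV_cdiff; rewrite -rnorm_gt0 (lt_le_trans a0).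
rewrite /tcoef; case: (ltgtP 2^-1 r) => [h|h|->//]; first exact: key.
by apply/esym; exact: key.
Qed.

Lemma kernel_cdiff z r w : rnorm z < r -> rnorm w = r -> cdiff (fun w => (1 - z / w)^-1) w.
Proof.
move=> zr wr; have r0 : 0 < r by exact: le_lt_trans (rnorm_ge0 z) zr.
have w0 : w != 0 by rewrite -rnorm_gt0 wr.
apply: cdiffV.
  rewrite subr_eq0 eq_sym; apply/eqP => /(congr1 (@rnorm R C)).
  rewrite rnormM rnormV wr rnorm1 => h.
  by move: zr; rewrite -[ltRHS]mul1r -ltr_pdivrMr// h ltxx.
apply: cdiffB; first exact: cdiff_cst.
by apply: cdiffM; [exact: cdiff_cst|exact: cdiff_inv].
Qed.

Lemma cI_kernel z r : rnorm z < r -> cI (fun t => (1 - z / circ r t)^-1).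
Proof.
move=> zr; have r0 : 0 < r by exact: le_lt_trans (rnorm_ge0 z) zr.
apply: (@cI_circ R (fun w => (1 - z / w)^-1)); first exact: ltW.
by move=> w wr; exact/cdiff_continuous/(kernel_cdiff zr).
Qed.

Lemma kernel_bound z r t : rnorm z < r ->
  1 - z / circ r t != 0 /\ rnorm (1 - z / circ r t)^-1 <= r / (r - rnorm z).
Proof.
move=> zr; have r0 : 0 < r by exact: le_lt_trans (rnorm_ge0 z) zr.
have h : 1 - rnorm z / r <= rnorm (1 - z / circ r t).
  have := rnorm_subr 1 (1 - z / circ r t).
  rewrite opprB (addrC 1 (_ - 1)) subrK rnorm1 rnormM rnormV rnorm_circ ?(ltW r0)//.
  by rewrite lerBlDr.
have p : 0 < 1 - rnorm z / r by rewrite subr_gt0 ltr_pdivrMr// mul1r.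
have n0 : 0 < rnorm (1 - z / circ r t) by exact: lt_le_trans h.
split; first by rewrite -rnorm_gt0.
rewrite rnormV (_ : r / (r - rnorm z) = (1 - rnorm z / r)^-1).
  by rewrite lef_pV2 ?posrE.
have rz : r - rnorm z != 0 by rewrite gt_eqF// subr_gt0.
by field; rewrite rz gt_eqF.
Qed.

Lemma circV r t n : r != 0 -> (circ r t)^-1 ^+ n = toC (r^-1 ^+ n) * expi (- (n%:R * t)).
Proof.
move=> r0; rewrite /circ invfM -toCV -expiN exprMn toCX expi_X; congr (_ * expi _).
ring.
Qed.

Lemma cmean_circV r n : 0 < r -> (0 < n)%N -> cmean (fun t => (circ r t)^-1 ^+ n) = 0.
Proof.
move=> r0 n0; rewrite (@eq_cmean _ _ (fun t => toC (r^-1 ^+ n) * expi ((- n%:Z)%:~R * t))).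
  rewrite cmeanZ; last by apply/ccts_cintble/ccts_expi.
  by rewrite cmean_expi ?mulr0// oppr_eq0; case: n n0.
move=> t _; rewrite circV ?gt_eqF//; congr (_ * expi _).
by rewrite intrN mulNr.
Qed.

Lemma cI_circV r n : 0 < r -> cI (fun t => (circ r t)^-1 ^+ n).
Proof.
move=> r0; apply: (@cI_circ R (fun w => w^-1 ^+ n)); first exact: ltW.
by move=> w wr; apply/cdiff_continuous/circV_cdiff; rewrite -rnorm_gt0 wr.
Qed.

(** Geometric series: every term but the constant one has mean 0, and the remainder is uniformly
    small. *)
Lemma cmean_kernel z r : rnorm z < r -> cmean (fun t => (1 - z / circ r t)^-1) = 1.
Proof.
move=> zr; have r0 : 0 < r by exact: le_lt_trans (rnorm_ge0 z) zr.
apply/eqP; rewrite -subr_eq0 -rnorm_eq0 eq_le rnorm_ge0 andbT.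
apply/ler_addgt0Pl => e e0; rewrite addr0.
have q1 : rnorm z / r < 1 by rewrite ltr_pdivrMr// mul1r.
have q0 : 0 <= rnorm z / r by rewrite divr_ge0 ?rnorm_ge0 ?(ltW r0).
have [N hN] := geo_small (2 * (r / (r - rnorm z))) q0 q1 e0.
have iK := cI_kernel zr.
have is0 i : cI (fun t => (z / circ r t) ^+ i).
  have -> : (fun t => (z / circ r t) ^+ i) = (fun t => z ^+ i * (circ r t)^-1 ^+ i).
    by apply/funext => t; rewrite exprMn.
  by apply: cintbleZ; exact: cI_circV.
pose m := N.+1.
have eK t : (1 - z / circ r t)^-1 - \sum_(i < m) (z / circ r t) ^+ i =
    (z / circ r t) ^+ m * (1 - z / circ r t)^-1.
  by have [n0 _] := kernel_bound t zr; rewrite {1}(geo_expand m n0) addrC addKr.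
have -> : cmean (fun t => (1 - z / circ r t)^-1) - 1 =
    cmean (fun t => (1 - z / circ r t)^-1 - \sum_(i < m) (z / circ r t) ^+ i).
  have iS := @cintble_sum R 0 (2 * pi) m (fun i t => (z / circ r t) ^+ i) is0.
  rewrite cmeanB// (@cmean_sum R m (fun i t => (z / circ r t) ^+ i))// big_ord_recl/= big1 ?addr0.
    by congr (_ - _); under [RHS]eq_cmean do rewrite expr0; rewrite cmean_cst.
  move=> i _; rewrite (@eq_cmean _ _ (fun t => z ^+ i.+1 * (circ r t)^-1 ^+ i.+1)).
    by rewrite cmeanZ ?cmean_circV ?mulr0//; exact: cI_circV.
  by move=> t _; rewrite exprMn.
have b t : rnorm ((1 - z / circ r t)^-1 - \sum_(i < m) (z / circ r t) ^+ i) <=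
     (r / (r - rnorm z)) * (rnorm z / r) ^+ m.
  rewrite eK rnormM rnormX rnormM rnormV rnorm_circ ?(ltW r0)// mulrC.
  by rewrite ler_wpM2r ?exprn_ge0//; have [_] := kernel_bound t zr.
rewrite (le_trans (@rnorm_cmean R _ _ _ (fun t _ => b t)))//.
  by apply: cintbleB => //; exact: (@cintble_sum R 0 (2 * pi) m (fun i t => (z / circ r t) ^+ i) is0).
by rewrite mulrA ltW// hN.
Qed.

Lemma cI_cauchy f z r : (forall w, rnorm w <= r -> {for w, continuous f}) ->
  rnorm z < r -> cI (fun t => f (circ r t) * (1 - z / circ r t)^-1).
Proof.
move=> cf zr; have r0 : 0 < r by exact: le_lt_trans (rnorm_ge0 z) zr.
apply: (@cI_circ R (fun w => f w * (1 - z / w)^-1)); first exact: ltW.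
move=> w wr; apply: (@continuousM C C); first by apply: cf; rewrite wr.
exact/cdiff_continuous/(kernel_cdiff zr).
Qed.

(** The quotient in [cauchy_mean0] is f minus f(z), times this kernel; the part with f(z) has mean
    f(z) by [cmean_kernel]. *)
Lemma cauchy_formula f z r : analytic_on_disc f -> rnorm z < r -> r < 1 ->
  f z = cmean (fun t => f (circ r t) * (1 - z / circ r t)^-1).
Proof.
move=> af zr r1; have r0 : 0 < r by exact: le_lt_trans (rnorm_ge0 z) zr.
have cf w : rnorm w <= r -> {for w, continuous f}.
  by move=> wr; apply: analytic_continuous => //; exact: le_lt_trans r1.
have iK := cI_kernel zr.
have cz t : circ r t - z != 0.
  rewrite subr_eq0; apply/eqP => cz.
  by move: zr; rewrite -cz rnorm_circ ?(ltW r0)// ltxx.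
have c0 t : circ r t != 0 by exact: circ_neq0.
have K t : circ r t / (circ r t - z) = (1 - z / circ r t)^-1.
  by rewrite -{1}[circ r t]invrK -invfM mulrC mulrBl mulfV// .
have ifK := cI_cauchy cf zr.
have := cauchy_mean0 af (lt_trans zr r1) zr r1.
rewrite (@eq_cmean _ _ (fun t => f (circ r t) * (1 - z / circ r t)^-1 - f z * (1 - z / circ r t)^-1)).
  rewrite cmeanB//; last exact: cintbleZ.
  by rewrite cmeanZ// cmean_kernel// mulr1 => /eqP; rewrite subr_eq0 => /eqP.
by move=> t _; rewrite -mulrBl -K [in RHS]mulrA [in LHS]mulrAC.
Qed.

Definition psum (a : nat -> C) z n : C := \sum_(i < n) a i * z ^+ i.

(** The finite geometric expansion of the kernel in Cauchy's formula; the last factor bounds the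
    kernel itself, and [M] is twice the maximum of |f| on the disc of radius r. *)
Lemma taylor_bound f (r : R) : analytic_on_disc f -> 0 < r < 1 ->
  exists2 M : R, 0 <= M & forall z n, rnorm z < r ->
    rnorm (f z - psum (tcoef f) z n) <= M * (rnorm z / r) ^+ n * (r / (r - rnorm z)).
Proof.
move=> af r01; have /andP[r0 r1] := r01.
have cf w : rnorm w <= r -> {for w, continuous f}.
  by move=> wr; apply: analytic_continuous => //; exact: le_lt_trans r1.
have [M M0 hM] := circ_bounded (ltW r0) cf.
exists (2 * M); first by rewrite mulr_ge0.
move=> z n zr.
have iK := cI_kernel zr.
have ifc : cI (fun t => f (circ r t)).
  by apply: cI_circ => [|w wr]; [exact: ltW|apply: cf; rewrite wr].
have cz t : circ r t - z != 0.
  rewrite subr_eq0; apply/eqP => cz.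
  by move: zr; rewrite -cz rnorm_circ ?(ltW r0)// ltxx.
have c0 t : circ r t != 0 by exact: circ_neq0.
have K t : circ r t / (circ r t - z) = (1 - z / circ r t)^-1.
  by rewrite -{1}[circ r t]invrK -invfM mulrC mulrBl mulfV// .
have cauchy := cauchy_formula af zr r1.
have ifK := cI_cauchy cf zr.
have ia i : cI (fun t => f (circ r t) * (circ r t)^-1 ^+ i).
  apply: (@cI_circ R (fun w => f w * w^-1 ^+ i)); first exact: ltW.
  move=> w wr; apply: (@continuousM C C); first by apply: cf; rewrite wr.
  by apply/cdiff_continuous/circV_cdiff; rewrite -rnorm_gt0 wr.
have iaz i : cI (fun t => z ^+ i * (f (circ r t) * (circ r t)^-1 ^+ i)).
  by apply: cintbleZ.
have -> : f z - psum (tcoef f) z n =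
    cmean (fun t => f (circ r t) * ((z / circ r t) ^+ n * (1 - z / circ r t)^-1)).
  rewrite /psum (eq_bigr (fun i : 'I_n => cmean (fun t => z ^+ i * (f (circ r t) * (circ r t)^-1 ^+ i)))); last first.
    by move=> i _; rewrite (tcoefE i af r01) cmeanZ// mulrC.
  rewrite -(cmean_sum n iaz) cauchy -cmeanB//; last exact: (cintble_sum n iaz).
  apply: eq_cmean => t _; have [n0 _] := kernel_bound t zr.
  rewrite {1}(geo_expand n n0) mulrDr addrAC -[RHS]add0r; congr (_ + _).
  apply/eqP; rewrite subr_eq0 mulr_sumr; apply/eqP/eq_bigr => i _.
  by rewrite exprMn mulrCA.
rewrite -!mulrA; apply: rnorm_cmean.
  apply: (@cI_circ R (fun w => f w * ((z / w) ^+ n * (1 - z / w)^-1))); first exact: ltW.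
  move=> w wr; apply: (@continuousM C C); first by apply: cf; rewrite wr.
  apply/cdiff_continuous/cdiffM; last exact: kernel_cdiff zr wr.
  apply/cdiffX/cdiffM; first exact: cdiff_cst.
  by apply: cdiff_inv; rewrite -rnorm_gt0 wr.
move=> t tI; rewrite !rnormM rnormX rnormM rnormV rnorm_circ ?(ltW r0)//.
rewrite ler_pM ?rnorm_ge0//.
  apply: mulr_ge0; last exact: rnorm_ge0.
  by rewrite exprn_ge0// divr_ge0 ?rnorm_ge0 ?(ltW r0).
  by apply: hM => //; rewrite lexx ltW.
by rewrite ler_wpM2l//; [rewrite exprn_ge0// divr_ge0 ?rnorm_ge0 ?(ltW r0)|have [_] := kernel_bound t zr].
Qed.

End taylor.

(** * Locally uniform limits of analytic functions *)

Section weierstrass.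
Variable R : realType.
Local Notation C := (Cplx R).
Implicit Types (f g G : C -> C) (w z : C) (r t : R) (n : nat).
Local Notation cI := (cintble 0 (2 * pi)).

(** Differentiation under the integral by an exact identity: for k(z) = (1 - z/c)^-1 one has k(z+h)
    - k(z) - h k(z)^2 / c = h^2 k(z)^2 k(z+h) / c^2, and the right side is O(h^2) uniformly in c. *)
Lemma cauchy_transform_cdiff f (r M : R) z : rnorm z < r ->
  (forall w, rnorm w <= r -> {for w, continuous f}) ->
  (forall t, 0 <= t <= 2 * pi -> rnorm (f (circ r t)) <= M) ->
  cdiff (fun z => cmean (fun t => f (circ r t) * (1 - z / circ r t)^-1)) z.
Proof.
move=> zr cf fM; have r0 : 0 < r by exact: le_lt_trans (rnorm_ge0 z) zr.
have M0 : 0 <= M.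
  by rewrite (le_trans (rnorm_ge0 _) (fM 0 _))// lexx (ltW (twopi_gt0 _)).
pose k z t : C := (1 - z / circ r t)^-1.
have iL : cI (fun t => f (circ r t) * (k z t * k z t / circ r t)).
  apply: (@cI_circ R (fun w => f w * ((1 - z / w)^-1 * (1 - z / w)^-1 / w))); first exact: ltW.
  move=> w wr; apply: (@continuousM C C); first by apply: cf; rewrite wr.
  apply/cdiff_continuous/cdiffM; last by apply: cdiff_inv; rewrite -rnorm_gt0 wr.
  by apply: cdiffM; exact: kernel_cdiff zr wr.
exists (cmean (fun t => f (circ r t) * (k z t * k z t / circ r t))) => e e0.
pose B : R := r / (r - rnorm z).
have rz : 0 < r - rnorm z by rewrite subr_gt0.
have B0 : 0 < B by rewrite divr_gt0.
have BE : B = r / (r - rnorm z) by [].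
clearbody B.
pose Q : R := 2 * (M * (B * B * (2 * B) / r ^+ 2)).
have Q0 : 0 <= Q.
  apply: mulr_ge0 => //; apply: mulr_ge0 => //; apply: divr_ge0.
    have := ltW B0 => ?; by rewrite !mulr_ge0.
  by rewrite exprn_ge0// (ltW r0).
exists (Num.min ((r - rnorm z) / 2) (e / (Q + 1))).
  by rewrite lt_min !divr_gt0// ltr_wpDl.
move=> h; rewrite lt_min => /andP[h1 h2].
have zh : rnorm (z + h) < r.
  by rewrite (le_lt_trans (rnormD _ _))// -ltrBrDl (lt_trans h1)// ltr_pdivrMr// ltr_pMr// ltr1n.
rewrite -cmeanB; [|exact: cI_cauchy|exact: cI_cauchy].
rewrite mulrC -cmeanZ// -cmeanB; [| |exact: cintbleZ]; last first.
  by apply: cintbleB; exact: cI_cauchy.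
have c0 t : circ r t != 0 by exact: circ_neq0.
have kz t : k z t != 0 /\ rnorm (k z t) <= B.
  by have [n0 b] := kernel_bound t zr; rewrite BE; split => //; rewrite invr_eq0.
have kzh t : k (z + h) t != 0 /\ rnorm (k (z + h) t) <= 2 * B.
  have [n0 b] := kernel_bound t zh; split; first by rewrite invr_eq0.
  rewrite (le_trans b)// BE mulrCA ler_wpM2l ?(ltW r0)//.
  rewrite -{1}[2]invrK -invfM lef_pV2 ?posrE ?subr_gt0//; last first.
    by rewrite mulr_gt0// invr_gt0.
  have := rnormD z h; move: h1; clear; move: (rnorm _) (rnorm _) (rnorm _) => a b c; lra.
rewrite (@eq_cmean _ _ (fun t => f (circ r t) * (h * h * (k z t * k z t * k (z + h) t / circ r t ^+ 2)))).
  have bd t : 0 <= t <= 2 * pi -> rnorm (f (circ r t) *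
      (h * h * (k z t * k z t * k (z + h) t / circ r t ^+ 2))) <=
      (M * (B * B * (2 * B) / r ^+ 2)) * (rnorm h * rnorm h).
    move=> tI; have [_ b1] := kz t; have [_ b2] := kzh t.
    have bX : rnorm (k z t * k z t * k (z + h) t / circ r t ^+ 2) <= B * B * (2 * B) / r ^+ 2.
      rewrite !rnormM rnormV rnormX rnorm_circ ?(ltW r0)//.
      rewrite ler_wpM2r ?invr_ge0 ?exprn_ge0 ?(ltW r0)//.
      by rewrite !ler_pM ?mulr_ge0 ?rnorm_ge0.
    rewrite rnormM (rnormM (h * h)) (rnormM h) -(mulrA M) (mulrC _ (rnorm h * rnorm h)).
    by rewrite ler_pM ?rnorm_ge0 ?fM// ?mulr_ge0 ?rnorm_ge0// ler_wpM2l// mulr_ge0 ?rnorm_ge0.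
  rewrite (le_trans (rnorm_cmean _ bd))//.
    apply: (@cI_circ R (fun w => f w * (h * h * ((1 - z / w)^-1 * (1 - z / w)^-1 * (1 - (z + h) / w)^-1 / w ^+ 2)))); first exact: ltW.
    move=> w wr; apply: (@continuousM C C); first by apply: cf; rewrite wr.
    have dz := kernel_cdiff zr wr; have dzh := kernel_cdiff zh wr.
    apply/cdiff_continuous/cdiffM; first exact: cdiff_cst.
    apply: cdiffM; first by apply: cdiffM => //; exact: cdiffM.
    have w0 : w != 0 by rewrite -rnorm_gt0 wr.
    by apply: cdiffV; [rewrite expf_neq0|apply: cdiffX; exact: cdiff_id].
  rewrite mulrA -/Q mulrA ler_wpM2r ?rnorm_ge0//.
  rewrite (@le_trans _ _ ((Q + 1) * rnorm h))//.
    by rewrite ler_wpM2r ?rnorm_ge0// lerDl.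
  by rewrite mulrC -ler_pdivlMr ?(ltW h2)// ltr_wpDl.
move=> t _; rewrite -mulrBr mulrCA -mulrBr; congr (_ * _).
rewrite /k.
have [n0 _] := kernel_bound t zr; have [n1 _] := kernel_bound t zh.
have e1 : 1 - z / circ r t = (circ r t - z) / circ r t by rewrite mulrBl mulfV.
have e2 : 1 - (z + h) / circ r t = (circ r t - (z + h)) / circ r t by rewrite mulrBl mulfV.
have d1 : circ r t - z != 0 by move: n0; rewrite e1 mulf_eq0 negb_or => /andP[].
have d2 : circ r t - (z + h) != 0 by move: n1; rewrite e2 mulf_eq0 negb_or => /andP[].
rewrite e1 e2; move: (circ r t) (c0 t) d1 d2; clear => c c0 d1 d2.
have d3 x : x = c - (z + h) -> x != 0 by move=> ->.
by field; rewrite c0 d1 /= ?andbT d3//; ring.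
Qed.

(** The limit is continuous and inherits Cauchy's formula from its approximants, and Cauchy
    integrals of continuous functions are differentiable. *)
Lemma weierstrass f : (forall (q e : R), q < 1 -> 0 < e -> exists2 g : C -> C,
    analytic_on_disc g & forall z, rnorm z <= q -> rnorm (f z - g z) <= e) ->
  analytic_on_disc f.
Proof.
move=> fg.
have cf w : rnorm w < 1 -> {for w, continuous f}.
  move=> w1; apply/(cvg_rnormP (V := C) (F := nbhs w)) => e e0.
  pose q : R := (rnorm w + 1) / 2.
  have wq : rnorm w < q /\ q < 1 by rewrite /q; move: w1; clear; lra.
  have [wq1 q1] := wq; have e4 : 0 < e / 4 by rewrite divr_gt0.
  have [g ag gf] := fg q _ q1 e4.
  have /(cvg_rnormP (V := C) (F := nbhs w))/(_ _ e4)/(nbhs_rnormP (V := C))[d d0 hd] :=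
    analytic_continuous ag w1.
  apply/nbhs_rnormP; exists (Num.min d (q - rnorm w)).
    by rewrite lt_min d0 subr_gt0.
  move=> y; rewrite lt_min => /andP[wyd wyq].
  have yq : rnorm y <= q.
    have := rnorm_subr y w; rewrite (rnorm_distC y w) => h.
    by rewrite (le_trans h)// -lerBrDl ltW.
  have h1 := gf _ (ltW wq1); have h2 := gf _ yq; have h3 := hd _ wyd.
  rewrite (le_lt_trans (rnorm_trian (g w) _ _))//.
  rewrite (le_lt_trans (lerD (lexx _) (rnorm_trian (g y) _ _)))//.
  rewrite (rnorm_distC (g y)).
  by move: h1 h2 h3 e0; clear; move: (rnorm _) (rnorm _) (rnorm _) => a b c; lra.
move=> z /discE z1; apply/cdiffP.
pose r : R := (rnorm z + 1) / 2.
have [zr r1] : rnorm z < r /\ r < 1 by rewrite /r; move: z1; clear; lra.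
have r0 : 0 < r by exact: le_lt_trans (rnorm_ge0 z) zr.
have cfr w : rnorm w <= r -> {for w, continuous f}.
  by move=> wr; apply: cf; exact: le_lt_trans r1.
have [M M0 hM] := circ_bounded (ltW r0) cfr.
have := @cauchy_transform_cdiff f r M z zr cfr.
have fMr t : 0 <= t <= 2 * pi -> rnorm (f (circ r t)) <= M.
  by apply: hM; rewrite lexx (ltW r0).
move=> /(_ fMr).
have rz : 0 < r - rnorm z by rewrite subr_gt0.
apply: (cdiff_near rz) => y zy.
have yr : rnorm y < r.
  have := rnorm_subr y z; rewrite (rnorm_distC y z) => h.
  by rewrite (le_lt_trans h)// -ltrBrDl.
apply/eqP; rewrite -subr_eq0 -rnorm_eq0 eq_le rnorm_ge0 andbT.
apply/ler_addgt0Pl => e e0; rewrite addr0.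
pose B : R := r / (r - rnorm y).
have B0 : 0 < B by rewrite divr_gt0 ?subr_gt0.
pose d : R := e / (1 + 2 * B).
have B1 : 0 < 1 + 2 * B by rewrite addr_gt0// mulr_gt0.
have d0 : 0 < d by rewrite divr_gt0.
have [g ag gf] := fg r d r1 d0.
have cg w : rnorm w <= r -> {for w, continuous g}.
  by move=> wr; apply: analytic_continuous => //; exact: le_lt_trans r1.
have -> : cmean (fun t => f (circ r t) / (1 - y / circ r t)) - f y =
  cmean (fun t => f (circ r t) / (1 - y / circ r t) - g (circ r t) / (1 - y / circ r t)) + (g y - f y).
  rewrite cmeanB; [|exact: cI_cauchy|exact: cI_cauchy].
  by rewrite -(cauchy_formula ag yr r1) addrA subrK.
rewrite (le_trans (rnormD _ _))// (rnorm_distC (g y)).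
have -> : e = 2 * (d * B) + d.
  by rewrite /d; field; rewrite gt_eqF.
rewrite lerD ?gf ?(ltW yr)//; apply: rnorm_cmean.
  by apply: cintbleB; exact: cI_cauchy.
move=> t tI; rewrite -mulrBl rnormM ler_pM ?rnorm_ge0//.
  by rewrite gf// rnorm_circ ?lexx// ltW.
by have [] := kernel_bound t yr.
Qed.

Lemma cplx_cauchy_cvg (u : nat -> C) (v : nat -> R) :
  (forall n m, (n <= m)%N -> rnorm (u m - u n) <= v n) -> v n @[n --> \oo] --> 0 ->
  exists2 l : C, u n @[n --> \oo] --> l & forall n, rnorm (l - u n) <= v n.
Proof.
move=> uv v0.
have key (p : C -> R) : (forall x y, p (x - y) = p x - p y) ->
    (forall x, `|p x| <= rnorm x) -> cvgn (fun n => p (u n)).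
  move=> pB pn; apply/(@cauchy_cvgP R)/cauchy_exP => e /= e0.
  have /cvgrPdist_lt/(_ _ e0)[N _ hN] := v0.
  exists (p (u N)); exists N => // m /= Nm; rewrite -ball_normE/= -pB.
  rewrite (le_lt_trans (pn _))// rnorm_distC (le_lt_trans (uv _ _ Nm))//.
  by have := hN N (leqnn N); rewrite sub0r normrN; exact/le_lt_trans/ler_norm.
have /cvg_ex[a ha] := key (@re R) (@reB R) (@re_le R).
have /cvg_ex[b hb] := key (@im R) (@imB R) (@im_le R).
have ul : u n @[n --> \oo] --> pt a b.
  have -> : u = (fun n => toC (re (u n)) + imag R * toC (im (u n))).
    by apply/funext => n; rewrite -cplxE.
  rewrite ptE; apply: (@cvgD C).
    by apply: (@cvg_comp _ _ _ (fun n => re (u n)) (@toC R) _ (nbhs a)) => //; exact: toC_continuous.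
  apply: (@cvgM C); first exact: cvg_cst.
  by apply: (@cvg_comp _ _ _ (fun n => im (u n)) (@toC R) _ (nbhs b)) => //; exact: toC_continuous.
exists (pt a b) => // n; apply/ler_addgt0Pr => e e0.
have [N _ hN] := (cvg_rnormP (V := C) _ _).1 ul _ e0.
have := hN _ (leq_maxr n N); have := uv _ _ (leq_maxl n N).
have := rnorm_trian (u (maxn n N)) (pt a b) (u n).
by move: (rnorm _) (rnorm _) (rnorm _); clear => *; lra.
Qed.

End weierstrass.

(** * Power series and their coefficients *)

Section power_series.
Variable R : realType.
Local Notation C := (Cplx R).
Implicit Types (f g G : C -> C) (a b : nat -> C) (w z : C) (r t : R) (n : nat).
Local Notation cI := (cintble 0 (2 * pi)).

Lemma analyticP f : analytic_on_disc f <-> forall z, rnorm z < 1 -> cdiff f z.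
Proof.
split=> [af z|af z /discE z1]; first exact: analytic_cdiff.
exact/cdiffP/af.
Qed.

Lemma analytic_cst k : analytic_on_disc (fun=> k : C).
Proof. by apply/analyticP => z _; exact: cdiff_cst. Qed.

Lemma analyticD f g : analytic_on_disc f -> analytic_on_disc g ->
  analytic_on_disc (fun z => f z + g z).
Proof.
by move=> /analyticP af /analyticP ag; apply/analyticP => z z1; apply: cdiffD; [exact: af|exact: ag].
Qed.

Lemma analyticB f g : analytic_on_disc f -> analytic_on_disc g ->
  analytic_on_disc (fun z => f z - g z).
Proof.
by move=> /analyticP af /analyticP ag; apply/analyticP => z z1; apply: cdiffB; [exact: af|exact: ag].
Qed.

Lemma analyticM f g : analytic_on_disc f -> analytic_on_disc g ->
  analytic_on_disc (fun z => f z * g z).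
Proof.
by move=> /analyticP af /analyticP ag; apply/analyticP => z z1; apply: cdiffM; [exact: af|exact: ag].
Qed.

Lemma analyticX n : analytic_on_disc (fun z : C => z ^+ n).
Proof. by apply/analyticP => z _; apply: cdiffX; exact: cdiff_id. Qed.

Lemma analytic_eq f g : (forall z, rnorm z < 1 -> f z = g z) ->
  analytic_on_disc f -> analytic_on_disc g.
Proof.
move=> fg /analyticP af; apply/analyticP => z z1.
apply: (@cdiff_near _ f _ _ (1 - rnorm z)); [by rewrite subr_gt0| |exact: af].
move=> y zy; apply: fg; have := rnorm_subr y z; rewrite (rnorm_distC y) => h.
by rewrite (le_lt_trans h)// -ltrBrDl.
Qed.

Lemma psum0 a z : psum a z 0 = 0. Proof. by rewrite /psum big_ord0. Qed.

Lemma psumS a z n : psum a z n.+1 = psum a z n + a n * z ^+ n.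
Proof. by rewrite /psum big_ord_recr. Qed.

Lemma psum_analytic a n : analytic_on_disc (fun z => psum a z n).
Proof.
elim: n => [|n IH].
  apply: (@analytic_eq (fun=> 0)); last exact: analytic_cst.
  by move=> z _; rewrite psum0.
apply: (@analytic_eq (fun z => psum a z n + a n * z ^+ n)) => [z _|].
  by rewrite psumS.
exact: (analyticD IH (analyticM (@analytic_cst (a n)) (@analyticX n))).
Qed.

Lemma psum_dist a (M : R) z n m : (forall n, rnorm (a n) <= M) -> rnorm z < 1 ->
  (n <= m)%N -> rnorm (psum a z m - psum a z n) <= M / (1 - rnorm z) * rnorm z ^+ n.
Proof.
move=> aM z1 nm; have z0 := rnorm_ge0 z.
have p : 0 < 1 - rnorm z by rewrite subr_gt0.
have M0 : 0 <= M by exact: le_trans (rnorm_ge0 _) (aM 0%N).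
suff h k : rnorm (psum a z (n + k) - psum a z n) <=
    M / (1 - rnorm z) * (rnorm z ^+ n - rnorm z ^+ (n + k)).
  rewrite -(subnKC nm) (le_trans (h _))// ler_wpM2l ?divr_ge0 ?(ltW p)//.
  by rewrite gerBl exprn_ge0.
elim: k => [|k IH]; first by rewrite addn0 !subrr rnorm0 mulr0.
rewrite addnS psumS addrAC (le_trans (rnormD _ _))//.
have -> : M / (1 - rnorm z) * (rnorm z ^+ n - rnorm z ^+ (n + k).+1) =
  M / (1 - rnorm z) * (rnorm z ^+ n - rnorm z ^+ (n + k)) + M * rnorm z ^+ (n + k).
  by rewrite exprS; field; rewrite gt_eqF.
by rewrite lerD// rnormM rnormX ler_wpM2r// exprn_ge0.
Qed.

Lemma cvg_geo0 (K q : R) : 0 <= q -> q < 1 -> K * q ^+ n @[n --> \oo] --> 0.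
Proof.
move=> q0 q1; have q1' : `|q| < 1 by rewrite ger0_norm.
exact: (@cvg_geometric R K q q1').
Qed.

(* Junk value 0 outside the disc. *)
Definition pser a z : C :=
  if rnorm z < 1 then xget 0 [set l | psum a z n @[n --> \oo] --> l] else 0.

Lemma pser_bound a (M : R) z n : (forall n, rnorm (a n) <= M) -> rnorm z < 1 ->
  rnorm (pser a z - psum a z n) <= M / (1 - rnorm z) * rnorm z ^+ n.
Proof.
move=> aM z1; have z0 := rnorm_ge0 z.
have [l ul hl] := @cplx_cauchy_cvg R (psum a z) (fun n => M / (1 - rnorm z) * rnorm z ^+ n)
  (fun n m => psum_dist aM z1) (cvg_geo0 _ z0 z1).
rewrite /pser z1; case: xgetP => [y _ hy|/(_ l)//].
suff -> : y = l by exact: hl.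
apply/eqP; rewrite -subr_eq0 -rnorm_eq0 eq_le rnorm_ge0 andbT.
apply/ler_addgt0Pr => e e0; rewrite add0r.
have e2 : 0 < e / 2 by rewrite divr_gt0.
have [N1 _ h1] := (cvg_rnormP (V := C) _ _).1 ul _ e2.
have [N2 _ h2] := (cvg_rnormP (V := C) _ _).1 hy _ e2.
have := h1 _ (leq_maxl N1 N2); have := h2 _ (leq_maxr N1 N2).
move=> /= k1 k2; rewrite (le_trans (rnorm_trian (psum a z (maxn N1 N2)) _ _))//.
rewrite (rnorm_distC (psum _ _ _)); move: k1 k2; clear.
by move: (rnorm _) (rnorm _) => x1 x2; lra.
Qed.

Lemma pser_analytic a (M : R) : (forall n, rnorm (a n) <= M) -> analytic_on_disc (pser a).
Proof.
move=> aM; apply: weierstrass => q e q1 e0.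
have M0 : 0 <= M by exact: le_trans (rnorm_ge0 _) (aM 0%N).
have [q0|q0] := ltP q 0.
  exists (fun=> 0); first exact: analytic_cst.
  by move=> z zq; have := le_trans (rnorm_ge0 z) zq; rewrite leNgt q0.
have [N hN] := geo_small (M / (1 - q)) q0 q1 e0.
exists (fun z => psum a z N); first exact: psum_analytic.
move=> z zq; have z1 := le_lt_trans zq q1.
rewrite (le_trans (pser_bound N aM z1))//.
rewrite (le_trans _ (ltW (hN N (leqnn N))))//.
apply: ler_pM => //.
- by rewrite divr_ge0// subr_ge0 ltW.
- by rewrite exprn_ge0// rnorm_ge0.
- by rewrite ler_wpM2l// lef_pV2 ?posrE ?subr_gt0// lerB.
- by rewrite lerXn2r// nnegrE// rnorm_ge0.
Qed.

(** Exact identities between coefficients are obtained from truncations at N whose error is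
    geometric in N. *)
Lemma geo_eq (x y : C) (K q : R) N0 : 0 <= q -> q < 1 ->
  (forall N, (N0 <= N)%N -> rnorm (x - y) <= K * q ^+ N) -> x = y.
Proof.
move=> q0 q1 h; apply/eqP; rewrite -subr_eq0 -rnorm_eq0 eq_le rnorm_ge0 andbT.
apply/ler_addgt0Pr => e e0; rewrite add0r.
have [N hN] := geo_small K q0 q1 e0.
by rewrite (le_trans (h _ (leq_maxl N0 N)))// ltW// hN// leq_maxr.
Qed.

Lemma taylor_unif f (s : R) : analytic_on_disc f -> 0 <= s -> s < 1 ->
  exists K q : R, [/\ 0 <= q, q < 1, 0 <= K & forall z n, rnorm z <= s ->
    rnorm (f z - psum (tcoef f) z n) <= K * q ^+ n].
Proof.
move=> af s0 s1; pose r : R := (s + 1) / 2.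
have [sr r1] : s < r /\ r < 1 by rewrite /r; move: s1; clear; lra.
have r0 : 0 < r by exact: le_lt_trans sr.
have [M M0 hM] : exists2 M : R, 0 <= M & forall z n, rnorm z < r ->
    rnorm (f z - psum (tcoef f) z n) <= M * (rnorm z / r) ^+ n * (r / (r - rnorm z)).
  by apply: taylor_bound; rewrite // r0.
have q0 : 0 <= s / r by rewrite divr_ge0// ltW.
exists (M * (r / (r - s))), (s / r); split => //.
- by rewrite ltr_pdivrMr// mul1r.
- by rewrite mulr_ge0// divr_ge0// ?subr_ge0 ltW.
move=> z n zs; have zr := le_lt_trans zs sr.
rewrite (le_trans (hM _ _ zr))// mulrAC -mulrA -[leRHS]mulrA ler_wpM2l//.
apply: ler_pM.
- by rewrite divr_ge0// ?subr_ge0 ltW.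
- by rewrite exprn_ge0// divr_ge0 ?rnorm_ge0// ltW.
- by rewrite ler_wpM2l ?(ltW r0)// lef_pV2 ?posrE ?subr_gt0// lerB.
- have ri : 0 <= r^-1 by rewrite invr_ge0 ltW.
  by apply: lerXn2r; rewrite ?nnegrE ?mulr_ge0 ?rnorm_ge0// ler_wpM2r.
Qed.

Lemma cmean_analytic f r : analytic_on_disc f -> 0 < r < 1 ->
  cmean (fun t => f (circ r t)) = f 0.
Proof.
move=> af /andP[r0 r1]; rewrite (@cauchy_formula R f 0 r af) ?rnorm0//.
by apply: eq_cmean => t _; rewrite mul0r subr0 invr1 mulr1.
Qed.

Lemma cI_analytic f r : analytic_on_disc f -> 0 < r < 1 -> cI (fun t => f (circ r t)).
Proof.
move=> af /andP[r0 r1]; apply: cI_circ; first exact: ltW.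
by move=> w wr; apply: analytic_continuous => //; rewrite wr.
Qed.

Lemma cI_tcoef f r n : analytic_on_disc f -> 0 < r < 1 ->
  cI (fun t => f (circ r t) * (circ r t)^-1 ^+ n).
Proof.
move=> af /andP[r0 r1]; apply: (@cI_circ R (fun w => f w * w^-1 ^+ n)); first exact: ltW.
move=> w wr; apply: (@continuousM C C).
  by apply: analytic_continuous => //; rewrite wr.
by apply/cdiff_continuous/circV_cdiff; rewrite -rnorm_gt0 wr.
Qed.

(** For i > n the integrand is analytic and vanishes at 0, so its mean is 0. *)
Lemma tcoef_shift f i n : analytic_on_disc f ->
  cmean (fun t => circ 2^-1 t ^+ i * (f (circ 2^-1 t) * (circ 2^-1 t)^-1 ^+ n)) =
  if (i <= n)%N then tcoef f (n - i) else 0.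
Proof.
move=> af; have h := half_itv R; have /andP[h0 _] := h.
have c0 t : circ 2^-1 t != 0 :> C by exact: circ_neq0.
case: leqP => ni.
  apply: eq_cmean => t _; rewrite mulrCA; congr (_ * _).
  rewrite -{1}(subnKC ni) exprD mulrA exprVn mulfV ?mul1r//.
  by rewrite expf_neq0.
rewrite (@eq_cmean _ _ (fun t => f (circ 2^-1 t) * circ 2^-1 t ^+ (i - n))).
  have aX : analytic_on_disc (fun w => f w * w ^+ (i - n)).
    exact: (analyticM af (@analyticX _)).
  by rewrite (cmean_analytic aX h) expr0n subn_eq0 leqNgt ni/= mulr0.
move=> t _; rewrite mulrCA; congr (_ * _).
by rewrite -{1}(subnKC (ltnW ni)) exprD mulrAC exprVn mulfV ?mul1r// expf_neq0.
Qed.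

(** Inside the integral for the n-th coefficient, f is replaced by a partial sum with N > n terms.
    By [tcoef_shift] this already gives the full Cauchy product, and the error is geometric in N. *)
Lemma tcoefM f g n : analytic_on_disc f -> analytic_on_disc g ->
  tcoef (fun z => f z * g z) n = \sum_(i < n.+1) tcoef f i * tcoef g (n - i).
Proof.
move=> af ag; have h := half_itv R; have /andP[h0 h1] := h.
have [K [q [q0 q1 K0 hK]]] := taylor_unif af (ltW h0) h1.
have [M M0 hM] := circ_bounded (ltW h0) (fun w wh => analytic_continuous ag (le_lt_trans wh h1)).
have afg := analyticM af ag.
apply: (@geo_eq _ _ (2 * (K * (M * 2 ^+ n))) q n.+1 q0 q1) => N nN.
pose F i t := tcoef f i * (circ 2^-1 t ^+ i * (g (circ 2^-1 t) * (circ 2^-1 t)^-1 ^+ n)).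
have iG i : cI (fun t => circ 2^-1 t ^+ i * (g (circ 2^-1 t) * (circ 2^-1 t)^-1 ^+ n)).
  apply: (@cI_circ R (fun w => w ^+ i * (g w * w^-1 ^+ n))); first exact: ltW.
  move=> w wr; apply: (@continuousM C C).
    by apply: cdiff_continuous; apply: cdiffX; exact: cdiff_id.
  apply: (@continuousM C C).
    by apply: analytic_continuous => //; rewrite wr.
  by apply/cdiff_continuous/circV_cdiff; rewrite -rnorm_gt0 wr.
have iF i : cI (F i) by exact: cintbleZ.
have -> : \sum_(i < n.+1) tcoef f i * tcoef g (n - i) = cmean (fun t => \sum_(i < N) F i t).
  rewrite (cmean_sum _ iF).
  rewrite [RHS](eq_bigr (fun i : 'I_N => if (i < n.+1)%N then tcoef f i * tcoef g (n - i) else 0)).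
    rewrite -big_mkcond/= (big_ord_widen_cond N xpredT (fun i => tcoef f i * tcoef g (n - i)))//.
  move=> i _; rewrite /F cmeanZ; last exact: (iG i).
  by rewrite (tcoef_shift i n ag) ltnS; case: ifP => // _; rewrite mulr0.
rewrite /tcoef -cmeanB; [|exact: (cI_tcoef n afg h)|exact: cintble_sum].
rewrite -mulrA; apply: rnorm_cmean.
  apply: cintbleB; [exact: (cI_tcoef n afg h)|exact: cintble_sum].
move=> t tI.
have -> : f (circ 2^-1 t) * g (circ 2^-1 t) * (circ 2^-1 t)^-1 ^+ n - \sum_(i < N) F i t =
  (f (circ 2^-1 t) - psum (tcoef f) (circ 2^-1 t) N) * (g (circ 2^-1 t) * (circ 2^-1 t)^-1 ^+ n).
  rewrite mulrBl mulrA; congr (_ - _); rewrite /psum mulr_suml.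
  by apply: eq_bigr => i _; rewrite /F mulrA.
rewrite rnormM -mulrA (mulrC _ (q ^+ N)) mulrA ler_pM ?rnorm_ge0//.
  by rewrite hK// rnorm_circ// ltW.
rewrite rnormM ler_pM ?rnorm_ge0//.
  by apply: hM => //; rewrite lexx (ltW h0).
by rewrite rnormX rnormV rnorm_circ ?(ltW h0)// invrK.
Qed.

Lemma tcoef_unif f a (K q : R) : analytic_on_disc f -> 0 <= q -> q < 1 ->
  (forall t n, rnorm (f (circ 2^-1 t) - psum a (circ 2^-1 t) n) <= K * q ^+ n) ->
  forall n, tcoef f n = a n.
Proof.
move=> af q0 q1 hK n; have h := half_itv R; have /andP[h0 h1] := h.
apply: (@geo_eq _ _ (2 * (K * 2 ^+ n)) q n.+1 q0 q1) => N nN.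
pose F i t := a i * (circ 2^-1 t ^+ i * (1 * (circ 2^-1 t)^-1 ^+ n)).
have iG i : cI (fun t => circ 2^-1 t ^+ i * (1 * (circ 2^-1 t)^-1 ^+ n)).
  apply: (@cI_circ R (fun w => w ^+ i * (1 * w^-1 ^+ n))); first exact: ltW.
  move=> w wr; apply: (@continuousM C C).
    by apply: cdiff_continuous; apply: cdiffX; exact: cdiff_id.
  apply: (@continuousM C C); first exact: cst_continuous.
  by apply/cdiff_continuous/circV_cdiff; rewrite -rnorm_gt0 wr.
have iF i : cI (F i) by exact: cintbleZ.
have t1 i : tcoef (fun=> 1 : C) i = (i == 0%N)%:R.
  rewrite /tcoef; case: i => [|i].
    by rewrite (@eq_cmean _ _ (fun=> 1)) ?cmean_cst// => t _; rewrite expr0 mulr1.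
  rewrite (@eq_cmean _ _ (fun t => (circ 2^-1 t)^-1 ^+ i.+1)) ?cmean_circV//.
  by move=> t _; rewrite mul1r.
have -> : a n = cmean (fun t => \sum_(i < N) F i t).
  have Fi i : cmean (F i) = if (i <= n)%N then a i * (n - i == 0)%N%:R else 0.
    rewrite /F cmeanZ; last exact: (iG i).
    rewrite (tcoef_shift i n (@analytic_cst 1)).
    by case: ifP; rewrite ?t1 ?mulr0.
  rewrite (cmean_sum _ iF) (bigD1 (Ordinal nN))//= big1 ?addr0.
    by rewrite Fi leqnn subnn mulr1.
  move=> i /eqP ni; rewrite Fi; case: leqP => [le|//].
  rewrite subn_eq0; case: leqP => [le2|_]; last by rewrite mulr0.
  by case: ni; apply/val_inj/eqP; rewrite /= eqn_leq le le2.
rewrite /tcoef -cmeanB; [|exact: (cI_tcoef n af h)|exact: cintble_sum].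
rewrite -mulrA; apply: rnorm_cmean.
  apply: cintbleB; [exact: (cI_tcoef n af h)|exact: cintble_sum].
move=> t tI.
have -> : f (circ 2^-1 t) * (circ 2^-1 t)^-1 ^+ n - \sum_(i < N) F i t =
  (f (circ 2^-1 t) - psum a (circ 2^-1 t) N) * ((circ 2^-1 t)^-1 ^+ n).
  rewrite mulrBl; congr (_ - _); rewrite /psum mulr_suml.
  by apply: eq_bigr => i _; rewrite /F mul1r mulrA.
rewrite rnormM -mulrA (mulrC _ (q ^+ N)) mulrA ler_pM ?rnorm_ge0//.
by rewrite rnormX rnormV rnorm_circ ?(ltW h0)// invrK.
Qed.

Lemma tcoef_pser a (M : R) n : (forall n, rnorm (a n) <= M) -> tcoef (pser a) n = a n.
Proof.
move=> aM; have h := half_itv R; have /andP[h0 h1] := h.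
apply: (@tcoef_unif _ _ (M / (1 - 2^-1)) 2^-1) ; [exact: pser_analytic aM|exact: (ltW h0)|exact: h1|].
move=> t k; have := @pser_bound a M (circ 2^-1 t) k aM.
by rewrite rnorm_circ ?(ltW h0)//; exact.
Qed.

Lemma psum_trunc a z N m : (N <= m)%N ->
  psum (fun i => if (i < N)%N then a i else 0) z m = psum a z N.
Proof.
move=> Nm; rewrite -(subnKC Nm); elim: (m - N)%N => [|k IH].
  by rewrite addn0; apply: eq_bigr => i _; rewrite ltn_ord.
by rewrite addnS psumS IH ltnNge leq_addr/= mul0r addr0.
Qed.

Lemma pser_trunc a z N : rnorm z < 1 ->
  pser (fun i => if (i < N)%N then a i else 0) z = psum a z N.
Proof.
move=> z1; set b := fun i => _.
have [M hM] : exists M : R, forall n, rnorm (b n) <= M.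
  exists (\sum_(i < N) rnorm (a i)) => n; rewrite /b; case: ltnP => nN.
    by rewrite (bigD1 (Ordinal nN))//= lerDl sumr_ge0// => i _; exact: rnorm_ge0.
  by rewrite rnorm0 sumr_ge0// => i _; exact: rnorm_ge0.
apply: (@geo_eq _ _ (M / (1 - rnorm z)) (rnorm z) N); [exact: rnorm_ge0|by []|].
by move=> m Nm; rewrite -(psum_trunc a z Nm); exact: pser_bound.
Qed.

Lemma tcoef_psum a n N : tcoef (fun z => psum a z N) n = if (n < N)%N then a n else 0.
Proof.
set b := fun i => if (i < N)%N then a i else 0.
have [M hM] : exists M : R, forall n, rnorm (b n) <= M.
  exists (\sum_(i < N) rnorm (a i)) => k; rewrite /b; case: ltnP => nN.
    by rewrite (bigD1 (Ordinal nN))//= lerDl sumr_ge0// => i _; exact: rnorm_ge0.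
  by rewrite rnorm0 sumr_ge0// => i _; exact: rnorm_ge0.
rewrite -[RHS]/(b n) -(tcoef_pser n hM); have /andP[h0 h1] := half_itv R.
by apply: eq_cmean => t _; rewrite pser_trunc// rnorm_circ// ltW.
Qed.

Lemma tcoef_inj f g : analytic_on_disc f -> analytic_on_disc g ->
  (forall n, tcoef f n = tcoef g n) -> forall z, rnorm z < 1 -> f z = g z.
Proof.
move=> af ag fg z z1.
have [K [q [q0 q1 K0 hK]]] := taylor_unif af (rnorm_ge0 z) z1.
have [K' [q' [q0' q1' K0' hK']]] := taylor_unif ag (rnorm_ge0 z) z1.
pose p := Num.max q q'.
apply: (@geo_eq _ _ (K + K') p 0%N); [by rewrite le_max q0|by rewrite gt_max q1|].
move=> N _.
have e : psum (tcoef f) z N = psum (tcoef g) z N.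
  by rewrite /psum; apply: eq_bigr => i _; rewrite fg.
rewrite (le_trans (rnorm_trian (psum (tcoef f) z N) _ _))// mulrDl lerD//.
  rewrite (le_trans (hK _ _ (lexx _)))// ler_wpM2l// lerXn2r ?nnegrE// ?le_max ?q0 ?lexx//.
rewrite e rnorm_distC (le_trans (hK' _ _ (lexx _)))// ler_wpM2l//.
by rewrite lerXn2r ?nnegrE// ?le_max ?q0 ?lexx ?orbT.
Qed.

Lemma tcoefD f g n : analytic_on_disc f -> analytic_on_disc g ->
  tcoef (fun z => f z + g z) n = tcoef f n + tcoef g n.
Proof.
move=> af ag; have h := half_itv R; rewrite /tcoef -cmeanD; [|exact: cI_tcoef..].
by apply: eq_cmean => t _; rewrite mulrDl.
Qed.

Lemma tcoefZ k f n : analytic_on_disc f ->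
  tcoef (fun z => k * f z) n = k * tcoef f n.
Proof.
move=> af; have h := half_itv R; rewrite /tcoef -cmeanZ; last exact: cI_tcoef.
by apply: eq_cmean => t _; rewrite mulrA.
Qed.

End power_series.

(** * Parseval's identity and the Hardy norm *)

Section integral_conull.
Context d (T : measurableType d) (R : realType).
Import HBNNSimple.
Local Open Scope ereal_scope.

(* Without any measurability assumption on f, which outside the disc is unconstrained. *)
Lemma integral_conull (mu : {measure set T -> \bar R}) (D : set T) (f : T -> \bar R) :
  measurable D -> mu (~` D) = 0 -> (forall x, 0 <= f x) ->
  \int[mu]_x f x = \int[mu]_(x in D) f x.
Proof.
move=> mD D0 f0; rewrite !ge0_integralE//; apply/eqP; rewrite eq_le; apply/andP; split.
  apply: ge_ereal_sup => _ [h hf <-]; apply: ereal_sup_ubound => /=.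
  exists (proj_nnsfun h mD).
    move=> x; rewrite -mrestrict /patch; have := hf x; rewrite /patch in_setT.
    by case: ifP.
  rewrite -mrestrict; apply: eq_fsbigr => r _.
  have [->|r0] := eqVneq r 0%R; first by rewrite !mul0e.
  congr (_ * _).
  have e : (h \_ D) @^-1` [set r] = h @^-1` [set r] `&` D.
    apply/seteqP; split => x /=; rewrite /patch.
      case: ifPn => [/set_mem Dx -> //|_ r0']; by rewrite -r0' eqxx in r0.
    by move=> [hx Dx]; rewrite mem_set.
  have mh : measurable (h @^-1` [set r]) by [].
  rewrite e [RHS](_ : _ = mu (h @^-1` [set r] `&` D) + mu (h @^-1` [set r] `\` D)); last first.
    by rewrite {1}(measureDI mu mh mD) addeC.
  rewrite [X in _ + X](_ : _ = 0) ?adde0//.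
  apply/eqP; rewrite eq_le measure_ge0 andbT -D0 le_measure ?inE//.
  - exact: measurableD.
  - exact: measurableC.
apply: ge_ereal_sup => _ [h hf <-]; apply: ereal_sup_ubound => /=; exists h => // x.
rewrite (le_trans (hf x))// /patch in_setT; case: ifP => // _; exact: f0.
Qed.

End integral_conull.

Section circle_integral.
Variable R : realType.
Local Notation C := (Cplx R).
Implicit Types (f g G : C -> C) (a b : nat -> C) (w z : C) (r t : R) (n : nat).
Local Notation leb := (@lebesgue_measure R).

Lemma open_borel (A : set C) : open A -> measurable (A : set (Cplx_borel R)).
Proof. by move=> oA; apply: sub_sigma_algebra. Qed.

Lemma measurable_open_continuous (D : set C) (g : C -> R) : open D ->
  (forall z, D z -> {for z, continuous g}) ->
  measurable_fun (D : set (Cplx_borel R)) (g : Cplx_borel R -> measurableTypeR R).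
Proof.
move=> oD cg.
apply: (@measurability _ _ (Cplx_borel R) (measurableTypeR R) D g (@measurable_realfun.RGenOInfty.G R)).
  exact: measurable_realfun.RGenOInfty.measurableE.
move=> _ [_ [a ->] <-]; apply: open_borel.
rewrite openE => z [Dz gz].
have h1 : nbhs z D by apply: open_nbhs_nbhs.
have h2 : nbhs z (g @^-1` `]a, +oo[).
  by apply: (cg z Dz); apply: open_nbhs_nbhs; split => //; exact: interval_open.
exact: filterI h1 h2.
Qed.

Let mI : measurable (`[0%R, (2 * pi)%R[%classic : set (measurableTypeR R)).
Proof. exact: measurable_itv. Qed.

Let c0 : 0 <= (2 * pi : R)^-1.
Proof. by rewrite invr_ge0 (ltW (twopi_gt0 R)). Qed.

Local Open Scope ereal_scope.

(** The integrand is controlled only on an open set [D] around the circle; [integral_conull] first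
    discards the complement, where nothing is known about measurability. *)
Lemma circle_integral (D : set C) (g : C -> R) : open D ->
  (forall t, D (expi t)) -> (forall z, D z -> {for z, continuous g}) ->
  (forall z, (0 <= g z)%R) ->
  \int[@circle_measure R]_z (g z)%:E = ((2 * pi)^-1 * rint 0 (2 * pi) (g \o @expi R))%:E.
Proof.
move=> oD De cg g0.
pose nu0 : {measure set (measurableTypeR R) -> \bar R} := mrestr leb mI.
pose nu := measure_function_pushforward__canonical__measure_function_Measure nu0
  (@measurable_expi R).
have mD : measurable (D : set (Cplx_borel R)) by exact: open_borel.
rewrite (@integral_conull _ _ _ _ (D : set (Cplx_borel R)))//; last first.
  rewrite /= /circle_measure (_ : `[0%R, (2 * pi)%R[%classic `&` _ = set0) ?measure0 ?mule0//.
  by apply/seteqP; split => // t [_ /=]; have := De t.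
rewrite (@eq_measure_integral _ _ _ _ (mscale (NngNum c0) nu)); last first.
  by move=> A mA _; rewrite /= /circle_measure /mscale/= /pushforward /mrestr setIC.
have mg : measurable_fun (D : set (Cplx_borel R)) (EFin \o (g : Cplx_borel R -> R)).
  have mg := measurable_open_continuous oD cg.
  exact/measurable_EFinP.
have gE0 (z : Cplx_borel R) : D z -> 0 <= (EFin \o g) z by rewrite lee_fin.
rewrite (ge0_integral_mscale nu mD (NngNum c0) mg gE0).
rewrite /nu (@ge0_integral_pushforward _ _ _ _ _ _ (@measurable_expi R) nu0)//; last first.
  by move=> z _; rewrite lee_fin.
rewrite (_ : @expi R @^-1` D = setT); last by apply/seteqP; split => t _ //; exact: De.
rewrite (@integral_conull _ _ _ _ (`[0%R, (2 * pi)%R[%classic : set (measurableTypeR R)))//; last 2 first.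
- by rewrite /= /nu0 /mrestr setICl measure0.
- by move=> t; rewrite /= lee_fin.
rewrite (@eq_measure_integral _ _ _ _ leb); last first.
  by move=> A mA AI; rewrite /= /mrestr; congr leb; apply/seteqP; split => [x []//|x Ax]; split => //; exact: AI.
have cge : rcts 0 (2 * pi) (g \o @expi R).
  move=> t _; apply: (@continuous_comp _ _ _ (@expi R) g); first exact: expi_continuousC.
  exact: cg.
have ige := rcts_rintble cge.
rewrite (integral_itv_bndo_bndc (a := BLeft 0%R)).
  rewrite /rint /Rintegral /= EFinM fineK//.
  exact: integrable_fin_num.
apply/measurable_realfun.measurable_EFinP.
apply: measurable_funS (rintble_measurable ige) => //.
by move=> x /=; rewrite !in_itv/= => /andP[-> /ltW->].
Qed.

Definition rmean (u : R -> R) : R := ((2 * pi)^-1 * rint 0 (2 * pi) u)%R.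

Lemma Lnorm_circ f r : analytic_on_disc f -> (0 <= r < 1)%R ->
  'N[@circle_measure R]_2%:E[(fun z => (rnorm (f (toC r * z)))%:E)] =
  (Num.sqrt (rmean (fun t => rnorm (f (circ r t)) ^+ 2)))%:E.
Proof.
move=> af /andP[r0 r1]; rewrite unlock.
have e z : `|(rnorm (f (toC r * z)))%:E| `^ 2 = (rnorm (f (toC r * z)) ^+ 2)%:E.
  by rewrite gee0_abs ?lee_fin ?rnorm_ge0// poweR_EFin -powR_mulrn ?rnorm_ge0.
under eq_integral do rewrite e.
pose D : set C := [set z | rnorm (toC r * z) < 1]%R.
have cr : continuous (fun z : C => toC r * z)%R.
  by move=> z; apply: (@continuousM C C); [exact: cst_continuous|exact: cvg_id].
have oD : open D.
  have -> : D = (fun z : C => toC r * z)%R @^-1` (@disc R).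
    by apply/seteqP; split => z /discE.
  by apply: open_comp => [z _|]; [exact: cr|exact: open_disc].
rewrite (@circle_integral D (fun z => rnorm (f (toC r * z)) ^+ 2)%R)//.
- rewrite poweR_EFin powR12_sqrt// mulr_ge0//.
  by rewrite /rint /Rintegral fine_ge0// integral_ge0// => t _; rewrite lee_fin exprn_ge0// rnorm_ge0.
- by move=> t; rewrite /D/= rnormM rnorm_expi mulr1 rnorm_toC ger0_norm.
- move=> z Dz.
  apply: (@continuous_comp _ _ _ (fun z : C => f (toC r * z)%R) (fun w : C => rnorm w ^+ 2)%R).
    apply: (@continuous_comp _ _ _ (fun z : C => toC r * z)%R f); first exact: cr.
    exact: analytic_continuous.
  apply: (@continuous_comp _ _ _ (@rnorm R C) (fun x : R => x ^+ 2)%R).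
    exact: rnorm_continuous.
  exact: exprn_continuous.
- by move=> z; rewrite exprn_ge0// rnorm_ge0.
Qed.

Lemma H2_normP f (k : R) : analytic_on_disc f -> (0 <= k)%R ->
  H2_norm f <= k%:E <->
  (forall r, (0 <= r < 1)%R -> (rmean (fun t => rnorm (f (circ r t)) ^+ 2) <= k ^+ 2)%R).
Proof.
move=> af k0; split=> [h r r01|h].
  have : (Num.sqrt (rmean (fun t => rnorm (f (circ r t)) ^+ 2)))%:E <= k%:E.
    rewrite -Lnorm_circ//; apply: le_trans h; apply: ereal_sup_ubound.
    by exists r.
  rewrite lee_fin -{1}(ger0_norm k0) -sqrtr_sqr.
  by rewrite ler_sqrt// exprn_ge0.
apply: ge_ereal_sup => _ [r /= r01 <-]; rewrite Lnorm_circ// lee_fin.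
by rewrite -(ger0_norm k0) -sqrtr_sqr ler_wsqrtr// h.
Qed.

End circle_integral.

(** * Mean squares on circles and sums of squared coefficients *)

Section parseval.
Variable R : realType.
Local Notation C := (Cplx R).
Implicit Types (f g G : C -> C) (a b : nat -> C) (w z : C) (r t : R) (n : nat).
Local Notation cI := (cintble 0 (2 * pi)).

Lemma cvgn_le_cst (u : nat -> R) (l K : R) : u n @[n --> \oo] --> l ->
  (forall n, u n <= K) -> l <= K.
Proof.
move=> ul uK; rewrite -(cvg_lim _ ul)//; apply: limr_le; first exact: (cvgP _ ul).
exact: nearW.
Qed.

Lemma toC_rmean (u : R -> R) : toC (rmean u) = cmean (fun t => toC (u t)).
Proof.
rewrite /rmean toCM /cmean; congr (_ * _); apply: cplxP.
  by rewrite re_cint.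
by rewrite im_cint im_toC rint_cst ?mul0r// (ltW (twopi_gt0 R)).
Qed.

Lemma cconj_circV r t n : r != 0 -> cconj (circ r t ^+ n) = toC (r ^+ n ^+ 2) * (circ r t)^-1 ^+ n.
Proof.
move=> r0; rewrite circ_expX circV// conjM conj_toC conj_expi mulrA; congr (_ * _).
rewrite -toCM; congr toC; rewrite expr2 exprVn mulfK//.
by rewrite expf_neq0.
Qed.

Lemma rnorm2_continuous f r : 0 <= r -> (forall w, rnorm w = r -> {for w, continuous f}) ->
  rcts 0 (2 * pi) (fun t => rnorm (f (circ r t)) ^+ 2).
Proof.
move=> r0 cf t _.
apply: (@continuous_comp _ _ _ (circ r) (fun w => rnorm (f w) ^+ 2)); first exact: circ_continuous.
apply: (@continuous_comp _ _ _ f (fun w : C => rnorm w ^+ 2)); first by apply: cf; rewrite rnorm_circ.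
apply: (@continuous_comp _ _ _ (@rnorm R C) (fun x : R => x ^+ 2)); first exact: rnorm_continuous.
exact: exprn_continuous.
Qed.

(** On |w| = r the conjugate of w^i is r^(2i) w^-i, so integrating f against a conjugated partial
    sum produces the coefficients of f through Cauchy's integrals. *)
Lemma parseval f r : analytic_on_disc f -> 0 < r < 1 ->
  \sum_(i < n) (rnorm (tcoef f i) ^+ 2 * r ^+ i ^+ 2) @[n --> \oo] -->
  rmean (fun t => rnorm (f (circ r t)) ^+ 2).
Proof.
move=> af r01; have /andP[r0 r1] := r01.
have [K [q [q0 q1 K0 hK]]] := taylor_unif af (ltW r0) r1.
have cf w : rnorm w = r -> {for w, continuous f}.
  by move=> wr; apply: analytic_continuous => //; rewrite wr.
have [M M0 hM] := circ_bounded (ltW r0) (fun w wh => analytic_continuous af (le_lt_trans wh r1)).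
have i2 : cI (fun t => f (circ r t) * cconj (f (circ r t))).
  apply: (@cI_circ R (fun w => f w * cconj (f w))); first exact: ltW.
  move=> w wr; apply: (@continuousM C C); first exact: cf.
  by apply: (@continuous_comp _ _ _ f (@cconj R)); [exact: cf|exact: conj_continuous].
have key n : rnorm (toC (rmean (fun t => rnorm (f (circ r t)) ^+ 2)) -
    toC (\sum_(i < n) (rnorm (tcoef f i) ^+ 2 * r ^+ i ^+ 2))) <= 2 * (M * K) * q ^+ n.
  rewrite toC_rmean.
  pose F i t := cconj (tcoef f i) * toC (r ^+ i ^+ 2) * (f (circ r t) * (circ r t)^-1 ^+ i).
  have iG i : cI (fun t => f (circ r t) * (circ r t)^-1 ^+ i) by exact: cI_tcoef.
  have iF i : cI (F i) by exact: cintbleZ.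
  have -> : toC (\sum_(i < n) (rnorm (tcoef f i) ^+ 2 * r ^+ i ^+ 2)) = cmean (fun t => \sum_(i < n) F i t).
    rewrite (cmean_sum _ iF) /toC rmorph_sum; apply: eq_bigr => i _.
    rewrite -[LHS]/(toC _) toCM rnorm_sqr_conj /F cmeanZ; last exact: iG.
    rewrite -tcoefE//; ring.
  rewrite (@eq_cmean _ _ (fun t => f (circ r t) * cconj (f (circ r t)))); last first.
    by move=> t _; rewrite rnorm_sqr_conj.
  have iS := cintble_sum n iF.
  rewrite -cmeanB// -mulrA; apply: rnorm_cmean; first exact: cintbleB.
  move=> t tI.
  have -> : \sum_(i < n) F i t = f (circ r t) * cconj (psum (tcoef f) (circ r t) n).
    rewrite /psum (big_morph (@cconj R) (@conjD R) (@conj0 R)) mulr_sumr.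
    apply: eq_bigr => i _; rewrite conjM cconj_circV ?gt_eqF// /F; ring.
  rewrite -mulrBr rnormM -mulrA ler_pM ?rnorm_ge0//.
    by apply: hM => //; rewrite lexx (ltW r0).
  have -> : cconj (f (circ r t)) - cconj (psum (tcoef f) (circ r t) n) =
    cconj (f (circ r t) - psum (tcoef f) (circ r t) n).
    by apply: cplxP; rewrite !cE; ring.
  by rewrite rnorm_conj hK// rnorm_circ ?(ltW r0).
apply/cvgrPdist_le => e e0.
have [N hN] := geo_small (2 * (M * K)) q0 q1 e0.
exists N => // n /= Nn; have := key n; rewrite -toCB rnorm_toC => h.
by rewrite (le_trans h)// ltW// hN.
Qed.

(** Stated through partial sums, so that bounds pass to limits without any convergence statement. *)
Definition l2le a (K : R) := forall n, \sum_(i < n) rnorm (a i) ^+ 2 <= K.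

Lemma rmean_le f (K r : R) : analytic_on_disc f -> l2le (tcoef f) K -> 0 <= r < 1 ->
  rmean (fun t => rnorm (f (circ r t)) ^+ 2) <= K.
Proof.
move=> af h /andP[r0 r1].
have key s : 0 < s < 1 -> rmean (fun t => rnorm (f (circ s t)) ^+ 2) <= K.
  move=> s01; have P := parseval af s01; have /andP[s0 s1] := s01.
  apply: (cvgn_le_cst P) => n; apply: le_trans (h n); apply: ler_sum => i _.
  by rewrite ler_piMr ?exprn_ge0 ?rnorm_ge0// -exprM exprn_ile1// ltW.
(* [parseval] requires r > 0; at r = 0 the mean is |f(0)|^2, the first partial sum. *)
have [->|rn0] := eqVneq r 0; last by apply: key; rewrite lt_neqAle eq_sym rn0 r0.
have e : rmean (fun t => rnorm (f (circ 0 t)) ^+ 2) = rnorm (tcoef f 0%N) ^+ 2.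
  rewrite /rmean (@eq_rint _ _ _ _ (fun=> rnorm (f 0) ^+ 2)); last first.
    by move=> t _; rewrite /circ toC0 mul0r.
  rewrite rint_cst ?(ltW (twopi_gt0 R))// subr0 mulrCA mulVf ?twopi_neq0// mulr1.
  congr (rnorm _ ^+ 2); rewrite -(cmean_analytic af (half_itv R)) /tcoef.
  by apply: eq_cmean => t _; rewrite expr0 mulr1.
by rewrite e; have := h 1%N; rewrite big_ord_recl big_ord0 addr0.
Qed.

Lemma l2le_rmean f (K : R) : analytic_on_disc f ->
  (forall r, 0 < r < 1 -> rmean (fun t => rnorm (f (circ r t)) ^+ 2) <= K) ->
  l2le (tcoef f) K.
Proof.
move=> af h n.
have key r : 0 < r < 1 -> \sum_(i < n) (rnorm (tcoef f i) ^+ 2 * r ^+ i ^+ 2) <= K.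
  move=> r01; have P := parseval af r01; apply: le_trans (h _ r01).
  have nd : nondecreasing_seq (fun n => \sum_(i < n) (rnorm (tcoef f i) ^+ 2 * r ^+ i ^+ 2)).
    apply/nondecreasing_seqP => m; rewrite big_ord_recr/= lerDl.
    by rewrite mulr_ge0// ?exprn_ge0// ?rnorm_ge0//; case/andP: r01 => /ltW.
  have := nondecreasing_cvgn_le nd; rewrite (cvg_lim _ P)//; apply.
  exact: P.
(* The radii [x k] tend to 1, and a partial sum with fixed number of terms is continuous in the
   radius. *)
pose x (k : nat) : R := 1 + (2^-1 - 1) * k.+1%:R^-1.
have xc : x k @[k --> \oo] --> (1 : R) by exact: harmonic_seq_cvg.
have [h0 h1] : 0 < (2^-1 : R) /\ (2^-1 : R) < 1 by have /andP[] := half_itv R.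
have x01 k : 0 < x k < 1.
  have /andP[h2 ->] := harmonic_seq_itvN k h1.
  by rewrite andbT (lt_le_trans h0).
have sc : \sum_(i < n) (rnorm (tcoef f i) ^+ 2 * x k ^+ i ^+ 2) @[k --> \oo] -->
    \sum_(i < n) rnorm (tcoef f i) ^+ 2.
  rewrite (eq_bigr (fun i : 'I_n => rnorm (tcoef f i) ^+ 2 * 1 ^+ i ^+ 2)); last first.
    by move=> i _; rewrite !expr1n mulr1.
  clear key; elim: n => [|m IH].
    rewrite big_ord0 (_ : (fun k => _) = (fun=> 0)); first exact: cvg_cst.
    by apply/funext => k; rewrite big_ord0.
  rewrite big_ord_recr/= (_ : (fun k => _) = (fun k => \sum_(i < m) (rnorm (tcoef f i) ^+ 2 * x k ^+ i ^+ 2) + rnorm (tcoef f m) ^+ 2 * x k ^+ m ^+ 2)); last first.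
    by apply/funext => k; rewrite big_ord_recr.
  apply: cvgD => //; apply: cvgM; first exact: cvg_cst.
  apply: (@cvg_comp _ _ _ x (fun y : R => y ^+ m ^+ 2) _ (nbhs (1 : R))); first exact: xc.
  by apply: (@continuous_comp R R R (fun y : R => y ^+ m) (fun y => y ^+ 2)); exact: exprn_continuous.
by apply: (cvgn_le_cst sc) => k; exact: key.
Qed.

(** This turns the Hardy norm into the l2 norm of the Taylor coefficients, so that outer functions
    can be studied in l2. *)
Lemma H2_norm_l2le f (k : R) : analytic_on_disc f -> 0 <= k ->
  (H2_norm f <= k%:E)%E <-> l2le (tcoef f) (k ^+ 2).
Proof.
move=> af k0; split=> [/(H2_normP af k0) h|h].
  by apply: l2le_rmean => // r /andP[r0 r1]; apply: h; rewrite ltW.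
by apply/(H2_normP af k0) => r r01; exact: rmean_le.
Qed.

End parseval.

(** * Square-summable sequences *)

Section l2.
Variable R : realType.
Local Notation C := (Cplx R).
Local Notation sq := (nat -> C).
Implicit Types (a b c u v g : sq) (t x y : R) (k : C) (n N : nat).

(** Partial sums of the real part of the Hermitian product. The real part determines the norm, and
    being orthogonal to a complex subspace for it is the same as for the full product. *)
Definition ipn a b N : R := \sum_(i < N) re (a i * cconj (b i)).
Definition ip a b : R := limn (ipn a b).
Definition l2 a := exists K : R, l2le a K.
Definition nn a : R := ip a a.

Lemma sqD a b n : (a + b) n = a n + b n. Proof. by []. Qed.
Lemma sqN a n : (- a) n = - a n. Proof. by []. Qed.
Lemma sqB a b n : (a - b) n = a n - b n. Proof. by []. Qed.
Lemma sqZ k a n : (k *: a) n = k * a n. Proof. by []. Qed.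
Lemma sq0 n : (0 : sq) n = 0. Proof. by []. Qed.
Definition sqE := (sqB, sqD, sqN, sqZ, sq0).

Lemma re_mul_conj (z : C) : re (z * cconj z) = rnorm z ^+ 2.
Proof. by rewrite -rnorm_sqr_conj re_toC. Qed.

Lemma ipnn a N : ipn a a N = \sum_(i < N) rnorm (a i) ^+ 2.
Proof. by apply: eq_bigr => i _; rewrite re_mul_conj. Qed.

Lemma ipnC a b N : ipn a b N = ipn b a N.
Proof. by apply: eq_bigr => i _; rewrite !cE; ring. Qed.

Lemma ipnDl a b c N : ipn (a + b) c N = ipn a c N + ipn b c N.
Proof. by rewrite /ipn -big_split; apply: eq_bigr => i _; rewrite sqD mulrDl reD. Qed.

Lemma ipnZl t a b N : ipn (toC t *: a) b N = t * ipn a b N.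
Proof. by rewrite /ipn mulr_sumr; apply: eq_bigr => i _; rewrite !sqE !cE; ring. Qed.

Lemma ipnJ k a b N : ipn (k *: a) b N = ipn a (cconj k *: b) N.
Proof. by apply: eq_bigr => i _; rewrite !sqE !cE; ring. Qed.

Lemma ipn_nd a : nondecreasing_seq (ipn a a).
Proof.
apply/nondecreasing_seqP => n; rewrite !ipnn big_ord_recr/= lerDl.
by rewrite exprn_ge0// rnorm_ge0.
Qed.

Lemma l2P a : l2 a <-> exists K, forall N, ipn a a N <= K.
Proof. by split=> -[K h]; exists K => N; [rewrite ipnn|rewrite -ipnn]; exact: h. Qed.

Lemma rnorm2D_le (z w : C) : rnorm (z + w) ^+ 2 <= 2 * rnorm z ^+ 2 + 2 * rnorm w ^+ 2.
Proof.
rewrite !rnorm_sq !cE -subr_ge0.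
have -> : 2 * (re z ^+ 2 + im z ^+ 2) + 2 * (re w ^+ 2 + im w ^+ 2) -
  ((re z + re w) ^+ 2 + (im z + im w) ^+ 2) = (re z - re w) ^+ 2 + (im z - im w) ^+ 2 by ring.
by rewrite addr_ge0// sqr_ge0.
Qed.

Lemma l2D a b : l2 a -> l2 b -> l2 (a + b).
Proof.
move=> [K hK] [L hL]; exists (2 * K + 2 * L) => n.
apply: (@le_trans _ _ (\sum_(i < n) (2 * rnorm (a i) ^+ 2 + 2 * rnorm (b i) ^+ 2))).
  by apply: ler_sum => i _; exact: rnorm2D_le.
by rewrite big_split/= -!mulr_sumr; apply: lerD; apply: ler_wpM2l => //; [exact: hK|exact: hL].
Qed.

Lemma l2Z k a : l2 a -> l2 (k *: a).
Proof.
move=> [K hK]; exists (rnorm k ^+ 2 * K) => n.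
rewrite (eq_bigr (fun i : 'I_n => rnorm k ^+ 2 * rnorm (a i) ^+ 2)).
  rewrite -mulr_sumr; apply: ler_wpM2l; [exact: exprn_ge0 (rnorm_ge0 _)|exact: hK].
by move=> i _; rewrite sqZ rnormM exprMn.
Qed.

Lemma l2N a : l2 a -> l2 (- a).
Proof. by move=> /(l2Z (-1)); rewrite scaleN1r. Qed.

Lemma l2B a b : l2 a -> l2 b -> l2 (a - b).
Proof. by move=> la lb; apply: l2D => //; exact: l2N. Qed.

Lemma l20 : l2 0.
Proof. by exists 0 => n; rewrite big1// => i _; rewrite sq0 rnorm0 expr0n. Qed.

Lemma ipnn_cvg a : l2 a -> cvgn (ipn a a).
Proof.
move=> /l2P[K hK]; apply: nondecreasing_is_cvgn; first exact: ipn_nd.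
by exists K => _ [n _ <-].
Qed.

(** Polarization reduces the convergence of inner products to the monotone convergence of squared
    norms. *)
Lemma ipn_polar a b N : ipn a b N = 4^-1 * ipn (a + b) (a + b) N - 4^-1 * ipn (a - b) (a - b) N.
Proof.
rewrite /ipn -mulrBr -sumrB mulr_sumr; apply: eq_bigr => i _.
by rewrite !sqE !cE; field.
Qed.

Lemma ip_cvg a b : l2 a -> l2 b -> ipn a b N @[N --> \oo] --> ip a b.
Proof.
move=> la lb; suff : cvgn (ipn a b) by [].
have /cvg_ex[x hx] := ipnn_cvg (l2D la lb).
have /cvg_ex[y hy] := ipnn_cvg (l2B la lb).
apply/cvg_ex; exists (4^-1 * x - 4^-1 * y).
have -> : ipn a b = (fun N => 4^-1 * ipn (a + b) (a + b) N - 4^-1 * ipn (a - b) (a - b) N).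
  by apply/funext => N; exact: ipn_polar.
by apply: cvgB; apply: cvgM => //; exact: cvg_cst.
Qed.

Lemma ip_uniq a b x : ipn a b N @[N --> \oo] --> x -> ip a b = x.
Proof. by move=> h; rewrite /ip (cvg_lim _ h). Qed.

Lemma ip_ext a b a' b' : (forall i, re (a i * cconj (b i)) = re (a' i * cconj (b' i))) ->
  ip a b = ip a' b'.
Proof.
move=> h; rewrite /ip (_ : ipn a b = ipn a' b')//; apply/funext => N.
by apply: eq_bigr => i _; exact: h.
Qed.

Lemma ipC a b : ip a b = ip b a.
Proof. by rewrite /ip (_ : ipn a b = ipn b a)//; apply/funext => N; exact: ipnC. Qed.

Lemma ipJ k a b : ip (k *: a) b = ip a (cconj k *: b).
Proof. by rewrite /ip (_ : ipn (k *: a) b = ipn a (cconj k *: b))//; apply/funext => N; exact: ipnJ. Qed.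

Lemma ipDl a b c : l2 a -> l2 b -> l2 c -> ip (a + b) c = ip a c + ip b c.
Proof.
move=> la lb lc; apply: ip_uniq.
have -> : ipn (a + b) c = (fun N => ipn a c N + ipn b c N) by apply/funext => N; exact: ipnDl.
by apply: cvgD; exact: ip_cvg.
Qed.

Lemma ipZl t a b : l2 a -> l2 b -> ip (toC t *: a) b = t * ip a b.
Proof.
move=> la lb; apply: ip_uniq.
have -> : ipn (toC t *: a) b = (fun N => t * ipn a b N) by apply/funext => N; exact: ipnZl.
by apply: cvgM; [exact: cvg_cst|exact: ip_cvg].
Qed.

Lemma ipNl a b : l2 a -> l2 b -> ip (- a) b = - ip a b.
Proof.
by move=> la lb; have := ipZl (-1) la lb; rewrite mulN1r toCN toC1 scaleN1r.
Qed.

Lemma ipBl a b c : l2 a -> l2 b -> l2 c -> ip (a - b) c = ip a c - ip b c.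
Proof. by move=> la lb lc; rewrite ipDl ?ipNl//; exact: l2N. Qed.

Lemma ipDr a b c : l2 a -> l2 b -> l2 c -> ip c (a + b) = ip c a + ip c b.
Proof. by move=> la lb lc; rewrite ipC ipDl// !(ipC c). Qed.

Lemma ipBr a b c : l2 a -> l2 b -> l2 c -> ip c (a - b) = ip c a - ip c b.
Proof. by move=> la lb lc; rewrite ipC ipBl// !(ipC c). Qed.

Lemma nn_le a K : l2le a K -> nn a <= K.
Proof.
move=> h; have la : l2 a by exists K.
apply: (cvgn_le_cst (ip_cvg la la)) => n; rewrite ipnn; exact: h.
Qed.

Lemma l2le_nn a : l2 a -> l2le a (nn a).
Proof.
move=> la n; rewrite -ipnn.
by have := nondecreasing_cvgn_le (@ipn_nd a) (ipnn_cvg la) n.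
Qed.

Lemma nn_ge0 a : l2 a -> 0 <= nn a.
Proof. by move=> /l2le_nn /(_ 0%N); rewrite big_ord0. Qed.

Lemma coef_nn a i : l2 a -> rnorm (a i) ^+ 2 <= nn a.
Proof.
move=> /l2le_nn /(_ i.+1); apply: le_trans; rewrite big_ord_recr/= lerDr.
by apply: sumr_ge0 => j _; rewrite exprn_ge0// rnorm_ge0.
Qed.

Lemma nnD a b : l2 a -> l2 b -> nn (a + b) = nn a + 2 * ip a b + nn b.
Proof.
move=> la lb; rewrite /nn ipDl ?(ipDr (c := a)) ?(ipDr (c := b))//; last exact: l2D.
by rewrite (ipC b a); ring.
Qed.

Lemma nnZ k a : l2 a -> nn (k *: a) = rnorm k ^+ 2 * nn a.
Proof.
move=> la; rewrite /nn -ipZl//; apply: ip_ext => i.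
by rewrite rnorm_sq !sqE !cE; ring.
Qed.

Lemma nnN a : nn (- a) = nn a.
Proof. by apply: ip_ext => i; rewrite !sqE !cE; ring. Qed.

Lemma nnB a b : l2 a -> l2 b -> nn (a - b) = nn a - 2 * ip a b + nn b.
Proof. by move=> la lb; rewrite nnD ?nnN 1?ipC ?ipNl// 1?ipC; [ring|exact: l2N]. Qed.

Lemma nn_distC a b : nn (a - b) = nn (b - a).
Proof. by rewrite -nnN opprB. Qed.

Lemma parallelogram a b : l2 a -> l2 b -> nn (a + b) + nn (a - b) = 2 * nn a + 2 * nn b.
Proof. by move=> la lb; rewrite nnD// nnB//; ring. Qed.

Lemma nnD_le a b : l2 a -> l2 b -> nn (a + b) <= 2 * nn a + 2 * nn b.
Proof. by move=> la lb; rewrite -parallelogram// lerDl nn_ge0//; exact: l2B. Qed.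

(** A discriminant bound, read off at the minimum t = x/y; for y = 0 the value t = (c + 1) / (2x)
    contradicts the hypothesis. With c the squared norm it gives Cauchy-Schwarz, with c small it
    gives approximate orthogonality in [projection]. *)
Lemma quad_ineq (x y c : R) : 0 <= y -> 0 <= c ->
  (forall t : R, - c <= t ^+ 2 * y - 2 * t * x) -> x ^+ 2 <= c * y.
Proof.
move=> y0 c0 h; have [y00|yn0] := eqVneq y 0.
  have [->|x0] := eqVneq x 0; first by rewrite expr0n/= mulr_ge0.
  have := h ((c + 1) / (2 * x)); rewrite y00 mulr0 sub0r lerN2.
  rewrite (_ : 2 * ((c + 1) / (2 * x)) * x = c + 1); last by field.
  by rewrite gerDl ler10.
have yp : 0 < y by rewrite lt_neqAle eq_sym yn0.
have := h (x / y); rewrite (_ : (x / y) ^+ 2 * y - 2 * (x / y) * x = - (x ^+ 2 / y)); last by field.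
by rewrite lerN2 ler_pdivrMr.
Qed.

Lemma cauchy_schwarz a b : l2 a -> l2 b -> ip a b ^+ 2 <= nn a * nn b.
Proof.
move=> la lb; apply: quad_ineq; [exact: nn_ge0|exact: nn_ge0|] => t.
have := nn_ge0 (l2B la (l2Z (toC t) lb)); rewrite nnB//; last exact: l2Z.
rewrite nnZ// rnorm_toC real_normK ?num_real// ipC ipZl// (ipC b) => h.
by move: h; move: (nn a) (nn b) (ip a b) (t ^+ 2 * _) => A B D E h; lra.
Qed.

Lemma nn_eq0 a : l2 a -> nn a = 0 -> a = 0.
Proof.
move=> la a0; apply/funext => i; have := coef_nn i la; rewrite a0.
rewrite real_exprn_even_le0 ?num_real//= => /eqP h.
exact: rnorm0_eq0.
Qed.

Lemma cvg_sqrt0 (v : nat -> R) : v n @[n --> \oo] --> 0 -> Num.sqrt (v n) @[n --> \oo] --> 0.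
Proof.
move=> v0; rewrite -(sqrtr0 R); apply: (@cvg_comp _ _ _ v (@Num.sqrt R) _ (nbhs (0 : R))) => //.
exact: sqrt_continuous.
Qed.

Lemma l2_complete (u : nat -> sq) (v : nat -> R) : (forall n, l2 (u n)) ->
  (forall n m, (n <= m)%N -> nn (u m - u n) <= v n) -> v n @[n --> \oo] --> 0 ->
  exists2 g : sq, l2 g & forall n, nn (g - u n) <= v n.
Proof.
move=> lu uv v0.
have vge n : 0 <= v n by rewrite (le_trans _ (uv n n (leqnn n)))// nn_ge0//; exact: l2B.
have co i : exists l : C, u n i @[n --> \oo] --> l.
  have [|l ul _] := @cplx_cauchy_cvg R (fun n => u n i) (fun n => Num.sqrt (v n)) _ (cvg_sqrt0 v0).
    move=> n m nm; rewrite -(ger0_norm (rnorm_ge0 _)) -sqrtr_sqr ler_wsqrtr//.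
    by apply: le_trans (uv _ _ nm); apply: (coef_nn i); exact: l2B.
  by exists l.
have [g hg] := choice co.
have le n : l2le (g - u n) (v n).
  move=> N.
  have c : \sum_(i < N) rnorm ((u m - u n) i) ^+ 2 @[m --> \oo] --> \sum_(i < N) rnorm ((g - u n) i) ^+ 2.
    elim: N => [|N IH].
      rewrite big_ord0 (_ : (fun m => _) = (fun=> 0)); first exact: cvg_cst.
      by apply/funext => m; rewrite big_ord0.
    rewrite big_ord_recr/= (_ : (fun m => _) = (fun m => \sum_(i < N) rnorm ((u m - u n) i) ^+ 2 + rnorm ((u m - u n) N) ^+ 2)); last first.
      by apply/funext => m; rewrite big_ord_recr.
    apply: cvgD => //.
    apply: (@cvg_comp _ _ _ (fun m => (u m - u n) N) (fun z : C => rnorm z ^+ 2) _ (nbhs ((g - u n) N))).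
      by apply: (@cvgB C C); [exact: hg|exact: cvg_cst].
    apply: (@continuous_comp C R R (@rnorm R C) (fun y => y ^+ 2)); first exact: rnorm_continuous.
    exact: exprn_continuous.
  apply: (@cvgn_le_cst R (fun m => \sum_(i < N) rnorm ((u (m + n)%N - u n) i) ^+ 2)).
    by rewrite (cvg_shiftn n (fun m => \sum_(i < N) rnorm ((u m - u n) i) ^+ 2)).
  move=> m; apply: le_trans (uv n (m + n)%N (leq_addl _ _)).
  by apply: l2le_nn; exact: l2B.
exists g => [|n]; last exact: nn_le (le n).
have -> : g = (g - u 0%N) + u 0%N by rewrite subrK.
by apply: l2D => //; exists (v 0%N).
Qed.

Lemma orth_lim u (w : nat -> sq) g : l2 u -> l2 g -> (forall n, l2 (w n)) ->
  nn (w n - g) @[n --> \oo] --> 0 -> ip (w n) u @[n --> \oo] --> ip g u.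
Proof.
move=> lu lg lw wg; apply/cvgrPdist_le => e e0.
have c : nn (w n - g) * nn u @[n --> \oo] --> 0.
  by rewrite -(mul0r (nn u)); apply: cvgM => //; exact: cvg_cst.
have /cvgrPdist_lt/(_ _ (exprn_gt0 2 e0))[N _ hN] := c.
exists N => // n /hN; rewrite sub0r normrN => h.
rewrite distrC -ipBl//.
have := cauchy_schwarz (l2B (lw n) lg) lu => cs.
rewrite -(@ler_pXn2r _ 2) ?nnegrE ?(ltW e0)// real_normK ?num_real//.
rewrite (le_trans cs)// (le_trans (ler_norm _))// ltW//.
Qed.

(** [S] need not be closed, so the nearest point is replaced by a minimizing sequence [s], and the
    residual [g] is the limit of v - s n. The parallelogram law makes these residuals a Cauchy
    sequence. *)
Lemma projection (S : set sq) v : l2 v -> (forall u, S u -> l2 u) -> S 0 ->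
  (forall u w k, S u -> S w -> S (u + k *: w)) ->
  exists (s : nat -> sq) (g : sq), [/\ forall n, S (s n), l2 g,
    nn (v - s n - g) @[n --> \oo] --> 0 & forall u, S u -> ip g u = 0].
Proof.
move=> lv Sl2 S0 SDZ.
pose E := [set nn (v - u) | u in S].
have E0 : E !=set0 by exists (nn (v - 0)); exists 0.
have lb : lbound E 0 by move=> _ [u Su <-]; apply: nn_ge0; apply: l2B => //; exact: Sl2.
have hE : has_inf E by split => //; exists 0.
pose d := inf E.
have dle u : S u -> d <= nn (v - u) by move=> Su; apply: ge_inf; [exists 0|exists u].
have ex n : exists u, S u /\ nn (v - u) <= d + n.+1%:R^-1.
  have [_ [u Su <-] h] := inf_adherent (ltac:(by rewrite invr_gt0) : 0 < (n.+1%:R^-1 : R)) hE.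
  by exists u; split => //; exact: ltW.
have [s hs] := choice ex.
have Ss n := (hs n).1; have ls n := Sl2 _ (Ss n).
have lvs n : l2 (v - s n) by exact: l2B.
have cauchy n m : (n <= m)%N -> nn ((v - s m) - (v - s n)) <= 4 * n.+1%:R^-1.
  move=> nm; have P := parallelogram (lvs m) (lvs n).
  have hh : 4 * d <= nn ((v - s m) + (v - s n)).
    have -> : (v - s m) + (v - s n) = toC 2 *: (v - (s m + 1 *: s n - 2^-1 *: (s m + 1 *: s n))).
      apply/funext => i; rewrite !sqE !mul1r (_ : toC 2 = 2); last by rewrite /toC rmorph_nat.
      by field.
    rewrite nnZ; last first.
      by do !apply: l2B => //; try apply: l2Z; apply: l2D => //; exact: l2Z.
    rewrite rnorm_toC ger0_norm// -natrX ler_wpM2l//; apply: dle.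
    have Sw : S (s m + 1 *: s n) by exact: SDZ.
    by rewrite -scaleNr; exact: SDZ.
  have := (hs n).2; have := (hs m).2.
  have mn : (m.+1%:R^-1 : R) <= n.+1%:R^-1 by rewrite lef_pV2 ?posrE// ler_nat.
  move: P hh mn; move: (nn _) (nn _) (nn _) (nn _) (n.+1%:R^-1) (m.+1%:R^-1) => *; lra.
have v0 : 4 * (n.+1%:R^-1 : R) @[n --> \oo] --> 0.
  rewrite -(mulr0 4); apply: cvgM; [exact: cvg_cst|exact: cvg_harmonic].
have [g lg hg] := l2_complete lvs cauchy v0.
have conv : nn (v - s n - g) @[n --> \oo] --> 0.
  apply: (@squeeze_cvgr _ _ _ _ (fun=> 0) (fun n => 4 * n.+1%:R^-1)) => //; last exact: cvg_cst.
  apply: nearW => n; rewrite nn_distC hg andbT; apply: nn_ge0; exact: l2B.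
exists s, g; split => // u Su; have lu := Sl2 _ Su.
have c2 := orth_lim lu lg lvs conv.
suff c1 : ip (v - s n) u @[n --> \oo] --> 0 by exact: (cvg_unique _ c2 c1).
(* [s n] is minimal up to 1/(n+1), so moving it along u lowers the squared distance by at most that
   much; [quad_ineq] converts this into a bound on the inner product. *)
have b n : `|ip (v - s n) u| <= Num.sqrt (n.+1%:R^-1 * nn u).
  rewrite -sqrtr_sqr ler_wsqrtr//; apply: quad_ineq; [exact: nn_ge0|by rewrite invr_ge0|].
  move=> t; have St : S (s n + toC t *: u) by exact: SDZ.
  have := dle _ St; have := (hs n).2; rewrite opprD addrA (nnB (lvs n) (l2Z _ lu)).
  rewrite nnZ// rnorm_toC real_normK ?num_real// ipC ipZl// (ipC u) mulrA.
  move: (nn _) (n.+1%:R^-1) (2 * t * _) (t ^+ 2 * _) => *; lra.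
have c0 : Num.sqrt (n.+1%:R^-1 * nn u) @[n --> \oo] --> 0.
  apply: cvg_sqrt0; rewrite -(mul0r (nn u)).
  by apply: cvgM; [exact: cvg_harmonic|exact: cvg_cst].
apply: norm_cvg0; apply: (@squeeze_cvgr _ _ _ _ (fun=> 0) (fun n => Num.sqrt (n.+1%:R^-1 * nn u))) => //; last exact: cvg_cst.
by apply: nearW => n; rewrite normr_ge0 b.
Qed.

End l2.

(** * Inner-outer factorization *)

Section convolution.
Variable R : realType.
Local Notation C := (Cplx R).
Local Notation sq := (nat -> C).
Implicit Types (a b c u v g : sq) (k : C) (n N : nat) (p : {poly C}).

Definition cprod a b : sq := fun n => \sum_(i < n.+1) a i * b (n - i)%N.
Definition cf p : sq := fun i => p`_i.
Definition trunc n a : {poly C} := \poly_(i < n.+1) a i.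
Definition shift a : sq := fun n => if n is m.+1 then a m else 0.

Lemma coef_trunc n i a : (trunc n a)`_i = if (i <= n)%N then a i else 0.
Proof. by rewrite coef_poly ltnS. Qed.

(** Entry n involves only entries up to n, so the laws of the Cauchy product are inherited from
    polynomials by truncation. *)
Lemma cprod_trunc n m a b : (n <= m)%N -> cprod a b n = (trunc m a * trunc m b)`_n.
Proof.
move=> nm; rewrite coefM; apply: eq_bigr => i _.
have im : (i <= m)%N by rewrite (leq_trans _ nm)// -ltnS ltn_ord.
by rewrite !coef_trunc im (leq_trans (leq_subr _ _) nm).
Qed.

Lemma cprodC a b : cprod a b = cprod b a.
Proof. by apply/funext => n; rewrite !(cprod_trunc (m := n))// mulrC. Qed.

Lemma coefM_eq n (p p' q q' : {poly C}) : (forall i, (i <= n)%N -> p`_i = p'`_i) ->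
  (forall i, (i <= n)%N -> q`_i = q'`_i) -> (p * q)`_n = (p' * q')`_n.
Proof.
move=> pp qq; rewrite !coefM; apply: eq_bigr => i _.
by rewrite pp ?qq ?leq_subr// -ltnS ltn_ord.
Qed.

Lemma trunc_cprod (n i : nat) a b : (i <= n)%N ->
  (trunc n (cprod a b))`_i = (trunc n a * trunc n b)`_i.
Proof. by move=> i_n; rewrite coef_trunc i_n (cprod_trunc _ _ i_n). Qed.

Lemma cprodA a b c : cprod a (cprod b c) = cprod (cprod a b) c.
Proof.
apply/funext => n; rewrite !(cprod_trunc _ _ (leqnn n)).
transitivity ((trunc n a * (trunc n b * trunc n c))`_n).
  by apply: coefM_eq => // i; exact: trunc_cprod.
by rewrite mulrA; apply: coefM_eq => // i i_n; rewrite trunc_cprod.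
Qed.

Lemma cprodDl a b c : cprod (a + b) c = cprod a c + cprod b c.
Proof.
apply/funext => n; rewrite sqD /cprod -big_split; apply: eq_bigr => i _.
by rewrite sqD mulrDl.
Qed.

Lemma cprodDr a b c : cprod c (a + b) = cprod c a + cprod c b.
Proof. by rewrite cprodC cprodDl !(cprodC _ c). Qed.

Lemma cprodZl k a b : cprod (k *: a) b = k *: cprod a b.
Proof.
apply/funext => n; rewrite sqZ /cprod mulr_sumr; apply: eq_bigr => i _.
by rewrite sqZ mulrA.
Qed.

Lemma cprodZr k a b : cprod a (k *: b) = k *: cprod a b.
Proof. by rewrite cprodC cprodZl cprodC. Qed.

Lemma cprodNr a b : cprod a (- b) = - cprod a b.
Proof. by rewrite -scaleN1r cprodZr scaleN1r. Qed.

Lemma cprodBr a b c : cprod c (a - b) = cprod c a - cprod c b.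
Proof. by rewrite cprodDr cprodNr. Qed.

Lemma cprodBl a b c : cprod (a - b) c = cprod a c - cprod b c.
Proof. by rewrite cprodC cprodBr !(cprodC c). Qed.

Lemma cfD p q : cf (p + q) = cf p + cf q.
Proof. by apply/funext => i; rewrite /cf coefD. Qed.

Lemma cfB p q : cf (p - q) = cf p - cf q.
Proof. by apply/funext => i; rewrite /cf coefB. Qed.

Lemma cfZ k p : cf (k *: p) = k *: cf p.
Proof. by apply/funext => i; rewrite /cf coefZ. Qed.

Lemma cfM p q : cf (p * q) = cprod (cf p) (cf q).
Proof. by apply/funext => i; rewrite /cf coefM. Qed.

Lemma cf0 : cf 0 = 0.
Proof. by apply/funext => i; rewrite /cf coef0. Qed.

Lemma cprod1 a : cprod a (cf 1) = a.
Proof.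
apply/funext => n; rewrite /cprod big_ord_recr/= big1 ?add0r.
  by rewrite subnn /cf coef1 mulr1.
by move=> i _; rewrite /cf coef1 subn_eq0 leqNgt ltn_ord mulr0.
Qed.

Lemma cprod0 a : cprod a 0 = 0.
Proof. by apply/funext => n; rewrite /cprod big1// => i _; rewrite mulr0. Qed.

Lemma cprodX a : cprod a (cf 'X) = shift a.
Proof.
apply/funext => -[|n]; rewrite /cprod; first by rewrite big_ord_recr big_ord0/= /cf coefX mulr0 addr0.
rewrite big_ord_recr big_ord_recr/= big1 ?add0r; last first.
  move=> i _; rewrite /cf coefX; case: eqP; last by rewrite mulr0.
  move=> e; have := ltn_ord i; rewrite -(ltn_add2r 1) !addn1.
  have : (n.+1 - i)%N = 1%N := e.
  move=> h1 h2; move: (subnK (leq_trans (ltnW (ltn_ord i)) (leqnSn n))); rewrite h1 add1n => h3.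
  by move: (ltn_ord i); rewrite -ltnS h3 ltnn.
by rewrite subSnn subnn /cf !coefX mulr1 mulr0 addr0.
Qed.

Lemma cprod_shift a p : cprod a (cf (p * 'X)) = shift (cprod a (cf p)).
Proof. by rewrite cfM cprodA cprodX. Qed.

Lemma shiftZ k a : shift (k *: a) = k *: shift a.
Proof. by apply/funext => -[|n]; rewrite sqZ ?mulr0. Qed.

Lemma shiftB a b : shift (a - b) = shift a - shift b.
Proof. by apply/funext => -[|n]; rewrite sqB ?subr0. Qed.

Lemma ipn_shift a b N : ipn (shift a) (shift b) N.+1 = ipn a b N.
Proof.
rewrite /ipn big_ord_recl (_ : re _ = 0) ?add0r; first by [].
by rewrite mul0r.
Qed.

Lemma l2_shift a : l2 a -> l2 (shift a).
Proof.
move=> /l2P[K hK]; apply/l2P; exists K => -[|N]; last by rewrite ipn_shift.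
by rewrite /ipn big_ord0 (le_trans _ (hK 0%N))// /ipn big_ord0.
Qed.

Lemma l2_unshift a : l2 (shift a) -> l2 a.
Proof. by move=> /l2P[K hK]; apply/l2P; exists K => N; rewrite -ipn_shift. Qed.

Lemma ip_shift a b : l2 a -> l2 b -> ip (shift a) (shift b) = ip a b.
Proof.
move=> la lb; have c := ip_cvg la lb.
apply: ip_uniq; rewrite -cvg_shiftS /=.
rewrite (_ : (fun n => _) = ipn a b)//; by apply/funext => N; rewrite ipn_shift.
Qed.

Lemma nn_shift a : l2 a -> nn (shift a) = nn a.
Proof. by move=> la; exact: ip_shift. Qed.

Lemma poly_split p : exists (q : {poly C}) (k : C), p = q * 'X + k%:P.
Proof. by elim/poly_ind: p => [|p c _]; [exists 0, 0; rewrite mul0r addr0|exists p, c]. Qed.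

Lemma cfP k : cf k%:P = k *: cf 1.
Proof. by rewrite -cfZ -mul_polyC mulr1. Qed.

Lemma cprod_split a q k : cprod a (cf (q * 'X + k%:P)) = shift (cprod a (cf q)) + k *: a.
Proof. by rewrite cfD cprodDr cprod_shift cfP cprodZr cprod1. Qed.

Lemma l2_cprod_cf a p : l2 a -> l2 (cprod a (cf p)).
Proof.
move=> la; elim/poly_ind: p => [|p k IH]; first by rewrite cf0 cprod0; exact: l20.
by rewrite cprod_split; apply: l2D; [exact: l2_shift|exact: l2Z].
Qed.

(** A crude constant, built by Horner's scheme; what counts is that it does not depend on [a]. *)
Lemma cprod_cf_bound p : exists2 K : R, 0 <= K & forall a, l2 a -> nn (cprod a (cf p)) <= K * nn a.
Proof.
elim/poly_ind: p => [|p k [K K0 hK]].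
  exists 0 => // a la; rewrite cf0 cprod0 mul0r; apply: nn_le => n.
  by rewrite big1// => i _; rewrite sq0 rnorm0 expr0n.
exists (2 * K + 2 * rnorm k ^+ 2).
  by rewrite addr_ge0// mulr_ge0// exprn_ge0// rnorm_ge0.
move=> a la; rewrite cprod_split.
have lp := l2_cprod_cf p la.
rewrite (le_trans (nnD_le (l2_shift lp) (l2Z k la)))// nn_shift// nnZ//.
rewrite [leRHS]mulrDl; apply: lerD; last by rewrite mulrA lexx.
rewrite -mulrA; by apply: ler_wpM2l; [|exact: hK].
Qed.

Lemma l2_cf p : l2 (cf p).
Proof.
have l1 : l2 (cf 1).
  exists 1 => -[|n]; first by rewrite big_ord0.
  rewrite big_ord_recl big1 ?addr0; last first.
    by move=> i _; rewrite /cf coef1/= rnorm0 expr0n.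
  by rewrite /cf coef1/= rnorm1 expr1n.
by rewrite -[p]mul1r cfM; exact: l2_cprod_cf.
Qed.

Lemma ip_shift_cst a k : ip (shift a) (k *: cf 1) = 0.
Proof.
apply: ip_uniq; rewrite (_ : ipn _ _ = fun=> 0); first exact: cvg_cst.
apply/funext => N; rewrite /ipn big1// => -[[|i] iN] _ /=.
  by rewrite !cE; ring.
by rewrite sqZ /cf coef1/= mulr0 !cE; ring.
Qed.

Lemma nn_cf1 : nn (cf 1) = 1.
Proof.
apply: ip_uniq; rewrite -cvg_shiftS /= (_ : (fun n => _) = fun=> 1); first exact: cvg_cst.
apply/funext => N; rewrite ipnn big_ord_recl big1 ?addr0; last first.
  by move=> i _; rewrite /cf coef1/= rnorm0 expr0n.
by rewrite /cf coef1/= rnorm1 expr1n.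
Qed.

Lemma nn_cf_split p k : nn (cf (p * 'X + k%:P)) = nn (cf p) + rnorm k ^+ 2.
Proof.
rewrite cfD cfM cprodX cfP nnD; [|exact/l2_shift/l2_cf|exact/l2Z/l2_cf].
rewrite ip_shift_cst nn_shift; last exact: l2_cf.
rewrite nnZ; last exact: l2_cf.
by rewrite nn_cf1; ring.
Qed.

Lemma l2le_trunc v n : l2 v -> l2le (cf (trunc n v)) (nn v).
Proof.
move=> lv N; apply: le_trans (l2le_nn lv N); apply: ler_sum => i _.
rewrite /cf coef_trunc; case: ifP => // _.
by rewrite rnorm0 expr0n/= exprn_ge0// rnorm_ge0.
Qed.

Lemma nn_trunc_cvg v : l2 v -> nn (cf (trunc n v) - v) @[n --> \oo] --> 0.
Proof.
move=> lv; have c := ip_cvg lv lv.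
have b n : nn (cf (trunc n v) - v) <= nn v - ipn v v n.+1.
  apply: nn_le => N.
  rewrite lerBrDr.
  apply: le_trans (l2le_nn lv (maxn N n.+1)); rewrite ipnn.
  have h1 : \sum_(i < N) rnorm ((cf (trunc n v) - v) i) ^+ 2 <=
      \sum_(i < maxn N n.+1) (if (i <= n)%N then 0 else rnorm (v i) ^+ 2).
    rewrite (big_ord_widen (maxn N n.+1) (fun i => rnorm ((cf (trunc n v) - v) i) ^+ 2)) ?leq_maxl// big_mkcond/=.
    apply: ler_sum => i _; rewrite sqB /cf coef_trunc; case: ifP; case: ifP => // _ _.
    - by rewrite subrr rnorm0 expr0n.
    - by rewrite sub0r rnormN.
    - by rewrite exprn_ge0// rnorm_ge0.
  rewrite (big_ord_widen (maxn N n.+1) (fun i => rnorm (v i) ^+ 2)) ?leq_maxr// [X in _ + X <= _]big_mkcond/=.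
  rewrite (le_trans (lerD h1 (lexx _)))// -big_split/=; apply: ler_sum => i _.
  by rewrite ltnS; case: ifP; rewrite ?add0r ?addr0.
apply: (@squeeze_cvgr _ _ _ _ (fun=> 0) (fun n => nn v - ipn v v n.+1)).
- by apply: nearW => n; rewrite b andbT nn_ge0//; apply: l2B => //; exact: l2_cf.
- exact: cvg_cst.
- rewrite -[X in _ --> X](subrr (nn v)); apply: cvgB; first exact: cvg_cst.
  by rewrite (cvg_shiftS (ipn v v)).
Qed.

Lemma nn_lim (w : nat -> sq) g : l2 g -> (forall n, l2 (w n)) ->
  nn (w n - g) @[n --> \oo] --> 0 -> nn (w n) @[n --> \oo] --> nn g.
Proof.
move=> lg lw wg; have c := orth_lim lg lg lw wg.
have -> : (fun n => nn (w n)) = (fun n => nn (w n - g) + 2 * (ip (w n) g) - nn g).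
  apply/funext => n; rewrite nnB//; ring.
rewrite -[X in _ --> X](_ : 0 + 2 * nn g - nn g = nn g); last by ring.
apply: cvgB; last exact: cvg_cst.
by apply: cvgD => //; apply: cvgM => //; exact: cvg_cst.
Qed.

(** The first N entries of the product see only the first entries of v, so the bound for polynomials
    applies to a truncation of v. *)
Lemma multiplier_l2 a (K : R) : 0 <= K -> l2 a ->
  (forall p, nn (cprod a (cf p)) <= K * nn (cf p)) ->
  forall v, l2 v -> l2 (cprod a v) /\ nn (cprod a v) <= K * nn v.
Proof.
move=> K0 la aK v lv.
have h : l2le (cprod a v) (K * nn v).
  move=> N.
  have -> : \sum_(i < N) rnorm (cprod a v i) ^+ 2 = \sum_(i < N) rnorm (cprod a (cf (trunc N v)) i) ^+ 2.
    apply: eq_bigr => i _; congr (rnorm _ ^+ 2); apply: eq_bigr => j _.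
    by rewrite /cf coef_trunc (leq_trans (leq_subr _ _))// ltnW.
  apply: le_trans (l2le_nn (l2_cprod_cf _ la) N) _.
  by rewrite (le_trans (aK _))// ler_wpM2l//; apply: nn_le; exact: l2le_trunc.
by split; [exists (K * nn v)|exact: nn_le].
Qed.

Lemma isometry_l2 a : l2 a -> (forall p, nn (cprod a (cf p)) = nn (cf p)) ->
  forall v, l2 v -> l2 (cprod a v) /\ nn (cprod a v) = nn v.
Proof.
move=> la iso v lv.
have M := @multiplier_l2 a 1 ler01 la (fun p => ltac:(by rewrite mul1r iso)).
have lav := (M v lv).1; split => //.
have c1 := nn_lim lv (fun n => l2_cf (trunc n v)) (nn_trunc_cvg lv).
have c2 : nn (cprod a (cf (trunc n v))) @[n --> \oo] --> nn (cprod a v).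
  apply: nn_lim => // [n|]; first exact: l2_cprod_cf.
  apply: (@squeeze_cvgr _ _ _ _ (fun=> 0) (fun n => nn (cf (trunc n v) - v))).
  - apply: nearW => n; rewrite -cprodBr.
    have ld : l2 (cf (trunc n v) - v) by apply: l2B => //; exact: l2_cf.
    have [l1 l2'] := M _ ld; rewrite mul1r in l2'.
    by rewrite l2' andbT nn_ge0.
  - exact: cvg_cst.
  - exact: nn_trunc_cvg.
have e : (fun n => nn (cprod a (cf (trunc n v)))) = (fun n => nn (cf (trunc n v))).
  by apply/funext => n; exact: iso.
by rewrite e in c2; exact: (cvg_unique _ c2 c1).
Qed.

(** Chooses d so that the two error terms met in [l2_factorization] add up to e exactly. *)
Lemma eps_split (e x y : R) : 0 < e -> 0 < x -> 0 <= y ->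
  exists2 d, 0 < d & 2 * d + 2 * (d / x * y) = e.
Proof.
move=> e0 x0 y0; have l0 : 0 < 2 + 2 * (y / x).
  by rewrite ltr_pwDl// mulr_ge0// divr_ge0// ltW.
have z : x * 2 + 2 * y != 0 by rewrite gt_eqF// ltr_pwDl ?mulr_gt0// mulr_ge0.
exists (e / (2 + 2 * (y / x))); first exact: divr_gt0.
by field; rewrite (gt_eqF x0) ?andbT; lra.
Qed.

Section factorization.
Variables (A : sq) (M : R).
Hypotheses (lA : l2 A) (A0 : A <> 0)
  (AM : forall p, nn (cprod A (cf p)) <= M ^+ 2 * nn (cf p)).

(** [q] is nonzero because it agrees with [A] at the first index where [A] does not vanish: shifted
    multiples of [A] are zero there. The last identity holds because A - q is a limit of shifted
    multiples, all orthogonal to [q]. *)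
Let extremal : exists q : sq, [/\ l2 q, 0 < nn q,
  forall e : R, 0 < e -> exists p, nn (cprod A (cf p) - q) <= e,
  forall p, ip q (shift (cprod A (cf p))) = 0 & ip A q = nn q].
Proof.
pose S := [set shift (cprod A (cf p)) | p in [set: {poly C}]].
have Sl2 u : S u -> l2 u by move=> [p _ <-]; exact/l2_shift/l2_cprod_cf.
have [||s [q [Ss lq sq' orth]]] := projection lA Sl2.
- by exists 0 => //; rewrite cf0 cprod0; apply/funext => -[].
- move=> _ _ k [p _ <-] [r _ <-]; exists (p + k *: r) => //.
  rewrite -cprod_shift mulrDl cfD cprodDr cprod_shift -scalerAl cfZ cprodZr cprod_shift.
  by [].
have approx e : 0 < e -> exists p, nn (cprod A (cf p) - q) <= e /\ exists r, p = 1 - r * 'X.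
  move=> e0; have /cvgrPdist_lt/(_ _ e0)[N _ hN] := sq'.
  have [r _ rs] := Ss N; exists (1 - r * 'X); split; last by exists r.
  have := hN N (leqnn N); rewrite /= sub0r normrN => h.
  rewrite cfB cprodBr cprod1 cprod_shift rs ltW// (le_lt_trans (ler_norm _))//.
have exk : exists m : nat, A m != 0.
  apply: contrapT => h; apply: A0; apply/funext => m; apply/eqP.
  by apply: contrapT => /negP hm; apply: h; exists m.
pose k := ex_minn exk.
have [Ak Amin] : A k != 0 /\ forall i, (i < k)%N -> A i = 0.
  rewrite /k; case: ex_minnP => m Am mmin; split => // i im.
  by apply/eqP; apply: contraT => /mmin; rewrite leqNgt im.
have qk : q k = A k.
  apply/eqP; rewrite -subr_eq0 -rnorm_eq0 eq_le rnorm_ge0 andbT.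
  apply/ler_addgt0Pr => e e0; rewrite add0r.
  have [p [hp [r pr]]] := approx _ (exprn_gt0 2 e0).
  rewrite -(@ler_pXn2r _ 2) ?nnegrE ?rnorm_ge0 ?(ltW e0)// (le_trans _ hp)//.
  have ld : l2 (cprod A (cf p) - q) by apply: l2B => //; exact: l2_cprod_cf.
  apply: le_trans (coef_nn k ld); rewrite sqB rnorm_distC.
  have -> : cprod A (cf p) k = A k; last by [].
  rewrite pr cfB cprodBr cprod1 cprod_shift sqB; case: (k) Amin => [|m] Amin /=.
    by rewrite subr0.
  rewrite (_ : cprod A (cf r) m = 0) ?subr0// /cprod big1// => i _.
  by rewrite Amin ?mul0r// ltn_ord.
have q0 : 0 < nn q.
  rewrite lt_neqAle nn_ge0// andbT eq_sym; apply/eqP => /(nn_eq0 lq) qq.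
  by move: Ak; rewrite -qk qq sq0 eqxx.
exists q; split => //.
- by move=> e /approx[p [hp _]]; exists p.
- by move=> p; apply: orth; exists p.
have c := orth_lim lq lq (fun n => l2B lA (Sl2 _ (Ss n))) sq'.
have e : (fun n => ip (A - s n) q) = (fun=> ip A q).
  apply/funext => n; rewrite ipBl//; last exact: Sl2 (Ss n).
  by rewrite (ipC (s n)) orth// subr0.
by rewrite e in c; apply: (cvg_unique _ (cvg_cst _) c).
Qed.

Lemma l2_factorization : exists phi h : sq, [/\ l2 phi, l2 h, cprod phi h = A,
  forall v, l2 v -> l2 (cprod phi v) /\ nn (cprod phi v) = nn v &
  (forall p, nn (cprod h (cf p)) <= M ^+ 2 * nn (cf p)) /\
  forall e : R, 0 < e -> exists p, nn (cf 1 - cprod h (cf p)) <= e].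
Proof.
have [q [lq q0 approx orth Aq]] := extremal.
(* [q] is a limit of multiples A r, and orthogonality of [q] to the shifts of A r p passes to the
   limit. *)
have orthq p : ip q (shift (cprod q (cf p))) = 0.
  have lqp := l2_cprod_cf p lq.
  have [K K0 hK] := cprod_cf_bound p.
  have small e : 0 < e -> ip q (shift (cprod q (cf p))) ^+ 2 <= nn q * (K * e).
    move=> /approx[r hr]; have lr := l2_cprod_cf r lA.
    have lrp := l2_cprod_cf p lr.
    have -> : ip q (shift (cprod q (cf p))) = - ip q (shift (cprod (cprod A (cf r) - q) (cf p))).
      rewrite cprodBl shiftB ipBr//; [|exact: l2_shift..].
      by rewrite -cprodA -cfM orth sub0r opprK.
    have ld : l2 (cprod A (cf r) - q) by exact: l2B.
    have ldp := l2_cprod_cf p ld.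
    rewrite sqrrN (le_trans (cauchy_schwarz lq (l2_shift ldp)))// nn_shift//.
    by rewrite ler_wpM2l ?(ltW q0)// (le_trans (hK _ ld))// ler_wpM2l.
  apply/eqP; rewrite -sqrf_eq0 eq_le sqr_ge0 andbT.
  apply/ler_addgt0Pr => e e0; rewrite add0r.
  have K1 : 0 < nn q * (K + 1) by rewrite mulr_gt0// ltr_wpDl.
  apply: le_trans (small (e / (nn q * (K + 1))) (divr_gt0 e0 K1)) _.
  rewrite mulrA mulrC -mulrA ler_piMr ?(ltW e0)// mulrC ler_pdivrMr// mul1r.
  by rewrite ler_wpM2l ?(ltW q0)// lerDl.
pose s : R := Num.sqrt (nn q).
have s0 : 0 < s by rewrite sqrtr_gt0.
have s2 : s ^+ 2 = nn q by rewrite sqr_sqrtr// ltW.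
pose k : C := toC s^-1.
have k2 : rnorm k ^+ 2 = (nn q)^-1.
  by rewrite rnorm_toC real_normK ?num_real// exprVn s2.
(* Horner induction: z q p and c q are orthogonal by [orthq], so squared norms add just as those of
   the coefficients do. *)
have isoq p : nn (cprod q (cf p)) = nn q * nn (cf p).
  elim/poly_ind: p => [|p c IH].
    rewrite cf0 cprod0 (_ : nn 0 = 0) ?mulr0//; apply: ip_uniq.
    rewrite (_ : ipn _ _ = fun=> 0); first exact: cvg_cst.
    by apply/funext => N; rewrite /ipn big1// => i _; rewrite sq0 mul0r.
  have lqp := l2_cprod_cf p lq.
  rewrite cprod_split nn_cf_split nnD; [|exact: l2_shift|exact: l2Z].
  rewrite nn_shift// IH nnZ// ipC ipJ -shiftZ -cprodZr -cfZ orthq; ring.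
pose phi := k *: q.
have lphi : l2 phi by exact: l2Z.
have isop p : nn (cprod phi (cf p)) = nn (cf p).
  rewrite cprodZl nnZ; last exact: l2_cprod_cf.
  by rewrite k2 isoq mulrA mulVf ?mul1r// gt_eqF.
have iso := isometry_l2 lphi isop.
(* A good g lies in the closure of the multiples of [A] and is orthogonal to the multiples of [phi].
   Showing that such g vanishes puts [A] in the closure of the multiples of [phi]. *)
pose good g := [/\ l2 g, forall e : R, 0 < e -> exists p, nn (cprod A (cf p) - g) <= e &
  forall p, ip g (cprod phi (cf p)) = 0].
(* When A (p z + c) approximates g, the constant c is detected by pairing with [q]: both g and z A p
   are orthogonal to [q], while [A] pairs with it to |q|^2. *)
have bnd g : good g -> forall e : R, 0 < e -> exists (p : {poly C}) (c : C),
    [/\ nn (cprod A (cf (p * 'X + c%:P)) - g) <= e & rnorm c ^+ 2 <= e / nn q].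
  move=> [lg appr og] e /appr[r hr]; have [p [c rpc]] := poly_split r; exists p, c.
  rewrite -rpc; split => //; rewrite ler_pdivlMr//.
  have lr := l2_cprod_cf r lA; have lp := l2_cprod_cf p lA.
  have ld : l2 (cprod A (cf r) - g) by exact: l2B.
  have e1 : ip (cprod A (cf r) - g) (c *: q) = rnorm c ^+ 2 * nn q.
    rewrite ipBl//; last exact: l2Z.
    have -> : ip g (c *: q) = 0.
      have := og (c * k^-1)%:P; rewrite cfP cprodZr cprod1 /phi scalerA divfK//.
      by rewrite toC_eq0 invr_neq0// gt_eqF.
    rewrite rpc cprod_split ipDl; [|exact: l2_shift|exact: l2Z|exact: l2Z].
    rewrite subr0 (_ : ip (shift _) _ = 0).
      rewrite add0r -Aq -ipZl//.
        by apply: ip_ext => i; rewrite rnorm_sq !sqE !cE; ring.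
    by rewrite ipC ipJ -shiftZ -cprodZr -cfZ orth.
  have := cauchy_schwarz ld (l2Z c lq); rewrite e1 nnZ//.
  have [->|c0] := eqVneq c 0; first by rewrite rnorm0 expr0n/= mul0r (le_trans _ hr)// nn_ge0.
  have cp : 0 < rnorm c ^+ 2 * nn q by rewrite mulr_gt0// exprn_gt0// rnorm_gt0.
  by rewrite expr2 ler_pM2r// => /le_trans; exact.
have good0 g : good g -> g 0%N = 0.
  move=> gg; have [lg appr og] := gg.
  apply/eqP; rewrite -rnorm_eq0 -sqrf_eq0 eq_le sqr_ge0 andbT.
  apply/ler_addgt0Pr => e e0; rewrite add0r.
  have [d d0 <-] := eps_split e0 q0 (exprn_ge0 2 (rnorm_ge0 (A 0%N))).
  have [p [c [h1 h2]]] := bnd g gg _ d0.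
  have lpc := l2_cprod_cf (p * 'X + c%:P) lA.
  have h3 := le_trans (coef_nn 0%N (l2B lpc lg)) h1.
  rewrite sqB cprod_split sqD sqZ /= add0r in h3.
  have -> : g 0%N = - (c * A 0%N - g 0%N) + c * A 0%N by ring.
  rewrite (le_trans (rnorm2D_le _ _))// rnormN rnormM exprMn.
  by rewrite lerD// ler_wpM2l// ler_wpM2r// exprn_ge0// rnorm_ge0.
(* Since g(0) = 0, g is a shift z g'. The constants c in its approximants are small, so dropping
   them shows that g' is good too, and induction kills every entry. *)
have key N : forall g, good g -> g N = 0.
  elim: N => [|N IH] g gg; first exact: good0.
  have [lg appr og] := gg; have g0 := good0 _ gg.
  pose g' : sq := fun i => g i.+1.
  have gs : g = shift g' by apply/funext => -[].
  have lg' : l2 g' by apply: l2_unshift; rewrite -gs.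
  apply: (IH g'); split => // [e e0|p].
    have [d d0 <-] := eps_split e0 q0 (nn_ge0 lA).
    have [p [c [h1 h2]]] := bnd g gg _ d0.
    exists p; have lp := l2_cprod_cf p lA.
    have lpc := l2_cprod_cf (p * 'X + c%:P) lA.
    rewrite -nn_shift; last exact: l2B.
    have -> : shift (cprod A (cf p) - g') = (cprod A (cf (p * 'X + c%:P)) - g) - c *: A.
      by rewrite shiftB -gs cprod_split addrAC addrK.
    rewrite (le_trans (nnD_le (l2B lpc lg) (l2N (l2Z c lA))))// nnN nnZ//.
    by rewrite lerD// ler_wpM2l// ler_wpM2r// nn_ge0.
  rewrite -ip_shift//; last exact: l2_cprod_cf.
  by rewrite -gs -cprod_shift og.
have dense e : 0 < e -> exists p, nn (A - cprod phi (cf p)) <= e.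
  pose S := [set cprod phi (cf p) | p in [set: {poly C}]].
  have Sl2 u : S u -> l2 u by move=> [p _ <-]; exact: l2_cprod_cf.
  have [||t [g [St lg tg og]]] := projection lA Sl2.
  - by exists 0 => //; rewrite cf0 cprod0.
  - move=> _ _ c [p _ <-] [r _ <-]; exists (p + c *: r) => //.
    by rewrite cfD cprodDr cfZ cprodZr.
  suff g0 : g = 0.
    move=> e0; have /cvgrPdist_lt/(_ _ e0)[N _ hN] := tg.
    have [r _ rs] := St N; exists r.
    have := hN N (leqnn N); rewrite /= sub0r normrN g0 subr0 -rs => h.
    by rewrite ltW// (le_lt_trans (ler_norm _)).
  apply/funext => N; apply: key; split => // [{}e e0|p]; last by apply: og; exists p.
  have /cvgrPdist_lt/(_ _ (divr_gt0 e0 (ltr0n R 4)))[n _ hn] := tg.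
  have [r _ rs] := St n.
  have := hn n (leqnn n); rewrite /= sub0r normrN -rs => /(le_lt_trans (ler_norm _)) h.
  have [K K0 hK] := cprod_cf_bound (k *: r).
  have K1 : 0 < 4 * (K + 1) by rewrite mulr_gt0// ltr_wpDl.
  have [p hp] := approx _ (divr_gt0 e0 K1).
  (* phi r equals q (k r) and [q] is close to A p, so A - phi r is close to the multiple A (1 - p k
     r). *)
  exists (1 - p * (k *: r)).
  have lp := l2_cprod_cf p lA; have ld : l2 (cprod A (cf p) - q) by exact: l2B.
  have lr := l2_cprod_cf r lphi.
  have -> : cprod A (cf (1 - p * (k *: r))) - g =
     (A - cprod phi (cf r) - g) - cprod (cprod A (cf p) - q) (cf (k *: r)).
    rewrite cfB cprodBr cprod1 cfM cprodA cprodBl.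
    have -> : cprod phi (cf r) = cprod q (cf (k *: r)) by rewrite cprodZl cfZ cprodZr.
    by apply/funext => i; rewrite !sqE; ring.
  have ldk := l2_cprod_cf (k *: r) ld.
  rewrite (le_trans (nnD_le (l2B (l2B lA lr) lg) (l2N ldk)))// nnN.
  have -> : e = 2 * (e / 4) + 2 * (e / 4) by field.
  rewrite lerD// ler_wpM2l// ?(ltW h)// (le_trans (hK _ ld))//.
  rewrite (le_trans (ler_wpM2l K0 hp))//.
  rewrite mulrA ler_pdivrMr// (_ : _ * (4 * _) = (K + 1) * e); last by field.
  by rewrite ler_wpM2r ?(ltW e0)// lerDl.
have ext n : exists p, nn (A - cprod phi (cf p)) <= (n.+1%:R^-1 : R).
  by apply: dense; rewrite invr_gt0.
(* phi (t n) converges to [A]; since [phi] acts isometrically the polynomials [t n] form a Cauchy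
   sequence, and their limit is the factor [h]. *)
have [t ht] := choice ext.
have lt n := l2_cprod_cf (t n) lphi.
have cauchy n m : (n <= m)%N -> nn (cf (t m) - cf (t n)) <= 4 * (n.+1%:R^-1 : R).
  move=> nm; have ld : l2 (cf (t m) - cf (t n)) by apply: l2B; exact: l2_cf.
  rewrite -(iso _ ld).2 cprodBr.
  have -> : cprod phi (cf (t m)) - cprod phi (cf (t n)) =
    (A - cprod phi (cf (t n))) - (A - cprod phi (cf (t m))).
    by apply/funext => i; rewrite !sqE; ring.
  rewrite (le_trans (nnD_le (l2B lA (lt n)) (l2N (l2B lA (lt m)))))// nnN.
  have mn : (m.+1%:R^-1 : R) <= n.+1%:R^-1 by rewrite lef_pV2 ?posrE// ler_nat.
  have := ht n; have := ht m; move: mn.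
  move: (nn _) (nn _) (m.+1%:R^-1) (n.+1%:R^-1) => *; lra.
have v0 : 4 * (n.+1%:R^-1 : R) @[n --> \oo] --> 0.
  rewrite -(mulr0 4); apply: cvgM; [exact: cvg_cst|exact: cvg_harmonic].
have [h lh hh] := l2_complete (fun n => l2_cf (t n)) cauchy v0.
have [lph _] := iso _ lh.
have Ah : cprod phi h = A.
  apply/eqP; rewrite -subr_eq0; apply/eqP; apply: nn_eq0; first exact: l2B.
  apply/eqP; rewrite eq_le nn_ge0 ?andbT//; last exact: l2B.
  have c : 10 * (n.+1%:R^-1 : R) @[n --> \oo] --> 0.
    rewrite -(mulr0 10); apply: cvgM; [exact: cvg_cst|exact: cvg_harmonic].
  rewrite -(cvg_lim _ c)//; apply: limr_ge; first exact: (cvgP _ c).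
  apply: nearW => n.
  have ld : l2 (h - cf (t n)) by apply: l2B => //; exact: l2_cf.
  have -> : cprod phi h - A = cprod phi (h - cf (t n)) - (A - cprod phi (cf (t n))).
    by rewrite cprodBr; apply/funext => i; rewrite !sqE; ring.
  rewrite (le_trans (nnD_le (iso _ ld).1 (l2N (l2B lA (lt n)))))// nnN (iso _ ld).2.
  have := hh n; have := ht n.
  move: (nn _) (nn _) (n.+1%:R^-1) => *; lra.
exists phi, h; split => //; split=> [p|e e0].
  have lhp := l2_cprod_cf p lh.
  by rewrite -(iso _ lhp).2 cprodA Ah.
(* Applying the isometry [phi] turns 1 - h (k p) into k (q - A p), whose squared norm carries the
   factor |k|^2 = 1/|q|^2; the tolerance is scaled accordingly. *)
have [p hp] := approx _ (mulr_gt0 e0 q0).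
exists (k *: p); have lhp := l2_cprod_cf (k *: p) lh.
have ld : l2 (cf 1 - cprod h (cf (k *: p))) by apply: l2B => //; exact: l2_cf.
rewrite -(iso _ ld).2 cprodBr cprod1 cprodA Ah cfZ cprodZr /phi -scalerBr nnZ.
  by rewrite k2 nn_distC mulrC ler_pdivrMr.
by apply: l2B => //; exact: l2_cprod_cf.
Qed.

End factorization.
End convolution.

(** * Multipliers, outer functions and factorization of bounded functions *)

Section outer_functions.
Variable R : realType.
Local Notation C := (Cplx R).
Local Notation sq := (nat -> C).
Implicit Types (f g : C -> C) (a b : sq) (z : C) (p q : {poly C}).

Lemma l2_bound a (K : R) : 0 <= K -> l2 a -> nn a <= K ^+ 2 -> forall n, rnorm (a n) <= K.
Proof.
move=> K0 la aK n; rewrite -(@ler_pXn2r _ 2) ?nnegrE ?rnorm_ge0//.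
exact: le_trans (coef_nn n la) aK.
Qed.

Lemma l2_bounded a : l2 a -> exists M : R, forall n, rnorm (a n) <= M.
Proof.
move=> la; exists (Num.sqrt (nn a)); apply: (l2_bound (sqrtr_ge0 _) la).
by rewrite sqr_sqrtr ?nn_ge0.
Qed.

Lemma pser_l2_analytic a : l2 a -> analytic_on_disc (pser a).
Proof. by move=> /l2_bounded[M aM]; apply: (pser_analytic aM). Qed.

Lemma tcoef_pser_l2 a : l2 a -> tcoef (pser a) = a.
Proof. by move=> /l2_bounded[M aM]; apply/funext => n; apply: (tcoef_pser n aM). Qed.

Lemma tcoef_mul f g : analytic_on_disc f -> analytic_on_disc g ->
  tcoef (fun z => f z * g z) = cprod (tcoef f) (tcoef g).
Proof. by move=> af ag; apply/funext => n; rewrite (tcoefM n af ag). Qed.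

Lemma pser_cprod a b z : l2 a -> l2 b -> l2 (cprod a b) -> rnorm z < 1 ->
  pser (cprod a b) z = pser a z * pser b z.
Proof.
move=> la lb lab z1.
have aa := pser_l2_analytic la; have ab := pser_l2_analytic lb.
apply: (tcoef_inj (pser_l2_analytic lab) (analyticM aa ab)) => // n.
by rewrite (tcoef_mul aa ab) !tcoef_pser_l2.
Qed.

Lemma pser_tcoef f z : analytic_on_disc f -> l2 (tcoef f) -> rnorm z < 1 ->
  pser (tcoef f) z = f z.
Proof.
move=> af lf z1; apply: (tcoef_inj (pser_l2_analytic lf) af) => // n.
by rewrite tcoef_pser_l2.
Qed.

Lemma power_le (x K c : R) : 0 <= x -> 0 <= K ->
  (forall n, x ^+ n <= c * K ^+ n) -> x <= K.
Proof.
move=> x0 K0 h; rewrite leNgt; apply/negP => Kx.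
have xp : 0 < x by exact: le_lt_trans Kx.
have q0 : 0 <= K / x by rewrite divr_ge0.
have q1 : K / x < 1 by rewrite ltr_pdivrMr// mul1r.
have [N hN] := geo_small c q0 q1 ltr01.
have := hN N (leqnn N); rewrite expr_div_n mulrA ltr_pdivrMr ?exprn_gt0// mul1r.
by rewrite ltNge h.
Qed.

(* The powers a^n of a multiplier of norm K have l2 norm at most K^n, so
   |f(z)|^n <= K^n / (1 - |z|) for every n. *)
Lemma multiplier_bound a (K : R) z : 0 <= K -> l2 a ->
  (forall p, nn (cprod a (cf p)) <= K ^+ 2 * nn (cf p)) -> rnorm z < 1 ->
  rnorm (pser a z) <= K.
Proof.
move=> K0 la aK z1.
have mul := multiplier_l2 (exprn_ge0 2 K0) la aK.
pose pw n := iter n (cprod a) (cf 1).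
have pwP n : [/\ l2 (pw n), nn (pw n) <= (K ^+ n) ^+ 2 & pser (pw n) z = pser a z ^+ n].
  elim: n => [|n [ln nnn en]] /=.
    split; [exact: l2_cf|by rewrite nn_cf1 !expr0 expr1n|].
    rewrite expr0; transitivity (psum (cf 1) z 1).
      rewrite -(pser_trunc _ _ z1); congr (pser _ z); apply/funext => -[|i] //=.
      by rewrite /cf coef1.
    by rewrite psumS psum0 /cf coef1 expr0 mulr1 add0r.
  have [l1 n1] := mul _ ln; split => //.
    by rewrite (le_trans n1)// [K ^+ n.+1]exprS exprMn ler_wpM2l// exprn_ge0.
  by rewrite pser_cprod// en exprS.
apply: (@power_le _ _ (1 / (1 - rnorm z))) => // [|n]; first exact: rnorm_ge0.
have [ln nnn en] := pwP n.
have := pser_bound 0 (l2_bound (exprn_ge0 n K0) ln nnn) z1.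
by rewrite psum0 subr0 en rnormX expr0 mulr1 mul1r mulrC.
Qed.

Lemma horner_psum p z : p.[z] = psum (cf p) z (size p).
Proof. by rewrite horner_coef. Qed.

Lemma horner_analytic p : analytic_on_disc (horner p).
Proof.
apply: (@analytic_eq R (fun z => psum (cf p) z (size p)) (horner p)).
  by move=> z _; rewrite horner_psum.
exact: psum_analytic.
Qed.
Arguments horner_analytic : clear implicits.

Lemma tcoef_horner p : tcoef (horner p) = cf p.
Proof.
have -> : horner p = (fun z => psum (cf p) z (size p)).
  by apply/funext => z; rewrite horner_psum.
apply/funext => n; rewrite tcoef_psum; case: ltnP => // pn.
by rewrite /cf nth_default.
Qed.

Lemma rmean_mono (u v : R -> R) : rcts 0 (2 * pi) u -> rcts 0 (2 * pi) v ->
  (forall t, u t <= v t) -> rmean u <= rmean v.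
Proof.
move=> cu cv uv; rewrite /rmean ler_wpM2l ?invr_ge0 ?(ltW (twopi_gt0 R))//.
by apply: le_rint => //; exact: rcts_rintble.
Qed.

Lemma rmeanZ (k : R) (u : R -> R) : rcts 0 (2 * pi) u -> rmean (fun t => k * u t) = k * rmean u.
Proof. by move=> /rcts_rintble cu; rewrite /rmean (rintZ k cu) mulrCA. Qed.

Lemma rmean_mul_le f g (M r : R) : analytic_on_disc f -> analytic_on_disc g ->
  (forall z, rnorm z < 1 -> rnorm (f z) <= M) -> 0 <= r < 1 ->
  rmean (fun t => rnorm (f (circ r t) * g (circ r t)) ^+ 2) <=
  M ^+ 2 * rmean (fun t => rnorm (g (circ r t)) ^+ 2).
Proof.
move=> af ag fM /andP[r0 r1].
have c h : analytic_on_disc h -> rcts 0 (2 * pi) (fun t => rnorm (h (circ r t)) ^+ 2).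
  by move=> ah; apply: rnorm2_continuous => // w wr; apply: analytic_continuous; rewrite ?wr.
have cg := c _ ag; rewrite -rmeanZ//; apply: rmean_mono.
- exact: (c _ (analyticM af ag)).
- by move=> t ht; apply: continuousM; [exact: cst_continuous|exact: cg].
- move=> t; rewrite rnormM exprMn ler_wpM2r ?exprn_ge0 ?rnorm_ge0//.
  have fz : rnorm (f (circ r t)) <= M by rewrite fM// rnorm_circ.
  by rewrite lerXn2r ?nnegrE ?rnorm_ge0// (le_trans (rnorm_ge0 _) fz).
Qed.

(** The supremum bound acts pointwise on circles, and Parseval's identity carries it to the
    coefficients. *)
Lemma l2_cprod_bound f g (M : R) : analytic_on_disc f -> analytic_on_disc g ->
  (forall z, rnorm z < 1 -> rnorm (f z) <= M) -> l2 (tcoef g) ->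
  l2le (cprod (tcoef f) (tcoef g)) (M ^+ 2 * nn (tcoef g)).
Proof.
move=> af ag fM lg; rewrite -tcoef_mul//.
apply: (l2le_rmean (analyticM af ag)) => r /andP[r0 r1].
have r01 : 0 <= r < 1 by rewrite (ltW r0).
rewrite (le_trans (rmean_mul_le af ag fM r01))// ler_wpM2l ?sqr_ge0//.
by apply: rmean_le => //; exact: l2le_nn.
Qed.

Lemma bounded_l2 f (M : R) : analytic_on_disc f ->
  (forall z, rnorm z < 1 -> rnorm (f z) <= M) -> l2 (tcoef f).
Proof.
move=> af fM.
have := l2_cprod_bound af (horner_analytic 1) fM.
rewrite tcoef_horner cprod1 => h; exists (M ^+ 2 * nn (cf 1)); apply: h; exact: l2_cf.
Qed.

Lemma bounded_multiplier f (M : R) p : analytic_on_disc f ->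
  (forall z, rnorm z < 1 -> rnorm (f z) <= M) ->
  nn (cprod (tcoef f) (cf p)) <= M ^+ 2 * nn (cf p).
Proof.
move=> af fM; apply: nn_le; rewrite -tcoef_horner.
apply: (l2_cprod_bound af (horner_analytic p) fM).
by rewrite tcoef_horner; exact: l2_cf.
Qed.

Lemma H2_norm_ge0 f : (0 <= H2_norm f)%E.
Proof.
have h := Lnorm_ge0 (@circle_measure R) 2%:E (fun z => (rnorm (f (toC 0 * z)))%:E).
apply: (le_trans h); apply: ereal_sup_ubound; exists 0 => //=.
by rewrite lexx ltr01.
Qed.

Lemma H2P f : H2 f <-> analytic_on_disc f /\ l2 (tcoef f).
Proof.
split=> -[af hf]; split=> //.
  have h0 := H2_norm_ge0 f.
  have hfin : H2_norm f \is a fin_num by rewrite ge0_fin_numE.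
  have k0 : 0 <= fine (H2_norm f) by exact: fine_ge0.
  exists (fine (H2_norm f) ^+ 2); apply/(H2_norm_l2le af k0).
  by rewrite fineK.
have k0 := sqrtr_ge0 (nn (tcoef f)).
apply: (@le_lt_trans _ _ (Num.sqrt (nn (tcoef f)))%:E); last exact: ltry.
by apply/(H2_norm_l2le af k0); rewrite sqr_sqrtr ?nn_ge0//; exact: l2le_nn.
Qed.

Lemma tcoef_sub_mul f g p : analytic_on_disc f -> analytic_on_disc g ->
  tcoef (g - (fun z => p.[z] * f z))%R = tcoef g - cprod (tcoef f) (cf p).
Proof.
move=> af ag; have ap := analyticM (horner_analytic p) af.
transitivity (tcoef (fun z => g z + -1 * (p.[z] * f z))).
  by congr tcoef; apply/funext => z; rewrite mulN1r.
apply/funext => n.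
rewrite (tcoefD n ag (analyticM (@analytic_cst R (-1)) ap)) (tcoefZ (-1) n ap) mulN1r.
by rewrite (tcoef_mul (horner_analytic p) af) tcoef_horner cprodC.
Qed.

(** Only the constant 1 has to be approximated: if f p is close to 1, then f p q is close to q for a
    fixed polynomial q, and truncations q are dense. *)
Lemma outer_criterion (f : Hinf R) :
  (forall e : R, 0 < e -> exists p, nn (cf 1 - cprod (tcoef f) (cf p)) <= e) -> outer f.
Proof.
move=> h; have af := @Hinf_analytic R f.
have lf : l2 (tcoef f).
  apply: (bounded_l2 (M := supnorm (@disc R) f) af) => z /discE z1.
  exact: supnorm_ub (Hinf_bounded f) z1.
apply/seteqP; split=> [g []//|g Hg]; split=> // e e0.
have /H2P[ag lg] := Hg.
pose d := (e / 2) ^+ 2.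
have d0 : 0 < d by rewrite exprn_gt0// divr_gt0.
suff [r hr] : exists r, nn (tcoef g - cprod (tcoef f) (cf r)) <= d.
  exists (fun z => r.[z] * f z); first by exists r.
  apply: (@le_lt_trans _ _ (e / 2)%:E); last by rewrite lte_fin; lra.
  have e2 : 0 <= e / 2 by rewrite divr_ge0// ltW.
  have agr : analytic_on_disc (g - (fun z => r.[z] * f z))%R.
    exact: (analyticB ag (analyticM (horner_analytic r) af)).
  apply/(H2_norm_l2le agr e2); rewrite tcoef_sub_mul//.
  have lr : l2 (tcoef g - cprod (tcoef f) (cf r)) by apply: l2B => //; exact: l2_cprod_cf.
  by move=> n; apply: le_trans (l2le_nn lr n) hr.
clearbody d.
have d4 : 0 < d / 4 by rewrite divr_gt0.
have /cvgrPdist_lt/(_ _ d4)[N _ hN] := nn_trunc_cvg lg.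
pose q := trunc N (tcoef g).
have hq : nn (tcoef g - cf q) <= d / 4.
  have := hN N (leqnn N); rewrite /= sub0r normrN nn_distC => /(le_lt_trans (ler_norm _)) hlt.
  exact: ltW.
have [K K0 hK] := cprod_cf_bound q.
have K1 : 0 < 4 * (K + 1) by rewrite mulr_gt0// ltr_wpDl.
have [p hp] := h _ (divr_gt0 d0 K1).
exists (p * q).
have lp := l2_cprod_cf p lf; have ld : l2 (cf 1 - cprod (tcoef f) (cf p)).
  by apply: l2B => //; exact: l2_cf.
have -> : tcoef g - cprod (tcoef f) (cf (p * q)) =
    (tcoef g - cf q) + cprod (cf 1 - cprod (tcoef f) (cf p)) (cf q).
  rewrite cprodBl cfM cprodA [cprod (cf 1) _]cprodC cprod1.
  by apply/funext => i; rewrite !sqE; ring.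
have lgq : l2 (tcoef g - cf q) by apply: l2B => //; exact: l2_cf.
rewrite (le_trans (nnD_le lgq (l2_cprod_cf q ld)))//.
have -> : d = 2 * (d / 4) + 2 * (d / 4) by field.
apply: lerD; rewrite ler_wpM2l// (le_trans (hK _ ld))//.
rewrite (le_trans (ler_wpM2l K0 hp))//.
rewrite mulrA ler_pdivrMr// (_ : _ * (4 * _) = (K + 1) * d); last by field.
by rewrite ler_wpM2r ?(ltW d0)// lerDl.
Qed.

Lemma outer_approx (f : Hinf R) (e : R) : outer f -> 0 < e ->
  exists p, l2le (cf 1 - cprod (tcoef f) (cf p)) (e ^+ 2).
Proof.
move=> of0 e0; have H21 : H2 (horner (1 : {poly C})).
  by apply/H2P; split; [exact: horner_analytic|rewrite tcoef_horner; exact: l2_cf].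
have [_ /(_ e e0)[_ [p _ <-] hp]] : H2_closure (shift_span f) (horner (1 : {poly C})).
  by rewrite [H2_closure _]of0.
exists p; rewrite -tcoef_horner -tcoef_sub_mul; [|exact: Hinf_analytic|exact: horner_analytic].
apply/(H2_norm_l2le _ (ltW e0)); last exact: ltW.
exact: (analyticB (horner_analytic 1) (analyticM (horner_analytic p) (@Hinf_analytic R f))).
Qed.

Lemma tcoef_eq f g : (forall z, rnorm z < 1 -> f z = g z) -> tcoef f = tcoef g.
Proof.
move=> fg; apply/funext => n; apply: eq_cmean => t _; rewrite fg// rnorm_circ//.
by rewrite invf_lt1// ltr1n.
Qed.

(** The values off the disc are reset to 0, the normal form of elements of [Hinf]. *)
Lemma Hinf_mk f (M : R) : analytic_on_disc f ->
  (forall z, rnorm z < 1 -> rnorm (f z) <= M) ->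
  exists F : Hinf R, forall z, rnorm z < 1 -> F z = f z.
Proof.
move=> af fM.
have h : (fun z : C => if rnorm z < 1 then f z else 0) \in @Hinf_pred R.
  apply/Hinf_predP; split=> [z z1||].
  - by case: ifPn => // h; case: z1; apply/discE.
  - by apply: analytic_eq af => z ->.
  - by exists M => z /discE z1; rewrite z1; exact: fM.
by exists (MkHinf h) => z z1 /=; rewrite z1.
Qed.

Lemma Hinf_ext (f g : Hinf R) : (forall z, rnorm z < 1 -> f z = g z) -> f = g.
Proof.
move=> fg; apply/val_inj/funext => z /=.
have [Dz|Dz] := pselect (disc z); last by rewrite !Hinf_out.
by apply: fg; apply/discE.
Qed.

Lemma Hinf_le (f : Hinf R) z : rnorm z < 1 -> rnorm (f z) <= rnorm f.
Proof. by move=> /discE z1; exact: supnorm_ub (Hinf_bounded f) z1. Qed.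

Lemma Hinf_l2 (f : Hinf R) : l2 (tcoef f).
Proof. exact: (bounded_l2 (@Hinf_analytic R f) (@Hinf_le f)). Qed.

(** The inner factor is described by |fI| <= 1 and unit l2 norm, which make sense without boundary
    values; [inner_isometric] converts them once radial limits are available. *)
Lemma inner_outer_factorization (f : Hinf R) : f != 0 ->
  exists fI fO : Hinf R, [/\ f = fI * fO, outer fO,
    forall z, rnorm z < 1 -> rnorm (fI z) <= 1 & nn (tcoef fI) = 1].
Proof.
move=> f0; have af := @Hinf_analytic R f; have lf := Hinf_l2 f.
have A0 : tcoef f <> 0.
  move=> h; move/eqP: f0; apply; apply: Hinf_ext => z z1.
  have a0 := @analytic_cst R 0.
  apply: (tcoef_inj af a0) => // n; rewrite h.
  have -> : (fun=> 0 : C) = horner 0 by apply/funext => w; rewrite horner0.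
  by rewrite tcoef_horner cf0.
have fM p := bounded_multiplier p af (@Hinf_le f).
have [phi [h [lphi lh ph iso [hM dens]]]] := l2_factorization lf A0 fM.
have isop p : nn (cprod phi (cf p)) <= 1 ^+ 2 * nn (cf p).
  by rewrite expr1n mul1r (iso _ (l2_cf p)).2.
have [fI fIE] := Hinf_mk (pser_l2_analytic lphi) (fun z => multiplier_bound ler01 lphi isop (z := z)).
have [fO fOE] := Hinf_mk (pser_l2_analytic lh) (fun z => multiplier_bound (rnorm_ge0 _) lh hM (z := z)).
have tI : tcoef fI = phi.
  by rewrite -[RHS](tcoef_pser_l2 lphi); apply: tcoef_eq.
exists fI, fO; split.
- apply: Hinf_ext => z z1; rewrite Hinf_mulE fIE// fOE// -pser_cprod ?ph//.
  by rewrite pser_tcoef.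
- apply: outer_criterion => e e0.
  have -> : tcoef fO = h; last exact: dens.
  by rewrite -[RHS](tcoef_pser_l2 lh); apply: tcoef_eq.
- by move=> z z1; rewrite fIE//; exact: multiplier_bound.
- by rewrite tI -[phi]cprod1 (iso _ (l2_cf 1)).2 nn_cf1.
Qed.

End outer_functions.

(** * The Hahn-Banach theorem and balls meeting an M-ideal *)

Section hahn_banach.
Variables (R : realType) (V : lmodType (Cplx R)).
Implicit Types (p q : V -> R) (x y : V) (s t : R).

Definition sublinear p := (forall x y, p (x + y) <= p x + p y) /\
  (forall t x, 0 < t -> p (toC t *: x) <= t * p x).

Lemma sublinearZ p t x : sublinear p -> 0 < t -> p (toC t *: x) = t * p x.
Proof.
move=> [_ h] t0; apply/eqP; rewrite eq_le h//=.
have := h t^-1 (toC t *: x); rewrite invr_gt0 => /(_ t0).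
rewrite scalerA -toCM mulVf ?gt_eqF// toC1 scale1r.
by rewrite ler_pdivlMl.
Qed.

Lemma sublinear0 p : sublinear p -> p 0 = 0.
Proof.
move=> sp; have := sublinearZ 0 sp (ltr0n R 2); rewrite scaler0; lra.
Qed.

Lemma sublinearZ0 p t x : sublinear p -> 0 <= t -> p (toC t *: x) = t * p x.
Proof.
move=> sp; rewrite le_eqVlt => /predU1P[<-|]; last exact: sublinearZ.
by rewrite toC0 scale0r sublinear0// mul0r.
Qed.

Lemma sublinearN p x : sublinear p -> - p (- x) <= p x.
Proof. by move=> sp; have := sp.1 x (- x); rewrite subrr sublinear0//; lra. Qed.

(* A minimal sublinear functional equals its tilt in every direction y, which
   makes it additive. *)
Definition tilt p y x := inf [set p (x + toC t *: y) - t * p y | t in [set t | 0 <= t]].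

Lemma tilt_has_inf p y x : sublinear p ->
  has_inf [set p (x + toC t *: y) - t * p y | t in [set t | 0 <= t]].
Proof.
move=> sp; split; first by exists (p (x + toC 0 *: y) - 0 * p y); exists 0 => /=.
exists (- p (- x)) => _ [t /= t0 <-].
rewrite -(sublinearZ0 y sp t0).
have := sp.1 (x + toC t *: y) (- x); rewrite addrAC subrr add0r; lra.
Qed.

Lemma tilt_le p y x t : sublinear p -> 0 <= t -> tilt p y x <= p (x + toC t *: y) - t * p y.
Proof. by move=> sp t0; apply: ge_inf; [case: (tilt_has_inf y x sp)|exists t]. Qed.

Lemma tilt_approx p y x e : sublinear p -> 0 < e ->
  exists2 t, 0 <= t & p (x + toC t *: y) - t * p y < tilt p y x + e.
Proof. by move=> sp e0; have [_ [t t0 <-] h] := inf_adherent e0 (tilt_has_inf y x sp); exists t. Qed.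

Lemma tilt_sublinear p y : sublinear p -> sublinear (tilt p y).
Proof.
move=> sp; split=> [x x'|s x s0]; apply/ler_addgt0Pr => e e0.
  have e2 : 0 < e / 2 by rewrite divr_gt0.
  have [t t0 ht] := tilt_approx y x sp e2.
  have [t' t0' ht'] := tilt_approx y x' sp e2.
  apply: (le_trans (tilt_le y (x + x') sp (addr_ge0 t0 t0'))).
  have := sp.1 (x + toC t *: y) (x' + toC t' *: y).
  by rewrite addrACA -scalerDl -toCD; lra.
have [t t0 ht] := tilt_approx y x sp (divr_gt0 e0 s0).
apply: (le_trans (tilt_le y (toC s *: x) sp (mulr_ge0 (ltW s0) t0))).
rewrite toCM -scalerA -scalerDr (sublinearZ _ sp s0) -mulrA -mulrBr.
have -> : s * tilt p y x + e = s * (tilt p y x + e / s) by field; rewrite gt_eqF.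
by rewrite ler_wpM2l ?(ltW s0) ?(ltW ht).
Qed.

Lemma tilt_le_id p y x : sublinear p -> tilt p y x <= p x.
Proof.
move=> sp; apply: (le_trans (tilt_le y x sp (lexx 0))).
by rewrite toC0 scale0r addr0 mul0r subr0.
Qed.

Definition rlinear (psi : V -> R) := (forall x y, psi (x + y) = psi x + psi y) /\
  (forall t x, psi (toC t *: x) = t * psi x).

Lemma minimal_sublinear p : sublinear p ->
  (forall q, sublinear q -> (forall x, q x <= p x) -> q = p) -> rlinear p.
Proof.
move=> sp pmin.
have add x y : p (x + y) = p x + p y.
  apply/eqP; rewrite eq_le sp.1/=.
  have e := pmin _ (tilt_sublinear y sp) (fun x => tilt_le_id y x sp).
  have := tilt_le y x sp ler01; rewrite e toC1 scale1r mul1r; lra.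
have pN x : p (- x) = - p x.
  by have := add x (- x); rewrite subrr sublinear0//; lra.
split=> // t x; have [t0|t0] := leP 0 t; first exact: sublinearZ0.
have := sublinearZ x sp (_ : 0 < - t); rewrite oppr_gt0 => /(_ t0).
by rewrite toCN scaleNr pN; lra.
Qed.

Lemma linear_below p : sublinear p ->
  exists psi, rlinear psi /\ forall x, psi x <= p x.
Proof.
move=> sp.
pose T := {q : V -> R | sublinear q /\ forall x, q x <= p x}.
(* The order is reversed, so that a maximal element is a minimal sublinear functional. *)
pose le (q q' : T) := `[< forall x, sval q' x <= sval q x >].
have T_eq (q q' : T) : sval q = sval q' -> q = q'.
  by case: q q' => [q hq] [q' hq'] /= e; subst q'; congr exist; exact: Prop_irrelevance.
have [||||[q [sq qp]] qmin] := @Zorn T le.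
- by move=> q; apply/asboolP.
- by move=> q1 q2 q3 /asboolP h1 /asboolP h2; apply/asboolP => x; exact: le_trans (h2 x) (h1 x).
- move=> q1 q2 /asboolP h1 /asboolP h2; apply: T_eq; apply/funext => x.
  by apply/eqP; rewrite eq_le h1 h2.
- move=> A totA; have [[q0 A0]|Ae] := pselect (exists q : T, A q); last first.
    have hp : sublinear p /\ forall x, p x <= p x by [].
    by exists (exist _ p hp) => s As; exfalso; apply: Ae; exists s.
  (* A chain is bounded by its pointwise infimum, which is finite because every member stays above
     -p(-x); totality of the chain gives subadditivity. *)
  pose g x := inf [set sval q x | q in A].
  have hi x : has_inf [set sval q x | q in A].
    split; first by exists (sval q0 x); exists q0.
    exists (- p (- x)) => _ [[q [sq qp]] _ <-] /=.
    apply: le_trans (sublinearN x sq); rewrite lerN2; exact: qp.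
  have gle x (q : T) : A q -> g x <= sval q x.
    by move=> Aq; apply: ge_inf; [case: (hi x)|exists q].
  have gap x e : 0 < e -> exists2 q, A q & sval q x < g x + e.
    by move=> e0; have [_ [q Aq <-] h] := inf_adherent e0 (hi x); exists q.
  have sg : sublinear g.
    split=> [x y|t x t0]; apply/ler_addgt0Pr => e e0.
      have e2 : 0 < e / 2 by rewrite divr_gt0.
      have [q1 A1 h1] := gap x _ e2; have [q2 A2 h2] := gap y _ e2.
      have [/asboolP l|/asboolP l] := totA _ _ A1 A2.
        apply: (le_trans (gle _ _ A2)); have := (svalP q2).1.1 x y.
        have := l x; lra.
      apply: (le_trans (gle _ _ A1)); have := (svalP q1).1.1 x y.
      have := l y; lra.
    have [q Aq hq] := gap x _ (divr_gt0 e0 t0).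
    apply: (le_trans (gle _ _ Aq)); apply: (le_trans ((svalP q).1.2 t x t0)).
    have -> : t * g x + e = t * (g x + e / t) by field; rewrite gt_eqF.
    by rewrite ler_wpM2l ?(ltW t0) ?(ltW hq).
  have gp : sublinear g /\ forall x, g x <= p x.
    by split=> // x; apply: le_trans (gle x _ A0) _; exact: (svalP q0).2.
  by exists (exist _ g gp) => q Aq; apply/asboolP => x; exact: gle.
exists q; split=> //; apply: minimal_sublinear => // q' sq' q'q.
have hq' : sublinear q' /\ forall x, q' x <= p x.
  by split=> // x; exact: le_trans (q'q x) (qp x).
by have /(congr1 sval) := qmin (exist _ q' hq') (asboolT q'q).
Qed.

(** A linear functional below the tilt of [p] towards [a] must attain p(a), because the tilt takes
    at -a a value at most -p(a). *)
Lemma hahn_banach p a : sublinear p ->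
  exists psi, [/\ rlinear psi, forall x, psi x <= p x & psi a = p a].
Proof.
move=> sp; have [psi [lpsi hpsi]] := linear_below (tilt_sublinear a sp).
have le x : psi x <= p x := le_trans (hpsi x) (tilt_le_id a x sp).
exists psi; split => //; apply/eqP; rewrite eq_le le/=.
have := le_trans (hpsi (- a)) (tilt_le a (- a) sp ler01).
rewrite toC1 scale1r addNr sublinear0// mul1r.
have := lpsi.2 (-1) a; rewrite toCN toC1 scaleN1r => ->; lra.
Qed.

End hahn_banach.

(** * Complex functionals and their real parts *)

Section dual_functionals.
Variables (R : realType) (X : normedModType (Cplx R)).
Local Notation C := (Cplx R).
Implicit Types (phi : dual X) (x y : X).

Lemma dual_lin phi a x y : phi (a *: x + y) = a * phi x + phi y.
Proof. by have /dual_predP[l _] := dual_funP phi; exact: l. Qed.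

Lemma dualD phi x y : phi (x + y) = phi x + phi y.
Proof. by have := dual_lin phi 1 x y; rewrite scale1r mul1r. Qed.

Lemma dualfun0 phi : phi 0 = 0.
Proof. by have := dualD phi 0 0; rewrite addr0 => h; apply/eqP; rewrite -(inj_eq (addrI (phi 0))) -h addr0. Qed.

Lemma dualZ phi a x : phi (a *: x) = a * phi x.
Proof. by have := dual_lin phi a x 0; rewrite dualfun0 !addr0. Qed.

Lemma dualB phi x y : phi (x - y) = phi x - phi y.
Proof. by rewrite dualD -scaleN1r dualZ mulN1r. Qed.

Lemma dual_sum (I : finType) (F : I -> dual X) x : (\sum_k F k) x = \sum_k F k x.
Proof. exact: (big_morph (fun phi : dual X => phi x) (fun f g => dual_addE f g x) erefl). Qed.

Lemma dual_bounded phi : bounded_on [set x : X | rnorm x <= 1] phi.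
Proof.
have /dual_predP[_ cphi] := dual_funP phi.
have /(cvg_rnormP (V := C) (F := nbhs (0 : X)))/(_ 1 ltr01) := cphi 0.
move=> /nbhs_rnormP[e e0 he].
exists (2 / e) => x /= x1.
have h : rnorm (toC (e / 2) *: x) < e.
  rewrite rnormZ rnorm_toC ger0_norm ?divr_ge0 ?(ltW e0)//.
  rewrite (@le_lt_trans _ _ (e / 2))//; last lra.
  by rewrite ler_piMr// divr_ge0// ltW.
have := he (toC (e / 2) *: x); rewrite sub0r rnormN => /(_ h).
rewrite dualfun0 sub0r rnormN dualZ rnormM rnorm_toC ger0_norm ?divr_ge0 ?(ltW e0)// => h2.
rewrite ler_pdivlMr// mulrC; move: h2; rewrite mulrAC ltr_pdivrMr// mul1r; exact: ltW.
Qed.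

Lemma rnorm_dual phi x : rnorm (phi x) <= rnorm phi * rnorm x.
Proof.
have [->|x0] := eqVneq x 0; first by rewrite dualfun0 !rnorm0 mulr0.
have n0 : 0 < rnorm x by rewrite rnorm_gt0.
have := @supnorm_ub _ _ _ phi (toC (rnorm x)^-1 *: x) (dual_bounded phi).
rewrite /= rnormZ rnorm_toC ger0_norm ?invr_ge0 ?(ltW n0)// mulVf ?gt_eqF// lexx => /(_ isT).
by rewrite dualZ rnormM rnorm_toC ger0_norm ?invr_ge0 ?(ltW n0)// ler_pdivrMl// mulrC.
Qed.

Lemma re_dual phi x : re (phi x) <= rnorm phi * rnorm x.
Proof. by apply: le_trans (ler_norm _) _; apply: le_trans (re_le _) (rnorm_dual _ _). Qed.

Lemma unimodular (w : C) : exists2 k : C, rnorm k = 1 & k * w = toC (rnorm w).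
Proof.
have [->|w0] := eqVneq w 0; first by exists 1; rewrite ?rnorm1// mulr0 rnorm0.
have n0 : rnorm w != 0 by rewrite rnorm_eq0.
have nC : toC (rnorm w) != 0 by rewrite toC_eq0.
exists (toC (rnorm w) / w); last by rewrite divfK.
by rewrite rnormM rnormV rnorm_toC ger0_norm ?rnorm_ge0// divff.
Qed.

Lemma dual_attain phi (e : R) : 0 < e ->
  exists2 x, rnorm x <= 1 & rnorm phi - e < re (phi x).
Proof.
move=> e0.
have hs : has_sup [set rnorm (phi x) | x in [set x : X | rnorm x <= 1]].
  split; first by exists (rnorm (phi 0)); exists 0; rewrite //= rnorm0.
  by have [M hM] := dual_bounded phi; exists M => _ [x hx <-]; exact: hM.
have [_ [x x1 <-] hx] := sup_adherent e0 hs.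
have [k k1 kx] := unimodular (phi x).
exists (k *: x); first by rewrite rnormZ k1 mul1r.
by rewrite dualZ kx.
Qed.

(** The complex functional with real part psi is psi(x) - i psi(i x). *)
Lemma dual_mk (psi : X -> R) (K : R) : rlinear psi -> (forall x, psi x <= K * rnorm x) ->
  exists phi : dual X, forall x, re (phi x) = psi x.
Proof.
move=> [pD pZ] pK.
pose phi x : C := toC (psi x) - imag R * toC (psi (imag R *: x)).
have scl (t : R) (x : X) : phi (toC t *: x) = toC t * phi x.
  have e : imag R *: (toC t *: x) = toC t *: (imag R *: x) by rewrite !scalerA mulrC.
  rewrite /phi e !pZ; apply: cplxP; rewrite !cE; ring.
have add x y : phi (x + y) = phi x + phi y.
  by rewrite /phi scalerDr !pD; apply: cplxP; rewrite !cE; ring.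
have im2 : imag R * imag R = toC (-1) by apply: cplxP; rewrite !cE; ring.
have pI x : phi (imag R *: x) = imag R * phi x.
  by rewrite /phi scalerA im2 pZ; apply: cplxP; rewrite !cE; ring.
have lphi : scalar phi.
  move=> a x y; rewrite add; congr (_ + _); rewrite {1}(cplxE a) scalerDl add -scalerA pI !scl.
  by rewrite [in RHS](cplxE a); ring.
have K0 x : `|psi x| <= `|K| * rnorm x.
  have pN : psi (- x) = - psi x by rewrite -scaleN1r -toC1 -toCN pZ mulN1r.
  have KK : K * rnorm x <= `|K| * rnorm x by rewrite ler_wpM2r ?rnorm_ge0// ler_norm.
  have h1 := le_trans (pK x) KK.
  have h2 := pK (- x); rewrite rnormN pN in h2; have {}h2 := le_trans h2 KK.
  by rewrite ler_norml; apply/andP; split; lra.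
have bnd x : rnorm (phi x) <= 2 * `|K| * rnorm x.
  apply: le_trans (rnormB _ _) _; rewrite rnormM !rnorm_toC rnorm_imag mul1r.
  have := K0 x; have := K0 (imag R *: x); rewrite rnormZ rnorm_imag mul1r; lra.
have cphi : continuous phi.
  move=> x; apply/(cvg_rnormP (V := C) (F := nbhs x)) => e e0.
  have d0 : 0 < e / (2 * `|K| + 1) by rewrite divr_gt0// ltr_wpDl// mulr_ge0.
  apply/nbhs_rnormP; exists (e / (2 * `|K| + 1)) => // y.
  have -> : phi x - phi y = phi (x - y).
    by rewrite -[in RHS]scaleN1r -toC1 -toCN add scl toCN mulN1r.
  rewrite ltr_pdivlMr ?ltr_wpDl ?mulr_ge0// => h; apply: le_lt_trans (bnd _) _.
  have := rnorm_ge0 (x - y); lra.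
have hphi : phi \in @dual_pred R X by apply/dual_predP.
have reE x : re (phi x) = psi x by rewrite /phi !cE; ring.
by exists (Dual hphi) => x; rewrite -reE.
Qed.

End dual_functionals.

(** * Balls meeting an M-ideal *)

Section ball_intersection.
Variables (R : realType) (X : normedModType (Cplx R)) (J : set X).
Local Notation C := (Cplx R).
Hypothesis MJ : M_ideal J.
Variables (K : finType) (a : K -> X) (r : K -> R).
Hypothesis r0 : forall k, 0 < r k.
Implicit Types (x y : X) (u v : K -> X).

Let J0 : J 0. Proof. by case: MJ => -[]. Qed.
Let JD x y : J x -> J y -> J (x + y).
Proof. by case: MJ => -[_ _ h] _ Jx Jy; rewrite -[x]scale1r; exact: h. Qed.
Let JZ k x : J x -> J (k *: x).
Proof. by case: MJ => -[_ _ h] _ Jx; rewrite -[_ *: _]addr0; exact: h. Qed.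

Let fits u := [set t : R | 0 <= t /\ exists2 y, J y & forall k, rnorm (u k - y) <= t * r k].
Let gauge u : R := inf (fits u).

Let gauge_has_inf u : has_inf (fits u).
Proof.
split; last by exists 0 => t [].
exists (\sum_k rnorm (u k) / r k); split.
  by apply: sumr_ge0 => k _; rewrite divr_ge0 ?rnorm_ge0 ?(ltW (r0 k)).
exists 0 => // k; rewrite subr0 -ler_pdivrMr// (bigD1 k)//= lerDl.
by apply: sumr_ge0 => i _; rewrite divr_ge0 ?rnorm_ge0 ?(ltW (r0 i)).
Qed.

Let gauge_le u y (t : R) : J y -> 0 <= t -> (forall k, rnorm (u k - y) <= t * r k) -> gauge u <= t.
Proof. by move=> Jy t0 h; apply: ge_inf; [case: (gauge_has_inf u)|split => //; exists y]. Qed.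

Let gauge_approx u (e : R) : 0 < e -> exists2 y, J y & forall k, rnorm (u k - y) <= (gauge u + e) * r k.
Proof.
move=> e0; have [t [t0 [y Jy hy]] ht] := inf_adherent e0 (gauge_has_inf u).
exists y => // k; apply: le_trans (hy k) _.
by rewrite ler_wpM2r ?(ltW (r0 k)) ?(ltW ht).
Qed.

Let gauge_ge0 u : 0 <= gauge u.
Proof. by apply: lb_le_inf => [|t []//]; case: (gauge_has_inf u). Qed.

Let gauge_sublinear : sublinear gauge.
Proof.
split=> [u v|t u t0]; apply/ler_addgt0Pr => e e0.
  have e2 : 0 < e / 2 by rewrite divr_gt0.
  have [y Jy hy] := gauge_approx u e2; have [y' Jy' hy'] := gauge_approx v e2.
  apply: (gauge_le (JD Jy Jy')) => [|k].
    by have := gauge_ge0 u; have := gauge_ge0 v; lra.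
  have -> : (u + v) k - (y + y') = (u k - y) + (v k - y').
    by rewrite opprD addrACA.
  apply: le_trans (rnormD _ _) _; have := hy k; have := hy' k; move: (r k) => rk; lra.
have [y Jy hy] := gauge_approx u (divr_gt0 e0 t0).
apply: (gauge_le (JZ (toC t) Jy)) => [|k].
  by rewrite addr_ge0 ?mulr_ge0 ?gauge_ge0 ?(ltW t0) ?(ltW e0).
have -> : (toC t *: u) k - toC t *: y = toC t *: (u k - y) by rewrite scalerBr.
rewrite rnormZ rnorm_toC gtr0_norm//.
have -> : (t * gauge u + e) * r k = t * ((gauge u + e / t) * r k) by field; rewrite gt_eqF.
by rewrite ler_wpM2l ?(ltW t0).
Qed.

Let at_coord k x : K -> X := fun i => if i == k then x else 0.

Let at_coordD k x y : at_coord k (x + y) = at_coord k x + at_coord k y.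
Proof. by apply/funext => i; rewrite fctE /at_coord; case: eqP; rewrite ?addr0. Qed.

Let at_coordZ k t x : at_coord k (t *: x) = t *: at_coord k x.
Proof. by apply/funext => i; rewrite fctE /at_coord; case: eqP; rewrite ?scaler0. Qed.

Let coord_sum u : u = \sum_k at_coord k (u k).
Proof.
apply/funext => i; rewrite fct_sumE (bigD1 i)//= /at_coord eqxx big1 ?addr0//.
by move=> k; rewrite eq_sym => /negPf ->.
Qed.

(* The gauge is the quotient of a weighted max-norm on X^K by the diagonal copy
   of J; a functional norming a is a family phi_k with sum in the annihilator
   of J, which the L-projection splits. *)
Lemma ball_intersection (c : X) (j : K -> X) : (forall k, rnorm (a k - c) <= r k) ->
  (forall k, J (j k)) -> (forall k, rnorm (a k - j k) <= r k) ->
  forall e : R, 0 < e -> exists2 y, J y & forall k, rnorm (a k - y) <= r k * (1 + e).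
Proof.
move=> hc Jj hj e e0.
have [psi [lpsi psile psia]] := hahn_banach a gauge_sublinear.
have [psiD psiZ] := lpsi.
have psi0 : psi 0 = 0 by have := psiZ 0 0; rewrite scaler0 mul0r.
have psi_sum u : psi u = \sum_k psi (at_coord k (u k)).
  by rewrite {1}[u]coord_sum (big_morph psi psiD psi0).
have lk k : rlinear (fun x => psi (at_coord k x)).
  by split=> [x y|t x]; rewrite ?at_coordD ?psiD// at_coordZ psiZ.
have bk k x : psi (at_coord k x) <= (r k)^-1 * rnorm x.
  apply: le_trans (psile _) _; apply: (gauge_le J0) => [|i].
    by rewrite mulr_ge0 ?invr_ge0 ?rnorm_ge0 ?(ltW (r0 k)).
  rewrite subr0 /at_coord; case: eqP => [->|_]; first by rewrite mulrAC mulVf ?mul1r ?gt_eqF.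
  by rewrite rnorm0 !mulr_ge0 ?invr_ge0 ?rnorm_ge0 ?(ltW (r0 _)).
have [phi hphi] := choice (fun k => dual_mk (lk k) (bk k)).
have psiE u : psi u = \sum_k re (phi k (u k)).
  by rewrite psi_sum; apply: eq_bigr => k _; rewrite hphi.
have re_sum (F : K -> C) : re (\sum_k F k) = \sum_k re (F k).
  exact: (big_morph (@re R) (@reD R) (@re0 R)).
(* Constant families with value y or -y in [J] have gauge at most 0, so [psi] vanishes on them. *)
have diag0 y : J y -> re ((\sum_k phi k) y) = 0.
  move=> Jy; rewrite dual_sum re_sum -(psiE (fun=> y)).
  have z x : J x -> psi (fun=> x) <= 0.
    by move=> Jx; apply: le_trans (psile _) _; apply: (gauge_le Jx) => // k; rewrite subrr rnorm0 mul0r.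
  have h1 := z _ Jy; have := z _ (JZ (-1) Jy).
  have -> : (fun=> -1 *: y) = toC (-1) *: (fun=> y) :> (K -> X).
    by apply/funext => k; rewrite toCN toC1.
  by rewrite psiZ; lra.
case: (MJ) => _ [P [_ PP rP Pn]].
have Pfix phi0 : annihilator J phi0 -> P phi0 = phi0.
  by rewrite -rP => -[xi _ <-]; rewrite PP.
have Pann phi0 y : J y -> P phi0 y = 0.
  move=> Jy; have : annihilator J (P phi0) by rewrite -rP; exists phi0.
  exact.
have annS : annihilator J (\sum_k phi k).
  move=> y Jy; apply: cplxP; first by rewrite diag0.
  have := diag0 _ (JZ (imag R) Jy); rewrite dualZ !cE; lra.
(* The parts outside the annihilator sum to zero, since [P] fixes the sum of the [phi k]. *)
pose sg k := phi k - P (phi k).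
have sg0 x : \sum_k sg k x = 0.
  rewrite -dual_sum /sg sumrB -linear_sum Pfix// subrr//.
have Pnr k : rnorm (P (phi k)) + rnorm (sg k) = rnorm (phi k).
  by apply: toC_inj; rewrite toCD !rnormE; exact: Pn.
(* [psi] is dominated by the gauge; testing it on nearly norming vectors of length [r k] bounds the
   weighted sum of norms. *)
have sum1 : \sum_k r k * rnorm (phi k) <= 1.
  apply/ler_addgt0Pr => d d0.
  pose S := \sum_k r k + 1.
  have S0 : 0 < S by rewrite /S ltr_wpDl// sumr_ge0// => k _; rewrite ltW.
  have [x hx] := choice (fun k => let: ex_intro2 x h1 h2 := dual_attain (phi k) (divr_gt0 d0 S0) in ex_intro _ x (conj h1 h2)).
  have h : \sum_k r k * (rnorm (phi k) - d / S) <= 1.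
    apply: (@le_trans _ _ (psi (fun k => toC (r k) *: x k))).
      rewrite psiE; apply: ler_sum => k _; rewrite dualZ !cE mul0r subr0.
      by rewrite ler_wpM2l ?(ltW (r0 k)) ?(ltW (hx k).2).
    apply: le_trans (psile _) _; apply: (gauge_le J0) => // k.
    by rewrite subr0 rnormZ rnorm_toC gtr0_norm// mul1r ler_piMr ?(ltW (r0 k)) ?(hx k).1.
  have e1 : \sum_k r k * (rnorm (phi k) - d / S) = \sum_k r k * rnorm (phi k) - (S - 1) * (d / S).
    by rewrite /S addrK mulr_suml -sumrB; apply: eq_bigr => k _; rewrite mulrBr.
  have e2 : (S - 1) * (d / S) = d - d / S by field; rewrite gt_eqF.
  have : 0 <= d / S by rewrite divr_ge0// ltW.
  move: h; rewrite e1 e2; lra.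
(* The annihilator parts do not see [j k], and the remaining parts together do not see [c]. Both
   displacements have norm at most [r k], and the L-decomposition adds the two norms back to that of
   [phi k]. *)
have le1 : gauge a <= 1.
  rewrite -psia psiE; apply: le_trans sum1.
  have -> : \sum_k re (phi k (a k)) = \sum_k (re (P (phi k) (a k - j k)) + re (sg k (a k - c))).
    rewrite big_split/= -[X in _ + X]re_sum.
    have -> : \sum_k sg k (a k - c) = \sum_k sg k (a k).
      rewrite (eq_bigr (fun k => sg k (a k) - sg k c)) => [|k _]; last exact: dualB.
      by rewrite sumrB sg0 subr0.
    rewrite re_sum -big_split/=; apply: eq_bigr => k _.
    rewrite dualB (Pann _ _ (Jj k)) subr0 -reD; congr re.
    transitivity (P (phi k) (a k) + (phi k (a k) - P (phi k) (a k))); last by [].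
    by rewrite addrCA subrr addr0.
  apply: ler_sum => k _; rewrite -Pnr mulrDr; apply: lerD.
    apply: le_trans (re_dual _ _) _; rewrite mulrC ler_wpM2r ?rnorm_ge0//.
  by apply: le_trans (re_dual _ _) _; rewrite mulrC ler_wpM2r ?rnorm_ge0.
have [y Jy hy] := gauge_approx a e0; exists y => // k.
apply: le_trans (hy k) _; rewrite mulrC ler_wpM2l ?(ltW (r0 k))//; lra.
Qed.

End ball_intersection.

(** * Radial limits *)

Section radial_subsequence.
Variable R : realType.
Local Notation C := (Cplx R).
Implicit Types (f g : C -> C) (z : C) (r s t : R).
Local Notation leb := (@lebesgue_measure R).

Lemma tcoef_dilate f r n : analytic_on_disc f -> 0 < r <= 1 ->
  tcoef (fun z => f (toC r * z)) n = tcoef f n * toC (r ^+ n).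
Proof.
move=> af /andP[r0 r1].
have r2 : 0 < r * 2^-1 < 1.
  by rewrite mulr_gt0//= (le_lt_trans (ler_wpM2r _ r1))// mul1r invf_lt1 ?ltr1n.
rewrite (tcoefE n af r2) mulrC /tcoef.
have ci := cI_tcoef n af r2.
rewrite -(cmeanZ _ ci); apply: eq_cmean => t _.
have -> : toC r * circ 2^-1 t = circ (r * 2^-1) t by rewrite /circ toCM mulrA.
rewrite mulrCA; congr (_ * _).
have -> : circ (r * 2^-1) t = toC r * circ 2^-1 t by rewrite /circ toCM mulrA.
have nz : toC r != 0 by rewrite toC_eq0 gt_eqF.
by rewrite [(toC r * _)^-1]invfM [in RHS]exprMn toCX mulrA (exprVn (toC r)) mulfV ?mul1r// expf_neq0.
Qed.

Lemma tcoefB f g n : analytic_on_disc f -> analytic_on_disc g ->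
  tcoef (fun z => f z - g z) n = tcoef f n - tcoef g n.
Proof.
move=> af ag; have -> : (fun z => f z - g z) = (fun z => f z + -1 * g z).
  by apply/funext => z; rewrite mulN1r.
by rewrite (tcoefD n af (analyticM (@analytic_cst R (-1)) ag)) (tcoefZ (-1) n ag) mulN1r.
Qed.

Lemma bernoulli (r : R) n : 0 <= r <= 1 -> 1 - n%:R * (1 - r) <= r ^+ n.
Proof.
move=> /andP[r0 r1]; elim: n => [|n IH]; first by rewrite mul0r subr0 expr0.
have h := ler_wpM2l r0 IH; rewrite exprS; apply: le_trans h.
rewrite -natr1; have := ler0n R n; move: (n%:R) => k k0.
have : 0 <= k * (1 - r) ^+ 2 by rewrite mulr_ge0// sqr_ge0.
rewrite expr2; lra.
Qed.

(** With q = r/r', the function f(w) - f(q w) has coefficients a_n (1 - q^n). Bernoulli's inequality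
    controls the first N of them, and the tail of the squared norm the others. *)
Lemma radial_cauchy f (e : R) : analytic_on_disc f -> l2 (tcoef f) -> 0 < e ->
  exists2 s, s < 1 & forall r r', 0 < r -> s <= r -> r <= r' -> r' < 1 ->
    rmean (fun t => rnorm (f (circ r' t) - f (circ r t)) ^+ 2) <= e.
Proof.
move=> af lf e0; have e2 : 0 < e / 2 by rewrite divr_gt0.
have c := ip_cvg lf lf; have /cvgrPdist_lt/(_ _ e2)[N _ hN] := c.
have {hN} := hN N (leqnn N) => /= hN.
have hN2 : nn (tcoef f) - ipn (tcoef f) (tcoef f) N < e / 2 := le_lt_trans (ler_norm _) hN.
(* The head contributes at most |a|^2 2N (1 - q), and 1 - q <= 1 - r <= (e/2) / A. *)
pose A := nn (tcoef f) * (N * 2)%:R + 1.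
have n0 : 0 <= nn (tcoef f) := nn_ge0 lf.
have A0 : 0 < A by rewrite ltr_wpDl// mulr_ge0// ler0n.
exists (1 - e / 2 / A); first by rewrite ltrBlDr ltrDl divr_gt0.
move=> r r' r0 sr rr r1; have r'0 := lt_le_trans r0 rr.
pose q := r / r'.
have q0 : 0 < q by rewrite divr_gt0.
have q1 : q <= 1 by rewrite ler_pdivrMr// mul1r.
have rq : r <= q by rewrite ler_pdivlMr// ler_piMr ?(ltW r1)// ltW.
have q01 : 0 < q <= 1 by rewrite q0.
have q01' : 0 <= q <= 1 by rewrite (ltW q0).
have afq : analytic_on_disc (fun z => f (toC q * z)).
  apply/analyticP => z z1; apply: (@cdiff_comp _ (fun z => toC q * z) f).
    by apply: cdiffM; [exact: cdiff_cst|exact: cdiff_id].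
  apply: analytic_cdiff => //.
  by rewrite rnormM rnorm_toC gtr0_norm// (le_lt_trans _ z1)// ler_piMl ?rnorm_ge0.
have ag := analyticB af afq.
have tg n : tcoef (fun z => f z - f (toC q * z)) n = tcoef f n * toC (1 - q ^+ n).
  by rewrite (tcoefB n af afq) (tcoef_dilate n af q01) toCB toC1 mulrBr mulr1.
have -> : (fun t => rnorm (f (circ r' t) - f (circ r t)) ^+ 2) =
    (fun t => rnorm ((fun z => f z - f (toC q * z)) (circ r' t)) ^+ 2).
  apply/funext => t; have -> : circ r t = toC q * circ r' t; last by [].
  by rewrite /circ mulrA -toCM /q divfK// gt_eqF.
apply: (rmean_le ag); last by rewrite (ltW r'0).
have qn i : 0 <= q ^+ i <= 1 by rewrite exprn_ge0 ?(ltW q0)//= exprn_ile1// ltW.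
have qN i : (i < N)%N -> 1 - q ^+ i ^+ 2 <= (N * 2)%:R * (1 - q).
  move=> iN; rewrite -exprM; have := bernoulli (i * 2) q01'.
  have : (i * 2)%:R * (1 - q) <= (N * 2)%:R * (1 - q).
    by rewrite ler_wpM2r ?subr_ge0// ler_nat leq_mul2r ltnW.
  lra.
have sq1 i : rnorm (tcoef f i * toC (1 - q ^+ i)) ^+ 2 <= rnorm (tcoef f i) ^+ 2 * (1 - q ^+ i ^+ 2).
  rewrite rnormM rnorm_toC exprMn ler_wpM2l ?exprn_ge0 ?rnorm_ge0//.
  have /andP[h1 h2] := qn i; move: (q ^+ i) h1 h2 => x h1 h2.
  rewrite real_normK ?num_real//; nra.
move=> n; under eq_bigr do rewrite tg.
pose m := maxn n N.
apply: (@le_trans _ _ (\sum_(i < m) rnorm (tcoef f i) ^+ 2 * (1 - q ^+ i ^+ 2))).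
  rewrite (big_ord_widen m (fun i => rnorm (tcoef f i * toC (1 - q ^+ i)) ^+ 2)) ?leq_maxl// big_mkcond/=.
  apply: ler_sum => i _; case: ifP => // _.
  rewrite mulr_ge0 ?exprn_ge0 ?rnorm_ge0// subr_ge0 expr_le1//; first by have /andP[] := qn i.
  by have /andP[] := qn i.
apply: (@le_trans _ _ (\sum_(i < m) (rnorm (tcoef f i) ^+ 2 * ((N * 2)%:R * (1 - q)) +
    (rnorm (tcoef f i) ^+ 2 - if (i < N)%N then rnorm (tcoef f i) ^+ 2 else 0)))).
  apply: ler_sum => i _; case: ltnP => iN.
    by rewrite subrr addr0 ler_wpM2l ?exprn_ge0 ?rnorm_ge0// qN.
  rewrite subr0 mulrBr mulr1 addrC lerD//.
  have h1 : 0 <= rnorm (tcoef f i) ^+ 2 * ((N * 2)%:R * (1 - q)).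
    by rewrite !mulr_ge0 ?ler0n ?subr_ge0 ?exprn_ge0 ?rnorm_ge0.
  by apply: le_trans h1; rewrite oppr_le0 mulr_ge0 ?exprn_ge0 ?rnorm_ge0 ?(ltW q0).
rewrite big_split/= -mulr_suml sumrB.
have -> : \sum_(i < m) (if (i < N)%N then rnorm (tcoef f i) ^+ 2 else 0) = ipn (tcoef f) (tcoef f) N.
  by rewrite -big_mkcond/= ipnn (big_ord_widen m (fun i => rnorm (tcoef f i) ^+ 2)) ?leq_maxr.
have hm := l2le_nn lf m.
have h3 : nn (tcoef f) * ((N * 2)%:R * (1 - q)) <= e / 2.
  have k : 1 - q <= e / 2 / A by lra.
  rewrite mulrA; apply: (@le_trans _ _ (A * (e / 2 / A))).
    by rewrite ler_pM ?mulr_ge0 ?ler0n ?subr_ge0// /A; lra.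
  by rewrite mulrCA divff ?gt_eqF// mulr1.
have h4 : (\sum_(i < m) rnorm (tcoef f i) ^+ 2) * ((N * 2)%:R * (1 - q)) <= nn (tcoef f) * ((N * 2)%:R * (1 - q)).
  by rewrite ler_wpM2r// mulr_ge0 ?ler0n ?subr_ge0.
lra.
Qed.

(** The rate 8^-n leaves room for the weights 4^n of [ae_radial_cvg]. *)
Lemma radial_sequence f : analytic_on_disc f -> l2 (tcoef f) ->
  exists x : nat -> R, [/\ forall n, 0 < x n < 1, x n @[n --> \oo] --> (1 : R) &
    forall n, rmean (fun t => rnorm (f (circ (x n.+1) t) - f (circ (x n) t)) ^+ 2) <= 8^-1 ^+ n].
Proof.
move=> af lf.
have e8 n : 0 < 8^-1 ^+ n :> R by rewrite exprn_gt0// invr_gt0.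
have [s hs] := choice (fun n : nat => let: ex_intro2 s h1 h2 := radial_cauchy af lf (e8 n) in ex_intro _ s (conj h1 h2)).
(* Each maximum has its role: [x n] gives the monotonicity asked by [radial_cauchy], [s n.+1] the
   rate, and 1 - 1/(n+2) convergence to 1. *)
pose x := fix x n := match n with
  | 0 => Num.max (s 0%N) 2^-1
  | n.+1 => Num.max (x n) (Num.max (s n.+1) (1 - n.+2%:R^-1)) end.
have h2 : 2^-1 < 1 :> R by rewrite invf_lt1 ?ltr1n.
have i1 n : 0 < 1 - (1 - n.+2%:R^-1) :> R by rewrite opprB addrC subrK invr_gt0.
have x1 n : x n < 1.
  elim: n => [|n IH] /=; rewrite !gt_max ?IH ?h2 ?(hs _).1//=.
have xs n : s n <= x n by case: n => [|n]; rewrite /= !le_max lexx ?orbT.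
have xx n : x n <= x n.+1 by rewrite /= le_max lexx.
have x0 n : 0 < x n.
  elim: n => [|n IH]; last exact: lt_le_trans (xx n).
  by rewrite /= lt_max invr_gt0 ltr0n orbT.
exists x; split => [n||n].
- by rewrite x0 x1.
- rewrite -(cvg_shiftS x) /=; apply: (@squeeze_cvgr _ _ _ _ (fun n => 1 - n.+2%:R^-1) (fun=> 1)).
  + by apply: nearW => n; rewrite (ltW (x1 n.+1)) andbT /= !le_max lexx !orbT.
  + rewrite -[X in _ --> X]subr0; apply: cvgB; first exact: cvg_cst.
    by rewrite (cvg_shiftS (fun n => n.+1%:R^-1 : R)); exact: cvg_harmonic.
  + exact: cvg_cst.
- exact: (hs n).2.
Qed.

Lemma dyadic_cvg (u : nat -> C) (K : R) : (forall n, rnorm (u n.+1 - u n) <= K * 2^-1 ^+ n) ->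
  exists l : C, u n @[n --> \oo] --> l.
Proof.
move=> h; have K0 : 0 <= K.
  by have := le_trans (rnorm_ge0 _) (h 0%N); rewrite expr0 mulr1.
have step n k : rnorm (u (n + k)%N - u n) <= 2 * K * 2^-1 ^+ n - 2 * K * 2^-1 ^+ (n + k).
  elim: k => [|k IH]; first by rewrite addn0 !subrr rnorm0.
  rewrite addnS; apply: le_trans (rnorm_trian (u (n + k)%N) _ _) _.
  have := h (n + k)%N; rewrite exprS; lra.
have h2 : `|2^-1 : R| < 1 by rewrite ger0_norm ?invr_ge0// invf_lt1 ?ltr1n.
have [||l ul _] := @cplx_cauchy_cvg R u (fun n => 2 * K * 2^-1 ^+ n).
- move=> n m nm; rewrite -(subnKC nm); apply: le_trans (step _ _) _.
  by rewrite gerBl mulr_ge0 ?mulr_ge0 ?exprn_ge0 ?invr_ge0.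
- by apply: cvg_geo0; [rewrite invr_ge0|rewrite invf_lt1 ?ltr1n].
by exists l.
Qed.

Lemma circle_continuous f r : analytic_on_disc f -> 0 <= r < 1 ->
  continuous (fun t => f (circ r t)).
Proof.
move=> af /andP[r0 r1] t; apply: (@continuous_comp _ _ _ (circ r) f).
  exact: circ_continuous.
by apply: analytic_continuous => //; rewrite rnorm_circ.
Qed.

(** The sum over n of 4^n times the squared n-th difference has finite integral, hence is finite
    almost everywhere; there the differences are O(2^-n). *)
Lemma ae_radial_cvg f (x : nat -> R) : analytic_on_disc f -> (forall n, 0 < x n < 1) ->
  (forall n, rmean (fun t => rnorm (f (circ (x n.+1) t) - f (circ (x n) t)) ^+ 2) <= 8^-1 ^+ n) ->
  {ae leb, forall t, 0 <= t <= 2 * pi -> exists l : C, f (circ (x n) t) @[n --> \oo] --> l}.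
Proof.
move=> af x01 hx.
pose d n t := rnorm (f (circ (x n.+1) t) - f (circ (x n) t)) ^+ 2.
have cx n : continuous (fun t => f (circ (x n) t)).
  by apply: circle_continuous => //; have /andP[h1 h2] := x01 n; rewrite (ltW h1).
have cd n : continuous (d n).
  move=> t; have c1 : {for t, continuous (fun t => rnorm (f (circ (x n.+1) t) - f (circ (x n) t)))}.
    apply: (@continuous_comp _ _ _ (fun t => f (circ (x n.+1) t) - f (circ (x n) t)) (@rnorm R C)).
      by apply: (@continuousB _ C); exact: cx.
    exact: rnorm_continuous.
  exact: (continuousM c1 c1).
have d0 n t : 0 <= d n t by exact: sqr_ge0.
have cg n (t : R) : {for t, continuous (fun t : R => 4 ^+ n * d n t)}.
  by apply: continuousM; [exact: cst_continuous|exact: cd].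
pose g n t := (4 ^+ n * d n t)%:E.
have mI : measurable (`[0, 2 * pi]%classic : set (measurableTypeR R)) by [].
have gint n : (\int[leb]_(t in `[0%R, (2 * pi)%R]) g n t <= (2 * pi * 2^-1 ^+ n)%:E)%E.
  have ig : rintble 0 (2 * pi) (fun t => 4 ^+ n * d n t).
    by apply: rcts_rintble => t _; exact: cg.
  have -> : (\int[leb]_(t in `[0%R, (2 * pi)%R]) g n t)%E = (rint 0 (2 * pi) (fun t => 4 ^+ n * d n t))%:E.
    by rewrite /rint /Rintegral fineK//; exact: integrable_fin_num.
  rewrite lee_fin rintZ; last by apply: rcts_rintble => t _; exact: cd.
  have := hx n; rewrite /rmean ler_pdivrMl ?twopi_gt0// => h.
  apply: le_trans (ler_wpM2l (exprn_ge0 n (ler0n R 4)) h) _.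
  by rewrite mulrCA -exprMn (_ : 4 * 8^-1 = 2^-1)//; field.
have mg n : measurable_fun (`[0, 2 * pi]%classic : set (measurableTypeR R)) (g n).
  apply/measurable_realfun.measurable_EFinP; apply: measurable_funTS.
  exact: measurable_realfun.continuous_measurable_fun (cg n).
have g0 n t : (`[0, 2 * pi]%classic : set R) t -> (0 <= g n t)%E.
  by move=> _; rewrite lee_fin mulr_ge0// exprn_ge0.
have iG : leb.-integrable `[0, 2 * pi] (fun t => \sum_(0 <= n <oo) g n t)%E.
  apply/integrableP; split.
    by apply: ge0_emeasurable_sum => // n t ht _; exact: g0.
  have -> : (\int[leb]_(t in `[0%R, (2 * pi)%R]) `|\sum_(0 <= n <oo) g n t| =
      \int[leb]_(t in `[0%R, (2 * pi)%R]) \sum_(0 <= n <oo) g n t)%E.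
    apply: eq_integral => t /set_mem ht; rewrite gee0_abs//.
    by apply: nneseries_ge0 => n _ _; exact: g0.
  rewrite integral_nneseries//.
  apply: (@le_lt_trans _ _ (\sum_(0 <= n <oo) (2 * pi * 2^-1 ^+ n)%:E)%E).
    by apply: lee_nneseries => [n _ _|n _]; [apply: integral_ge0 => t; exact: g0|exact: gint].
  apply: (@le_lt_trans _ _ (4 * pi : R)%:E); last exact: ltry.
  have p0 : 0 <= 4 * pi :> R by rewrite mulr_ge0// pi_ge0.
  apply: le_trans (epsilon_trick0 xpredT p0).
  apply: lee_nneseries => [n _ _|n _]; rewrite lee_fin.
    by rewrite mulr_ge0 ?exprn_ge0 ?invr_ge0// ltW// twopi_gt0.
  by rewrite natrX exprS invfM exprVn; have : 0 <= (2 ^+ n)^-1 :> R; [rewrite invr_ge0 exprn_ge0|move: (_^-1) (pi) => *; lra].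
have := integrable_ae mI iG; apply: ae_lebS => t h ht.
have {h} := h _; rewrite /= in_itv/= => /(_ ht) fG.
set S := (\sum_(0 <= n <oo) g n t)%E in fG.
have gS n : 4 ^+ n * d n t <= fine S.
  rewrite -lee_fin fineK//; apply: le_trans (nneseries_lim_ge n.+1 _) => [|k _ _]; last by apply: g0; rewrite /= in_itv.
  rewrite big_nat_recr//= leeDr// sume_ge0// => k _; by apply: g0; rewrite /= in_itv.
apply: (@dyadic_cvg _ (Num.sqrt (fine S))) => n.
have S0 : 0 <= fine S by apply: le_trans (gS 0%N); rewrite mulr_ge0.
rewrite -(@ler_pXn2r _ 2) ?nnegrE ?rnorm_ge0 ?mulr_ge0 ?sqrtr_ge0 ?exprn_ge0 ?invr_ge0//.
rewrite exprMn sqr_sqrtr// -exprM mulnC exprM exprVn -natrX exprVn ler_pdivlMr ?exprn_gt0//.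
by rewrite mulrC; exact: gS.
Qed.

(** Poisson integrals need boundary values that are measurable and bounded everywhere. The upper
    limits of real and imaginary parts are measurable and agree with the limits where these exist;
    clipping to [-M, M] bounds them elsewhere. *)
Lemma radial_boundary f (M : R) : analytic_on_disc f ->
  (forall z, rnorm z < 1 -> rnorm (f z) <= M) ->
  exists (x : nat -> R) (u : R -> C), [/\ forall n, 0 < x n < 1, x n @[n --> \oo] --> (1 : R),
    measurable_fun (setT : set (measurableTypeR R)) (fun t => re (u t)) /\
    measurable_fun (setT : set (measurableTypeR R)) (fun t => im (u t)),
    forall t, `|re (u t)| <= M /\ `|im (u t)| <= M &
    {ae leb, forall t, 0 <= t <= 2 * pi -> f (circ (x n) t) @[n --> \oo] --> u t}].
Proof.
move=> af fM; have lf := bounded_l2 af fM.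
have [x [x01 x1 hx]] := radial_sequence af lf.
have ae := ae_radial_cvg af x01 hx.
have bx n t : rnorm (f (circ (x n) t)) <= M.
  by have /andP[h1 h2] := x01 n; rewrite fM// rnorm_circ// ltW.
have cx n : continuous (fun t => f (circ (x n) t)).
  by apply: circle_continuous => //; have /andP[h1 h2] := x01 n; rewrite (ltW h1).
have part (P : C -> R) : continuous P -> (forall z, `|P z| <= rnorm z) ->
    exists v : R -> R, [/\ measurable_fun (setT : set (measurableTypeR R)) v,
      forall t, `|v t| <= M & forall t l, f (circ (x n) t) @[n --> \oo] --> l -> v t = P l].
  move=> cP Pn; pose h n t := P (f (circ (x n) t)).
  have hM n t : `|h n t| <= M by exact: le_trans (Pn _) (bx n t).
  have mh n : measurable_fun (setT : set (measurableTypeR R)) (h n).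
    have ch : continuous (h n : R -> R).
      move=> t; apply: (@continuous_comp _ _ _ (fun t => f (circ (x n) t)) P); [exact: cx|exact: cP].
    exact: measurable_realfun.continuous_measurable_fun ch.
  have ub t : has_ubound (range (h ^~ t)).
    by exists M => _ [n _ <-]; apply: le_trans (hM n t); exact: ler_norm.
  have lb t : has_lbound (range (h ^~ t)).
    by exists (- M) => _ [n _ <-]; have := hM n t; rewrite ler_norml => /andP[].
  pose w t := limn_sup (h ^~ t).
  have mw : measurable_fun (setT : set (measurableTypeR R)) w.
    by apply: measurable_fun_limn_sup => // t _.
  pose v t := Num.max (- M) (Num.min M (w t)).
  have M0 : 0 <= M by exact: le_trans (normr_ge0 _) (hM 0%N 0).
  exists v; split.
  - apply: measurable_realfun.measurable_maxr; first exact: measurable_cst.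
    by apply: measurable_realfun.measurable_minr; first exact: measurable_cst.
  - by move=> t; rewrite ler_norml /v le_max lexx/= ge_max ge_min lexx/= andbT; lra.
  - move=> t l hl; have hP : h n t @[n --> \oo] --> P l.
      by apply: (@continuous_cvg _ _ _ _ _ (fun n => f (circ (x n) t)) P l _ hl); exact: cP.
    have wl : w t = P l by rewrite /w (cvg_limn_inf_sup hP).2.
    have lM : `|P l| <= M.
      have c : `|h n t| @[n --> \oo] --> `|P l| by apply: cvg_norm.
      exact: (cvgn_le_cst c (fun n => hM n t)).
    move: lM; rewrite /v wl ler_norml => /andP[l1 l2].
    by rewrite min_r// max_r.
have [v1 [m1 b1 e1]] := part _ (@re_continuous R) (@re_le R).
have [v2 [m2 b2 e2]] := part _ (@im_continuous R) (@im_le R).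
exists x, (fun t => toC (v1 t) + imag R * toC (v2 t)).
have er t : re (toC (v1 t) + imag R * toC (v2 t)) = v1 t by rewrite !cE; ring.
have ei t : im (toC (v1 t) + imag R * toC (v2 t)) = v2 t by rewrite !cE; ring.
split => //.
- by split; [rewrite (_ : (fun t => _) = v1)|rewrite (_ : (fun t => _) = v2)] => //; apply/funext.
- by move=> t; rewrite er ei.
apply: ae_lebS ae => t h /h[l hl].
rewrite (_ : _ + _ = l)//; apply: cplxP; rewrite ?er ?ei; [exact: e1|exact: e2].
Qed.

End radial_subsequence.

(** * Poisson's formula *)

Section poisson.
Variable R : realType.
Local Notation C := (Cplx R).
Implicit Types (f : C -> C) (z w : C) (r s t : R).
Local Notation leb := (@lebesgue_measure R).
Local Notation cI := (cintble 0 (2 * pi)).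

(** The Poisson kernel at z for the circle through w; the same formula serves the radii r < 1 and
    the limit radius 1. *)
Definition pkernel z w : R := (rnorm w ^+ 2 - rnorm z ^+ 2) / rnorm (w - z) ^+ 2.

(** Cauchy's kernel plus a term which, for |w| = r fixed, extends analytically in w and vanishes at
    0, so that it contributes mean 0 against an analytic function. *)
Lemma pkernelE z w : rnorm z < rnorm w ->
  (1 - z / w)^-1 + cconj z * w / (toC (rnorm w ^+ 2) - cconj z * w) = toC (pkernel z w).
Proof.
move=> zw; have w0 : w != 0 by rewrite -rnorm_gt0 (le_lt_trans _ zw)// rnorm_ge0.
have wz : w - z != 0.
  by apply: contraTneq zw => /eqP; rewrite subr_eq0 => /eqP ->; rewrite ltxx.
have cw0 : cconj (w - z) != 0.
  by rewrite -rnorm_eq0 rnorm_conj rnorm_eq0.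
have cB : cconj (w - z) = cconj w - cconj z.
  by apply: cplxP; rewrite !cE; ring.
have -> : toC (pkernel z w) = (w * cconj w - z * cconj z) / ((w - z) * cconj (w - z)).
  by rewrite /pkernel toCM toCB toCV !rnorm_sqr_conj.
rewrite rnorm_sqr_conj; rewrite cB in cw0 *; move: (cconj w) (cconj z) cw0 => cw cz cw0.
have e1 : w * cw - cz * w = w * (cw - cz) by ring.
by rewrite e1; field; rewrite w0 wz cw0.
Qed.

Lemma pkernel_continuous z w : rnorm z < rnorm w -> {for w, continuous (pkernel z)}.
Proof.
move=> zw; have c1 : {for w, continuous (@rnorm R C)} by exact: rnorm_continuous.
have c2 : {for w, continuous (fun w => rnorm (w - z))}.
  apply: (@continuous_comp _ _ _ (fun w => w - z) (@rnorm R C)); last exact: rnorm_continuous.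
  by apply: (@continuousB _ C); [exact: cvg_id|exact: cst_continuous].
have n0 : rnorm (w - z) ^+ 2 != 0.
  by rewrite sqrf_eq0 rnorm_eq0 subr_eq0; apply: contraTneq zw => ->; rewrite ltxx.
have c4 : {for w, continuous (fun w => rnorm (w - z) ^+ 2)} by exact: (continuousM c2 c2).
have c3 : {for w, continuous (fun w : C => rnorm w ^+ 2 - rnorm z ^+ 2)}.
  by apply: continuousB; [exact: (continuousM c1 c1)|exact: cst_continuous].
by rewrite /pkernel; apply: continuousM; [exact: c3|apply: continuousV].
Qed.

Lemma pkernel_curve z (g : R -> C) : continuous g -> (forall t, rnorm z < rnorm (g t)) ->
  continuous (fun t => pkernel z (g t)).
Proof.
move=> cg zg t; apply: (@continuous_comp _ _ _ g (pkernel z)); first exact: cg.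
exact: pkernel_continuous.
Qed.

(** The condition |z| < r^2 keeps the pole of the second term of [pkernelE] out of the unit disc, so
    [G] is analytic and has mean G(0) = 0. *)
Lemma poisson_circ f z r : analytic_on_disc f -> rnorm z < r ^+ 2 -> 0 < r -> r < 1 ->
  f z = cmean (fun t => f (circ r t) * toC (pkernel z (circ r t))).
Proof.
move=> af zr2 r0 r1.
have zr : rnorm z < r by rewrite (lt_le_trans zr2)// expr2 ler_piMl ?(ltW r0) ?(ltW r1).
have nr t : rnorm (circ r t) = r by rewrite rnorm_circ// ltW.
pose G w := f w * (cconj z * w / (toC (r ^+ 2) - cconj z * w)).
have aG : analytic_on_disc G.
  apply/analyticP => w w1; apply: cdiffM; first exact: analytic_cdiff.
  have cw : cdiff (fun w => cconj z * w) w by apply: cdiffM; [exact: cdiff_cst|exact: cdiff_id].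
  apply: cdiffM => //; apply: cdiffV; last by apply: cdiffB => //; exact: cdiff_cst.
  rewrite subr_eq0; apply/eqP => h.
  have : rnorm (toC (r ^+ 2)) = rnorm z * rnorm w by rewrite h rnormM rnorm_conj.
  rewrite rnorm_toC ger0_norm ?sqr_ge0// => h2; move: zr2; rewrite h2 ltNge => /negP; apply.
  by rewrite ler_piMr ?rnorm_ge0 ?(ltW w1).
have r01 : 0 < r < 1 by rewrite r0.
have G0 : cmean (fun t => G (circ r t)) = 0.
  by rewrite (cmean_analytic aG r01) /G mulr0 mul0r mulr0.
rewrite (cauchy_formula af zr r1) -[LHS]addr0 -G0 -cmeanD.
- apply: eq_cmean => t _; rewrite /G -mulrDr -[in RHS]pkernelE ?nr//.
- apply: cI_cauchy => // w wr; apply: analytic_continuous => //; exact: le_lt_trans r1.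
- exact: cI_analytic.
Qed.

Lemma pkernel_le z w : rnorm z < rnorm w -> rnorm w <= 1 ->
  0 <= pkernel z w <= ((rnorm w - rnorm z) ^+ 2)^-1.
Proof.
move=> zw w1; have d0 : 0 < rnorm w - rnorm z by rewrite subr_gt0.
have h : rnorm w - rnorm z <= rnorm (w - z) by have := rnorm_subr w z; lra.
have n0 : 0 < rnorm (w - z) by exact: lt_le_trans h.
have z0 := rnorm_ge0 z; have s0 : rnorm z ^+ 2 <= rnorm w ^+ 2.
  by rewrite lerXn2r ?nnegrE ?rnorm_ge0// ltW.
rewrite /pkernel divr_ge0 ?subr_ge0 ?sqr_ge0//= -[leRHS]mul1r.
apply: ler_pM; rewrite ?subr_ge0 ?invr_ge0 ?sqr_ge0//.
  rewrite lerBlDr (@le_trans _ _ 1)// ?lerDl ?sqr_ge0// expr_le1 ?rnorm_ge0//.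
by rewrite lef_pV2 ?posrE ?exprn_gt0// lerXn2r ?nnegrE ?rnorm_ge0 ?(ltW d0).
Qed.

Lemma re_cmean (u : R -> C) : re (cmean u) = rmean (fun t => re (u t)).
Proof. by rewrite /cmean !cE mul0r subr0 re_cint. Qed.

Lemma im_cmean (u : R -> C) : im (cmean u) = rmean (fun t => im (u t)).
Proof. by rewrite /cmean !cE mul0r addr0 im_cint. Qed.

Lemma poisson_boundary f z (M : R) (x : nat -> R) (u : R -> C) : analytic_on_disc f ->
  (forall z, rnorm z < 1 -> rnorm (f z) <= M) -> rnorm z < 1 ->
  (forall n, 0 < x n < 1) -> x n @[n --> \oo] --> (1 : R) ->
  measurable_fun (setT : set (measurableTypeR R)) (fun t => re (u t)) ->
  measurable_fun (setT : set (measurableTypeR R)) (fun t => im (u t)) ->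
  {ae leb, forall t, 0 <= t <= 2 * pi -> f (circ (x n) t) @[n --> \oo] --> u t} ->
  re (f z) = rmean (fun t => re (u t) * pkernel z (expi t)) /\
  im (f z) = rmean (fun t => im (u t) * pkernel z (expi t)).
Proof.
move=> af fM z1 x01 x1 mr mi ae.
have z0 := rnorm_ge0 z.
(* Radii beyond 1 - d = (1 + |z|)/2 satisfy |z| < r^2 and keep the kernels below 1/d^2, the bound
   for dominated convergence. *)
pose d := (1 - rnorm z) / 2; have d0 : 0 < d by rewrite /d; lra.
have /cvgrPdist_lt/(_ _ d0)[N _ hN] := x1.
pose y n := x (n + N)%N.
have yd n : 1 - d < y n.
  have := hN (n + N)%N (leq_addl n N); rewrite /= => /(le_lt_trans (ler_norm _)).
  by rewrite /y; lra.
have y01 n : 0 < y n < 1 by exact: x01.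
have zy2 n : rnorm z < y n ^+ 2.
  have := yd n; have /andP[] := y01 n; rewrite /d; nra.
have zy n : rnorm z < y n by have := yd n; rewrite /d; lra.
have ny n t : rnorm (circ (y n) t) = y n by rewrite rnorm_circ// ltW//; have /andP[] := y01 n.
pose F n t := f (circ (y n) t) * toC (pkernel z (circ (y n) t)).
pose U t := u t * toC (pkernel z (expi t)).
have cy n : continuous (fun t => f (circ (y n) t)).
  by apply: circle_continuous => //; have /andP[h1 h2] := y01 n; rewrite (ltW h1).
have cF n : continuous (F n).
  move=> t; apply: (@cvgM C); first exact: cy.
  apply: (@continuous_comp _ _ _ (fun t => pkernel z (circ (y n) t)) (@toC R)); last exact: toC_continuous.
  by apply: pkernel_curve => [|s]; [exact: circ_continuous|rewrite ny].
have cK : continuous (fun t : R => pkernel z (expi t)).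
  by apply: pkernel_curve => [|t]; [exact: expi_continuousC|rewrite rnorm_expi].
have mK := measurable_realfun.continuous_measurable_fun cK.
have reU t : re (U t) = re (u t) * pkernel z (expi t) by rewrite /U !cE; ring.
have imU t : im (U t) = im (u t) * pkernel z (expi t) by rewrite /U !cE; ring.
have [] := @cmean_dct R F U (M * (d ^+ 2)^-1).
- by move=> n; apply: cI_cont; exact: cF.
- split; apply: measurable_funTS.
    by under eq_fun do rewrite reU; exact: measurable_realfun.measurable_funM.
  by under eq_fun do rewrite imU; exact: measurable_realfun.measurable_funM.
- apply: ae_lebS ae => t h /h{}h; apply: (@cvgM C).
    by have := cvg_comp _ _ (cvg_addnr N) h.
  have cc : circ (y n) t @[n --> \oo] --> (expi t : C).
    rewrite -[X in _ --> X]mul1r -toC1; apply: (@cvgM C); last exact: cvg_cst.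
    apply: (@continuous_cvg _ _ _ _ _ y (@toC R)); first exact: toC_continuous.
    by have := cvg_comp _ _ (cvg_addnr N) x1.
  apply: (@continuous_cvg _ _ _ _ _ (fun n => pkernel z (circ (y n) t)) (@toC R)); first exact: toC_continuous.
  apply: (@continuous_cvg _ _ _ _ _ (fun n => circ (y n) t) (pkernel z)) => //.
  by apply: pkernel_continuous; rewrite rnorm_expi.
- move=> n t _; rewrite rnormM rnorm_toC; apply: ler_pM => //; first exact: rnorm_ge0.
    by rewrite fM// ny; have /andP[] := y01 n.
  have [||h1 h2] := andP (@pkernel_le z (circ (y n) t) _ _); rewrite ?ny//.
    by rewrite ltW//; have /andP[] := y01 n.
  rewrite ger0_norm// (le_trans h2)// ny lef_pV2 ?posrE ?exprn_gt0 ?subr_gt0//.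
  by rewrite lerXn2r ?nnegrE ?subr_ge0 ?(ltW d0) ?(ltW (zy n))//; have := yd n; rewrite /d; lra.
move=> _ cF'.
have fz : f z = cmean U.
  symmetry; apply: (cvgC_cst_eq (u := fun n => cmean (F n))) => // n.
  by rewrite -poisson_circ//; have /andP[] := y01 n.
split.
  rewrite fz re_cmean; congr rmean; apply/funext => t; exact: reU.
rewrite fz im_cmean; congr rmean; apply/funext => t; exact: imU.
Qed.

End poisson.

(** * Poisson integrals at Lebesgue points *)

Section lebesgue_points.
Variable R : realType.
Local Notation C := (Cplx R).
Implicit Types (f : C -> C) (z w : C) (r s t h : R) (v g : R -> R).
Local Notation leb := (@lebesgue_measure R).
Local Notation Rm := (setT : set (measurableTypeR R)).

Lemma bounded_rintble a b g (K : R) : measurable_fun Rm g -> (forall t, a <= t <= b -> `|g t| <= K) ->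
  rintble a b g.
Proof.
move=> mg gK; apply: measurable_bounded_integrable => //.
- by apply: compact_finite_measure; exact: segment_compact.
- exact: measurable_funTS.
- exists `|K|; split; first exact: num_real.
  move=> x Kx t /=; rewrite in_itv/= => /gK h; apply: le_trans h _.
  by rewrite (le_trans (ler_norm _))// ltW.
Qed.

Lemma circ_dist2 r t t0 : rnorm (expi t - circ r t0 : C) ^+ 2 =
  (1 - r) ^+ 2 + 4 * r * sin ((t - t0) / 2) ^+ 2.
Proof.
have h1 : cos (t - t0) = 1 - 2 * sin ((t - t0) / 2) ^+ 2.
  have {1}-> : t - t0 = ((t - t0) / 2) *+ 2 by rewrite -mulr_natr; field.
  rewrite cos_mulr2n; have := cos2Dsin2 ((t - t0) / 2); rewrite -mulr_natr; lra.
have h2 := cos2Dsin2 t; have h3 := cos2Dsin2 t0.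
rewrite cosB in h1; rewrite rnorm_sq /circ !cE.
rewrite -[re (expi t)]/(cos t) -[im (expi t)]/(sin t) -[re (expi t0)]/(cos t0) -[im (expi t0)]/(sin t0).
move: (sin ((t - t0) / 2) ^+ 2) h1 h2 h3 => x h1 h2 h3.
move: (cos t) (sin t) (cos t0) (sin t0) h1 h2 h3 => a b c d h1 h2 h3.
have -> : (a - (r * c - 0 * d)) ^+ 2 + (b - (r * d + 0 * c)) ^+ 2 =
  (a ^+ 2 + b ^+ 2) + r ^+ 2 * (c ^+ 2 + d ^+ 2) - 2 * r * (a * c + b * d) by ring.
by rewrite h1 h2 h3; ring.
Qed.

Lemma kernel_center r t t0 : 0 <= r < 1 ->
  0 <= pkernel (circ r t0) (expi t : C) <= 2 / (1 - r).
Proof.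
move=> /andP[r0 r1].
have [||/= ->] /= := andP (@pkernel_le R (circ r t0) (expi t) _ _); rewrite ?rnorm_expi ?rnorm_circ//.
move=> _; rewrite /pkernel rnorm_expi rnorm_circ// circ_dist2.
have h0 : 0 < 1 - r by rewrite subr_gt0.
have s0 : 0 <= 4 * r * sin ((t - t0) / 2) ^+ 2 by rewrite mulr_ge0 ?sqr_ge0 ?mulr_ge0.
rewrite ler_pdivrMr; last by rewrite ltr_pwDl// exprn_gt0.
have -> : 2 / (1 - r) * ((1 - r) ^+ 2 + 4 * r * sin ((t - t0) / 2) ^+ 2) =
   2 * (1 - r) + 2 / (1 - r) * (4 * r * sin ((t - t0) / 2) ^+ 2) by field; rewrite gt_eqF.
have s1 : 0 <= 2 / (1 - r) * (4 * r * sin ((t - t0) / 2) ^+ 2) by rewrite mulr_ge0// divr_ge0// ltW.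
move: s1; move: (2 / _ * _) => X; nra.
Qed.

Lemma kernel_away r t t0 (m : R) : 2^-1 <= r -> r < 1 -> 0 < m -> m <= sin ((t - t0) / 2) ^+ 2 ->
  pkernel (circ r t0) (expi t : C) <= (1 - r) / m.
Proof.
move=> r2 r1 m0 ms; have r0 : 0 <= r by lra.
rewrite /pkernel rnorm_expi rnorm_circ// circ_dist2.
have h0 : 0 < 1 - r by rewrite subr_gt0.
move: (sin _ ^+ 2) ms => S ms.
have S0 : 0 < 4 * r * S by rewrite !mulr_gt0 ?(lt_le_trans m0 ms)//; lra.
rewrite ler_pdivrMr; last by rewrite ltr_wpDl ?sqr_ge0.
rewrite mulrAC ler_pdivlMr// expr1n.
have -> : 1 - r ^+ 2 = (1 - r) * (1 + r) by ring.
rewrite -[leLHS]mulrA ler_wpM2l ?(ltW h0)//.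
have := sqr_ge0 (1 - r); nra.
Qed.

(** From |sin x| >= |x|/2 near 0, with x = s/2. *)
Lemma sin_half_lower : exists2 d : R, 0 < d & forall s, `|s| < d -> s ^+ 2 / 16 <= sin (s / 2) ^+ 2.
Proof.
have ds : is_derive (0 : R) (1 : R) (@sin R) 1 by have := @is_derive_sin R 0; rewrite cos0.
have h2 : 0 < 2^-1 :> R by rewrite invr_gt0.
have [d d0 hd] := is_derive_small ds h2.
exists (2 * d) => [|s sd]; first lra.
have s2 : `|s / 2| < d.
  by rewrite normrM (ger0_norm (ltW h2)) ltr_pdivrMr// mulrC.
have := hd _ s2; rewrite sin0 subr0 mul1r; set x := s / 2; set y := sin x => h.
have -> : s ^+ 2 / 16 = (2^-1 * `|x|) ^+ 2.
  by rewrite exprMn real_normK ?num_real// /x; field.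
rewrite -[y ^+ 2]real_normK ?num_real// lerXn2r ?nnegrE ?mulr_ge0//.
have : `|x| <= `|y| + `|x - y| by have := ler_normD y (x - y); rewrite addrCA subrr addr0.
by rewrite distrC in h; move: h; move: (`|x - y|) (`|x|) (`|y|) => *; lra.
Qed.

Section fixed_point.
Variables (v : R -> R) (M t0 : R).
Hypotheses (mv : measurable_fun Rm v) (vM : forall t, `|v t| <= M) (lp : lebesgue_pt v t0).

Let w : R -> R := fun t => `|v t - v t0|.
Let w0 t : 0 <= w t. Proof. exact: normr_ge0. Qed.
Let M0 : 0 <= M. Proof. exact: le_trans (vM 0). Qed.
Let wM t : w t <= 2 * M.
Proof. by apply: le_trans (ler_normB _ _) _; have := vM t; have := vM t0; lra. Qed.
Let mw : measurable_fun Rm w.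
Proof.
apply: measurableT_comp; first exact: measurable_realfun.normr_measurable.
by apply: measurable_realfun.measurable_funB.
Qed.

Let iw a b : rintble a b w.
Proof. by apply: (bounded_rintble mw (K := 2 * M)) => t _; rewrite ger0_norm. Qed.

Let P r t := pkernel (circ r t0) (expi t : C).

Let cP r : 0 <= r < 1 -> continuous (P r : R -> R).
Proof.
move=> /andP[r0 r1]; apply: pkernel_curve; first exact: expi_continuousC.
by move=> t; rewrite rnorm_expi rnorm_circ.
Qed.

Let iP (g : R -> R) (K : R) r a b : measurable_fun Rm g -> (forall t, `|g t| <= K) -> 0 <= r < 1 ->
  rintble a b (fun t => g t * P r t).
Proof.
move=> mg gK r01; apply: (bounded_rintble (K := K * (2 / (1 - r)))) => [|t _].
  apply: measurable_realfun.measurable_funM => //.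
  exact: measurable_realfun.continuous_measurable_fun (cP r01).
have /andP[h1 h2] := kernel_center t t0 r01.
by rewrite normrM ler_pM// ger0_norm.
Qed.

Let iwP r a b : 0 <= r < 1 -> rintble a b (fun t => w t * P r t).
Proof. by apply: (@iP w (2 * M)) => // t; rewrite ger0_norm. Qed.

(** Averages at a Lebesgue point are taken over open balls; the ball of radius 2h contains the
    closed segment of radius h, and its length 4h explains e/4. *)
Let small_average (e : R) : 0 < e -> exists2 d, 0 < d &
  forall h, 0 < h -> h < d -> rint (t0 - h) (t0 + h) w <= e * h.
Proof.
move=> e0; have e4 : 0 < e / 4 by rewrite divr_gt0.
have : \forall r \near (0 : R)^'+, (davg v t0 r < (e / 4)%:E)%E.
  have lp' := @lp [set y | (y < (e / 4)%:E)%E].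
  apply: lp'; apply: open_nbhs_nbhs; split; first exact: open_ereal_lt_ereal.
  by rewrite /= lte_fin.
rewrite near_withinE => /nbhs_ballP[d /= d0 hd].
exists (d / 2) => [|h h0 h2]; first by rewrite divr_gt0.
have h20 : 0 < 2 * h by rewrite mulr_gt0.
have /hd/(_ h20) : ball (0 : R) d (2 * h) by rewrite /ball/= sub0r normrN gtr0_norm//; lra.
rewrite /davg /iavg lebesgue_measure_ball ?(ltW h20)// inver.
have -> : (2 * h *+ 2 == 0) = false by rewrite mulrn_eq0/= gt_eqF.
have h40 : 0 < 2 * h *+ 2 by rewrite pmulrn_lgt0.
rewrite lte_pdivrMl// => /ltW H.
have mE : measurable_fun (setT : set (measurableTypeR R)) (fun t => (w t)%:E).
  exact/measurable_realfun.measurable_EFinP.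
have -> : e * h = 2 * h *+ 2 * (e / 4) by rewrite -mulr_natr; field.
rewrite -lee_fin EFinM; apply: le_trans H.
rewrite /rint /Rintegral fineK; last exact: integrable_fin_num (iw _ _).
have -> : (\int[leb]_(y in ball t0 (2 * h)) `|((center (v t0) \o v) y)%:E| =
    \int[leb]_(y in ball t0 (2 * h)) (w y)%:E)%E by apply: eq_integral.
apply: ge0_subset_integral => //.
- exact: measurable_ball.
- exact: measurable_funTS.
- by move=> x _; rewrite lee_fin.
- move=> x /=; rewrite in_itv/= /ball/= => /andP[x1 x2].
  by rewrite ltr_norml; apply/andP; split; lra.
Qed.

(* The kernel is at most 2 / (1 - r) everywhere and 16 (1 - r) / s^2 at distance s
   from t0, so that the n-th dyadic shell contributes 64 eta / 2^n. *)
Let dyadic (eta r D : R) : 2^-1 <= r -> r < 1 ->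
  (forall h, 0 < h -> h <= D -> rint (t0 - h) (t0 + h) w <= eta * h) ->
  (forall s, `|s| <= D -> s ^+ 2 / 16 <= sin (s / 2) ^+ 2) ->
  forall n, 2 ^+ n * (1 - r) <= D ->
  rint (t0 - 2 ^+ n * (1 - r)) (t0 + 2 ^+ n * (1 - r)) (fun t => w t * P r t) <=
  (130 - 128 * 2^-1 ^+ n) * eta.
Proof.
move=> r2 r1 avg sb; set h := 1 - r.
have h0 : 0 < h by rewrite subr_gt0.
have r01 : 0 <= r < 1 by rewrite r1 andbT; lra.
have step (a b k c : R) : a <= b -> 0 <= c -> 0 < k -> k <= D -> t0 - k <= a -> b <= t0 + k ->
    (forall t, a <= t <= b -> P r t <= c) ->
    rint a b (fun t => w t * P r t) <= c * (eta * k).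
  move=> ab c0 k0 kD ka bk Pc.
  apply: (@le_trans _ _ (rint a b (fun t => c * w t))).
    apply: le_rint; [exact: iwP|exact: rintbleZ|move=> t tab].
    by rewrite mulrC ler_wpM2r// Pc.
  rewrite rintZ// ler_wpM2l// (le_trans _ (avg k k0 kD))//.
  have kk : t0 - k <= a <= t0 + k by rewrite ka (le_trans ab).
  have kk2 : a <= b <= t0 + k by rewrite ab.
  rewrite (rint_split kk (iw _ _)) (rint_split kk2 (iw _ _)).
  have pos x y : 0 <= rint x y w by apply: Rintegral_ge0 => t _.
  have := pos (t0 - k) a; have := pos b (t0 + k); lra.
elim=> [|n IH] hD.
  rewrite expr0 mul1r in hD *; rewrite expr0 mulr1.
  apply: le_trans (step _ _ h (2 / h) _ _ h0 hD (lexx _) (lexx _) _) _.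
  - lra.
  - by rewrite divr_ge0// ltW.
  - by move=> t _; have /andP[_] := kernel_center t t0 r01.
  - by have -> : 2 / h * (eta * h) = (130 - 128) * eta by field; rewrite gt_eqF.
have q0 : 0 < 2 ^+ n * h by rewrite mulr_gt0// exprn_gt0.
have qD : 2 ^+ n * h <= D by move: hD q0; rewrite exprS -mulrA; lra.
have {}IH := IH qD.
set q := 2 ^+ n * h in IH q0 qD.
have qq : 2 ^+ n.+1 * h = 2 * q by rewrite exprS mulrA.
rewrite qq in hD *.
have away t : q <= `|t - t0| -> `|t - t0| <= D -> P r t <= 16 * h / q ^+ 2.
  move=> qt tD; have m0 : 0 < q ^+ 2 / 16 by rewrite divr_gt0// exprn_gt0.
  have ms : q ^+ 2 / 16 <= sin ((t - t0) / 2) ^+ 2.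
    apply: le_trans (sb _ tD); rewrite ler_wpM2r ?invr_ge0//.
    by rewrite -[leRHS]real_normK ?num_real// lerXn2r ?nnegrE ?(ltW q0).
  apply: le_trans (kernel_away r2 r1 m0 ms) _.
  by rewrite -/h invfM invrK mulrA (mulrC (_ * _) 16) mulrA.
have c0 : 0 <= 16 * h / q ^+ 2 by rewrite divr_ge0 ?mulr_ge0 ?sqr_ge0 ?(ltW h0).
have q2 : 0 < 2 * q by rewrite mulr_gt0.
have s1 : rint (t0 - 2 * q) (t0 - q) (fun t => w t * P r t) <= 16 * h / q ^+ 2 * (eta * (2 * q)).
  apply: (step _ _ (2 * q)) => //; [lra|lra|move=> t /andP[ta tb]].
  apply: away; [rewrite ler0_norm; lra|rewrite ler_norml; apply/andP; split; lra].
have s2 : rint (t0 + q) (t0 + 2 * q) (fun t => w t * P r t) <= 16 * h / q ^+ 2 * (eta * (2 * q)).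
  apply: (step _ _ (2 * q)) => //; [lra|lra|move=> t /andP[ta tb]].
  apply: away; [rewrite ger0_norm; lra|rewrite ler_norml; apply/andP; split; lra].
have i1 : t0 - 2 * q <= t0 - q <= t0 + 2 * q by apply/andP; split; lra.
have i2 : t0 - q <= t0 + q <= t0 + 2 * q by apply/andP; split; lra.
rewrite (rint_split i1 (iwP _ _ r01)) (rint_split i2 (iwP _ _ r01)).
have e1 : 16 * h / q ^+ 2 * (eta * (2 * q)) = 32 * 2^-1 ^+ n * eta.
  rewrite /q exprVn; field; rewrite (gt_eqF h0) gt_eqF// exprn_gt0//.
rewrite e1 in s1 s2; rewrite exprS; lra.
Qed.

(** Since t0 is strictly between 0 and 2 pi, |t - t0|/2 stays in [D/2, b] with b < pi, where sin has
    a positive minimum; if D/2 > b no t qualifies. *)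
Let outer_kernel (D : R) : 0 < t0 < 2 * pi -> 0 < D -> exists2 m, 0 < m &
  forall t, 0 <= t <= 2 * pi -> D <= `|t - t0| -> m <= sin ((t - t0) / 2) ^+ 2.
Proof.
move=> /andP[t00 t01] D0; pose b := Num.max t0 (2 * pi - t0) / 2.
have bpi : b < pi by rewrite /b ltr_pdivrMr// gt_max; apply/andP; split; lra.
have [Db|bD] := leP (D / 2) b; last first.
  exists 1 => // t /andP[ta tb] Dt; exfalso.
  have h1 : t0 / 2 <= b by rewrite /b ler_pM2r ?invr_gt0// le_max lexx.
  have h2 : (2 * pi - t0) / 2 <= b by rewrite /b ler_pM2r ?invr_gt0// le_max lexx orbT.
  have : `|t - t0| < D by rewrite ltr_norml; apply/andP; split; lra.
  by rewrite ltNge Dt.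
have [c cb hc] := @EVT_min R (@sin R) (D / 2) b Db (continuous_subspaceT (@continuous_sin R)).
move: cb; rewrite in_itv/= => /andP[c1 c2].
have sc : 0 < sin c by apply: sin_gt0_pi; apply/andP; split; lra.
exists (sin c ^+ 2); first exact: exprn_gt0.
move=> t /andP[ta tb] Dt.
have -> : sin ((t - t0) / 2) ^+ 2 = sin (`|t - t0| / 2) ^+ 2.
  by case: ger0P => // _; rewrite mulNr sinN sqrrN.
have h : sin c <= sin (`|t - t0| / 2).
  apply: hc; rewrite in_itv/= ler_pM2r ?invr_gt0// Dt/= /b ler_pM2r ?invr_gt0//.
  by rewrite le_max; case: (ger0P (t - t0)) => _; apply/orP; [right|left]; lra.
by rewrite lerXn2r ?nnegrE ?(ltW sc)// (le_trans (ltW sc)).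
Qed.

(** Poisson's formula for the constant function 1. *)
Lemma rmean_kernel1 r : 0 <= r < 1 -> rmean (P r) = 1.
Proof.
move=> r01; have /andP[r0 r1] := r01.
have z1 : rnorm (circ r t0) < 1 by rewrite rnorm_circ.
pose x n : R := 1 - n.+2%:R^-1.
have x01 n : 0 < x n < 1.
  by rewrite /x subr_gt0 invf_lt1// ltr1n/= ltrBlDr ltrDl invr_gt0.
have x1 : x n @[n --> \oo] --> (1 : R).
  rewrite -[X in _ --> X]subr0; apply: cvgB; first exact: cvg_cst.
  by rewrite (cvg_shiftS (fun n => n.+1%:R^-1 : R)); exact: cvg_harmonic.
have f1 (z : C) : rnorm z < 1 -> rnorm (1 : C) <= 1 by rewrite rnorm1.
have [|||e _] := @poisson_boundary R (fun=> 1) (circ r t0) 1 x (fun=> 1) (@analytic_cst R 1) f1 z1 x01 x1.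
- exact: measurable_cst.
- exact: measurable_cst.
- by apply: aeW => t _; exact: cvg_cst.
transitivity (rmean (fun t => 1 * P r t)); last exact: esym e.
by congr rmean; apply/funext => t; rewrite mul1r.
Qed.

Lemma dyadic_scale (h D : R) : 0 < h -> h <= D -> exists n, 2 ^+ n * h <= D /\ D < 2 * (2 ^+ n * h).
Proof.
move=> h0 hD.
have ex : exists n, D < 2 ^+ n * h.
  have i2 : 0 <= 2^-1 :> R by rewrite invr_ge0.
  have i3 : 2^-1 < 1 :> R by rewrite invf_lt1 ?ltr1n.
  have [N hN] := geo_small D i2 i3 h0; exists N.
  by have := hN N (leqnn N); rewrite exprVn ltr_pdivrMr ?exprn_gt0// mulrC.
case: (ex_minnP ex) => -[|n] hn min; first by move: hn; rewrite expr0 mul1r ltNge hD.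
exists n; split; last by rewrite mulrA -exprS.
by rewrite leNgt; apply/negP => /min; rewrite ltnn.
Qed.

(** Within the largest dyadic window 2^n (1 - r) <= D around t0 the mean is controlled by [dyadic];
    outside it the kernel is O(1 - r). *)
Lemma poisson_limit (e : R) : 0 < t0 < 2 * pi -> 0 < e -> exists2 d, 0 < d &
  forall r, 1 - d < r -> r < 1 -> `|rmean (fun t => v t * P r t) - v t0| <= e.
Proof.
move=> t02 e0; have /andP[t00 t01] := t02.
have p0 : 0 < pi :> R := pi_gt0 R.
(* [dyadic] then contributes at most 130 eta = e pi, half of the admissible e (2 pi). *)
pose eta := e * pi / 130; have eta0 : 0 < eta by rewrite divr_gt0// mulr_gt0.
have [d1 d10 hd1] := small_average eta0.
have [d2 d20 hd2] := sin_half_lower.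
pose D := Num.min (Num.min (d1 / 2) (d2 / 2)) (Num.min (t0 / 2) ((2 * pi - t0) / 2)).
have [D0 Dd1 Dd2 Dt Dt'] : [/\ 0 < D, D < d1, D < d2, D < t0 & D < 2 * pi - t0].
  by rewrite /D; split; rewrite ?lt_min ?gt_min ?divr_gt0 ?subr_gt0//=; apply/orP;
    [left; apply/orP; left|left; apply/orP; right|right; apply/orP; left|right; apply/orP; right]; lra.
clearbody D.
(* The window has radius q with q <= D < 2q, so points outside it are at distance more than D/2. *)
have D20 : 0 < D / 2 by rewrite divr_gt0.
have [m m0 hm] := outer_kernel t02 D20.
(* For 1 - r < k the integrand outside the window is at most e/4. *)
pose k := e * m / (8 * M + 8).
have k0 : 0 < k by rewrite divr_gt0 ?mulr_gt0// ltr_wpDl// mulr_ge0.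
exists (Num.min (Num.min D 2^-1) k); first by rewrite !lt_min D0 k0 invr_gt0 ltr0n.
move=> r hr r1; pose h := 1 - r.
have [h0 hD h2 hk] : [/\ 0 < h, h < D, h < 2^-1 & h < k].
  have : h < Num.min (Num.min D 2^-1) k by rewrite /h; lra.
  by rewrite !lt_min => /andP[/andP[? ?] ?]; rewrite /h subr_gt0.
have r2 : 2^-1 <= r by move: h2; rewrite /h; lra.
have r01 : 0 <= r < 1 by rewrite r1 andbT; lra.
have [n [qD Dq]] := dyadic_scale h0 (ltW hD).
set q := 2 ^+ n * h in qD Dq.
have inner : rint (t0 - q) (t0 + q) (fun t => w t * P r t) <= 130 * eta.
  apply: (@le_trans _ _ ((130 - 128 * 2^-1 ^+ n) * eta)).
    apply: (dyadic (D := D)) => // [s s0 sD|s sD].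
      by apply: hd1 => //; exact: le_lt_trans Dd1.
    by apply: hd2; exact: le_lt_trans Dd2.
  by rewrite ler_wpM2r ?(ltW eta0)// gerBl mulr_ge0// exprn_ge0// invr_ge0.
have away a b : 0 <= a -> a <= b -> b <= 2 * pi -> (forall t, a <= t <= b -> q <= `|t - t0|) ->
    rint a b (fun t => w t * P r t) <= 2 * M * (h / m) * (b - a).
  move=> a0 ab b2 hq; rewrite -rint_cst//; apply: le_rint.
  - exact: iwP.
  - exact: rintble_cst.
  - move=> t tab; apply: ler_pM => //.
      by have /andP[] := kernel_center t t0 r01.
    apply: kernel_away => //; apply: hm.
      by have /andP[h3 h4] := tab; rewrite (le_trans a0)// (le_trans h4).
    have := hq t tab; lra.
have s1 : rint 0 (t0 - q) (fun t => w t * P r t) <= 2 * M * (h / m) * (t0 - q - 0).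
  apply: away; [lra|lra|lra|move=> t /andP[ta tb]; rewrite ler0_norm; lra].
have s2 : rint (t0 + q) (2 * pi) (fun t => w t * P r t) <= 2 * M * (h / m) * (2 * pi - (t0 + q)).
  apply: away; [lra|lra|lra|move=> t /andP[ta tb]; rewrite ger0_norm; lra].
have i1 : 0 <= t0 - q <= 2 * pi by apply/andP; split; lra.
have i2 : t0 - q <= t0 + q <= 2 * pi by apply/andP; split; lra.
have total : rint 0 (2 * pi) (fun t => w t * P r t) <= e * (2 * pi).
  rewrite (rint_split i1 (iwP _ _ r01)) (rint_split i2 (iwP _ _ r01)).
  have c0 : 0 <= 2 * M * (h / m) by rewrite !mulr_ge0 ?invr_ge0 ?(ltW h0) ?(ltW m0).
  have c1 : 2 * M * (h / m) <= e / 4.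
    have k1 : h * (8 * M + 8) <= e * m.
      by rewrite -ler_pdivlMr ?ltr_wpDl ?mulr_ge0// ltW.
    rewrite mulrA ler_pdivrMr//; nra.
  have e1 : 130 * eta = e * pi by rewrite /eta; field.
  have q0 : 0 < q by rewrite mulr_gt0// exprn_gt0.
  have : 2 * M * (h / m) * (t0 - q - 0) + 2 * M * (h / m) * (2 * pi - (t0 + q)) <= e / 4 * (2 * pi).
    rewrite -mulrDr; apply: ler_pM => //; lra.
  have : 0 <= e * pi by rewrite mulr_ge0 ?ltW.
  move: inner s1 s2; rewrite e1; move: (rint 0 _ _) (rint (t0 - q) _ _) (rint (t0 + q) _ _) => *; lra.
have iv := @iP v M r 0 (2 * pi) mv vM r01.
have i1' : rintble 0 (2 * pi) (P r) by apply: rcts_rintble => t _; exact: cP.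
have -> : rmean (fun t => v t * P r t) - v t0 = (2 * pi)^-1 * rint 0 (2 * pi) (fun t => (v t - v t0) * P r t).
  have -> : rmean (fun t => v t * P r t) - v t0 = rmean (fun t => v t * P r t) - v t0 * rmean (P r).
    by rewrite rmean_kernel1// mulr1.
  rewrite /rmean.
  have -> : (fun t => (v t - v t0) * P r t) = (fun t => v t * P r t + (- v t0) * P r t).
    by apply/funext => t; rewrite mulrDl.
  by rewrite rintD ?rintZ//; [ring|exact: rintbleZ].
have ig : rintble 0 (2 * pi) (fun t => (v t - v t0) * P r t).
  apply: (@iP (fun t => v t - v t0) (2 * M)) => //.
  by apply: measurable_realfun.measurable_funB.
have Pp t : 0 <= P r t by have /andP[] := kernel_center t t0 r01.
rewrite normrM gtr0_norm ?invr_gt0 ?twopi_gt0// ler_pdivrMl ?twopi_gt0// [leRHS]mulrC.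
apply: le_trans total; rewrite ler_norml; apply/andP; split.
  rewrite lerNl -rintN//; apply: le_rint => [||t _].
  - by have := rintbleZ (-1) ig; under [X in rintble _ _ X]eq_fun do rewrite mulN1r.
  - exact: iwP.
  - by rewrite -mulNr ler_wpM2r// /w -normrN; exact: ler_norm.
apply: le_rint => // [|t _]; first exact: iwP.
by rewrite ler_wpM2r//; exact: ler_norm.
Qed.

End fixed_point.

Lemma bounded_locally_integrable v (M : R) : measurable_fun Rm v -> (forall t, `|v t| <= M) ->
  locally_integrable setT v.
Proof.
move=> mv vM; split => //; first exact: openT.
move=> K _ cK; have mK : measurable (K : set (measurableTypeR R)) by exact: compact_measurable.
have : leb.-integrable K (EFin \o v).
  apply: measurable_bounded_integrable => //.
  - exact: compact_finite_measure.
  - exact: measurable_funTS.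
  - exists M; split; first exact: num_real.
    by move=> x Mx t _ /=; apply: le_trans (vM t) (ltW Mx).
by move=> /integrableP[].
Qed.

(** At common Lebesgue points of the real and imaginary parts of u, Poisson's formula upgrades
    convergence along the sequence [x] to the full radial limit. *)
Lemma fatou_radial f (M : R) : analytic_on_disc f -> (forall z, rnorm z < 1 -> rnorm (f z) <= M) ->
  exists (x : nat -> R) (u : R -> C), [/\
    [/\ forall n, 0 < x n < 1, x n @[n --> \oo] --> (1 : R) &
    {ae leb, forall t, 0 <= t <= 2 * pi -> f (circ (x n) t) @[n --> \oo] --> u t}],
    measurable_fun Rm (fun t => re (u t)), measurable_fun Rm (fun t => im (u t)),
    forall t, `|re (u t)| <= M /\ `|im (u t)| <= M &
    {ae leb, forall t, 0 < t < 2 * pi -> f (toC r * expi t) @[r --> (1 : R)^'-] --> u t}].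
Proof.
move=> af fM; have [x [u [x01 x1 [mr mi] uM ae]]] := radial_boundary af fM.
exists x, u; split => //.
have lr := lebesgue_differentiation (bounded_locally_integrable mr (fun t => (uM t).1)).
have li := lebesgue_differentiation (bounded_locally_integrable mi (fun t => (uM t).2)).
apply: ae_lebS (ae_lebI lr li) => t0 [pr pi'] t02.
apply/(cvg_rnormP (V := C) _ _) => e e0.
have e4 : 0 < e / 4 by rewrite divr_gt0.
have [d1 d10 h1] := poisson_limit mr (fun t => (uM t).1) pr t02 e4.
have [d2 d20 h2] := poisson_limit mi (fun t => (uM t).2) pi' t02 e4.
near=> r.
have r1 : r < 1 by near: r; exact: nbhs_left_lt.
have r0 : 0 < r by near: r; exact: nbhs_left_gt.
have rd1 : 1 - d1 < r by near: r; apply: nbhs_left_gt; rewrite ltrBlDr ltrDl.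
have rd2 : 1 - d2 < r by near: r; apply: nbhs_left_gt; rewrite ltrBlDr ltrDl.
have z1 : rnorm (circ r t0) < 1 by rewrite rnorm_circ// ltW.
have [er ei] := poisson_boundary af fM z1 x01 x1 mr mi ae.
have {}h1 := h1 r rd1 r1; have {}h2 := h2 r rd2 r1.
rewrite -er in h1; rewrite -ei in h2.
rewrite rnorm_distC; apply: le_lt_trans (rnorm_le_reim _) _; rewrite reB imB.
rewrite -[toC r * expi t0]/(circ r t0); move: h1 h2; move: (`|_|) (`|_|) => a b; lra.
Unshelve. all: by end_near. Qed.

End lebesgue_points.

(** * Boundary values of inner and outer functions *)

Section boundary_values.
Variable R : realType.
Local Notation C := (Cplx R).
Implicit Types (f : C -> C) (z w : C) (r s t : R) (v g : R -> R) (u : R -> C).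
Local Notation leb := (@lebesgue_measure R).
Local Notation Rm := (setT : set (measurableTypeR R)).
Local Notation mI := (measurable_itv `[0, 2 * pi]).

Lemma ae_interior (P : R -> Prop) : {ae leb, forall t, 0 < t < 2 * pi -> P t} ->
  {ae leb, forall t, 0 <= t <= 2 * pi -> t <> 0 -> t <> 2 * pi -> P t}.
Proof.
apply: ae_lebS => t h /andP[t0 t1] n0 n1; apply: h.
by rewrite !lt_neqAle t0 t1 !andbT eq_sym; apply/andP; split; apply/eqP.
Qed.

Lemma ae_closed (P : R -> Prop) : {ae leb, forall t, 0 < t < 2 * pi -> P t} ->
  {ae leb, forall t, 0 <= t <= 2 * pi -> P t}.
Proof.
have pt (a : R) : {ae leb, forall t, t <> a}.
  exists [set a]; split; [exact: measurable_set1|exact: lebesgue_measure_set1|].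
  by move=> t /= /contrapT.
move=> /ae_interior h; have := ae_lebI h (ae_lebI (pt 0) (pt (2 * pi))).
by apply: ae_lebS => t [+ [n0 n1]] tI; apply.
Qed.

(* S is arbitrary: on sets that are not Borel, circle_measure is computed from
   the Lebesgue outer measure. *)
Lemma circle_null (S : set C) : {ae leb, forall t, 0 < t < 2 * pi -> ~ S (expi t)} <->
  circle_measure (S : set (Cplx_borel R)) = 0%E.
Proof.
have p0 : (0 < (2 * pi : R)^-1)%R by rewrite invr_gt0 twopi_gt0.
pose N : set R := `[0%R, (2 * pi)%R[ `&` @expi R @^-1` S.
have e1 : (circle_measure (S : set (Cplx_borel R)) = 0%E) <-> leb.-negligible N.
  rewrite negligible_outer_measure /circle_measure; split=> [|h].
    by move=> /eqP; rewrite mule_eq0 eqe gt_eqF//= => /eqP.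
  by rewrite [X in (_ * X)%E](_ : _ = 0%E) ?mule0.
rewrite e1; split => [/ae_closed h|h].
  have : leb.-negligible [set t | ~ (0 <= t <= 2 * pi -> ~ S (expi t))] by exact: h.
  apply: negligibleS => t [/=]; rewrite in_itv/= => /andP[t0 t1] St /(_ _); apply => //.
  by rewrite t0 ltW.
suff sub : ~` [set t | 0 < t < 2 * pi -> ~ S (expi t)] `<=` N.
  have hn : leb.-negligible (~` [set t | 0 < t < 2 * pi -> ~ S (expi t)]) by apply: negligibleS h.
  exact: hn.
move=> t /= nh; split.
  rewrite /= in_itv/=; apply: contrapT => hn; apply: nh => /andP[t0 t1]; case: hn.
  by rewrite t1 ltW.
by apply: contrapT => nS; apply: nh.
Qed.

(** The exceptional set in the plane must be enlarged to a Borel null set. The null set of angles is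
    covered by open sets U n of measure below 1/(n+1); the remaining angles form compact sets with
    compact images, and the complement of all these images is Borel. *)
Lemma ae_circle (P : C -> Prop) : {ae leb, forall t, 0 < t < 2 * pi -> P (expi t)} ->
  {ae (@circle_measure R), forall z, circle z -> P z}.
Proof.
move=> /ae_closed [N [mN N0 NP]].
have key n : exists U : set R, [/\ open U, N `<=` U & (leb U < (n.+1%:R^-1)%:E)%E].
  have e0 : 0 < n.+1%:R^-1 :> R by rewrite invr_gt0.
  have [|U [oU NU hU]] := lebesgue_regularity_outer mN _ e0; first by rewrite [X in (X < _)%E]N0.
  exists U; split => //; apply: le_lt_trans hU.
  rewrite -[X in (_ X <= _)%E](setDUK NU); apply: le_trans (measureU2 _ _ _) _ => //.
    by apply: measurableD => //; exact: measurable_realfun.open_measurable.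
  by rewrite [X in (X + _)%E]N0 add0e.
have [U hU] := choice key.
pose K n := `[0%R, (2 * pi)%R]%classic `\` U n.
have cK n : compact (@expi R @` K n).
  apply: continuous_compact; first exact: continuous_subspaceT (@expi_continuousC R).
  apply: subclosed_compact (@segment_compact _ 0 (2 * pi)) _; last exact: subDsetl.
  by rewrite /K setDE; apply: closedI; [exact: interval_closed|apply: open_closedC; case: (hU n)].
pose B := \bigcap_n ~` (@expi R @` K n).
have mB : measurable (B : set (Cplx_borel R)).
  apply: bigcapT_measurable => n; apply: open_borel; apply: closed_openC.
  exact: compact_closed (cK n).
exists B; split => //.
  have mU n : measurable (U n : set (measurableTypeR R)).
    by apply: measurable_realfun.open_measurable; case: (hU n).
  apply/circle_null; exists (\bigcap_n U n); split.
  - exact: bigcapT_measurable.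
  - apply/eqP; rewrite eq_le measure_ge0 andbT; apply/lee_addgt0Pr => e e0; rewrite add0e.
    have /cvgrPdist_lt/(_ _ e0)[n _ hn] := @cvg_harmonic R.
    have := hn n (leqnn n); rewrite /= sub0r normrN gtr0_norm ?invr_gt0// => /ltW he.
    have [_ _ /ltW Un] := hU n.
    apply: (@le_trans _ _ (leb (U n))).
      apply: le_measure; rewrite ?inE//; first exact: bigcapT_measurable.
      exact: bigcap_inf.
    by apply: le_trans Un _; rewrite lee_fin.
  - move=> t /= nt n _; apply: contrapT => nU; apply: nt => /andP[t0 t1] Bt.
    by apply: (Bt n I); exists t => //; split => //=; rewrite in_itv/= !ltW.
move=> z /= nz n _ [t [/= tI tU] tz]; apply: tU.
have [_ NU _] := hU n; apply: NU; apply: NP => /= h; apply: nz => _.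
by rewrite -tz; apply: h; move: tI; rewrite in_itv.
Qed.

Lemma radial_limitE f t (l : C) : f (toC r * expi t) @[r --> (1 : R)^'-] --> l ->
  radial_limit f (expi t) = l.
Proof. by move=> h; apply: cvg_lim => //; exact: norm_hausdorff. Qed.

Lemma rnorm2_measurable u : measurable_fun Rm (fun t => re (u t)) ->
  measurable_fun Rm (fun t => im (u t)) -> measurable_fun Rm (fun t => rnorm (u t) ^+ 2).
Proof.
move=> mr mi; rewrite (_ : (fun t => _) = (fun t => re (u t) ^+ 2 + im (u t) ^+ 2)).
  by apply: measurable_realfun.measurable_funD; apply: measurable_realfun.measurable_funX.
by apply/funext => t; rewrite rnorm_sq.
Qed.

Lemma cvg_rmean (G : C -> C) (K : R) (x : nat -> R) u : analytic_on_disc G ->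
  (forall z, rnorm z < 1 -> rnorm (G z) <= K) -> (forall n, 0 < x n < 1) ->
  measurable_fun Rm (fun t => re (u t)) -> measurable_fun Rm (fun t => im (u t)) ->
  {ae leb, forall t, 0 <= t <= 2 * pi -> G (circ (x n) t) @[n --> \oo] --> u t} ->
  rintble 0 (2 * pi) (fun t => rnorm (u t) ^+ 2) /\
  rmean (fun t => rnorm (G (circ (x n) t)) ^+ 2) @[n --> \oo] --> rmean (fun t => rnorm (u t) ^+ 2).
Proof.
move=> aG GK x01 mr mi ae.
have GK' n t : rnorm (G (circ (x n) t)) <= K.
  by have /andP[h1 h2] := x01 n; rewrite GK// rnorm_circ// ltW.
have K0 : 0 <= K := le_trans (rnorm_ge0 _) (GK' 0%N 0).
have [] := @rint_dct R 0 (2 * pi) (fun n t => rnorm (G (circ (x n) t)) ^+ 2) (fun t => rnorm (u t) ^+ 2) (K ^+ 2).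
- move=> n; apply: rcts_rintble; apply: rnorm2_continuous; first by have /andP[/ltW] := x01 n.
  by move=> w wr; apply: analytic_continuous => //; rewrite wr; have /andP[] := x01 n.
- exact: measurable_funTS (rnorm2_measurable mr mi).
- apply: ae_lebS ae => t h /h {}h.
  have h2 : rnorm (G (circ (x n) t)) @[n --> \oo] --> rnorm (u t).
    by apply: (@continuous_cvg _ _ _ _ _ (fun n => G (circ (x n) t)) (@rnorm R C)) => //; exact: rnorm_continuous.
  exact: (cvgM h2 h2).
- by move=> n t _; rewrite ger0_norm ?sqr_ge0// lerXn2r ?nnegrE ?rnorm_ge0.
by move=> h1 h2; split => //; apply: cvgM => //; exact: cvg_cst.
Qed.

Lemma rint_ae_zero g (K : R) : measurable_fun Rm g -> (forall t, `|g t| <= K) ->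
  {ae leb, forall t, 0 <= t <= 2 * pi -> 0 <= g t} -> rint 0 (2 * pi) g <= 0 ->
  {ae leb, forall t, 0 <= t <= 2 * pi -> g t = 0}.
Proof.
move=> mg gK g0 gle.
have ig : rintble 0 (2 * pi) g by apply: (bounded_rintble mg (K := K)).
have mI : measurable (`[0, 2 * pi]%classic : set (measurableTypeR R)) by [].
have mE : measurable_fun (`[0, 2 * pi]%classic : set (measurableTypeR R)) (EFin \o g).
  by apply/measurable_realfun.measurable_EFinP; exact: measurable_funTS.
have mA : measurable_fun (`[0, 2 * pi]%classic : set (measurableTypeR R)) (fun t => `|(g t)%:E|%E).
  by apply: measurableT_comp => //.
have e1 : (\int[leb]_(t in `[0%R, (2 * pi)%R]) `|(g t)%:E| = \int[leb]_(t in `[0%R, (2 * pi)%R]) (g t)%:E)%E.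
  apply: ae_eq_integral => //.
  by apply: ae_lebS g0 => t h; rewrite /= in_itv/= => /h h2; rewrite /= ger0_norm.
have e2 : (\int[leb]_(t in `[0%R, (2 * pi)%R]) `|(g t)%:E| = 0)%E.
  apply/eqP; rewrite eq_le integral_ge0 ?andbT//.
  rewrite e1 -(fineK (integrable_fin_num mI ig)) lee_fin; exact: gle.
have := (ae_eq_integral_abs leb mI mE).1 e2.
apply: ae_lebS => t h tI; have := h; rewrite /= in_itv/= => /(_ tI) [].
by [].
Qed.

Lemma cvg_sum_ord N (F : nat -> nat -> R) (l : nat -> R) :
  (forall i, F i n @[n --> \oo] --> l i) ->
  \sum_(i < N) F i n @[n --> \oo] --> \sum_(i < N) l i.
Proof.
move=> h; elim: N => [|N IH].
  by rewrite big_ord0 (_ : (fun n => _) = fun=> 0); [exact: cvg_cst|apply/funext => n; rewrite big_ord0].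
rewrite big_ord_recr (_ : (fun n => _) = (fun n => \sum_(i < N) F i n + F N n)).
  by apply: cvgD.
by apply/funext => n; rewrite big_ord_recr.
Qed.

Lemma horner_continuous (p : {poly C}) : continuous (horner p).
Proof.
move=> w; apply: cdiff_continuous; elim/poly_ind: p => [|p c IH].
  by rewrite (_ : horner 0 = fun=> 0); [exact: cdiff_cst|apply/funext => v; rewrite horner0].
rewrite (_ : horner (p * 'X + c%:P) = fun w => p.[w] * w + c).
  by apply: cdiffD; [apply: cdiffM; [exact: IH|exact: cdiff_id]|exact: cdiff_cst].
by apply/funext => v; rewrite !hornerE.
Qed.

Lemma horner_bound (p : {poly C}) : exists2 K : R, 0 <= K & forall z, rnorm z <= 1 -> rnorm p.[z] <= K.
Proof.
exists (\sum_(i < size p) rnorm p`_i); first by apply: sumr_ge0 => i _; exact: rnorm_ge0.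
move=> z z1; rewrite horner_coef; apply: le_trans (rnorm_sum _ _ _) _.
apply: ler_sum => i _; rewrite rnormM rnormX ler_piMr ?rnorm_ge0//.
by rewrite exprn_ile1// rnorm_ge0.
Qed.

(** By Parseval's identity the boundary values have mean square at least 1, while their modulus is
    at most 1; so it equals 1 almost everywhere. *)
Lemma inner_isometric (f : Hinf R) : (forall z, rnorm z < 1 -> rnorm (f z) <= 1) ->
  nn (tcoef f) = 1 -> inner f.
Proof.
move=> f1 nf; have af := @Hinf_analytic R f; have lf := Hinf_l2 f.
have [x [u [[x01 x1 ae] mr mi uM rad]]] := fatou_radial af f1.
have [iu cu] := cvg_rmean af f1 x01 mr mi ae.
have ub : {ae leb, forall t, 0 <= t <= 2 * pi -> rnorm (u t) <= 1}.
  apply: ae_lebS ae => t h /h{}h.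
  have h2 : rnorm (f (circ (x n) t)) @[n --> \oo] --> rnorm (u t).
    by apply: (@continuous_cvg _ _ _ _ _ (fun n => f (circ (x n) t)) (@rnorm R C)) => //; exact: rnorm_continuous.
  apply: (cvgn_le_cst h2) => n; have /andP[h3 h4] := x01 n.
  by rewrite f1// rnorm_circ// ltW.
have mean1 : 1 <= rmean (fun t => rnorm (u t) ^+ 2).
  rewrite -nf; apply: nn_le => N.
  pose S (r : R) := \sum_(i < N) rnorm (tcoef f i) ^+ 2 * r ^+ i ^+ 2.
  have SN n : S (x n) <= rmean (fun t => rnorm (f (circ (x n) t)) ^+ 2).
    have P := parseval af (x01 n).
    rewrite -(cvg_lim _ P)//; apply: limr_ge; first exact: (cvgP _ P).
    exists N => // m /= Nm; rewrite /S.
    rewrite (big_ord_widen m (fun i => rnorm (tcoef f i) ^+ 2 * x n ^+ i ^+ 2))// big_mkcond/=.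
    apply: ler_sum => i _; case: ifP => // _.
    by rewrite mulr_ge0 ?sqr_ge0.
  have cS : S (x n) @[n --> \oo] --> \sum_(i < N) rnorm (tcoef f i) ^+ 2.
    rewrite (eq_bigr (fun i : 'I_N => rnorm (tcoef f i) ^+ 2 * 1 ^+ i ^+ 2)); last by move=> i _; rewrite !expr1n mulr1.
    rewrite /S; apply: (@cvg_sum_ord N (fun i n => rnorm (tcoef f i) ^+ 2 * x n ^+ i ^+ 2) (fun i => rnorm (tcoef f i) ^+ 2 * 1 ^+ i ^+ 2)) => i.
    apply: cvgM; first exact: cvg_cst.
    have ci : x n ^+ i @[n --> \oo] --> (1 ^+ i : R).
      by apply: (@continuous_cvg _ _ _ _ _ x (fun r => r ^+ i)) => //; exact: exprn_continuous.
    exact: (cvgM ci ci).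
  have c2 : rmean (fun t => rnorm (f (circ (x n) t)) ^+ 2) - S (x n) @[n --> \oo] -->
      rmean (fun t => rnorm (u t) ^+ 2) - \sum_(i < N) rnorm (tcoef f i) ^+ 2 by exact: cvgB.
  rewrite -subr_ge0 -(cvg_lim _ c2)//; apply: limr_ge; first exact: (cvgP _ c2).
  by apply: nearW => n; rewrite subr_ge0.
have uK t : rnorm (u t) ^+ 2 <= 2.
  rewrite rnorm_sq; have [h1 h2] := uM t.
  have s1 : re (u t) ^+ 2 <= 1 by rewrite -[leLHS]real_normK ?num_real// expr_le1.
  have s2 : im (u t) ^+ 2 <= 1 by rewrite -[leLHS]real_normK ?num_real// expr_le1.
  lra.
pose g t := 1 - rnorm (u t) ^+ 2.
have mg : measurable_fun Rm g.
  by apply: measurable_realfun.measurable_funB => //; exact: rnorm2_measurable.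
have gK t : `|g t| <= 1.
  by have := uK t; have := sqr_ge0 (rnorm (u t)); rewrite ler_norml /g => *; apply/andP; split; lra.
have gz : {ae leb, forall t, 0 <= t <= 2 * pi -> g t = 0}.
  apply: (rint_ae_zero mg gK).
    apply: ae_lebS ub => t h /h{}h; rewrite /g subr_ge0 expr_le1 ?rnorm_ge0//.
  have -> : rint 0 (2 * pi) g = rint 0 (2 * pi) (fun t => 1 + - 1 * rnorm (u t) ^+ 2).
    by apply: eq_rint => t _; rewrite /g mulN1r.
  rewrite rintD; [|exact: rintble_cst|exact: rintbleZ].
  rewrite rintZ// rint_cst ?(ltW (twopi_gt0 R))// subr0 mul1r mulN1r subr_le0.
  by move: mean1; rewrite /rmean ler_pdivlMl ?twopi_gt0// mulr1.
apply: ae_circle; apply: ae_lebS (ae_lebI gz rad) => t [h1 h2] t0.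
have tI : 0 <= t <= 2 * pi by case/andP: t0 => *; rewrite !ltW.
rewrite (radial_limitE (h2 t0)) -rnormE; congr toC.
have := h1 tI; rewrite /g => /eqP; rewrite subr_eq0 eq_sym sqrp_eq1 ?rnorm_ge0// => /eqP.
by [].
Qed.

(** On the zero set E of the boundary values, 1 - p F has boundary value 1 for every polynomial p.
    The mean square of 1 - p F can be made arbitrarily small, so E is null. *)
Lemma outer_nonzero (F : Hinf R) (x : nat -> R) u : outer F -> (forall n, 0 < x n < 1) ->
  x n @[n --> \oo] --> (1 : R) ->
  measurable_fun Rm (fun t => re (u t)) -> measurable_fun Rm (fun t => im (u t)) ->
  {ae leb, forall t, 0 <= t <= 2 * pi -> F (circ (x n) t) @[n --> \oo] --> u t} ->
  {ae leb, forall t, 0 <= t <= 2 * pi -> u t <> 0}.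
Proof.
move=> oF x01 x1 mr mi ae; have af := @Hinf_analytic R F.
pose E := [set t : R | re (u t) = 0] `&` [set t | im (u t) = 0].
have mE : measurable (E : set (measurableTypeR R)).
  apply: measurableI.
    by have := mr measurableT _ (measurable_set1 0); rewrite setTI.
  by have := mi measurableT _ (measurable_set1 0); rewrite setTI.
have mg : measurable_fun Rm (\1_E : R -> R) by exact: measurable_indic.
have gK t : `|\1_E t : R| <= 1 by rewrite indicE; case: (t \in E); rewrite ?normr1 ?normr0.
have key (e : R) : 0 < e -> rint 0 (2 * pi) (\1_E) <= 2 * pi * e ^+ 2.
  move=> e0; have [p hp] := outer_approx oF e0.
  pose G z := 1 - p.[z] * F z.
  have ap := analyticM (@horner_analytic R p) af.
  have aG : analytic_on_disc G by exact: (analyticB (@analytic_cst R 1) ap).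
  have tG : tcoef G = cf 1 - cprod (tcoef F) (cf p).
    rewrite -[cf 1]tcoef_horner -tcoef_sub_mul; [|exact: af|exact: horner_analytic].
    by congr tcoef; apply/funext => z; rewrite fctE hornerC.
  have cp := @horner_continuous p.
  have [Kp Kp0 hKp] := horner_bound p.
  have GK z : rnorm z < 1 -> rnorm (G z) <= 1 + Kp * rnorm F.
    move=> z1; apply: le_trans (rnormB _ _) _; rewrite rnorm1 lerD2l rnormM.
    by apply: ler_pM; rewrite ?rnorm_ge0 ?Hinf_le// hKp// ltW.
  pose U t := 1 - p.[expi t] * u t.
  have cpe : continuous (fun t : R => p.[expi t]).
    move=> t; apply: (@continuous_comp _ _ _ (@expi R) (horner p)); last exact: cp.
    exact: expi_continuousC.
  have cr : continuous (fun t : R => re p.[expi t]).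
    move=> t; apply: (@continuous_comp _ _ _ (fun t => p.[expi t]) (@re R)); last exact: re_continuous.
    exact: cpe.
  have ci : continuous (fun t : R => im p.[expi t]).
    move=> t; apply: (@continuous_comp _ _ _ (fun t => p.[expi t]) (@im R)); last exact: im_continuous.
    exact: cpe.
  have mpr := measurable_realfun.continuous_measurable_fun cr.
  have mpi := measurable_realfun.continuous_measurable_fun ci.
  have mUr : measurable_fun Rm (fun t => re (U t)).
    rewrite (_ : (fun t => _) = (fun t => 1 - (re p.[expi t] * re (u t) - im p.[expi t] * im (u t)))); last first.
      by apply/funext => t; rewrite /U !cE.
    by apply: measurable_realfun.measurable_funB => //; apply: measurable_realfun.measurable_funB; exact: measurable_realfun.measurable_funM.
  have mUi : measurable_fun Rm (fun t => im (U t)).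
    rewrite (_ : (fun t => _) = (fun t => 0 - (re p.[expi t] * im (u t) + im p.[expi t] * re (u t)))); last first.
      by apply/funext => t; rewrite /U !cE.
    by apply: measurable_realfun.measurable_funB => //; apply: measurable_realfun.measurable_funD; exact: measurable_realfun.measurable_funM.
  have aeU : {ae leb, forall t, 0 <= t <= 2 * pi -> G (circ (x n) t) @[n --> \oo] --> U t}.
    apply: ae_lebS ae => t h /h{}h; apply: (@cvgB C); first exact: cvg_cst.
    apply: (@cvgM C); last exact: h.
    apply: (@continuous_cvg _ _ _ _ _ (fun n => circ (x n) t) (horner p)); first exact: cp.
    rewrite -[X in _ --> X]mul1r -toC1; apply: (@cvgM C); last exact: cvg_cst.
    by apply: (@continuous_cvg _ _ _ _ _ x (@toC R)); [exact: toC_continuous|exact: x1].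
  have [iU cU] := cvg_rmean aG GK x01 mUr mUi aeU.
  have le2 : rmean (fun t => rnorm (U t) ^+ 2) <= e ^+ 2.
    apply: (cvgn_le_cst cU) => n; apply: rmean_le => //; first by rewrite tG.
    by have /andP[h1 h2] := x01 n; rewrite (ltW h1).
  move: le2; rewrite /rmean ler_pdivrMl ?twopi_gt0// => le2; apply: le_trans le2.
  apply: le_rint => // [|t _].
    by apply: (bounded_rintble mg) => t _; exact: gK.
  rewrite indicE; case: (boolP (t \in E)) => [/set_mem[/= tr ti]|_]; last exact: sqr_ge0.
  have -> : U t = 1 by rewrite /U (_ : u t = 0) ?mulr0 ?subr0//; apply: cplxP.
  by rewrite rnorm1 expr1n.
have h0 : rint 0 (2 * pi) (\1_E) <= 0.
  apply/ler_addgt0Pr => e e0; rewrite add0r.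
  have p2 := twopi_gt0 R.
  have s0 : 0 < Num.sqrt (e / (2 * pi)) by rewrite sqrtr_gt0 divr_gt0.
  have := key _ s0; rewrite sqr_sqrtr; last by rewrite divr_ge0// ltW.
  by rewrite mulrCA divff ?mulr1// gt_eqF.
have g0 : {ae leb, forall t, 0 <= t <= 2 * pi -> 0 <= (\1_E t : R)}.
  by apply: aeW => t _; rewrite indicE.
apply: ae_lebS (rint_ae_zero mg gK g0 h0) => t h /h; rewrite indicE => h1 ut.
have tE : E t by split; rewrite /= ut.
by move/eqP: h1; rewrite mem_set// oner_eq0.
Qed.

End boundary_values.

(** * Essential zeros *)

Section essential_zeros.
Variable R : realType.
Local Notation C := (Cplx R).
Implicit Types (f g h x : Hinf R) (z w : C) (r s t : R).
Local Notation leb := (@lebesgue_measure R).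

Lemma ae_circle_inv (P : C -> Prop) : {ae (@circle_measure R), forall z, circle z -> P z} ->
  {ae leb, forall t, 0 < t < 2 * pi -> P (expi t)}.
Proof.
move=> [B [_ B0 PB]]; have := (circle_null B).2 B0; apply: ae_lebS => t h t0.
apply: contrapT => nP; apply: (h t0); apply: PB => /= hP; apply: nP; apply: hP.
exact: circle_expi.
Qed.

Lemma ae_radial f : {ae leb, forall t, 0 < t < 2 * pi ->
  f (toC r * expi t) @[r --> (1 : R)^'-] --> radial_limit f (expi t)}.
Proof.
have [x [u [_ _ _ _ rad]]] := fatou_radial (@Hinf_analytic R f) (@Hinf_le R f).
by apply: ae_lebS rad => t h /h h2; rewrite (radial_limitE h2).
Qed.

Lemma outer_radial_neq0 f : outer f ->
  {ae leb, forall t, 0 < t < 2 * pi -> radial_limit f (expi t) <> 0}.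
Proof.
move=> of_.
have [x [u [[x01 x1 ae] mr mi _ rad]]] := fatou_radial (@Hinf_analytic R f) (@Hinf_le R f).
apply: ae_lebS (ae_lebI rad (outer_nonzero of_ x01 x1 mr mi ae)) => t [h1 h2] t0.
rewrite (radial_limitE (h1 t0)); apply: h2.
by case/andP: t0 => *; rewrite !ltW.
Qed.

Lemma radial_rnorm_le (a : R -> C) (l : C) (K : R) : a r @[r --> (1 : R)^'-] --> l ->
  (\forall r \near (1 : R)^'-, rnorm (a r) <= K) -> rnorm l <= K.
Proof.
move=> al aK; apply/ler_addgt0Pr => e e0.
have /(cvg_rnormP (V := C) (F := (1 : R)^'-) _ _)/(_ e e0) h := al.
have [r [h1 h2]] : exists r, rnorm (l - a r) < e /\ rnorm (a r) <= K.
  apply: (@filter_ex _ ((1 : R)^'-)); apply: filterS2 h aK => r; by split.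
by rewrite (le_trans (rnorm_subr _ (a r)))// lerD// ltW.
Qed.

Lemma near_radial_disc t (P : C -> Prop) : (forall z, rnorm z < 1 -> P z) ->
  \forall r \near (1 : R)^'-, P (toC r * expi t).
Proof.
move=> h; near=> r; apply: h; rewrite rnormM rnorm_expi mulr1 rnorm_toC ger0_norm.
  by near: r; exact: nbhs_left_lt.
by apply: ltW; near: r; exact: nbhs_left_gt.
Unshelve. all: by end_near. Qed.

(** On the circle |fO| = |f| <= |xO| |h| + e/2, so |xO| < d forces |fO| < e almost everywhere. The
    positivity of |fO| demanded of an essential zero comes from [outer_radial_neq0]. *)
Lemma ess_zero_quotient x f (z : C) : f != 0 ->
  (forall e : R, 0 < e -> exists h, rnorm (f - x * h) <= e) -> ess_zero x z -> ess_zero f z.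
Proof.
move=> f0 fx [xI [xO [ixI oxO xE [cz zO]]]].
have [fI [fO [fE ofO fI1 nfI]]] := inner_outer_factorization f0.
exists fI, fO; split => //; first exact: inner_isometric.
split => // e U e0 Uz mu0.
have e2 : 0 < e / 2 by rewrite divr_gt0.
have [h hh] := fx _ e2.
pose d := e / 2 / (rnorm h + 1).
have h0 : 0 < rnorm h + 1 by rewrite ltr_wpDl ?rnorm_ge0.
have d0 : 0 < d by rewrite divr_gt0.
apply: (zO d U d0 Uz); apply/circle_null.
have A1 := ae_lebI (ae_radial fI) (ae_radial fO).
have A2 := ae_lebI (ae_radial xI) (ae_radial xO).
have A3 := ae_lebI (ae_circle_inv (inner_isometric fI1 nfI)) (ae_circle_inv ixI).
have A4 := ae_lebI (ae_radial h) (outer_radial_neq0 ofO).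
have A5 := (circle_null _).2 mu0.
apply: ae_lebS (ae_lebI A1 (ae_lebI A2 (ae_lebI A3 (ae_lebI A4 A5)))).
move=> t [[a1 a2] [[b1 b2] [[c1 c2] [[e1 e3] e4]]]] t0 [[_ /andP[x0 xd]] Ut].
have {}a1 := a1 t0; have {}a2 := a2 t0; have {}b1 := b1 t0; have {}b2 := b2 t0.
have {}c1 := c1 t0; have {}c2 := c2 t0; have {}e1 := e1 t0; have {}e3 := e3 t0; have {}e4 := e4 t0.
have fOe : e <= rnorm (radial_limit fO (expi t)).
  rewrite leNgt; apply/negP => lt; apply: e4; split => //; split; first exact: circle_expi.
  by rewrite lt andbT rnorm_gt0; apply/eqP.
have hn : rnorm (radial_limit h (expi t)) <= rnorm h.
  by apply: (radial_rnorm_le e1); apply: (@near_radial_disc t (fun w => rnorm (h w) <= rnorm h)) => w; exact: Hinf_le.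
pose D w := fI w * fO w - xI w * xO w * h w.
have Dle w : rnorm w < 1 -> rnorm (D w) <= e / 2.
  move=> w1; apply: le_trans hh; rewrite fE xE.
  exact: (Hinf_le (fI * fO - xI * xO * h) w1).
have cv : D (toC r * expi t) @[r --> (1 : R)^'-] -->
    radial_limit fI (expi t) * radial_limit fO (expi t) -
    radial_limit xI (expi t) * radial_limit xO (expi t) * radial_limit h (expi t).
  exact: (@cvgB C _ _ _ _ _ _ _ _ (@cvgM C _ _ _ _ _ _ _ a1 a2) (@cvgM C _ _ _ _ _ _ _ (@cvgM C _ _ _ _ _ _ _ b1 b2) e1)).
have lim2 : rnorm (radial_limit fI (expi t) * radial_limit fO (expi t) -
    radial_limit xI (expi t) * radial_limit xO (expi t) * radial_limit h (expi t)) <= e / 2.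
  apply: (radial_rnorm_le cv); exact: (@near_radial_disc t (fun w => rnorm (D w) <= e / 2) Dle).
have n1 (l : C) : `|l| = 1 -> rnorm l = 1 by move=> hl; apply: toC_inj; rewrite rnormE hl.
have := rnorm_subr (radial_limit fI (expi t) * radial_limit fO (expi t))
  (radial_limit xI (expi t) * radial_limit xO (expi t) * radial_limit h (expi t)).
rewrite !rnormM (n1 _ c1) (n1 _ c2) !mul1r leNgt => /negP; apply.
move: lim2 fOe; set N := rnorm (_ - _) => lim2 fOe.
apply: lt_le_trans fOe.
have : rnorm (radial_limit xO (expi t)) * rnorm (radial_limit h (expi t)) < e / 2.
  apply: (@le_lt_trans _ _ (rnorm (radial_limit xO (expi t)) * rnorm h)).
    by rewrite ler_wpM2l// rnorm_ge0.
  have xh : rnorm (radial_limit xO (expi t)) * (rnorm h + 1) < e / 2 by rewrite -ltr_pdivlMr.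
  by apply: le_lt_trans xh; rewrite ler_wpM2l ?rnorm_ge0// lerDl.
lra.
Qed.

Definition vanishes_at (z : C) f := forall e : R, 0 < e -> exists2 d : R, 0 < d &
  forall w, rnorm w < 1 -> rnorm (w - z) < d -> rnorm (f w) < e.

(** If the extension had a value g(z) other than 0, then |fO| = |f| would be at least |g(z)|/2 at
    almost all nearby points of the circle, and z would not be an essential zero. *)
Lemma Zinf_vanishes f z : Zinf f -> ess_zero f z -> vanishes_at z f.
Proof.
move=> [f0 [g [gf cg]]] fz; have [fI [fO [ifI ofO fE [cz zO]]]] := fz.
have /subspace_continuousP/(_ z (or_intror fz)) := cg.
move=> /(cvg_rnormP (V := C) _ _) cgz.
have nbd (e : R) : 0 < e -> exists2 d : R, 0 < d & forall w, rnorm w < 1 ->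
    rnorm (w - z) < d -> rnorm (g z - f w) < e.
  move=> e0; have := cgz e e0; rewrite near_withinE => /nbhs_rnormP[d d0 hd].
  exists d => // w w1 wd; rewrite -gf; last exact/discE.
  by apply: hd; [rewrite rnorm_distC|left; apply/discE].
have [g0|gn0] := eqVneq (g z) 0.
  move=> e /nbd[d d0 hd]; exists d => // w w1 wd.
  by have := hd w w1 wd; rewrite g0 sub0r rnormN.
exfalso; have G0 : 0 < rnorm (g z) / 2 by rewrite divr_gt0// rnorm_gt0.
have [d d0 hd] := nbd _ G0.
(* Half of [d] is kept for the radial distance, so that points near the end of a radius towards [U]
   are within [d] of z. *)
pose U : set C := [set w | rnorm (w - z) < d / 2].
have Uz : open_nbhs z U.
  split; last by rewrite /U /= subrr rnorm0 divr_gt0.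
  rewrite (_ : U = (fun w => rnorm (w - z)) @^-1` [set s | s < d / 2]); last by [].
  apply: open_comp; last exact: open_lt.
  move=> w _; apply: (@continuous_comp _ _ _ (fun w => w - z) (@rnorm R C)); last exact: rnorm_continuous.
  by apply: (@continuousB _ C); [exact: cvg_id|exact: cst_continuous].
apply: (zO _ U G0 Uz); apply/circle_null.
apply: ae_lebS (ae_lebI (ae_radial fI) (ae_lebI (ae_radial fO) (ae_circle_inv ifI))).
move=> t [a1 [a2 a3]] t0 [[_ /andP[l0 l1]] Ut].
have n1 : rnorm (radial_limit fI (expi t)) = 1 by apply: toC_inj; rewrite rnormE (a3 t0).
have cv : g z - fI (toC r * expi t) * fO (toC r * expi t) @[r --> (1 : R)^'-] -->
    g z - radial_limit fI (expi t) * radial_limit fO (expi t).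
  apply: (@cvgB C); first exact: cvg_cst.
  by apply: (@cvgM C); [exact: a1|exact: a2].
have le2 : rnorm (g z - radial_limit fI (expi t) * radial_limit fO (expi t)) <= rnorm (g z) / 2.
  apply: (radial_rnorm_le cv).
  near=> r; have r1 : r < 1 by near: r; exact: nbhs_left_lt.
  have r0 : 0 < r by near: r; exact: nbhs_left_gt.
  have rd : 1 - d / 2 < r by near: r; apply: nbhs_left_gt; rewrite ltrBlDr ltrDl divr_gt0.
  rewrite -Hinf_mulE -fE; apply: ltW; apply: hd.
    by rewrite rnormM rnorm_expi mulr1 rnorm_toC gtr0_norm.
  apply: le_lt_trans (rnorm_trian (expi t) _ _) _.
  have -> : toC r * expi t - expi t = toC (r - 1) * expi t.
    by rewrite toCB toC1 mulrBl mul1r.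
  rewrite rnormM rnorm_expi mulr1 rnorm_toC ler0_norm; last by rewrite subr_le0 ltW.
  move: Ut; rewrite /U /=; lra.
have := rnorm_subr (g z) (radial_limit fI (expi t) * radial_limit fO (expi t)).
rewrite rnormM n1 mul1r; lra.
Unshelve. all: by end_near. Qed.

Lemma vanishes_ideal z : closed_ideal (vanishes_at z).
Proof.
split.
- move=> f cf_ e e0; have e2 : 0 < e / 2 by rewrite divr_gt0.
  have nb : nbhs f [set g : Hinf R | rnorm (f - g) < e / 2].
    by apply/nbhs_rnormP; exists (e / 2).
  have [g [gv fg]] := cf_ _ nb.
  have [d d0 hd] := gv _ e2; exists d => // w w1 wd.
  have := hd w w1 wd; have := Hinf_le (f - g) w1; have := rnorm_subr (f w) (g w).
  rewrite /= in fg; rewrite -[(f - g) w]/(f w - g w); lra.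
- by move=> e e0; exists 1 => // w w1 _; rewrite rnorm0.
- move=> f g vf vg e e0; have e2 : 0 < e / 2 by rewrite divr_gt0.
  have [d1 d10 h1] := vf _ e2; have [d2 d20 h2] := vg _ e2.
  exists (Num.min d1 d2); first by rewrite lt_min d10.
  move=> w w1; rewrite lt_min => /andP[wd1 wd2].
  rewrite Hinf_addE; apply: le_lt_trans (rnormD _ _) _.
  by have := h1 w w1 wd1; have := h2 w w1 wd2; lra.
- move=> f g vf e e0; have g0 : 0 < rnorm g + 1 by rewrite ltr_wpDl ?rnorm_ge0.
  have [d d0 hd] := vf _ (divr_gt0 e0 g0); exists d => // w w1 wd.
  rewrite Hinf_mulE rnormM; have := hd w w1 wd; rewrite ltr_pdivlMr//; apply: le_lt_trans.
  by rewrite ler_wpM2l ?rnorm_ge0// (le_trans (Hinf_le g w1))// lerDl.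
Qed.

(** Elements of [Hinf] are 0 off the disc, so [x] is its own extension: its default value on the
    circle is the limit required at the essential zeros. *)
Lemma Zinf_of_vanishing x : x != 0 -> (forall z, ess_zero x z -> vanishes_at z x) -> Zinf x.
Proof.
move=> x0 xv; split => //; exists x; split => //.
have out z : ess_zero x z -> x z = 0.
  move=> [_ [_ [_ _ _ [/circleE cz _]]]]; apply: Hinf_out => /discE.
  by rewrite cz ltxx.
apply/subspace_continuousP => z [/discE Dz|Ez].
  apply: cvg_within_filter; exact: (analytic_continuous (@Hinf_analytic R x) Dz).
apply/(cvg_rnormP (V := C) _ _) => e e0; have [d d0 hd] := xv z Ez e e0.
rewrite near_withinE; apply/nbhs_rnormP; exists d => // w zw [/discE Dw|Ew]; rewrite -[_ - _]/(x z - x w).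
  by rewrite out// sub0r rnormN hd// rnorm_distC.
by rewrite !out// subrr rnorm0.
Qed.

Lemma closed_ideal_gen (S : set (Hinf R)) : closed_ideal (ideal_gen S).
Proof.
split.
- move=> f cf_ I hI; have [[cI _ _ _] _] := hI; apply: cI; apply: closureS cf_ => g Jg.
  exact: Jg.
- by move=> I [[]].
- by move=> f g Jf Jg I hI; have [[_ _ h _] _] := hI; apply: h; [exact: Jf|exact: Jg].
- by move=> f g Jf I hI; have [[_ _ _ h] _] := hI; apply: h; exact: Jf.
Qed.

End essential_zeros.

(** * Functions with nonnegative real part *)

Section Hinf_algebra.
Variable R : realType.
Local Notation C := (Cplx R).
Implicit Types (f g h x y : Hinf R) (z w : C) (r s t : R).

Lemma Hinf_norm_le f (K : R) : (forall z, rnorm z < 1 -> rnorm (f z) <= K) -> rnorm f <= K.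
Proof.
move=> fK; apply: supnorm_le => [|z /discE]; last exact: fK.
by exists 0; apply/discE; rewrite rnorm0 ltr01.
Qed.

Lemma rnorm_Hinf_mul f g : rnorm (f * g) <= rnorm f * rnorm g.
Proof. by rewrite -toC_le toCM !rnormE; exact: Hinf_normM. Qed.

Lemma Hinf1E z : rnorm z < 1 -> (1 : Hinf R) z = 1.
Proof. by move=> z1; rewrite -[LHS]/((z \in disc (R := R))%:R : C) mem_set//; apply/discE. Qed.

Lemma rnorm_Hinf1 : rnorm (1 : Hinf R) <= 1.
Proof. by apply: Hinf_norm_le => z z1; rewrite Hinf1E// rnorm1. Qed.

Lemma rnorm_Hinf_exp f n : rnorm (f ^+ n) <= rnorm f ^+ n.
Proof.
elim: n => [|n IH]; first by rewrite !expr0 rnorm_Hinf1.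
rewrite !exprS; apply: le_trans (rnorm_Hinf_mul _ _) _.
by rewrite ler_wpM2l ?rnorm_ge0.
Qed.

Lemma Hinf_expE f n z : rnorm z < 1 -> (f ^+ n) z = f z ^+ n.
Proof. by move=> z1; elim: n => [|n IH]; rewrite ?Hinf1E// !exprS Hinf_mulE IH. Qed.

(** The pointwise limit is uniform, hence analytic by [weierstrass]. Summable consecutive
    differences are what [correction] and [generator] provide. *)
Lemma Hinf_complete (y : nat -> Hinf R) (K : R) :
  (forall n, rnorm (y n.+1 - y n) <= K * 2^-1 ^+ n) ->
  exists l : Hinf R, forall n, rnorm (l - y n) <= 2 * K * 2^-1 ^+ n.
Proof.
move=> h; have K0 : 0 <= K by have := le_trans (rnorm_ge0 _) (h 0%N); rewrite expr0 mulr1.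
have step n k : rnorm (y (n + k)%N - y n) <= 2 * K * 2^-1 ^+ n - 2 * K * 2^-1 ^+ (n + k).
  elim: k => [|k IH]; first by rewrite addn0 !subrr rnorm0.
  rewrite addnS; apply: le_trans (rnorm_trian (y (n + k)%N) _ _) _.
  have := h (n + k)%N; rewrite exprS; lra.
have dist n m : (n <= m)%N -> rnorm (y m - y n) <= 2 * K * 2^-1 ^+ n.
  move=> nm; rewrite -(subnKC nm); apply: le_trans (step _ _) _.
  by rewrite gerBl mulr_ge0 ?mulr_ge0 ?exprn_ge0 ?invr_ge0.
have v0 : 2 * K * 2^-1 ^+ n @[n --> \oo] --> (0 : R).
  by apply: cvg_geo0; [rewrite invr_ge0|rewrite invf_lt1 ?ltr1n].
have ptw z : exists l : C, rnorm z < 1 -> forall n, rnorm (l - y n z) <= 2 * K * 2^-1 ^+ n.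
  have [z1|z1] := pselect (rnorm z < 1); last by exists 0 => /z1.
  have [|l _ hl] := @cplx_cauchy_cvg R (fun n => y n z) (fun n => 2 * K * 2^-1 ^+ n) _ v0.
    by move=> n m /dist; apply: le_trans; exact: (Hinf_le (y m - y n) z1).
  by exists l.
have [l hl] := choice ptw.
have al : analytic_on_disc l.
  apply: weierstrass => q e q1 e0.
  have /cvgrPdist_lt/(_ _ e0)[N _ hN] := v0.
  exists (y N); first exact: Hinf_analytic.
  move=> z zq; apply: le_trans (hl z (le_lt_trans zq q1) N) _.
  by have := hN N (leqnn N); rewrite /= sub0r normrN => /(le_lt_trans (ler_norm _))/ltW.
have lb z : rnorm z < 1 -> rnorm (l z) <= rnorm (y 0%N) + 2 * K.
  move=> z1; apply: le_trans (rnorm_subr _ (y 0%N z)) _; apply: lerD; first exact: Hinf_le.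
  by have := hl z z1 0%N; rewrite expr0 mulr1.
have [L LE] := Hinf_mk al lb.
exists L => n; apply: Hinf_norm_le => z z1.
by rewrite -[(L - y n) z]/(L z - y n z) LE//; exact: hl.
Qed.

Lemma Hinf_inv f (m : R) : 0 < m -> (forall z, rnorm z < 1 -> m <= rnorm (f z)) ->
  exists g, f * g = 1.
Proof.
move=> m0 fm; have nz z : rnorm z < 1 -> f z != 0.
  by move=> z1; rewrite -rnorm_gt0 (lt_le_trans m0)// fm.
have av : analytic_on_disc (fun z => (f z)^-1).
  apply/analyticP => z z1; apply: cdiffV; first exact: nz.
  exact: (analytic_cdiff (@Hinf_analytic R f) z1).
have bv z : rnorm z < 1 -> rnorm (f z)^-1 <= m^-1.
  by move=> z1; rewrite rnormV lef_pV2 ?posrE ?fm// rnorm_gt0 nz.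
have [g gE] := Hinf_mk av bv.
by exists g; apply: Hinf_ext => z z1; rewrite Hinf_mulE gE// Hinf1E// mulfV ?nz.
Qed.

Lemma norm2_one_sub (w : C) : rnorm (1 - w) ^+ 2 = 1 - 2 * re w + rnorm w ^+ 2.
Proof. by rewrite !rnorm_sq !cE; ring. Qed.

Section accretive.
Variable x : Hinf R.
Hypotheses (x_re : forall z, rnorm z < 1 -> 0 <= re (x z)) (x_neq0 : x != 0).

Lemma accretive_shift (e : R) z : 0 < e -> rnorm z < 1 -> e + re (x z) <= rnorm (x z + toC e).
Proof.
move=> e0 z1; have h := le_trans (ler_norm _) (re_le (x z + toC e)).
by apply: le_trans h; rewrite reD re_toC addrC.
Qed.

Lemma accretive_inv (e : R) : 0 < e -> exists g : Hinf R, (x + toC e *: (1 : Hinf R)) * g = 1 /\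
  forall z, rnorm z < 1 -> g z = (x z + toC e)^-1.
Proof.
move=> e0; have E z : rnorm z < 1 -> (x + toC e *: (1 : Hinf R)) z = x z + toC e.
  by move=> z1; rewrite Hinf_addE Hinf_scaleE Hinf1E// mulr1.
have [|g gE] := @Hinf_inv (x + toC e *: (1 : Hinf R)) e e0.
  move=> z z1; rewrite E//; have := accretive_shift e0 z1; have := x_re z1; lra.
exists g; split => // z z1; have : ((x + toC e *: (1 : Hinf R)) * g) z = 1 by rewrite gE Hinf1E.
rewrite Hinf_mulE E// => h; have nz : x z + toC e != 0.
  by apply/eqP => v0; move/eqP: h; rewrite v0 mul0r eq_sym oner_eq0.
by apply: (mulfI nz); rewrite h mulfV.
Qed.

(* w = e / (x + e) satisfies |w|^2 <= Re w, so its mean square on every circle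
   is at most Re w(0). *)
Lemma accretive_mean (e : R) (g : Hinf R) : 0 < e ->
  (forall z, rnorm z < 1 -> g z = (x z + toC e)^-1) ->
  forall z, rnorm z < 1 -> rnorm (toC e * g z) ^+ 2 <= re (toC e * g z).
Proof.
move=> e0 gE z z1; rewrite gE//; have := x_re z1; have := accretive_shift e0 z1.
set v := x z + toC e => h1 h2.
have v0 : v != 0 by rewrite -rnorm_gt0; lra.
have n0 : 0 < rnorm v ^+ 2 by rewrite exprn_gt0 ?rnorm_gt0.
have iv : v^-1 = toC (rnorm v ^+ 2)^-1 * cconj v.
  apply: (mulfI v0); rewrite mulfV// mulrCA -rnorm_sqr_conj -toCM mulVf ?toC1// gt_eqF//.
rewrite rnormM exprMn rnormV iv rnorm_toC real_normK ?num_real//.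
have -> : re (toC e * (toC (rnorm v ^+ 2)^-1 * cconj v)) = e * ((rnorm v ^+ 2)^-1 * re v).
  by rewrite !cE; ring.
rewrite exprVn expr2 -mulrA ler_wpM2l ?(ltW e0)// mulrC ler_wpM2l ?invr_ge0 ?(ltW n0)//.
by rewrite /v reD re_toC; lra.
Qed.

Lemma rmean_re_analytic f r : 0 < r < 1 -> rmean (fun t => re (f (circ r t))) = re (f 0).
Proof. by move=> r01; rewrite -re_cmean (cmean_analytic (@Hinf_analytic R f) r01). Qed.

Lemma re_circ_rcts f r : 0 < r < 1 -> rcts 0 (2 * pi) (fun t => re (f (circ r t))).
Proof.
move=> /andP[r0 r1] t _; have cf := @circle_continuous R f r (@Hinf_analytic R f).
have r01 : 0 <= r < 1 by rewrite (ltW r0).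
by apply: (@continuous_comp _ _ _ (fun t => f (circ r t)) (@re R)); [exact: cf|exact: re_continuous].
Qed.

Lemma norm2_circ_rcts f r : 0 < r < 1 -> rcts 0 (2 * pi) (fun t => rnorm (f (circ r t)) ^+ 2).
Proof.
move=> /andP[r0 r1]; apply: rnorm2_continuous; first exact: ltW.
by move=> w wr; apply: analytic_continuous; [exact: Hinf_analytic|rewrite wr].
Qed.

Lemma rnorm_at0 : rnorm (0 : C) < 1.
Proof. by rewrite rnorm0. Qed.

Lemma accretive_l2 (e : R) (g : Hinf R) : 0 < e ->
  (forall z, rnorm z < 1 -> g z = (x z + toC e)^-1) ->
  l2le (tcoef (toC e *: g)) (re (toC e * g 0)).
Proof.
move=> e0 gE; apply: l2le_rmean; first exact: Hinf_analytic.
move=> r r01; rewrite -(@rmean_re_analytic (toC e *: g) r r01).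
apply: rmean_mono; [exact: norm2_circ_rcts|exact: re_circ_rcts|move=> t].
have /andP[r0 r1] := r01.
by apply: accretive_mean => //; rewrite rnorm_circ// ltW.
Qed.

(** A minimum principle for Re x. If x(0) = 0 then g = 1/(x + 1) has g(0) = 1, and |1 - g|^2 = 1 - 2
    Re g + |g|^2 <= 1 - Re g, whose mean is 1 - Re g(0) = 0; so g = 1 and x = 0. *)
Lemma accretive_x0 : x 0 != 0.
Proof.
apply/eqP => x00; move/eqP: x_neq0; apply.
have [g [gx gE]] := accretive_inv ltr01.
have g0 : g 0 = 1 by rewrite gE ?rnorm_at0// x00 toC1 add0r invr1.
pose w : Hinf R := 1 - g.
have wle : l2le (tcoef w) 0.
  apply: l2le_rmean; first exact: Hinf_analytic.
  move=> r r01; have /andP[r0 r1] := r01.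
  apply: (@le_trans _ _ (rmean (fun t => 1 + - 1 * re (g (circ r t))))); last first.
    have c1 := @re_circ_rcts g r r01.
    rewrite /rmean rintD; [|exact: rintble_cst|apply: rintbleZ; exact: rcts_rintble].
    rewrite rintZ; last exact: rcts_rintble.
    rewrite rint_cst ?(ltW (twopi_gt0 R))// subr0 mulrDr mul1r mulVf ?twopi_neq0//.
    rewrite mulrCA -[X in -1 * X]/(rmean _) (rmean_re_analytic _ r01) g0.
    by have -> : re (1 : C) = 1 by []; lra.
  apply: rmean_mono; first exact: norm2_circ_rcts.
    move=> t ht; apply: continuousD; first exact: cst_continuous.
    by apply: continuousM; [exact: cst_continuous|exact: (@re_circ_rcts g r r01 t ht)].
  move=> t; have c1 : rnorm (circ r t) < 1 by rewrite rnorm_circ// ltW.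
  have := accretive_mean ltr01 gE c1; rewrite toC1 mul1r.
  rewrite -[w _]/((1 : Hinf R) (circ r t) - g (circ r t)) Hinf1E// norm2_one_sub; lra.
have w0 z : rnorm z < 1 -> w z = 0.
  move=> z1; apply: (tcoef_inj (@Hinf_analytic R w) (@analytic_cst R 0)) => // n.
  have -> : tcoef w n = 0.
    apply/eqP; rewrite -rnorm_eq0 -sqrf_eq0 eq_le sqr_ge0 andbT.
    apply: le_trans (wle n.+1); rewrite big_ord_recr/= lerDr.
    by apply: sumr_ge0 => i _; exact: sqr_ge0.
  have -> : (fun=> 0 : C) = horner 0 by apply/funext => v; rewrite horner0.
  by rewrite tcoef_horner /cf coef0.
apply: Hinf_ext => z z1; have g1 : g z = 1.
  by apply/eqP; rewrite eq_sym -subr_eq0; apply/eqP; rewrite -[RHS](w0 z z1) -[in LHS](Hinf1E z1).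
have := gE z z1; rewrite g1 toC1 => h; apply/eqP; rewrite -(inj_eq (addIr 1)) -[x z + 1]invrK -h invr1.
by rewrite -[(0 : Hinf R) z]/(0 : C) add0r.
Qed.

Lemma accretive_outer : outer x.
Proof.
apply: outer_criterion => d d0.
have n0 : 0 < rnorm (x 0) by rewrite rnorm_gt0 accretive_x0.
(* Then |e g(0)| <= e / |x(0)| = d/4, as Re x(0) >= 0. *)
pose e := d / 4 * rnorm (x 0); have e0 : 0 < e by rewrite mulr_gt0 ?divr_gt0.
have [g [gx gE]] := accretive_inv e0.
have lw := accretive_l2 e0 gE.
have re4 : re (toC e * g 0) <= d / 4.
  apply: (le_trans (ler_norm _)); apply: le_trans (re_le _) _.
  rewrite gE ?rnorm_at0// rnormM rnormV rnorm_toC gtr0_norm//.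
  have h : rnorm (x 0) <= rnorm (x 0 + toC e).
    rewrite -(@ler_pXn2r _ 2) ?nnegrE ?rnorm_ge0// !rnorm_sq !cE addr0.
    have := x_re rnorm_at0; nra.
  by rewrite ler_pdivrMr ?(lt_le_trans n0)// /e ler_wpM2l// divr_ge0// ltW.
have lx := Hinf_l2 x; have lg := Hinf_l2 g.
have mulx := multiplier_l2 (exprn_ge0 2 (rnorm_ge0 x)) lx (fun p => bounded_multiplier p (@Hinf_analytic R x) (@Hinf_le R x)).
pose K := rnorm x ^+ 2.
have K0 : 0 <= K by exact: sqr_ge0.
have K1 : 0 < 4 * (K + 1) by rewrite mulr_gt0// ltr_wpDl.
(* [outer_criterion] asks for polynomials, so g is replaced by a Taylor polynomial; x is a bounded
   multiplier, and the loss is at most another d/4. *)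
have /cvgrPdist_lt/(_ _ (divr_gt0 d0 K1))[N _ hN] := nn_trunc_cvg lg.
exists (trunc N (tcoef g)).
have := hN N (leqnn N); rewrite /= sub0r normrN => /(le_lt_trans (ler_norm _))/ltW hlt.
set p := trunc N (tcoef g) in hlt *.
have lgp : l2 (cf p - tcoef g) by apply: l2B => //; exact: l2_cf.
have E : cf 1 - cprod (tcoef x) (cf p) = tcoef (toC e *: g) - cprod (tcoef x) (cf p - tcoef g).
  have e1 : cf 1 = cprod (tcoef x) (tcoef g) + tcoef (toC e *: g).
    rewrite -tcoef_mul; [|exact: Hinf_analytic|exact: Hinf_analytic].
    rewrite -tcoef_horner; apply/funext => n; rewrite -[RHS]/(_ + _).
    rewrite -(@tcoefD R _ _ n (@Hinf_analytic R (x * g)) (@Hinf_analytic R (toC e *: g))).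
    congr (_ n); apply: tcoef_eq => z z1; rewrite hornerC.
    have : ((x + toC e *: (1 : Hinf R)) * g) z = 1 by rewrite gx Hinf1E.
    rewrite mulrDl => <-; rewrite -[LHS]/((x * g) z + toC e * (1 : Hinf R) z * g z).
    by rewrite -mulrA Hinf1E// mul1r.
  by rewrite e1 cprodBr; apply/funext => i; rewrite !sqE; ring.
have lw2 : l2 (tcoef (toC e *: g)) by exact: Hinf_l2.
have [l3 n3] := mulx _ lgp.
rewrite E (le_trans (nnD_le lw2 (l2N l3)))// nnN.
have h1 : nn (tcoef (toC e *: g)) <= d / 4 by apply: le_trans (nn_le lw) re4.
have h2 : nn (cprod (tcoef x) (cf p - tcoef g)) <= d / 4.
  apply: (le_trans n3); apply: le_trans (ler_wpM2l K0 hlt) _.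
  rewrite mulrA ler_pdivrMr// (_ : _ * (4 * _) = (K + 1) * d); last by field.
  by rewrite ler_wpM2r ?(ltW d0)// lerDl.
lra.
Qed.

End accretive.
End Hinf_algebra.

(** * The generator *)

Section approximate_unit.
Variables (R : realType) (m : nat) (f : 'I_m -> Hinf R).
Hypothesis m_gt0 : (0 < m)%N.
Local Notation C := (Cplx R).
Let J := ideal_gen (range f).
Hypothesis MJ : M_ideal J.
Implicit Types (g h x y : Hinf R) (z w : C) (i : 'I_m).

Let cJ : closed J. Proof. by case: (closed_ideal_gen (range f)). Qed.
Let J0 : J 0. Proof. by case: (closed_ideal_gen (range f)). Qed.
Let JD g h : J g -> J h -> J (g + h).
Proof. by case: (closed_ideal_gen (range f)) => _ _ + _; apply. Qed.
Let JM g h : J g -> J (g * h).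
Proof. by case: (closed_ideal_gen (range f)) => _ _ _; apply. Qed.
Let JZ (k : C) g : J g -> J (k *: g).
Proof.
move=> Jg; have [[_ _ h] _] := MJ; rewrite -[_ *: _]addr0; exact: h.
Qed.
Let Jf i : J (f i).
Proof. by move=> I [_ fI]; apply: fI; exists i. Qed.

Let B : R := \sum_i (rnorm (f i) + 1).

Let fB i : rnorm (f i) + 1 <= B.
Proof.
rewrite /B (bigD1 i)//= lerDl sumr_ge0// => k _.
by rewrite addr_ge0 ?rnorm_ge0.
Qed.

Let B1 : 1 <= B.
Proof. by apply: le_trans (fB (Ordinal m_gt0)); rewrite lerDr rnorm_ge0. Qed.

Let closed_limit l : (forall e : R, 0 < e -> exists2 y, J y & rnorm (l - y) < e) -> J l.
Proof.
move=> h; apply: cJ => U /nbhs_rnormP[e e0 eU]; have [y Jy ly] := h e e0.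
by exists y; split => //; exact: eU.
Qed.

Let nf_gt0 i : 0 < rnorm (f i) + 1.
Proof. by rewrite ltr_wpDl ?rnorm_ge0. Qed.

(* The balls of radius 1 about 1 + v and 1 - v, with v a small multiple of f i,
   both contain 1 and both meet J. *)
Lemma ball_pairs (e : R) : 0 < e -> exists2 y, J y & forall i z, rnorm z < 1 ->
  rnorm (1 - y z) ^+ 2 + (rnorm (f i z) / (rnorm (f i) + 1)) ^+ 2 <= (1 + e) ^+ 2.
Proof.
move=> e0.
pose v (k : 'I_m * bool) : Hinf R := toC ((-1) ^+ k.2 / (rnorm (f k.1) + 1)) *: f k.1.
have nv k : rnorm (v k) <= 1.
  rewrite rnormZ rnorm_toC normrM normrX normrN1 expr1n mul1r gtr0_norm ?invr_gt0 ?nf_gt0//.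
  by rewrite mulrC ler_pdivrMr ?nf_gt0// mul1r lerDl.
have [||||y Jy hy] := @ball_intersection R (Hinf R) J MJ _ (fun k => 1 + v k) (fun=> 1) _ 1 v _ _ _ e e0.
- by [].
- by move=> k; rewrite addrAC subrr add0r.
- by move=> k; exact: JZ.
- by move=> k; rewrite addrK rnorm_Hinf1.
exists y => // i z z1.
have hk b : rnorm (1 - y z + v (i, b) z) <= 1 + e.
  apply: (@le_trans _ _ (rnorm (1 + v (i, b) - y))); last by have := hy (i, b); rewrite mul1r.
  apply: le_trans (Hinf_le (1 + v (i, b) - y) z1).
  by rewrite -[(1 + _ - y) z]/((1 : Hinf R) z + v (i, b) z - y z) Hinf1E// addrAC.
have vz b : v (i, b) z = toC ((-1) ^+ b / (rnorm (f i) + 1)) * f i z by [].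
have vE : v (i, true) z = - v (i, false) z.
  by rewrite !vz /= expr0 expr1 mulN1r mul1r toCN mulNr.
have n2 : rnorm (v (i, false) z) = rnorm (f i z) / (rnorm (f i) + 1).
  by rewrite vz rnormM rnorm_toC expr0 mul1r gtr0_norm ?invr_gt0 ?nf_gt0// mulrC.
have sq b : rnorm (1 - y z + v (i, b) z) ^+ 2 <= (1 + e) ^+ 2.
  by rewrite lerXn2r ?nnegrE ?rnorm_ge0 ?addr_ge0 ?(ltW e0).
have h1 := sq true; have h2 := sq false; rewrite vE in h1.
rewrite -n2; move: h1 h2; rewrite !rnorm_sq !cE; move: (re _) (im _) (re _) (im _) => a b c d; nra.
Qed.

Lemma geometric_bound (t : R) n : 0 <= t <= 1 -> n%:R * (t * (1 - t) ^+ n) <= 1.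
Proof.
move=> /andP[t0 t1].
have p0 : 0 <= (1 - t) ^+ n by rewrite exprn_ge0// subr_ge0.
(* Strengthened for the induction, whose step reduces to (1 - t)(1 + t) <= 1. *)
suff : n%:R * (t * (1 - t) ^+ n) + (1 - t) ^+ n <= 1 by lra.
elim: n {p0} => [|n IH]; first by rewrite mul0r add0r expr0.
have q0 : 0 <= (1 - t) ^+ n by rewrite exprn_ge0// subr_ge0.
have q1 : (1 - t) ^+ n <= 1 by rewrite exprn_ile1 ?subr_ge0// gerBl.
rewrite exprS -natr1.
have -> : (n%:R + 1) * (t * ((1 - t) * (1 - t) ^+ n)) + (1 - t) * (1 - t) ^+ n =
  (1 - t) * (n%:R * (t * (1 - t) ^+ n) + (1 - t) ^+ n + t * (1 - t) ^+ n) by ring.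
apply: (@le_trans _ _ ((1 - t) * (1 + t))); last by nra.
rewrite ler_wpM2l ?subr_ge0// lerD// ler_piMr//.
Qed.

Lemma power_near1 (d : R) n : 0 < d -> exists2 e : R, 0 < e & (1 + e) ^+ n <= 1 + d.
Proof.
move=> d0; have /cvgrPdist_lt/(_ _ d0) := @exprn_continuous R n 1.
move=> /nbhs_ballP[e /= e0 he]; exists (e / 2); first by rewrite divr_gt0.
have := he (1 + e / 2); rewrite /ball/= opprD addrA subrr add0r normrN gtr0_norm ?divr_gt0//.
rewrite expr1n distrC => h; have : e / 2 < e by lra.
by move=> /h/(le_lt_trans (ler_norm _)); lra.
Qed.

(** With A = (1 + e)^2 and s the normalized |f_i|^2, [ball_pairs] gives |1 - y|^2 <= A - s, so s |1
    - y|^(2n) <= s (A - s)^n = A^(n+1) t (1 - t)^n with t = s/A, which [geometric_bound] makes at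
    most 2/n. *)
Lemma near_unit (d : R) : 0 < d -> exists y, [/\ J y, rnorm (1 - y) <= 1 + d &
  forall i, rnorm (f i * (1 - y)) <= d].
Proof.
move=> d0; pose d' := Num.min d 1.
have d'0 : 0 < d' by rewrite lt_min d0 ltr01.
have d'd : d' <= d by rewrite ge_min lexx.
have d'1 : d' <= 1 by rewrite ge_min lexx orbT.
(* Large enough for B^2 (2/n) <= d^2, where [B] absorbs the normalization of the f_i. *)
pose n := (Num.truncn (2 * B ^+ 2 / d ^+ 2)).+1.
have nB : 2 * B ^+ 2 / d ^+ 2 <= n%:R.
  by apply: ltW; apply: truncnS_gt.
have n0 : 0 < n%:R :> R by rewrite ltr0n.
(* This exponent yields both (1 + e)^n <= 1 + d and A^(n+1) <= 2. *)
have [e e0 he] := power_near1 (2 * n.+1) d'0.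
have [y Jy hy] := ball_pairs e0.
have e1 : 1 <= 1 + e by rewrite lerDl ltW.
have y1 : rnorm (1 - y) <= 1 + e.
  apply: Hinf_norm_le => z z1; rewrite -[(1 - y) z]/((1 : Hinf R) z - y z) Hinf1E//.
  rewrite -(@ler_pXn2r _ 2) ?nnegrE ?rnorm_ge0 ?(le_trans ler01 e1)//.
  by have := hy (Ordinal m_gt0) z z1; apply: le_trans; rewrite lerDl sqr_ge0.
exists (1 - (1 - y) ^+ n); rewrite opprB addrCA subrr addr0; split.
- elim: (n) => [|k IH]; first by rewrite expr0 subrr.
  have -> : 1 - (1 - y) ^+ k.+1 = (1 - (1 - y) ^+ k) + y * (1 - y) ^+ k by rewrite exprS; ring.
  by apply: JD => //; exact: JM.
- apply: le_trans (rnorm_Hinf_exp _ _) _.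
  apply: (@le_trans _ _ ((1 + e) ^+ n)); first by rewrite lerXn2r ?nnegrE ?rnorm_ge0 ?(le_trans ler01 e1).
  apply: (@le_trans _ _ ((1 + e) ^+ (2 * n.+1))); last by apply: le_trans he _; rewrite lerD2l.
  by rewrite ler_weXn2l// mulnC muln2 -addnn (leq_trans (leqnSn n))// leq_addr.
move=> i; apply: Hinf_norm_le => z z1; rewrite Hinf_mulE Hinf_expE//.
rewrite -[(1 - y) z]/((1 : Hinf R) z - y z) Hinf1E//.
set F := f i z; set p := 1 - y z.
pose A := (1 + e) ^+ 2; pose s := (rnorm F / (rnorm (f i) + 1)) ^+ 2.
have A0 : 0 < A by rewrite exprn_gt0// ltr_pwDl// ltW.
have s0 : 0 <= s by exact: sqr_ge0.
have psA : rnorm p ^+ 2 <= A - s by rewrite lerBrDr; exact: hy.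
have sA : s <= A by rewrite -subr_ge0 (le_trans _ psA)// sqr_ge0.
have t01 : 0 <= s / A <= 1 by rewrite divr_ge0 ?(ltW A0)//= ler_pdivrMr// mul1r.
have An : A ^+ n.+1 <= 2 by rewrite /A -exprM; apply: le_trans he _; lra.
have key : s * rnorm p ^+ 2 ^+ n <= 2 / n%:R.
  apply: (@le_trans _ _ (s * (A - s) ^+ n)).
    by rewrite ler_wpM2l// lerXn2r ?nnegrE ?sqr_ge0// subr_ge0.
  have -> : s * (A - s) ^+ n = A ^+ n.+1 * (s / A * (1 - s / A) ^+ n).
    have -> : A - s = A * (1 - s / A) by field; rewrite gt_eqF.
    by rewrite exprMn exprS; move: ((1 - s / A) ^+ n) (A ^+ n) => b a; field; rewrite gt_eqF.
  rewrite ler_pdivlMr// -[leLHS]mulrA -[leRHS]mulr1; apply: ler_pM => //.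
  - by rewrite exprn_ge0// ltW.
  - case/andP: t01 => t0 t1.
    by rewrite mulr_ge0 ?ler0n// mulr_ge0// exprn_ge0// subr_ge0.
  - by rewrite mulrC geometric_bound.
rewrite rnormM rnormX -(@ler_pXn2r _ 2) ?nnegrE ?mulr_ge0 ?exprn_ge0 ?rnorm_ge0 ?(ltW d0)//.
rewrite exprMn -exprM mulnC exprM.
have -> : rnorm F ^+ 2 = (rnorm (f i) + 1) ^+ 2 * s.
  by rewrite /s; field; rewrite gt_eqF ?nf_gt0.
rewrite -mulrA; apply: (@le_trans _ _ (B ^+ 2 * (2 / n%:R))).
  have p0 : 0 <= rnorm p ^+ 2 ^+ n by rewrite exprn_ge0// sqr_ge0.
  apply: ler_pM; [exact: sqr_ge0|exact: mulr_ge0| |exact: key].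
  by rewrite lerXn2r ?nnegrE ?(ltW (nf_gt0 i)) ?(le_trans ler01 B1).
rewrite mulrA ler_pdivrMr// -ler_pdivrMl ?exprn_gt0// mulrC [B ^+ 2 * 2]mulrC.
exact: nB.
Qed.

(* The balls B(1, 1) and B(y, d) meet J at 0 and y and have a common point on
   the segment from 1 to y. *)
Lemma correction_step y (d : R) : 0 < d -> J y -> rnorm (1 - y) <= 1 + d ->
  exists y', [/\ J y', rnorm (1 - y') <= 1 + d / 2 & rnorm (y' - y) <= 2 * d].
Proof.
move=> d0 Jy hy; pose e := Num.min (d / 2) 1.
have e0 : 0 < e by rewrite lt_min divr_gt0// ltr01.
have d1 : 0 < 1 + d by rewrite ltr_pwDl// ltW.
have d1n : 1 + d != 0 by rewrite gt_eqF.
pose c : Hinf R := 1 - toC (1 + d)^-1 *: (1 - y).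
have nc : rnorm (toC (1 + d)^-1 *: (1 - y)) <= 1.
  by rewrite rnormZ rnorm_toC gtr0_norm ?invr_gt0// ler_pdivrMl// mulr1.
have [||||y' Jy' hy'] := @ball_intersection R (Hinf R) J MJ _ (fun b : bool => if b then 1 else y)
    (fun b : bool => if b then 1 else d) _ c (fun b : bool => if b then 0 else y) _ _ _ e e0.
- by case.
- case; first by rewrite /c opprB addrCA subrr addr0.
  have -> : y - c = toC (- (d / (1 + d))) *: (1 - y).
    rewrite /c opprB addrA addrAC.
    have -> : y - 1 = toC (-1) *: (1 - y) :> Hinf R by rewrite toCN toC1 scaleN1r opprB.
    by rewrite -scalerDl -toCD; congr (toC _ *: _); field.
  rewrite rnormZ rnorm_toC normrN gtr0_norm ?divr_gt0//.
  apply: le_trans (ler_wpM2l _ hy) _; first by rewrite ltW// divr_gt0.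
  by rewrite divfK.
- by case.
- by case; rewrite ?subr0 ?rnorm_Hinf1// subrr rnorm0 ltW.
exists y'; split => //.
  by have := hy' true; rewrite mul1r => /le_trans; apply; rewrite lerD2l ge_min lexx.
have := hy' false; rewrite rnorm_distC => /le_trans; apply.
by rewrite mulrC ler_wpM2r ?(ltW d0)// -[2]/(1 + 1) lerD2l ge_min lexx orbT.
Qed.

(** Iterates [correction_step] with excess d 2^-n: the moves add up to at most 4 d, and the limit
    stays in [J] because [J] is closed. *)
Lemma correction y (d : R) : 0 < d -> J y -> rnorm (1 - y) <= 1 + d ->
  exists y', [/\ J y', rnorm (1 - y') <= 1 & rnorm (y' - y) <= 4 * d].
Proof.
move=> d0 Jy hy.
have /choice[S hS] : forall a : Hinf R * R, exists y', 0 < a.2 -> J a.1 -> rnorm (1 - a.1) <= 1 + a.2 ->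
    [/\ J y', rnorm (1 - y') <= 1 + a.2 / 2 & rnorm (y' - a.1) <= 2 * a.2].
  move=> [a b] /=; have [[[b0 Ja] ha]|n] := pselect (((0 < b) /\ J a) /\ rnorm (1 - a) <= 1 + b).
    by have [y' hy'] := correction_step b0 Ja ha; exists y'.
  by exists 0 => *; case: n.
pose s := fix s n := if n is k.+1 then S (s k, d * 2^-1 ^+ k) else y.
have dn n : 0 < d * 2^-1 ^+ n by rewrite mulr_gt0// exprn_gt0// invr_gt0.
have sP n : J (s n) /\ rnorm (1 - s n) <= 1 + d * 2^-1 ^+ n.
  elim: n => [|n [Js hs]] /=; first by rewrite expr0 mulr1.
  have [h1 h2 _] := hS (s n, d * 2^-1 ^+ n) (dn n) Js hs; split => //.
  by have -> : d * 2^-1 ^+ n.+1 = d * 2^-1 ^+ n / 2 by rewrite exprS; ring.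
have sd n : rnorm (s n.+1 - s n) <= 2 * d * 2^-1 ^+ n.
  have [Js hs] := sP n; have [_ _ h] := hS (s n, d * 2^-1 ^+ n) (dn n) Js hs.
  by rewrite -mulrA.
have [l hl] := Hinf_complete sd.
have small (e : R) : 0 < e -> exists n, 2 * (2 * d) * 2^-1 ^+ n < e /\ d * 2^-1 ^+ n < e.
  move=> e0; have i2 : 0 <= 2^-1 :> R by rewrite invr_ge0.
  have i3 : 2^-1 < 1 :> R by rewrite invf_lt1 ?ltr1n.
  have [N hN] := geo_small (2 * (2 * d)) i2 i3 e0; exists N.
  have h := hN N (leqnn N); split => //; apply: le_lt_trans h.
  by rewrite ler_wpM2r ?exprn_ge0//; lra.
exists l; split.
- apply: closed_limit => e /small[n [h _]]; exists (s n); first by case: (sP n).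
  exact: le_lt_trans (hl n) h.
- apply/ler_addgt0Pr => e e0; have e2 : 0 < e / 2 by rewrite divr_gt0.
  have [n [h1 h2]] := small _ e2.
  apply: le_trans (rnorm_trian (s n) _ _) _.
  have -> : 1 + e = (1 + e / 2) + e / 2 by field.
  apply: lerD; first by apply: le_trans (sP n).2 _; rewrite lerD2l ltW.
  by rewrite rnorm_distC; apply: le_trans (hl n) (ltW h1).
- by apply: le_trans (hl 0%N) _; rewrite expr0 mulr1 (_ : 2 * (2 * d) = 4 * d)//; ring.
Qed.

Lemma approximate_unit (d : R) : 0 < d -> exists y, [/\ J y, rnorm (1 - y) <= 1 &
  forall i, rnorm (f i * (1 - y)) <= d].
Proof.
(* With k = d / (1 + 4 B), the correction moves y by at most 4 k, hence f_i y by at most 4 B k. *)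
move=> d0; have B4 : 0 < 1 + 4 * B by have := B1; lra.
have k0 : 0 < d / (1 + 4 * B) by rewrite divr_gt0.
have [y [Jy y1 yf]] := near_unit k0.
have [y' [Jy' y1' yy]] := correction k0 Jy y1.
exists y'; split => // i.
have -> : f i * (1 - y') = f i * (1 - y) - f i * (y' - y) by ring.
apply: le_trans (rnormB _ _) _.
have -> : d = d / (1 + 4 * B) + B * (4 * (d / (1 + 4 * B))) by field; rewrite gt_eqF.
apply: lerD => //; apply: le_trans (rnorm_Hinf_mul _ _) _.
apply: ler_pM; rewrite ?rnorm_ge0//.
by apply: le_trans (fB i); rewrite lerDl.
Qed.

Lemma generator : exists x, [/\ J x, forall z, rnorm z < 1 -> 0 <= re (x z) &
  forall i (e : R), 0 < e -> exists h, rnorm (f i - x * h) <= e].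
Proof.
have h2 n : 0 < 2^-1 ^+ n :> R by rewrite exprn_gt0// invr_gt0.
have [Y hY] := choice (fun n => approximate_unit (h2 n)).
pose S n : Hinf R := \sum_(k < n) toC (2^-1 ^+ k) *: Y k.
have Y2 n : rnorm (Y n) <= 2.
  have [_ h _] := hY n; have := rnorm_subr (Y n) 1; rewrite rnorm_distC.
  by have := rnorm_Hinf1 R; lra.
have Sd n : rnorm (S n.+1 - S n) <= 2 * 2^-1 ^+ n.
  rewrite /S big_ord_recr/= addrAC subrr add0r rnormZ rnorm_toC gtr0_norm// mulrC.
  by rewrite ler_wpM2r ?(ltW (h2 n)).
have [x hx] := Hinf_complete Sd.
have JS n : J (S n).
  by elim: n => [|n IH]; rewrite /S ?big_ord0// big_ord_recr; apply: JD => //; apply: JZ; case: (hY n).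
have small (e : R) : 0 < e -> exists n, forall k, (n <= k)%N -> 2 * 2 * 2^-1 ^+ k < e.
  by move=> e0; apply: geo_small => //; rewrite ?invr_ge0// invf_lt1 ?ltr1n.
have Jx : J x.
  apply: closed_limit => e /small[n h]; exists (S n) => //.
  exact: le_lt_trans (hx n) (h n (leqnn n)).
have Yre n z : rnorm z < 1 -> rnorm (1 - Y n z) <= 1 /\ 0 <= re (Y n z).
  move=> z1; have [_ h _] := hY n.
  have h1 : rnorm (1 - Y n z) <= 1.
    apply: le_trans h; apply: le_trans (Hinf_le (1 - Y n) z1).
    by rewrite -[(1 - Y n) z]/((1 : Hinf R) z - Y n z) Hinf1E.
  split => //; have : rnorm (1 - Y n z) ^+ 2 <= 1 by rewrite expr_le1 ?rnorm_ge0.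
  rewrite norm2_one_sub; have := sqr_ge0 (rnorm (Y n z)); lra.
have Sre n z : rnorm z < 1 -> re (S n z) = \sum_(k < n) 2^-1 ^+ k * re (Y k z).
  move=> z1; elim: n => [|n IH]; first by rewrite /S !big_ord0.
  have -> : S n.+1 = S n + toC (2^-1 ^+ n) *: Y n by rewrite /S big_ord_recr.
  transitivity (re (S n z + toC (2^-1 ^+ n) * Y n z)); first by [].
  by rewrite big_ord_recr/= -IH !cE; ring.
(* The terms of the series have nonnegative real part, so Re x dominates that of each single
   term. *)
have xre n z : rnorm z < 1 -> 2^-1 ^+ n * re (Y n z) <= re (x z).
  move=> z1; apply/ler_addgt0Pr => e /small[k hk].
  have h := hk (maxn k n.+1) (leq_maxl _ _).
  have h3 := le_trans (Hinf_le (x - S (maxn k n.+1)) z1) (hx _).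
  have h4 : 2^-1 ^+ n * re (Y n z) <= re (S (maxn k n.+1) z).
    rewrite Sre// (bigD1 (Ordinal (leq_maxr k n.+1)))//= lerDl sumr_ge0// => j _.
    by rewrite mulr_ge0 ?(ltW (h2 j))//; case: (Yre j z z1).
  have := re_le (x z - S (maxn k n.+1) z).
  rewrite reB => /(le_trans (ler_norm _)) => h5.
  have := le_trans (ler_norm _) (le_trans (re_le (S (maxn k n.+1) z - x z)) (lexx _)).
  rewrite reB rnorm_distC -[x z - _]/((x - S (maxn k n.+1)) z); lra.
have x_re z : rnorm z < 1 -> 0 <= re (x z).
  move=> z1; apply: le_trans (xre 0%N z z1); rewrite expr0 mul1r.
  by case: (Yre 0%N z z1).
exists x; split => // i e e0.
have e2 : 0 < e / 2 by rewrite divr_gt0.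
have [n hn] : exists n, 2^-1 ^+ n <= e / 2.
  have [n hn] := small _ e2; exists n; have := hn n (leqnn n); have := h2 n; lra.
(* Chosen so that k |f_i| <= e 2^-n / 2, against the lower bound 2^-n / 2 for |x + k| where |f_i| >=
   e. *)
pose k := e * 2^-1 ^+ n / 2 / (rnorm (f i) + 1).
have k0 : 0 < k by rewrite !divr_gt0 ?mulr_gt0 ?nf_gt0.
have [g [gx gE]] := accretive_inv x_re k0.
exists (f i * g); apply: Hinf_norm_le => z z1.
rewrite -[(f i - x * (f i * g)) z]/(f i z - x z * (f i z * g z)) gE//.
have low := @accretive_shift R x k z k0 z1.
set X := x z + toC k in low *.
have X0 : 0 < rnorm X by have := x_re z z1; lra.
have Xn : X != 0 by rewrite -rnorm_gt0.
have -> : f i z - x z * (f i z / X) = toC k * f i z / X.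
  have -> : x z = X - toC k by rewrite /X addrK.
  by field.
rewrite !rnormM rnormV rnorm_toC gtr0_norm// ler_pdivrMr//.
(* If |f_i| < e at z, it suffices that k <= |x + k|. *)
have [fe|fe] := ltP (rnorm (f i z)) e.
  rewrite mulrC; apply: ler_pM; rewrite ?rnorm_ge0 ?(ltW k0) ?(ltW fe)//.
  by have := x_re z z1; lra.
(* Now |f_i| >= e, so the smallness of f_i (1 - Y n) forces |1 - Y n| <= 1/2 at z. *)
have Yh : 2^-1 <= re (Y n z).
  have [_ _ /(_ i) hf] := hY n.
  have h : rnorm (f i z) * rnorm (1 - Y n z) <= e / 2.
    apply: le_trans hn; apply: le_trans hf; rewrite -rnormM.
    apply: le_trans (Hinf_le (f i * (1 - Y n)) z1).
    by rewrite Hinf_mulE -[(1 - Y n) z]/((1 : Hinf R) z - Y n z) Hinf1E.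
  have h1 : rnorm (1 - Y n z) <= 2^-1.
    rewrite -(ler_pM2l e0); apply: le_trans h.
    by rewrite ler_wpM2r ?rnorm_ge0.
  have := le_trans (ler_norm _) (re_le (1 - Y n z)); rewrite reB.
  have -> : re (1 : C) = 1 by []; lra.
have X1 : 2^-1 ^+ n / 2 <= rnorm X.
  have := xre n z z1; have : 2^-1 ^+ n * 2^-1 <= 2^-1 ^+ n * re (Y n z).
    by rewrite ler_wpM2l ?(ltW (h2 n)).
  lra.
apply: (@le_trans _ _ (e * (2^-1 ^+ n / 2))); last by rewrite ler_wpM2l ?(ltW e0).
apply: (@le_trans _ _ (k * (rnorm (f i) + 1))).
  rewrite ler_wpM2l ?(ltW k0)//; apply: le_trans (Hinf_le _ z1) _.
  by rewrite lerDl.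
by rewrite /k divfK ?gt_eqF ?nf_gt0// mulrA.
Qed.

End approximate_unit.

Theorem theorem8p1 (R : realType) (m : nat) (m_gt0 : (0 < m)%N)
    (f : 'I_m -> Hinf R) (fZ : forall i, Zinf (f i)) :
  M_ideal (ideal_gen (range f)) ->
  exists g : Hinf R,
    [/\ outer g, Zinf g & ideal_gen (range f) = ideal_gen [set g] ].
Proof.
move=> MJ; have [x [Jx x_re fx]] := generator m_gt0 MJ.
have x0 : x != 0.
  apply/eqP => x0; have [f0 _] := fZ (Ordinal m_gt0).
  move/eqP: f0; apply; apply: rnorm0_eq0; apply/eqP; rewrite eq_le rnorm_ge0 andbT.
  apply/ler_addgt0Pr => e e0; rewrite add0r; have [h] := fx (Ordinal m_gt0) e e0.
  by rewrite x0 mul0r subr0.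
exists x; split.
- exact: accretive_outer.
- apply: Zinf_of_vanishing => // z xz.
  (* [Jx] places x in every closed ideal containing the generators, in particular in the ideal of
     functions tending to 0 at z. *)
  apply: Jx; split; first exact: vanishes_ideal.
  move=> _ [i _ <-]; apply: Zinf_vanishes => //.
  by apply: ess_zero_quotient xz; [case: (fZ i)|exact: fx].
- apply/seteqP; split; apply: smallest_sub; try exact: closed_ideal_gen; last first.
    by move=> _ ->.
  move=> _ [i _ <-]; rewrite ideal_gen1 => U /nbhs_rnormP[e e0 eU].
  have e2 : 0 < e / 2 by rewrite divr_gt0.
  have [h hh] := fx i _ e2; exists (x * h); split; first by exists h.
  by apply: eU; apply: le_lt_trans hh _; lra.
Qed.
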